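(* Let $d<k$ be positive integers and consider the linear actions of $d$-dimensional subspaces $V\subset\mathbb{R}^k$ on $\mathbb{T}^k$. (1) If $(k+1)/2<d<k$, then for almost every $V$, for every $\mathbf{x}\in\mathbb{T}^k$ and every linear section $\mathcal{S}$ which is $(k-d)$-dimensionally open and satisfies $\dim_M\partial\mathcal{S}=k-d-1$, the corresponding separated net $Y_{\mathcal{S},\mathbf{x}}$ is BD to a lattice. (2) For any $2\le d<k$, for almost every $V$, for every $\mathbf{x}\in\mathbb{T}^k$ and every linear section $\mathcal{S}$ which is a box with sides parallel to $k-d$ of the coordinate axes, the corresponding net $Y_{\mathcal{S},\mathbf{x}}$ is BD to a lattice. (3) Let $1<d<k$. For almost every linear section $\mathcal{S}$ which is a parallelotope, there is a residual set of subspaces $V$ for which the corresponding nets are not BD to a lattice. Precisely: let $r=k-d$, let $W\subset\mathbb{R}^k$ be a totally irrational $r$-dimensional subspace with basis $\mathbf{w}_1,\dots,\mathbf{w}_r$, and for $\mathbf{a},\mathbf{b}\in(0,1)^r$ put $$P(\mathbf{a},\mathbf{b})=\pi\Big(\Big\{\sum_{i=1}^r t_i\mathbf{w}_i: t_i\in(a_i,a_i+b_i)\Big\}\Big).$$ Then for Lebesgue-almost every $(\mathbf{a},\mathbf{b})\in(0,1)^{2r}$ there is a residual set of $V$ in the Grassmannian of $d$-dimensional subspaces of $\mathbb{R}^k$ such that, for every $\mathbf{x}\in\mathbb{T}^k$, the net $Y_{P(\mathbf{a},\mathbf{b}),\mathbf{x}}$ is not BD to a lattice.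
   Context: $\mathbb{T}^k=\mathbb{R}^k/\mathbb{Z}^k$, $\pi:\mathbb{R}^k\to\mathbb{T}^k$ is the canonical projection, and $V\cong\mathbb{R}^d$ acts on $\mathbb{T}^k$ by $\mathbf{v}.\pi(\mathbf{x})=\pi(\mathbf{v}+\mathbf{x})$; $V$ is identified with $\mathbb{R}^d$ by any linear isomorphism (the choice is immaterial). For $\mathcal{S}\subset\mathbb{T}^k$, $Y_{\mathcal{S},\mathbf{x}}=\{\mathbf{v}\in V:\mathbf{v}.\mathbf{x}\in\mathcal{S}\}$. ''Almost every $V$'' refers to the smooth measure class on the Grassmannian of $d$-dimensional subspaces of $\mathbb{R}^k$; ''residual'' means containing a dense $G_\delta$ subset. A subspace $W\subset\mathbb{R}^k$ is totally irrational if $\pi(W)$ is dense in $\mathbb{T}^k$. A section $\mathcal{S}\subset\mathbb{T}^k$ is linear if $\mathcal{S}=\pi(B)$ for a bounded subset $B$ of a $(k-d)$-dimensional plane transverse to $V$. It is $(k-d)$-dimensionally open if $B$ is open in that plane, and $\partial\mathcal{S}$ refers to the boundary of $B$ in that plane; it is a box with sides parallel to $k-d$ of the coordinate axes if $B$ is a translate of a product of bounded nondegenerate intervals in the span of $k-d$ of the standard basis vectors $\mathbf{e}_1,\dots,\mathbf{e}_k$. $\dim_M A=\limsup_{r\to0}\frac{\log N(A,r)}{-\log r}$ is the upper Minkowski dimension, where $N(A,r)$ is the minimal number of balls of radius $r$ needed to cover $A$. A separated net in $\mathbb{R}^d$ is a subset $Y$ for which there are $0<r<R$ such that distinct points of $Y$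 are at distance at least $r$ and every ball of radius $R$ contains a point of $Y$. Two separated nets $Y_1,Y_2\subset\mathbb{R}^d$ are BD (bounded displacement) if there is a bijection $f:Y_1\to Y_2$ with $\sup_{\mathbf{y}\in Y_1}\|f(\mathbf{y})-\mathbf{y}\|<\infty$. *)

(* Defs.v *)
(* All norms and balls on 'rV[R]_n and 'M[R]_(m, n) are those
   of the library (the sup norm of the entries). Being a separated net, being
   BD, and the Minkowski dimension are the same for all norms on R^n. *)
From HB Require Import structures.
From mathcomp Require Import all_boot all_order all_algebra.
From mathcomp Require Import all_classical all_reals all_analysis.
From mathcomp Require Import borel_hierarchy.
Set Implicit Arguments.
Unset Strict Implicit.
Unset Printing Implicit Defensive.
Import Order.TTheory GRing.Theory Num.Theory.
Import numFieldNormedType.Exports.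
Local Open Scope classical_set_scope.
Local Open Scope ring_scope.

Section Torus.
Variables (R : realType) (k : nat).
Local Open Scope quotient_scope.

Definition integer_translate (x y : 'rV[R]_k) : bool :=
  [forall i, (x - y) 0 i \is a Num.int].

Lemma integer_translate_refl : reflexive integer_translate.
Proof. by move=> x; apply/forallP => i; rewrite subrr mxE rpred0. Qed.

Lemma integer_translate_sym : symmetric integer_translate.
Proof.
by move=> x y; apply/forallP/forallP => h i; move: (h i); rewrite -rpredN !mxE opprB.
Qed.

Lemma integer_translate_trans : transitive integer_translate.
Proof.
move=> y x z /forallP xy /forallP yz; apply/forallP => i.
by rewrite -(subrK y x) -addrA mxE rpredD.
Qed.

Canonical integer_translate_equiv :=
  EquivRel integer_translate integer_translate_refl integer_translate_sym
    integer_translate_trans.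

Definition torus := quotient_topology {eq_quot integer_translate}.

HB.instance Definition _ := Topological.on torus.
HB.instance Definition _ := Quotient.on torus.

Definition torus_proj (x : 'rV[R]_k) : torus := \pi_torus x.

Definition torus_act (v : 'rV[R]_k) (x : torus) : torus :=
  torus_proj (v + repr x).

Lemma torus_projP (x y : 'rV[R]_k) :
  torus_proj x = torus_proj y <-> integer_translate x y.
Proof. by split=> [/eqmodP//|xy]; apply/eqmodP. Qed.

Lemma torus_act_proj (v x : 'rV[R]_k) :
  torus_act v (torus_proj x) = torus_proj (v + x).
Proof.
apply/torus_projP; rewrite /integer_translate opprD addrACA subrr add0r.
by apply/torus_projP; rewrite /torus_proj reprK.
Qed.

Definition totally_irrational (W : {vspace 'rV[R]_k}) :=
  dense (torus_proj @` [set u | u \in W]).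

Definition visit_set (V : {vspace 'rV[R]_k}) (S : set torus) (x : torus) :
    set 'rV[R]_k :=
  [set v | v \in V /\ S (torus_act v x)].

End Torus.

Definition lebesgue_null (R : realType) (m n : nat) (N : set 'M[R]_(m, n)) :=
  forall e : R, 0 < e ->
    exists a b : nat -> 'M[R]_(m, n),
      [/\ forall l i j, a l i j <= b l i j,
          N `<=` \bigcup_l [set X | forall i j, a l i j <= X i j <= b l i j] &
          (\sum_(0 <= l <oo) (\prod_i \prod_j (b l i j - a l i j))%:E
             <= e%:E)%E].

Section Grassmannian.
Variables (R : realType) (d k : nat).

Record grassmannian := Grassmannian {
  grass_space :> {vspace 'rV[R]_k};
  _ : \dim grass_space == d }.

HB.instance Definition _ := [isSub for grass_space].
HB.instance Definition _ := [Choice of grassmannian by <:].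

(* A bijection s splits the coordinates into a first group of d and a second
   group of k - d; the chart of s maps A to the graph of the linear map with
   matrix A from the first coordinate subspace to the second. *)
Definition graph_tuple (s : 'I_d + 'I_(k - d) -> 'I_k) (A : 'M[R]_(d, k - d)) :
    d.-tuple 'rV[R]_k :=
  [tuple delta_mx 0 (s (inl i)) + \sum_j A i j *: delta_mx 0 (s (inr j))
    | i < d].

Lemma dim_graph (s : 'I_d + 'I_(k - d) -> 'I_k) (A : 'M[R]_(d, k - d)) :
  bijective s -> \dim <<graph_tuple s A>>%VS == d.
Proof.
move=> /bij_inj s_inj; suff /eqP-> : free (graph_tuple s A).
  by rewrite size_tuple.
apply/freeP => c /matrixP c0 i; move: (c0 0 (s (inl i))).
have coordE (j : 'I_d) : ((graph_tuple s A)`_j) 0 (s (inl i)) = (i == j)%:R.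
  rewrite -tnth_nth tnth_mktuple !mxE !eqxx summxE big1 ?addr0 => [|l _].
    by rewrite (inj_eq s_inj).
  by rewrite !mxE (inj_eq s_inj) mulr0.
rewrite summxE [RHS]mxE => <-; rewrite (bigD1 i)//= big1 => [|j /negbTE ji].
  by rewrite addr0 mxE coordE eqxx mulr1.
by rewrite mxE coordE eq_sym ji mulr0.
Qed.

Definition grass_chart (s : 'I_d + 'I_(k - d) -> 'I_k) (hs : bijective s)
    (A : 'M[R]_(d, k - d)) : grassmannian :=
  Grassmannian (dim_graph A hs).

Definition grass_open (U : set grassmannian) :=
  forall s (hs : bijective s), open (grass_chart hs @^-1` U).

Lemma grass_openT : grass_open setT.
Proof. by move=> s hs; rewrite preimage_setT; exact: openT. Qed.

Lemma grass_openI : setI_closed grass_open.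
Proof.
by move=> A B oA oB s hs; rewrite preimage_setI; apply: openI; [apply: oA|apply: oB].
Qed.

Lemma grass_open_bigcup (I : Type) (f : I -> set grassmannian) :
  (forall i, grass_open (f i)) -> grass_open (\bigcup_i f i).
Proof.
move=> of_ s hs; rewrite preimage_bigcup.
by apply: bigcup_open => i _; exact: of_.
Qed.

HB.instance Definition _ := isOpenTopological.Build grassmannian
  grass_openT grass_openI grass_open_bigcup.

(* The smooth measure class: null means Lebesgue null in every chart. *)
Definition almost_every_subspace (P : grassmannian -> Prop) :=
  forall s (hs : bijective s),
    lebesgue_null (grass_chart hs @^-1` [set V | ~ P V]).

End Grassmannian.

Definition residual (T : topologicalType) (A : set T) :=
  exists G : set T, [/\ Gdelta G, dense G & G `<=` A].

Definition covering_number (R : realType) (k : nat) (A : set 'rV[R]_k) (r : R) :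
    \bar R :=
  ereal_inf [set n%:R%:E | n in [set n : nat |
    exists c : 'I_n -> 'rV[R]_k, A `<=` \bigcup_i ball (c i) r]].

(* lne 0 = -oo, so that the empty set has dimension -oo. *)
Definition minkowski_dim (R : realType) (k : nat) (A : set 'rV[R]_k) : \bar R :=
  limf_esup (fun r : R => lne (covering_number A r) * ((- ln r)^-1)%:E)%E 0^'+.

Section Sections.
Variables (R : realType) (k : nat).
Implicit Types (p : 'rV[R]_k) (V L : {vspace 'rV[R]_k}) (B : set 'rV[R]_k).

Definition plane p L : set 'rV[R]_k := [set p + u | u in [set u | u \in L]].

(* The section is torus_proj @` B. *)
Definition linear_section V p L B :=
  [/\ \dim L = (k - \dim V)%N, (V + L)%VS = fullv,
      B `<=` plane p L & bounded_set B].

Definition open_in (P B : set 'rV[R]_k) := open (B : set (subspace P)).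

Definition boundary_in (P B : set 'rV[R]_k) : set 'rV[R]_k :=
  closure (B : set (subspace P)) `\` interior (B : set (subspace P)).

Definition nondegenerate_bounded (I : interval R) :=
  exists (a b : R) (ba bb : bool),
    a < b /\ I = Interval (BSide ba a) (BSide bb b).

Definition coordinate_box (r : nat) B :=
  exists (J : {set 'I_k}) (I : 'I_k -> interval R) (p : 'rV[R]_k),
    [/\ #|J| = r, forall i, i \in J -> nondegenerate_bounded (I i) &
        B = [set p + \sum_(i in J) t i *: delta_mx 0 i |
              t in [set t : 'I_k -> R | forall i, i \in J -> t i \in I i]]].

Definition parallelotope (r : nat) (w : r.-tuple 'rV[R]_k) (a b : 'rV[R]_r) :
    set 'rV[R]_k :=
  [set \sum_(i < r) t 0 i *: tnth w i |
    t in [set t : 'rV[R]_r | forall i, a 0 i < t 0 i < a 0 i + b 0 i]].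

End Sections.

Section Nets.
Variables (R : realType) (d : nat).
Implicit Types Y : set 'rV[R]_d.

Definition separated_net Y :=
  exists r r' : R, [/\ 0 < r, r < r',
    forall y1 y2, Y y1 -> Y y2 -> y1 <> y2 -> r <= `|y1 - y2| &
    forall c : 'rV[R]_d, Y `&` ball c r' !=set0].

Definition bounded_displacement Y1 Y2 :=
  exists f : 'rV[R]_d -> 'rV[R]_d,
    set_bij Y1 Y2 f /\ has_ubound [set `|f y - y| | y in Y1].

Definition lattice Y :=
  exists2 G : 'M[R]_d, G \in unitmx &
    Y = range (fun z : 'rV[int]_d => map_mx intr z *m G).

Definition BD_to_lattice Y := exists2 Y', lattice Y' & bounded_displacement Y Y'.

End Nets.

(* Main.v *)
(** Write [V] as the graph of a [d x r] matrix [A], [r = k - d]. A visit of [V] to the section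
    [pi(B)] is then an integer point whose first [d] coordinates [n] range over [Z^d] and such that
    [theta + A n] hits, modulo [Z^r], the image [E] of [B] in [R^k / V]; so visits are counted by
    sums along the rotation by [A] of the torus [T^r].

    Positive results. If every finite set [F] of indices [n] sees [lam |F|] hits up to a multiple of
    the perimeter of [F], Hall's theorem matches the visits with a lattice. Such a bound follows by
    telescoping over the scales [tau^i] as soon as the averages over cubes of side [tau^i] approach
    their mean at a rate [kap^i] with [kap tau < 1]. For almost every [A] a Diophantine condition
    (Borel-Cantelli over the resonant slabs) gives this rate: [E] is smoothed at a scale
    comparable to a power of [tau^-i] by a Fejer-type kernel, the smoothing error is governed by the
    measure of a neighbourhood of the boundary, and the remaining trigonometric sum by small
    divisors. When [d > (k+1)/2] crude bounds on the Fourier coefficients suffice for any boundary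
    of dimension [r - 1]; for coordinate boxes the coefficients factor, and their sum against the
    small divisors converges as soon as [d >= 2].

    Negative result. In coordinates adapted to [W], let [V] be rational; its visits are periodic under
    a lattice of rank [d]. Move the base point so that a coset of this lattice enters the
    parallelotope through a face. For all but countably many values of [b] no integer point lies on
    the opposite face at the same time, so nothing leaves there, and the number of visits in a cube
    of side [N] jumps by a multiple of [N^d], which beats [n N^(d-1)]. Being a finite statement this
    persists for all [V] close by. By Baire's theorem a generic [V] has such jumps for every [n], and
    by density of the orbits they occur for every base point, while nets BD to a lattice only
    tolerate [O(N^(d-1))]. *)

(* A section may overlap itself modulo [Z^k], while a visit counts once. Both positive results
   therefore replace [B] by a subset with the same image in the torus that meets each class once,
   chosen so that its boundary stays under control. The Diophantine condition is imposed on a basis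
   of [V] and on all of [Z^k] ([well_generic]) rather than in one chart, because a coordinate box
   dictates which coordinates must parametrise the graph. Up to logarithms it says
   [beta^d >= prod_j (1 + |q_j|)^-1] for the largest distance [beta] of an entry of [q A] to the
   integers. With trivial Fourier bounds, the side [T] of the averaging cubes and the smoothing
   frequency [H] must satisfy both [H > T] and [T^d > H^r] with room to spare; the exponents [2 r]
   and [2 r + 2] achieve this for [d >= r + 2], which is what the first hypothesis says. The density
   [lam] arises by comparing averages at different scales, and a recurrence argument makes it
   positive. In the negative result the visits are recorded by finite sets, bounded above from one
   base point and below from another, uniformly on neighbourhoods; this makes a jump open in [V] and
   transferable to every orbit. *)
Require Import Defs.
From HB Require Import structures.
From mathcomp Require Import all_boot all_order all_algebra.
From mathcomp Require Import all_classical all_reals all_analysis.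
From mathcomp Require Import finmap complex zify ring lra.
From mathcomp Require Import borel_hierarchy.
Set Implicit Arguments.
Unset Strict Implicit.
Unset Printing Implicit Defensive.
Import Order.TTheory GRing.Theory Num.Theory.
Import numFieldNormedType.Exports.
Local Open Scope classical_set_scope.
Local Open Scope ring_scope.

(** * Hall's theorem *)

Section Hall.
Local Open Scope fset_scope.
Variables (X : countType) (Y : choiceType) (N : X -> {fset Y}).

Definition neighbours (A : {fset X}) : {fset Y} := \bigcup_(x <- A) N x.

Lemma mem_neighbours (A : {fset X}) y :
  reflect (exists2 x, x \in A & y \in N x) (y \in neighbours A).
Proof.
apply: (iffP (bigfcupP _ _ _ _)) => [[x /andP[xA _] yx]|[x xA yx]]; exists x => //.
by rewrite xA.
Qed.

Lemma neighboursU (A B : {fset X}) :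
  neighbours (A `|` B) = neighbours A `|` neighbours B.
Proof.
apply/fsetP => y; rewrite in_fsetU; apply/mem_neighbours/orP.
  by move=> [x]; rewrite in_fsetU => /orP[xA|xB] yx; [left|right];
    apply/mem_neighbours; exists x.
by move=> [/mem_neighbours[x xA yx]|/mem_neighbours[x xB yx]]; exists x;
  rewrite // in_fsetU ?xA ?xB ?orbT.
Qed.

(* The Hall condition for the graph deprived of R and S. *)
Definition hall_outside (R : {fset X}) (S : {fset Y}) :=
  forall A : {fset X}, [disjoint A & R]%fset ->
    (#|` A| <= #|` neighbours A `\` S|)%N.

(* The union of two tight sets is tight, by submodularity. *)
Lemma tight_union R S (A B : {fset X}) : hall_outside R S ->
  [disjoint A & R]%fset -> [disjoint B & R]%fset ->
  #|` neighbours A `\` S| = #|` A| -> #|` neighbours B `\` S| = #|` B| ->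
  #|` neighbours (A `|` B) `\` S| = #|` A `|` B|.
Proof.
move=> h dA dB tA tB; apply/eqP; rewrite eqn_leq; apply/andP; split; last first.
  by apply: h; rewrite fdisjointUX dA.
have dI : [disjoint A `&` B & R]%fset.
  by apply: fdisjointWl dA; exact: fsubsetIl.
have := h _ dI; have := cardfsUI A B.
have := cardfsUI (neighbours A `\` S) (neighbours B `\` S).
rewrite tA tB -fsetDUl neighboursU.
have : (#|` neighbours (A `&` B) `\` S| <=
        #|` (neighbours A `\` S) `&` (neighbours B `\` S)|)%N.
  apply: fsubset_leq_card; apply/fsubsetP => y; rewrite !inE => /andP[->].
  move=> /mem_neighbours[x]; rewrite in_fsetI => /andP[xA xB] yx /=.
  by apply/andP; split; apply/mem_neighbours; exists x.
lia.
Qed.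

(** If every admissible partner of [x] broke the condition, each would be adjacent to a tight set
    avoiding [x] and [R]. By [tight_union] these merge into one tight set [A] adjacent to all of
    [N x] outside [S]. Adding [x] to [A] gains a vertex and no neighbour, against
    [hall_outside R S]. *)
Lemma hall_step R S x : hall_outside R S -> x \notin R ->
  exists y, [/\ y \in N x, y \notin S & hall_outside (x |` R) (y |` S)].
Proof.
move=> h xR; apply: contrapT => hn.
have bad y : y \in N x `\` S -> exists A : {fset X},
    [/\ [disjoint A & x |` R]%fset, #|` neighbours A `\` S| = #|` A| &
        y \in neighbours A].
  rewrite inE => /andP[yS yx]; apply: contrapT => hA; apply: hn; exists y.
  split=> // A dA; have dAR : [disjoint A & R]%fset.
    by apply: fdisjointWr dA; exact: fsubsetUr.
  have [yA|yA] := boolP (y \in neighbours A); last first.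
    apply: leq_trans (h _ dAR) _; apply: fsubset_leq_card.
    apply/fsubsetP => z; rewrite !inE => /andP[zS zA].
    by rewrite zA (negbTE zS) !orbF !andbT; apply: contra yA => /eqP <-.
  have [eqA|neA] := eqVneq (#|` neighbours A `\` S|) (#|` A|).
    by case: hA; exists A.
  have := h _ dAR; rewrite leq_eqVlt eq_sym (negbTE neA)/= => ltA.
  have := cardfsD1 y (neighbours A `\` S); rewrite !inE yS yA /= => e.
  have -> : neighbours A `\` (y |` S) = (neighbours A `\` S) `\ y.
    by apply/fsetP => z; rewrite !inE; case: (z == y); case: (z \in S).
  lia.
have [A [dA tA sA]] : exists A : {fset X},
    [/\ [disjoint A & x |` R]%fset, #|` neighbours A `\` S| = #|` A| &
        N x `\` S `<=` neighbours A].
  have : forall s : seq Y, {subset s <= N x `\` S} -> exists A : {fset X},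
    [/\ [disjoint A & x |` R]%fset, #|` neighbours A `\` S| = #|` A| &
        {subset s <= neighbours A}].
    elim=> [_|y s IH ss].
      exists fset0; split=> //; first exact: fdisjoint0X.
      by rewrite /neighbours big_nil fset0D.
    have [|A [dA tA sA]] := IH; first by move=> z zs; apply: ss; rewrite inE zs orbT.
    have [|B [dB tB yB]] := bad y; first by apply: ss; rewrite inE eqxx.
    exists (A `|` B); split; first by rewrite fdisjointUX dA.
      have sub C : [disjoint C & x |` R]%fset -> [disjoint C & R]%fset.
        by apply: fdisjointWr; exact: fsubsetUr.
      exact: (tight_union h (sub _ dA) (sub _ dB)).
    move=> z; rewrite inE neighboursU inE => /orP[/eqP->|/sA->//].
    by rewrite yB orbT.
  move=> /(_ (N x `\` S)) [//|A [dA tA sA]]; exists A; split=> //.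
  by apply/fsubsetP => z /sA.
have dxA : [disjoint x |` A & R]%fset.
  move: dA; rewrite fdisjoint_sym fdisjointUX => /andP[_ dRA].
  by rewrite fdisjointUX fdisjoint1X xR fdisjoint_sym.
have xA : x \notin A.
  by move: dA; rewrite fdisjoint_sym fdisjointUX fdisjoint1X => /andP[].
have := h _ dxA; rewrite cardfsU1 xA leqNgt => /negP; apply.
rewrite -tA add1n ltnS; apply: fsubset_leq_card.
apply/fsubsetP => z; rewrite !inE => /andP[zS] /mem_neighbours[x'].
rewrite zS !inE => /orP[/eqP-> zx|x'A zx'].
  by apply: (fsubsetP sA); rewrite inE zS.
by apply/mem_neighbours; exists x'.
Qed.

(** Besides a finite matching, a stage keeps the Hall condition for the rest of the graph: this
    invariant lets [hall_step] serve any further vertex without revising earlier choices. *)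
Record matching := Matching {
  edges :> seq (X * Y);
  edges_uniql : uniq [seq e.1 | e <- edges];
  edges_uniqr : uniq [seq e.2 | e <- edges];
  edges_adj : forall e, e \in edges -> e.2 \in N e.1;
  edges_hall : hall_outside [fset x | x in [seq e.1 | e <- edges]]
                            [fset y | y in [seq e.2 | e <- edges]] }.

Lemma matching_extend (s : matching) x :
  exists s' : matching, {subset edges s <= edges s'} /\ x \in [seq e.1 | e <- s'].
Proof.
have [xs|xs] := boolP (x \in [seq e.1 | e <- s]); first by exists s; split.
have [|y [yx ys h]] := @hall_step _ _ x (@edges_hall s); first by rewrite inE.
rewrite inE in ys.
have u1 : uniq [seq e.1 | e <- (x, y) :: s] by rewrite /= xs edges_uniql.
have u2 : uniq [seq e.2 | e <- (x, y) :: s] by rewrite /= ys edges_uniqr.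
have adj e : e \in (x, y) :: edges s -> e.2 \in N e.1.
  by rewrite inE => /orP[/eqP->//|/edges_adj].
have h' : hall_outside [fset x0 | x0 in [seq e.1 | e <- (x, y) :: s]]
                       [fset y0 | y0 in [seq e.2 | e <- (x, y) :: s]].
  rewrite /=; congr hall_outside: h; apply/fsetP => z; rewrite !inE //.
exists (Matching u1 u2 adj h'); split => [e es|] /=; by rewrite inE ?es ?eqxx ?orbT.
Qed.

(** Vertices are served in the order of their codes, and a matched vertex keeps its partner. The
    edges of the increasing sequence of matchings form a function, injective because any two of them
    lie in a common stage. *)
Lemma hall_injection : (forall A : {fset X}, (#|` A| <= #|` neighbours A|)%N) ->
  exists f : X -> Y, injective f /\ forall x, f x \in N x.
Proof.
move=> h.
have h0 : hall_outside [fset x | x in [seq e.1 | e <- [::] : seq (X * Y)]]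
                       [fset y | y in [seq e.2 | e <- [::] : seq (X * Y)]].
  move=> A _; apply: leq_trans (h A) _; apply: fsubset_leq_card.
  by apply/fsubsetP => y yA; rewrite !inE yA.
have [ext extP] : {ext : matching -> X -> matching | forall s x,
    {subset edges s <= edges (ext s x)} /\ x \in [seq e.1 | e <- ext s x]}.
  have /choice[f fP] := fun sx : matching * X => matching_extend sx.1 sx.2.
  by exists (fun s x => f (s, x)) => s x; have := fP (s, x).
pose s0 := @Matching [::] isT isT (fun e (he : e \in [::]) =>
  False_ind _ (Bool.diff_false_true he)) h0.
pose st := fix st n := if n is n'.+1 then
  (if choice.unpickle n' is Some x then ext (st n') x else st n') else s0.
have st_sub m n : (m <= n)%N -> {subset edges (st m) <= edges (st n)}.
  elim: n => [|n IH]; first by rewrite leqn0 => /eqP->.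
  rewrite leq_eqVlt => /orP[/eqP->//|/IH sub e /sub]; rewrite /=.
  by case: (choice.unpickle n) => // x; apply: (extP _ _).1.
have st_mem x : x \in [seq e.1 | e <- st (choice.pickle x).+1].
  by rewrite /= choice.pickleK; apply: (extP _ _).2.
have /choice[f fP] : forall x, exists y, (x, y) \in edges (st (choice.pickle x).+1).
  move=> x; have /mapP[[x' y] es /= ex] := st_mem x; exists y.
  by rewrite {1}ex.
exists f; split=> [x1 x2 e|x]; last by have := edges_adj (fP x).
pose n := maxn (choice.pickle x1).+1 (choice.pickle x2).+1.
have m1 : (x1, f x1) \in edges (st n) by apply: st_sub (fP x1); exact: leq_maxl.
have m2 : (x2, f x2) \in edges (st n) by apply: st_sub (fP x2); exact: leq_maxr.
have uq := edges_uniqr (st n).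
have /(nthP (x1, f x1))[i1 s1 e1] := m1.
have /(nthP (x1, f x1))[i2 s2 e2] := m2.
have := uq => /(uniqP (f x1)) /(_ i1 i2).
rewrite !inE size_map => /(_ s1 s2).
rewrite !(nth_map (x1, f x1)) // e1 e2 /= => /(_ e) ei.
by move: e1; rewrite ei e2 => -[->].
Qed.

End Hall.

(** The point is that [h] follows an edge of [f] or a reversed edge of [g], which preserves bounds
    on displacements. [S] collects the points whose backward chain starts outside the image of [g];
    there [h] is [f], elsewhere it inverts [g]. *)
Lemma cantor_bernstein_graph (X Y : choiceType) (f : X -> Y) (g : Y -> X) :
  injective f -> injective g ->
  exists h : X -> Y, bijective h /\ forall x, h x = f x \/ g (h x) = x.
Proof.
move=> fi gi; pose S x := exists n x0, (forall y, g y <> x0) /\ x = iter n (g \o f) x0.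
have notS x : ~ S x -> exists y, g y = x.
  move=> nS; apply: contrapT => hn; apply: nS; exists 0%N, x; split=> // y gy.
  by apply: hn; exists y.
have Sgf x : S (g (f x)) <-> S x.
  split=> [[[|n] [x0 [hx0 /= e]]]|[n [x0 [hx0 ->]]]].
  - by case: (hx0 _ e).
  - by exists n, x0; split=> //; apply: fi; apply: gi.
  - by exists n.+1, x0.
have /choice[h hP] : forall x, exists y, (S x /\ y = f x) \/ (~ S x /\ g y = x).
  move=> x; have [Sx|nSx] := pselect (S x); first by exists (f x); left.
  by have [y gy] := notS x nSx; exists y; right.
exists h; split; last by move=> x; have [[_ ->]|[_ ->]] := hP x; [left|right].
have /choice[k kP] : forall y, exists x, h x = y.
  move=> y; have [Sg|nSg] := pselect (S (g y)); last first.
    by exists (g y); have [[]//|[_ /gi]] := hP (g y).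
  have [[|n] [x0 [hx0 /= e]]] := Sg; first by case: (hx0 y).
  move/gi in e; have [[_ hx]|[nS _]] := hP (iter n (g \o f) x0).
    by exists (iter n (g \o f) x0); rewrite hx e.
  by case: nS; exists n, x0.
exists k => x; last by rewrite kP.
have := kP (h x); set x' := k _ => e.
have [[Sx hx]|[nSx hx]] := hP x; have [[Sx' hx']|[nSx' hx']] := hP x'.
- by apply: fi; rewrite -hx -hx' e.
- case: nSx'; have -> : x' = g (f x) by rewrite -hx -e hx'.
  exact/Sgf.
- case: nSx; have -> : x = g (f x') by rewrite -hx' e hx.
  exact/Sgf.
- by rewrite -hx -hx' e.
Qed.

(** * Discrepancy and perimeter *)

Lemma eq_lerW (R : numDomainType) (x y : R) : x = y -> x <= y.
Proof. by move=> ->. Qed.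

Section Perimeter.
Variables (d : nat) (R : realType).
Local Notation Z := 'rV[int]_d.
Implicit Types (F : {fset Z}) (m n : Z) (g : Z -> R) (S : seq Z).

Definition exits F m : nat := #|` [fset n in F | (n + m)%R \notin F]%fset|.

(** Only positive directions occur: by [exitsN] the exits in opposite directions are equally
    many. *)
Definition perimeter F : nat := (\sum_(j < d) exits F (delta_mx 0%R j))%N.

Lemma eq_fset_card (A B : {fset Z}) : A = B -> #|` A| = #|` B|.
Proof. by move=> ->. Qed.

Lemma card_shift F m : #|` [fset (c + m)%R | c in F]%fset| = #|` F|.
Proof. by apply: card_in_imfset => x y _ _ /addIr. Qed.

Lemma exits0 F : exits F 0 = 0%N.
Proof.
apply/eqP; rewrite cardfs_eq0; apply/eqP/fsetP => n.
by rewrite !inE addr0; case: (n \in F).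
Qed.

(** A point leaving [F] under [m + m'] either leaves under [m], or its translate by [m] is in [F]
    and leaves under [m']. *)
Lemma exitsD F m m' : (exits F (m + m') <= exits F m + exits F m')%N.
Proof.
rewrite /exits; set A := [fset n in F | _]%fset; set B := [fset n in F | (n + m)%R \notin F]%fset.
set C := [fset n in F | (n + m')%R \notin F]%fset.
have -> : #|` C| = #|` [fset (c - m)%R | c in C]%fset|.
  by rewrite card_shift.
apply: leq_trans (leq_trans (leq_addr _ _) (eq_leq (cardfsUI B _))).
apply: fsubset_leq_card; apply/fsubsetP => n; rewrite !inE => /andP[nF nmF].
have [nm|nm] := boolP (n + m \in F); rewrite ?nF ?andbT //=.
by apply/imfsetP; exists (n + m); rewrite ?addrK //= !inE nm -addrA.
Qed.

(** Translation by [m] maps the points that stay in [F] under [m] onto those that stay under [- m];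
    the remaining points are therefore equally many. *)
Lemma exitsN F m : exits F (- m) = exits F m.
Proof.
have eI m' : [fset n in F | (n + m')%R \in F]%fset =
             [fset (n - m')%R | n in [fset n in F | (n - m')%R \in F]]%fset.
  apply/fsetP => n; apply/idP/imfsetP => [|[n' /=]]; rewrite !inE.
    by move=> /andP[nF nm]; exists (n + m'); rewrite ?addrK //= !inE nm addrK.
  by move=> /andP[nF nm] ->; rewrite subrK nm nF.
have cI m' : (#|` [fset n in F | (n + m')%R \in F]%fset| + exits F m' = #|` F|)%N.
  rewrite /exits -(cardfsID [fset n in F | (n + m')%R \in F]%fset F); congr (_ + _)%N.
    by apply: eq_fset_card; apply/fsetP => n; rewrite !inE; case: (n \in F); rewrite ?andbT ?andbF.
  by apply: eq_fset_card; apply/fsetP => n; rewrite !inE; case: (n \in F); rewrite ?andbT ?andbF.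
have := cI m; have := cI (- m).
by rewrite (eI m) card_shift => <- /addnI.
Qed.

Lemma exits_natmul F m k : (exits F (m *+ k) <= k * exits F m)%N.
Proof.
elim: k => [|k IH]; first by rewrite mulr0n exits0.
by rewrite mulrS mulSn (leq_trans (exitsD _ _ _)) // leq_add2l.
Qed.

Lemma exits_intmul F m (z : int) : (exits F (m *~ z) <= `|z| * exits F m)%N.
Proof.
case: z => k; first exact: exits_natmul.
by rewrite NegzE mulrNz exitsN abszN; exact: exits_natmul.
Qed.

Lemma exits_le_perimeter F m (L : nat) : (forall j, `|m 0 j| <= L%:Z) ->
  (exits F m <= L * perimeter F)%N.
Proof.
move=> hL; have -> : m = \sum_j delta_mx 0 j *~ m 0 j.
  rewrite {1}[m]row_sum_delta; apply: eq_bigr => j _.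
  by rewrite -scaler_int intz.
have sub (s : seq 'I_d) (f : 'I_d -> Z) :
    (exits F (\sum_(j <- s) f j) <= \sum_(j <- s) exits F (f j))%N.
  elim: s => [|j s IH]; first by rewrite !big_nil exits0.
  by rewrite !big_cons (leq_trans (exitsD _ _ _)) // leq_add2l.
apply: leq_trans (sub _ _) _; rewrite big_distrr /=; apply: leq_sum => j _.
apply: leq_trans (exits_intmul _ _ _) _; rewrite leq_mul2r; apply/orP; right.
by have := hL j; rewrite -lez_nat abszE.
Qed.

Definition translate_avg S g n : R := (size S)%:R^-1 * \sum_(m <- S) g (n + m).

Lemma translate_avgC S S' g :
  translate_avg S (translate_avg S' g) =1 translate_avg S' (translate_avg S g).
Proof.
move=> n; rewrite /translate_avg -!mulr_sumr mulrCA; congr (_ * (_ * _)).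
rewrite exchange_big /=; apply: eq_bigr => m _; apply: eq_bigr => m' _.
by rewrite addrAC.
Qed.

(** The points common to [F] and its translate cancel; on either side [exits F m] points remain. *)
Lemma sum_translate F g m (B : R) : (forall n, `|g n| <= B) ->
  `|\sum_(n <- F) g n - \sum_(n <- F) g (n + m)| <= 2 * B * (exits F m)%:R.
Proof.
move=> hB; have -> : \sum_(n <- F) g (n + m) = \sum_(n <- [fset (n + m)%R | n in F]%fset) g n.
  by rewrite big_imfset //= => x y _ _ /addIr.
set F' := [fset (n + m)%R | n in F]%fset.
rewrite (big_fsetID _ (mem F') F) (big_fsetID _ (mem F) F') /=.
have -> : [fset x in F | x \in F']%fset = [fset x in F' | x \in F]%fset.
  by apply/fsetP => x; rewrite !inE andbC.
rewrite opprD addrACA subrr add0r.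
have hs A : `|\sum_(n <- A : {fset Z}) g n| <= B * #|` A|%:R.
  apply: le_trans (ler_norm_sum _ _ _) _; apply: le_trans (ler_sum _ (fun n _ => hB n)) _.
  by rewrite big_const_seq count_predT iter_addr_0 mulr_natr.
have e1 : #|` [fset x in F' | x \notin F]%fset| = exits F m.
  rewrite /exits; have -> : [fset x in F' | x \notin F]%fset =
    [fset (n + m)%R | n in [fset n in F | (n + m)%R \notin F]]%fset.
    apply/fsetP => x; apply/idP/imfsetP => [|[y /=]]; rewrite !inE.
      by move=> /andP[/imfsetP[y /= yF ->]] yF'; exists y; rewrite //= !inE yF.
    by move=> /andP[yF ymF] ->; rewrite ymF andbT; apply/imfsetP; exists y.
  by rewrite card_shift.
have e2 : #|` [fset x in F | x \notin F']%fset| = exits F m.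
  rewrite -exitsN /exits; apply: eq_fset_card; apply/fsetP => x; rewrite !inE.
  case: (x \in F) => //=; congr (~~ _); apply/imfsetP/idP => [[y /= yF ->]|xF].
    by rewrite addrK.
  by exists (x - m); rewrite //= subrK.
apply: le_trans (ler_normB _ _) _; apply: le_trans (lerD (hs _) (hs _)) _.
rewrite e1 e2; apply/eq_lerW; ring.
Qed.

Lemma sum_avg_defect F g S (B : R) (L : nat) :
  (forall n, `|g n| <= B) -> S != [::] -> (forall m, m \in S -> forall j, `|m 0 j| <= L%:Z) ->
  `|\sum_(n <- F) (g n - translate_avg S g n)| <= 2 * B * L%:R * (perimeter F)%:R.
Proof.
move=> hB S0 hL; have B0 : 0 <= B by apply: le_trans (hB 0).
have Sgt0 : 0 < (size S)%:R :> R by rewrite ltr0n; case: S S0 {hL}.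
have -> : \sum_(n <- F) (g n - translate_avg S g n) =
   (size S)%:R^-1 * \sum_(m <- S) (\sum_(n <- F) g n - \sum_(n <- F) g (n + m)).
  rewrite !sumrB mulrBr; congr (_ - _).
    rewrite big_const_seq count_predT iter_addr_0 -[X in _ * X]mulr_natl mulrA.
    by rewrite mulVf ?mul1r // gt_eqF.
  by rewrite -mulr_sumr exchange_big.
rewrite normrM (ger0_norm (ltW _)) ?invr_gt0 // mulrC ler_pdivrMr //.
apply: le_trans (ler_norm_sum _ _ _) _; rewrite big_seq.
apply: (@le_trans _ _ (\sum_(m <- S | m \in S) (2 * B * L%:R * (perimeter F)%:R))).
  apply: ler_sum => m mS; apply: le_trans (sum_translate F m hB) _.
  rewrite -!mulrA -natrM !ler_wpM2l //.
  by rewrite ler_nat; apply: exits_le_perimeter; exact: hL.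
by rewrite -big_seq big_const_seq count_predT iter_addr_0 -[X in X <= _]mulr_natr.
Qed.

(* With A_i the i-th averaging operator, everything rests on
   A_i - A_(i+1) = (1 - A_(i+1)) A_i - (1 - A_i) A_(i+1). *)
Lemma sum_le_perimeter g (S : nat -> seq Z) (C kap : R) (D tau : nat) :
  0 <= C -> 0 <= kap < 1 -> kap * tau%:R < 1 ->
  S 0 = [:: 0] -> (forall i, S i != [::]) ->
  (forall i m, m \in S i -> forall j, `|m 0 j| <= (D * tau ^ i)%N%:Z) ->
  (forall i n, `|translate_avg (S i) g n| <= C * kap ^+ i) ->
  exists K : R, 0 <= K /\ forall F, `|\sum_(n <- F) g n| <= K * (perimeter F)%:R.
Proof.
move=> C0 /andP[kap0 kap1] kt S00 Sn0 hS hA.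
pose A i := translate_avg (S i) g.
have A0 n : A 0%N n = g n.
  by rewrite /A /translate_avg S00 big_seq1 invr1 mul1r addr0.
have step F i : `|\sum_(n <- F) (A i n - A i.+1 n)| <=
    (2 * C * D%:R * (tau%:R + kap)) * (kap * tau%:R) ^+ i * (perimeter F)%:R.
  have -> : \sum_(n <- F) (A i n - A i.+1 n) =
      \sum_(n <- F) (A i n - translate_avg (S i.+1) (A i) n)
      - \sum_(n <- F) (A i.+1 n - translate_avg (S i) (A i.+1) n).
    rewrite -sumrB; apply: eq_bigr => n _; rewrite /A translate_avgC; ring.
  apply: le_trans (ler_normB _ _) _.
  have := sum_avg_defect F (hA i) (Sn0 i.+1) (hS i.+1).
  have := sum_avg_defect F (hA i.+1) (Sn0 i) (hS i) => h1 h2.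
  apply: le_trans (lerD h2 h1) _.
  by rewrite !natrM !natrX !exprS exprMn; apply/eq_lerW; ring.
pose K := 2 * C * D%:R * (tau%:R + kap) / (1 - kap * tau%:R).
have kt0 : 0 <= kap * tau%:R by rewrite mulr_ge0.
have c0 : 0 <= 2 * C * D%:R * (tau%:R + kap) by rewrite !mulr_ge0 // addr_ge0.
have K0 : 0 <= K by rewrite divr_ge0 // subr_ge0 ltW.
exists K; split=> // F.
(* The differences of consecutive scales sum to a geometric series of ratio [kap * tau]. The last
   term still carries the cardinality of [F], but for fixed [F] it tends to 0 with [k]. *)
have tele (k : nat) : `|\sum_(m <- F) g m| <=
    K * (perimeter F)%:R + #|` F|%:R * (C * kap ^+ k).
  have -> : \sum_(m <- F) g m =
      \sum_(i < k) \sum_(m <- F) (A i m - A i.+1 m) + \sum_(m <- F) A k m.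
    rewrite exchange_big /= -big_split /=; apply: eq_bigr => m _.
    elim: k => [|k IH]; first by rewrite big_ord0 add0r A0.
    by rewrite big_ord_recr /= IH; ring.
  apply: le_trans (ler_normD _ _) _; apply: lerD.
    apply: le_trans (ler_norm_sum _ _ _) _.
    apply: (le_trans (ler_sum _ (fun (i : 'I_k) _ => step F i))).
    rewrite -mulr_suml -mulr_sumr ler_wpM2r // /K ler_wpM2l //.
    have -> : (1 - kap * tau%:R)^-1 = 1 / (1 - kap * tau%:R) by rewrite mul1r.
    rewrite ler_pdivlMr ?subr_gt0 // mulrC.
    have := subrX1 (kap * tau%:R) k; set q := kap * _; set s := \sum_(i < k) _ => e.
    have : 0 <= q ^+ k by rewrite exprn_ge0.
    have -> : (1 - q) * s = 1 - q ^+ k by rewrite -[1 - q]opprB mulNr -e opprB.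
    lra.
  apply: le_trans (ler_norm_sum _ _ _) _.
  apply: le_trans (ler_sum _ (fun m _ => hA k m)) _.
  by rewrite big_const_seq count_predT iter_addr_0 mulr_natl.
apply/ler_addgt0Pr => e e0.
pose a := #|` F|%:R * C.
have a0 : 0 <= a by rewrite mulr_ge0.
have [k hk] : exists k : nat, a * kap ^+ k <= e.
  have : (fun k : nat => a * kap ^+ k) @ \oo --> a * (0 : R).
    by apply: cvgMr; apply: cvg_expr; rewrite ger0_norm.
  rewrite mulr0 => /cvgrPdist_le /(_ _ e0) [k _ /(_ k (leqnn k)) /=].
  by rewrite sub0r normrN ger0_norm ?mulr_ge0 ?exprn_ge0 //; exists k.
by apply: le_trans (tele k) _; rewrite lerD2l mulrA.
Qed.

End Perimeter.

(** * Cubical blocks and Hall's condition between blocks *)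

Section Blocks.
Variables (d : nat) (M : nat).
Hypothesis M_gt0 : (0 < M)%N.
Local Notation Z := 'rV[int]_d.
Implicit Types (F : {fset Z}) (b n : Z).

Definition block n : Z := \row_j (n 0%R j %/ M)%Z.

Definition block_point b (h : {ffun 'I_d -> 'I_M}) : Z :=
  \row_j (b 0 j * M%:Z + (h j : nat)%:Z).

Definition cells b : {fset Z} := [fset block_point b h | h in {ffun 'I_d -> 'I_M}]%fset.

Lemma block_pointK b h : block (block_point b h) = b.
Proof.
apply/rowP => j; rewrite !mxE divzMDl; last by rewrite eqz_nat; case: (M) M_gt0.
by rewrite divz_small ?addr0 // ltz_nat ltn_ord.
Qed.

Lemma block_point_inj b : injective (block_point b).
Proof.
move=> h h' /rowP e; apply/ffunP => j; apply: val_inj.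
by have := e j; rewrite !mxE => /addrI [].
Qed.

Lemma block_offset n : exists2 h : {ffun 'I_d -> 'I_M}, n = block_point (block n) h &
  forall j, ((h j : nat)%:Z = n 0%R j %% M)%Z.
Proof.
have M0 : M%:Z != 0 by rewrite eqz_nat; case: (M) M_gt0.
have lt j : (`|(n 0%R j %% M)%Z| < M)%N.
  by rewrite -ltz_nat gez0_abs ?modz_ge0 // ltz_pmod // ltz_nat.
exists [ffun j => Ordinal (lt j)] => [|j]; last first.
  by rewrite ffunE /= gez0_abs ?modz_ge0.
apply/rowP => j; rewrite !mxE ffunE /= gez0_abs ?modz_ge0 //.
exact: divz_eq.
Qed.

Lemma mem_cells b n : (n \in cells b) = (block n == b).
Proof.
apply/imfsetP/eqP => [[h _ ->]|<-]; first exact: block_pointK.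
by have [h eh _] := block_offset n; exists h.
Qed.

Lemma card_cells b : #|` cells b| = (M ^ d)%N.
Proof.
transitivity (size (enum {ffun 'I_d -> 'I_M})).
  by rewrite /cells card_in_imfset //= => h h' _ _; exact: block_point_inj.
by rewrite -cardE card_ffun !card_ord.
Qed.

Definition cells_of F : {fset Z} := (\bigcup_(b <- F) cells b)%fset.

Lemma mem_cells_of F n : (n \in cells_of F) = (block n \in F).
Proof.
apply/bigfcupP/idP => [[b /andP[bF _]]|bF].
  by rewrite mem_cells => /eqP->.
by exists (block n); rewrite ?bF ?mem_cells.
Qed.

Lemma block_add_delta n j : block (n + delta_mx 0 j) = block n \/
  (block (n + delta_mx 0 j) = block n + delta_mx 0 j /\ (n 0%R j %% M)%Z = M.-1%:Z).
Proof.
have [h eh hj] := block_offset n.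
have M0 : M%:Z != 0 by rewrite eqz_nat; case: (M) M_gt0.
have [lt|ge] := ltnP (h j).+1 M; [left|right].
  apply/rowP => i; rewrite !mxE [n in LHS]eh !mxE eqxx /= -addrA divzMDl //.
  case: eqVneq => [->|_]; rewrite ?mulr1n ?mulr0n ?addr0.
    have -> : (h j : nat)%:Z + 1 = (h j).+1%:Z by rewrite -addn1 PoszD.
    by rewrite [X in _ + X]divz_small ?addr0 // ltz_nat.
  by rewrite [X in _ + X]divz_small ?addr0 // ltz_nat ltn_ord.
have hM : (h j : nat) = M.-1 by have := ltn_ord (h j); lia.
split; last by rewrite -hj hM.
apply/rowP => i; rewrite !mxE [n in LHS]eh !mxE eqxx /= -addrA divzMDl //.
case: eqVneq => [->|_]; rewrite ?mulr1n ?mulr0n ?addr0.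
  have -> : (h j : nat)%:Z + 1 = M%:Z by rewrite hM -[X in _ = Posz X](prednK M_gt0) -addn1 PoszD.
  by rewrite divzz M0.
by rewrite [X in _ + X]divz_small ?addr0 // ltz_nat ltn_ord.
Qed.

(** A unit step changes the block only from the last of the [M] layers in its direction. An exit
    from the union of cubes is thus an exit of [F] together with one of the [M ^ d.-1] cells of that
    layer. *)
Lemma exits_cells_of F j :
  (exits (cells_of F) (delta_mx 0%R j) <= M ^ d.-1 * exits F (delta_mx 0%R j))%N.
Proof.
pose last_layer := family (fun i : 'I_d =>
  [pred x : 'I_M | (i == j) ==> (x == M.-1 :> nat)]).
pose E := [fset b in F | (b + delta_mx 0 j)%R \notin F]%fset.
have cardL : #|last_layer| = (M ^ d.-1)%N.
  rewrite card_family foldrE big_map big_enum /= (bigD1 j) //= eqxx /=.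
  have ltM : (M.-1 < M)%N by rewrite prednK.
  rewrite (eq_card (B := pred1 (Ordinal ltM))) ?card1 => [|x]; last first.
    by rewrite !inE -val_eqE.
  rewrite mul1n (eq_bigr (fun=> M)) => [|i /negbTE ij]; last first.
    by rewrite (eq_card (B := predT)) ?card_ord => // x; rewrite !inE ij.
  by rewrite prod_nat_const cardC1 card_ord.
have -> : (M ^ d.-1 * exits F (delta_mx 0%R j))%N =
    size [seq block_point b h | b <- E, h <- enum last_layer].
  by rewrite size_allpairs -cardE cardL mulnC.
apply: uniq_leq_size; first exact: fset_uniq.
move=> n; rewrite !inE !mem_cells_of => /andP[nF nF'].
have [h eh hj] := block_offset n.
apply/allpairsP; exists (block n, h); split=> //=.
  rewrite !inE nF /=; have [e|[e _]] := block_add_delta n j.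
    by rewrite e nF in nF'.
  by rewrite -e.
rewrite mem_enum; apply/familyP => i; rewrite inE; apply/implyP => /eqP->.
have [e|[_ e]] := block_add_delta n j; first by rewrite e nF in nF'.
by move: (hj j); rewrite e => -[->].
Qed.

Lemma perimeter_cells_of F : (perimeter (cells_of F) <= M ^ d.-1 * perimeter F)%N.
Proof. by rewrite big_distrr leq_sum // => j _; exact: exits_cells_of. Qed.

Lemma sum_cells_of (V : nmodType) F (g : Z -> V) :
  \sum_(n <- cells_of F) g n = \sum_(b <- F) \sum_(n <- cells b) g n.
Proof.
apply: partition_disjoint_bigfcup => b b' _ _ bb'.
apply/fdisjointP => n; rewrite !mem_cells => /eqP->; exact: bb'.
Qed.

(** Neighbours in the positive directions only, matching the exits counted by [perimeter]. *)
Definition forward F : {fset Z} :=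
  (F `|` [fset (b + delta_mx 0 j)%R | b in F, j in 'I_d])%fset.

Lemma perimeter_le_forward F : (perimeter F <= d * #|` (forward F `\` F)%fset|)%N.
Proof.
rewrite /perimeter -[d in (d * _)%N]card_ord -sum_nat_const; apply: leq_sum => j _.
rewrite /exits -(card_shift _ (delta_mx 0 j)); apply: fsubset_leq_card.
apply/fsubsetP => n /imfsetP[b /=]; rewrite !inE => /andP[bF bF'] ->.
by rewrite bF' /=; apply/orP; right; apply/imfset2P; exists b => //; exists j.
Qed.

Section Transport.
Variables (X X' : countType) (a : X -> Z) (a' : X' -> Z).
Variables (fib : Z -> {fset X}) (fib' : Z -> {fset X'}) (R : realType) (K : R).
Hypothesis fibP : forall n x, (x \in fib n) = (a x == n).
Hypothesis fibP' : forall n x, (x \in fib' n) = (a' x == n).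
Hypothesis K0 : 0 <= K.
Hypothesis discrepancy : forall F,
  \sum_(n <- F) ((#|` fib n|)%:R - (#|` fib' n|)%:R) <= K * (perimeter F)%:R.
Hypothesis fat : forall b, K * (d * M ^ d.-1)%N%:R <= \sum_(n <- cells b) (#|` fib' n|)%:R.

(** Hall's condition for a finite [A] meeting the blocks [F]: passing from [F] to [forward F] adds
    whole cubes, each holding by [fat] at least [K * d * M ^ d.-1] points of [X']. The perimeter of
    the cells of [F] is at most [d * M ^ d.-1] times the number of added cubes, so these make up for
    the discrepancy. *)
Lemma block_injection : exists f : X -> X', injective f /\
  forall x, block (a' (f x)) \in forward [fset block (a x)]%fset.
Proof.
pose N x := (\bigcup_(n <- cells_of (forward [fset block (a x)])) fib' n)%fset.
have memN x y : (y \in N x) = (block (a' y) \in forward [fset block (a x)]%fset).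
  apply/bigfcupP/idP => [[n /andP[+ _]]|h].
    by rewrite mem_cells_of fibP' => h /eqP->.
  by exists (a' y); rewrite ?fibP' ?eqxx // mem_cells_of h.
have [A|f [fi hf]] := @hall_injection _ _ N; last first.
  by exists f; split=> // x; rewrite -memN.
pose F := [fset block (a x) | x in A]%fset.
have cardU (T : countType) (a0 : T -> Z) (fb : Z -> {fset T}) (G : {fset Z}) :
    (forall n x, (x \in fb n) = (a0 x == n)) ->
    #|` (\bigcup_(n <- G) fb n)%fset| = (\sum_(n <- G) #|` fb n|)%N.
  move=> fbP; rewrite card_fset_sum1; under [RHS]eq_bigr do rewrite card_fset_sum1.
  apply: partition_disjoint_bigfcup => n n' _ _ nn'.
  by apply/fdisjointP => x; rewrite !fbP => /eqP->.
have hA : (#|` A| <= \sum_(n <- cells_of F) #|` fib n|)%N.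
  rewrite -(cardU _ a) //; apply: fsubset_leq_card; apply/fsubsetP => x xA.
  apply/bigfcupP; exists (a x); rewrite ?fibP // mem_cells_of andbT.
  by apply/imfsetP; exists x.
have hN : (\sum_(n <- cells_of (forward F)) #|` fib' n| <= #|` neighbours N A|)%N.
  rewrite -(cardU _ a') //; apply: fsubset_leq_card; apply/fsubsetP => y.
  move=> /bigfcupP[n /andP[+ _]]; rewrite mem_cells_of fibP' => + /eqP en.
  rewrite -en !inE => /orP[/imfsetP[x /= xA e]|/imfset2P[b /= /imfsetP[x /= xA ->] [j _ e]]];
    apply/mem_neighbours; exists x; rewrite // memN e !inE ?eqxx //.
  by apply/orP; right; apply/imfset2P; exists (block (a x)); rewrite ?inE //; exists j.
apply: leq_trans hA (leq_trans _ hN).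
rewrite -(ler_nat R) !natr_sum.
have -> : forward F = (F `|` (forward F `\` F))%fset.
  by apply/fsetP => n; rewrite !inE; case: (n \in F).
have dis : \sum_(n <- cells_of (F `|` (forward F `\` F))%fset) (#|` fib' n|)%:R =
    \sum_(n <- cells_of F) (#|` fib' n|)%:R +
    \sum_(b <- (forward F `\` F)%fset) \sum_(n <- cells b) (#|` fib' n|)%:R :> R.
  rewrite !sum_cells_of (big_fsetID _ (mem F)) /=; congr (_ + _);
    apply: eq_fbigl => b; rewrite !inE; by case: (b \in F); rewrite ?andbF ?andbT.
rewrite dis -lerBlDl -sumrB; apply: le_trans (discrepancy _) _.
have : K * (d * M ^ d.-1)%N%:R * (#|` (forward F `\` F)%fset|)%:R <=
    \sum_(b <- (forward F `\` F)%fset) \sum_(n <- cells b) (#|` fib' n|)%:R.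
  rewrite [X in X <= _](_ : _ = \sum_(b <- (forward F `\` F)%fset) (K * (d * M ^ d.-1)%N%:R)).
    by apply: ler_sum => b _; exact: fat.
  by rewrite big_const_seq count_predT iter_addr_0 mulr_natr.
apply: le_trans; rewrite -mulrA ler_wpM2l // -natrM ler_nat.
apply: leq_trans (perimeter_cells_of F) _.
by rewrite [(d * _)%N]mulnC -mulnA leq_mul2l perimeter_le_forward orbT.
Qed.

End Transport.

Lemma forward1_dist n n' : block n' \in forward [fset block n]%fset ->
  forall j, `|n 0%R j - n' 0%R j| <= (2 * M)%N%:Z.
Proof.
have [h eh _] := block_offset n; have [h' eh' _] := block_offset n'.
move=> + j; rewrite {2}eh {2}eh' !mxE.
have := ltn_ord (h j); have := ltn_ord (h' j).
rewrite !inE => + + /orP[/eqP/rowP/(_ j)|/imfset2P[b /=]].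
  by rewrite !mxE => + + ->; move: (_ * M%:Z)%R => z; lia.
rewrite !inE => + + /eqP-> [i _ /rowP/(_ j)]; rewrite !mxE eqxx /= => + + ->.
rewrite mulrDl; move: (_ * M%:Z)%R => z.
by case: (_ == _); rewrite ?mul0r ?mul1r; lia.
Qed.

End Blocks.

Section BoundedTransport.
Variables (d : nat) (X X' : countType) (a : X -> 'rV[int]_d) (a' : X' -> 'rV[int]_d).
Variables (fib : 'rV[int]_d -> {fset X}) (fib' : 'rV[int]_d -> {fset X'}).
Variables (R : realType) (K : R) (M : nat).

(** Hall's argument gives injections both ways that move points by at most two blocks, and
    [cantor_bernstein_graph] combines them along their graphs. *)
Lemma bounded_transport (M_gt0 : (0 < M)%N) :
  (forall n x, (x \in fib n) = (a x == n)) ->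
  (forall n x, (x \in fib' n) = (a' x == n)) -> 0 <= K ->
  (forall F : {fset 'rV[int]_d},
    `|\sum_(n <- F) ((#|` fib n|)%:R - (#|` fib' n|)%:R)| <= K * (perimeter F)%:R) ->
  (forall b, K * (d * M ^ d.-1)%N%:R <= \sum_(n <- cells M b) (#|` fib n|)%:R) ->
  (forall b, K * (d * M ^ d.-1)%N%:R <= \sum_(n <- cells M b) (#|` fib' n|)%:R) ->
  exists h : X -> X', bijective h /\
    forall x j, `|a x 0 j - a' (h x) 0 j| <= (2 * M)%N%:Z.
Proof.
move=> hf hf' K0 disc fat fat'.
have [F|f [fi fP]] := block_injection M_gt0 hf hf' K0 _ fat'.
  by apply: le_trans (ler_norm _) (disc F).
have [F|g [gi gP]] := block_injection M_gt0 hf' hf K0 _ fat.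
  apply: le_trans (ler_norm _) _; rewrite -normrN -sumrN.
  by under eq_bigr do rewrite opprB.
have [h [hb hP]] := cantor_bernstein_graph fi gi.
exists h; split=> // x j; have [->|e] := hP x; first exact: forward1_dist (fP x) j.
by rewrite distrC -{2}e; exact: forward1_dist (gP (h x)) j.
Qed.

End BoundedTransport.

(** * Comparison with a stretched lattice *)

Section Rounding.
Variables (R : realType) (d : nat) (i0 : 'I_d) (lam : R).
Hypothesis lam_gt0 : 0 < lam.
Local Notation Z := 'rV[int]_d.
Implicit Types (n z : Z).

(** The lattice of density [lam] to compare with: [Z^d] dilated by [1 / lam] in the single direction
    [i0]. *)
Definition stretch z : 'rV[R]_d :=
  \row_j if j == i0 then (z 0 j)%:~R / lam else (z 0 j)%:~R.

Definition stretch_floor z : Z :=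
  \row_j if j == i0 then Num.floor ((z 0%R j)%:~R / lam) else z 0%R j.

Definition stretch_width n : nat :=
  `|Num.ceil (lam * (n 0%R i0 + 1)%:~R) - Num.ceil (lam * (n 0%R i0)%:~R)|%N.

Definition stretch_point n (i : nat) : Z :=
  \row_j if j == i0 then Num.ceil (lam * (n 0%R i0)%:~R) + i%:Z else n 0%R j.

Definition stretch_fibre n : {fset Z} :=
  [fset stretch_point n i | i in iota 0 (stretch_width n)]%fset.

Lemma ceil_mono n : Num.ceil (lam * (n 0 i0)%:~R) <= Num.ceil (lam * (n 0 i0 + 1)%:~R).
Proof. by apply: le_ceil; rewrite (ler_wpM2l (ltW lam_gt0)) // ler_int lerDl. Qed.

Lemma mem_stretch_fibre n z : (z \in stretch_fibre n) = (stretch_floor z == n).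
Proof.
have fl (y x : int) : (Num.floor (y%:~R / lam) == x) =
    (Num.ceil (lam * x%:~R) <= y < Num.ceil (lam * (x + 1)%:~R)).
  rewrite eq_le andbC floor_ge_int ler_pdivlMr // mulrC -ceil_le_int; congr (_ && _).
  by rewrite -ltzD1 floor_lt_int ltr_pdivrMr // mulrC ltNge -ceil_le_int ltNge.
apply/imfsetP/eqP => [[i /=]|<-].
  rewrite mem_iota add0n /= => lti ->.
  apply/rowP => j; rewrite !mxE; case: eqVneq => [->|//]; apply/eqP.
  rewrite fl.
  move: lti; rewrite /stretch_width; have := ceil_mono n; lia.
have /esym := fl (z 0 i0) (Num.floor ((z 0 i0)%:~R / lam)); rewrite eqxx => /andP[h1 h2].
have lt : (absz (z 0%R i0 - Num.ceil (lam * (stretch_floor z 0%R i0)%:~R)) <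
           stretch_width (stretch_floor z))%N.
  by rewrite /stretch_width mxE eqxx; lia.
exists (absz (z 0%R i0 - Num.ceil (lam * (stretch_floor z 0%R i0)%:~R))).
  by rewrite mem_iota.
apply/rowP => j; rewrite !mxE eqxx.
by case: eqVneq => [->|//] /=; lia.
Qed.

Lemma card_stretch_fibre n : #|` stretch_fibre n| = stretch_width n.
Proof.
transitivity (size (iota 0 (stretch_width n))); last by rewrite size_iota.
rewrite /stretch_fibre card_in_imfset //= => [|i i' _ _ /rowP/(_ i0)].
  by rewrite undup_id ?iota_uniq.
by rewrite !mxE eqxx => /addrI [].
Qed.

(** The excess of a fibre over [lam] is the difference of [ceil (lam t) - lam t] at consecutive
    integers [t], so its sum over [F] only sees the exits in direction [i0]. *)
Lemma stretch_discrepancy (F : {fset Z}) :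
  `|\sum_(n <- F) ((#|` stretch_fibre n|)%:R - lam)| <= 2 * (perimeter F)%:R.
Proof.
pose g n : R := (Num.ceil (lam * (n 0 i0)%:~R))%:~R - lam * (n 0 i0)%:~R.
have g1 n : `|g n| <= 1.
  rewrite /g ger0_norm ?subr_ge0 ?ceil_ge //.
  by have := ceil_itv (lam * (n 0 i0)%:~R) => /andP[+ _]; rewrite rmorphB /=; lra.
have := sum_translate F (delta_mx 0 i0) g1.
rewrite distrC -sumrB mulr1 => h.
have e n : (#|` stretch_fibre n|)%:R - lam = g (n + delta_mx 0 i0) - g n.
  rewrite card_stretch_fibre /g !mxE !eqxx /stretch_width natr_absz ger0_norm.
    rewrite !rmorphB !rmorphD /= !mulrDr mulr1; ring.
  by rewrite subr_ge0 ceil_mono.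
under eq_bigr do rewrite e.
apply: le_trans h _; rewrite ler_wpM2l // ler_nat /perimeter.
by rewrite (bigD1 i0) //= leq_addr.
Qed.

Theorem equidistributed_bijection (X : countType) (a : X -> Z) (fib : Z -> {fset X}) (K : R) :
  (forall n x, (x \in fib n) = (a x == n)) -> 0 <= K ->
  (forall F : {fset Z}, `|\sum_(n <- F) ((#|` fib n|)%:R - lam)| <= K * (perimeter F)%:R) ->
  exists h : X -> Z, bijective h /\ exists C : R, forall x j,
    `|(a x 0 j)%:~R - stretch (h x) 0 j| <= C.
Proof.
move=> fibP K0 disc.
have d0 : (0 < d)%N by case: (i0) => m; case: (d).
(* A block has mean content [lam * M ^ d]. This must cover the demand [(K + 2) * d * M ^ d.-1] of
   Hall's argument and, once more, the same amount as a bound for what a single block may lose to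
   its own discrepancy. In [K + 2], the 2 is the discrepancy of the lattice. *)
pose M := (Num.trunc ((K + 2 + (K + 2)) * d%:R / lam)).+1.
have hM : (K + 2 + (K + 2)) * d%:R <= lam * M%:R.
  by rewrite [X in _ <= X]mulrC -ler_pdivrMr // ltW // truncnS_gt.
have fat (T : countType) (f : Z -> {fset T}) (K' : R) : 0 <= K' <= K + 2 ->
    (forall F : {fset Z}, `|\sum_(n <- F) ((#|` f n|)%:R - lam)| <= K' * (perimeter F)%:R) ->
    forall b, (K + 2) * (d * M ^ d.-1)%N%:R <= \sum_(n <- cells M b) (#|` f n|)%:R.
  move=> /andP[K'0 K'K] hf b; have := hf (cells M b); rewrite sumrB.
  rewrite [X in _ - X]big_const_seq count_predT iter_addr_0 card_cells //.
  have pb : (perimeter (cells M b) <= d * M ^ d.-1)%N.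
    have -> : cells M b = cells_of M [fset b]%fset.
      by apply/fsetP => n; rewrite mem_cells_of // mem_cells // inE.
    apply: leq_trans (perimeter_cells_of _ _) _ => //.
    rewrite mulnC leq_mul2r; apply/orP; right.
    rewrite /perimeter -[X in (_ <= X)%N]card_ord -sum1_card leq_sum // => j _.
    rewrite /exits -[X in (_ <= X)%N](cardfs1 b); apply: fsubset_leq_card.
    by apply/fsubsetP => n; rewrite !inE => /andP[].
  have : K' * (perimeter (cells M b))%:R <= (K + 2) * (d * M ^ d.-1)%N%:R.
    by rewrite ler_pM // ler_nat.
  rewrite ler_norml => h /andP[+ _]; set s := \sum_(_ <- _) _.
  have : lam *+ M ^ d >= (K + 2 + (K + 2)) * (d * M ^ d.-1)%N%:R.
    have eM : (M ^ d = M * M ^ d.-1)%N by rewrite -expnS prednK.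
    by rewrite -[lam *+ _]mulr_natr eM !natrM !mulrA ler_wpM2r.
  lra.
have disc' (F : {fset Z}) :
    `|\sum_(n <- F) ((#|` fib n|)%:R - (#|` stretch_fibre n|)%:R)| <= (K + 2) * (perimeter F)%:R.
  have -> : \sum_(n <- F) ((#|` fib n|)%:R - (#|` stretch_fibre n|)%:R) =
      \sum_(n <- F) ((#|` fib n|)%:R - lam) - \sum_(n <- F) ((#|` stretch_fibre n|)%:R - lam).
    by rewrite -sumrB; apply: eq_bigr => n _; ring.
  rewrite mulrDl; apply: le_trans (ler_normB _ _) _.
  by apply: lerD; [exact: disc|exact: stretch_discrepancy].
have K20 : 0 <= K + 2 by rewrite addr_ge0.
have fat1 := fat _ fib K; have fat2 := fat _ stretch_fibre 2.
have [||h [hb hd]] := @bounded_transport d X Z a stretch_floor fib stretch_fibre R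
    (K + 2) M isT fibP mem_stretch_fibre K20 disc'.
- by apply: (fat1 _ disc); rewrite K0 /= lerDl.
- by apply: (fat2 _ stretch_discrepancy); rewrite lerDr K0 ler0n.
exists h; split=> //; exists ((2 * M)%N%:R + 1) => x j.
have := hd x j; rewrite -(ler_int R) intr_norm rmorphB /= !mxE => hx.
case: eqVneq hx => [->|_] hx; last by apply: le_trans hx _; rewrite lerDl.
have := floor_itv ((h x 0 i0)%:~R / lam) => /andP[f1 f2].
move: hx f1 f2; set u := (a x 0 i0)%:~R; set v := _ / lam; set w := (Num.floor v)%:~R.
rewrite rmorphD /= -/w => hx f1 f2.
have -> : u - v = (u - w) - (v - w) by ring.
apply: le_trans (ler_normB _ _) _; apply: lerD => //.
by rewrite ler_norml; apply/andP; split; lra.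
Qed.

End Rounding.

(** * Exponentials and smoothing kernels *)

Section Exponential.
Variable R : realType.
Implicit Types (x y t : R) (z w : R[i]).

(** Takes its values in [R], while the norm of [R[i]] takes them in [R[i]]. *)
Definition cabs z : R := Normc.normc z.

Lemma cabsM z w : cabs (z * w) = cabs z * cabs w.
Proof. exact: Normc.normcM. Qed.

Lemma cabsD z w : cabs (z + w) <= cabs z + cabs w.
Proof. exact: le_normcD. Qed.

Lemma cabs_real x : cabs x%:C%C = `|x|.
Proof. by rewrite /cabs /Normc.normc /= expr0n addr0 sqrtr_sqr. Qed.

Lemma cabs0 : cabs 0 = 0. Proof. exact: Normc.normc0. Qed.

Lemma cabs1 : cabs 1 = 1. Proof. exact: Normc.normc1. Qed.

Lemma cabs_ge0 z : 0 <= cabs z.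
Proof. by case: z => a b; rewrite /cabs /= sqrtr_ge0. Qed.

Lemma cabsN z : cabs (- z) = cabs z.
Proof. by case: z => a b; rewrite /cabs /= !sqrrN. Qed.

Lemma cabs_sum (I : Type) (s : seq I) (P : pred I) (F : I -> R[i]) :
  cabs (\sum_(i <- s | P i) F i) <= \sum_(i <- s | P i) cabs (F i).
Proof.
elim/big_ind2: _ => [|z a w b za wb|//]; first by rewrite cabs0.
by apply: le_trans (cabsD a b) _; exact: lerD.
Qed.

Lemma cabs_prod (I : Type) (s : seq I) (P : pred I) (F : I -> R[i]) :
  cabs (\prod_(i <- s | P i) F i) = \prod_(i <- s | P i) cabs (F i).
Proof. by elim/big_ind2: _ => [|z a w b <- <-|//]; rewrite ?cabs1 ?cabsM. Qed.

Lemma cabs_exp z n : cabs (z ^+ n) = cabs z ^+ n.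
Proof. by elim: n => [|n IH]; rewrite ?expr0 ?cabs1 // !exprS cabsM IH. Qed.

(** This is [exp (2 pi i x)], a character of [R / Z]. *)
Definition expi x : R[i] := (cos (pi *+ 2 * x) +i* sin (pi *+ 2 * x))%C.

Lemma expiD x y : expi (x + y) = expi x * expi y.
Proof. by rewrite /expi mulrDr cosD sinD; apply/eqP; rewrite eq_complex /= eqxx addrC eqxx. Qed.

Lemma expi0 : expi 0 = 1.
Proof. by rewrite /expi mulr0 cos0 sin0. Qed.

Lemma expi_sum (I : Type) (s : seq I) (F : I -> R) :
  expi (\sum_(i <- s) F i) = \prod_(i <- s) expi (F i).
Proof. exact: (big_morph expi expiD expi0). Qed.

Lemma cabs_expi x : cabs (expi x) = 1.
Proof. by rewrite /cabs /= cos2Dsin2 sqrtr1. Qed.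

Lemma expi1 : expi 1 = 1.
Proof. by rewrite /expi mulr1 cos2pi sin2pi. Qed.

Lemma expiN x : expi (- x) = (expi x)^-1.
Proof.
apply/eqP; rewrite -[_^-1]mul1r eq_sym; have e0 : expi x != 0.
  by apply/eqP => e; have := cabs_expi x; rewrite e cabs0 => /eqP; rewrite eq_sym oner_eq0.
by rewrite -(inj_eq (mulIf e0)) mulfVK // -expiD addNr expi0.
Qed.

Lemma expi_muln x n : expi (x *+ n) = expi x ^+ n.
Proof. by elim: n => [|n IH]; rewrite ?expi0 // mulrS exprS expiD IH. Qed.

Lemma expi_int (n : int) : expi n%:~R = 1.
Proof.
case: n => n; first by rewrite -[_%:~R]/(n%:R) expi_muln expi1 expr1n.
by rewrite NegzE rmorphN /= expiN -[_%:~R]/(n.+1%:R) expi_muln expi1 expr1n invr1.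
Qed.

Lemma expiDint x (n : int) : expi (x + n%:~R) = expi x.
Proof. by rewrite expiD expi_int mulr1. Qed.

Lemma cabs_expi_sub1 x : cabs (expi x - 1) = 2 * `|sin (pi * x)|.
Proof.
have -> : expi x - 1 = ((cos (pi *+ 2 * x) - 1) +i* sin (pi *+ 2 * x))%C.
  by apply/eqP; rewrite eq_complex /= subr0 !eqxx.
rewrite /cabs /= -[RHS]ger0_norm ?mulr_ge0 // -sqrtr_sqr; congr Num.sqrt.
rewrite exprMn real_normK ?num_real // mulrnAl.
rewrite cos_mulr2n sin_mulr2n.
have := cos2Dsin2 (pi * x); move: (cos _) (sin _) => c s h.
have hc : c ^+ 2 = 1 - s ^+ 2 by rewrite -h addrK.
have -> : (c * s *+ 2) ^+ 2 = c ^+ 2 * s ^+ 2 *+ 4 by ring.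
by rewrite hc; ring.
Qed.

(** The mean value theorem gives [t cos t <= sin t], and [1 <= cos t + sin t] gives
    [t (1 - cos t) <= t sin t]. Adding, [t <= (1 + t) sin t], and [1 + t <= pi] on the interval. *)
Lemma sin_lower t : 0 <= t <= pi / 2 -> t <= pi * sin t.
Proof.
move=> /andP[]; rewrite le_eqVlt => /orP[/eqP<-|t0] t1; first by rewrite sin0 mulr0.
have p2 := pi_ge2 R.
have c0 : 0 <= cos t by apply: cos_ge0_pihalf; rewrite t1 andbT; lra.
have s0 : 0 <= sin t by apply: sin_ge0_pi; rewrite (ltW t0) /=; lra.
have h1 : t * cos t <= sin t.
  have [|c] := @MVT R sin cos 0 t t0 (fun x _ => is_derive_sin x).
    by apply: continuous_subspaceT => x; exact: continuous_sin.
  rewrite in_itv /= sin0 !subr0 mulrC => /andP[c1 c2] ->; rewrite ler_wpM2l ?(ltW t0) //.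
  by rewrite leNgt ltr_cos ?ltNge ?(ltW c2) // in_itv /=; apply/andP; split; lra.
have h2 : t * (1 - cos t) <= t * sin t.
  rewrite ler_wpM2l ?(ltW t0) // lerBlDr -(cos2Dsin2 t) addrC.
  by rewrite lerD // expr2 ler_piMl ?sin_le1 ?cos_le1.
have : t <= (1 + t) * sin t by rewrite mulrDl mul1r; lra.
move=> /le_trans; apply; rewrite ler_wpM2r //; lra.
Qed.

Lemma sin_upper t : `|sin t| <= `|t|.
Proof.
wlog t0 : t / 0 < t => [hw|].
  have [t0|t0|<-] := ltgtP 0 t; first exact: hw.
    by rewrite -normrN -sinN -[X in _ <= X]normrN; apply: hw; lra.
  by rewrite sin0.
have [|c] := @MVT R sin cos 0 t t0 (fun x _ => is_derive_sin x).
  by apply: continuous_subspaceT => x; exact: continuous_sin.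
by rewrite sin0 !subr0 => _ ->; rewrite normrM ler_piMl // cos_max.
Qed.

Lemma nearest_int x : exists n : int, `|x - n%:~R| <= 2^-1.
Proof.
exists (Num.floor (x + 2^-1)); have /andP[] := floor_itv (x + 2^-1).
by rewrite rmorphD /= => h1 h2; rewrite ler_norml; apply/andP; split; lra.
Qed.

Lemma expi_sub1_lower x (n : int) : `|x - n%:~R| <= 2^-1 ->
  2 * `|x - n%:~R| <= cabs (expi x - 1).
Proof.
rewrite -(expiDint x (- n)) mulrNz cabs_expi_sub1 => h.
rewrite ler_wpM2l //; move: (x - _) h => y h.
have p2 := pi_ge2 R; have p0 : 0 < pi :> R by lra.
rewrite -(ler_pM2l p0) -[X in X * `|y|](ger0_norm (ltW p0)) -normrM.
have -> : `|sin (pi * y)| = sin `|pi * y|.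
  have [y0|y0] := leP 0 y.
    rewrite (ger0_norm (x := pi * y)) ?mulr_ge0 ?(ltW p0) // ger0_norm //.
    by apply: sin_ge0_pi; rewrite mulr_ge0 ?(ltW p0) //=; move: h; rewrite ger0_norm //; nra.
  rewrite (ler0_norm (x := pi * y)) ?mulr_ge0_le0 ?(ltW p0) ?(ltW y0) // sinN ler0_norm //.
  rewrite -[pi * y]opprK sinN oppr_le0; apply: sin_ge0_pi.
  by move: h; rewrite ltr0_norm // => h; apply/andP; split; nra.
apply: sin_lower; rewrite normr_ge0 /= normrM (gtr0_norm p0) ler_pM2l //.
Qed.

Lemma expi_sub1_upper x (n : int) : cabs (expi x - 1) <= 8 * `|x - n%:~R|.
Proof.
rewrite -(expiDint x (- n)) mulrNz cabs_expi_sub1.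
apply: le_trans (ler_wpM2l _ (sin_upper _)) _ => //.
have [/andP[_ p4] _] := pihalf_02_cos_pihalf R; have p2 := pi_ge2 R.
by rewrite normrM (ger0_norm (x := pi)) ?mulrA ?ler_wpM2r //; lra.
Qed.

Lemma expi_eq1 x : expi x = 1 -> exists n : int, x = n%:~R.
Proof.
move=> e; have [n hn] := nearest_int x; exists n.
have := expi_sub1_lower hn; rewrite e subrr cabs0 pmulr_rle0 // normr_le0 subr_eq0.
by move/eqP.
Qed.

Lemma geometric_sum_bound x (T : nat) :
  cabs (expi x - 1) * cabs (\sum_(h < T) expi (x *+ h)) <= 2.
Proof.
under eq_bigr do rewrite expi_muln.
rewrite -cabsM -subrX1 -expi_muln; apply: le_trans (cabsD _ _) _.
by rewrite cabsN cabs1 cabs_expi.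
Qed.

End Exponential.
Arguments expi {R} x : simpl never.
Arguments cabs {R} z : simpl never.

(** * Powers of the Fejer kernel *)

Section Kernel.
Variables (R : realType) (H M : nat).
Hypotheses (H_gt0 : (0 < H)%N) (M_gt0 : (0 < M)%N).
Local Notation L := (M * H)%N.

Lemma expi_conj (x : R) : (expi x)^*%C = expi (- x).
Proof. by rewrite /expi mulrN cosN sinN. Qed.

Lemma cabs_sqr (z : R[i]) : (cabs z ^+ 2)%:C%C = z * z^*%C.
Proof.
case: z => a b; rewrite /cabs /= sqr_sqrtr ?addr_ge0 ?sqr_ge0 //.
by apply/eqP; rewrite eq_complex /=; apply/andP; split; apply/eqP; ring.
Qed.

(** The coefficient of [z ^ s] in [(1 + z + ... + z ^ (H - 1)) ^ M]. The sum of the squares of these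
    numbers, [mass], is the constant Fourier coefficient of the squared modulus of
    [dirichlet_power]. *)
Definition sum_count (s : nat) : nat :=
  #|[pred a : {ffun 'I_M -> 'I_H} | (\sum_i a i)%N == s]|.

Definition mass : nat := (\sum_(s < L) sum_count s ^ 2)%N.

Definition dirichlet_power (x : R) : R[i] := (\sum_(h < H) expi (x *+ h)) ^+ M.

Lemma sum_index_lt (a : {ffun 'I_M -> 'I_H}) : ((\sum_i a i)%N < L)%N.
Proof.
apply: (@leq_ltn_trans (\sum_(i < M) H.-1)%N).
  by apply: leq_sum => i _; have := ltn_ord (a i); lia.
by rewrite sum_nat_const card_ord ltn_mul2l M_gt0 prednK /=.
Qed.

Lemma dirichlet_powerE x : dirichlet_power x = \sum_(s < L) (sum_count s)%:R * expi (x *+ s).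
Proof.
rewrite /dirichlet_power -[M in LHS]card_ord -prodr_const bigA_distr_bigA /=.
under eq_bigr do rewrite -expi_sum sumrMnr.
rewrite (partition_big (fun a => Ordinal (sum_index_lt a)) predT) //=.
apply: eq_bigr => s _; rewrite mulr_natl /sum_count -sum1_card -sumrMnr.
by apply: eq_big => [a|a /eqP <- //]; rewrite inE.
Qed.

Lemma total_sum_count : (\sum_(s < L) sum_count s = H ^ M)%N.
Proof.
have -> : (H ^ M = #|{ffun 'I_M -> 'I_H}|)%N by rewrite card_ffun !card_ord.
rewrite -sum1_card (partition_big (fun a => Ordinal (sum_index_lt a)) predT) //=.
apply: eq_bigr => s _; rewrite /sum_count -sum1_card; apply: eq_bigl => a.
by rewrite inE.
Qed.

(* Cauchy-Schwarz *)
Lemma mass_lower : (H ^ (2 * M) <= L * mass)%N.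
Proof.
rewrite mulnC expnM -total_sum_count -mulnn big_distrlr /=.
apply: (@leq_trans (\sum_(s < L) \sum_(t < L) (sum_count s ^ 2 + sum_count t ^ 2) %/ 2)%N).
  apply: leq_sum => s _; apply: leq_sum => t _.
  rewrite leq_divRL // mulnC; exact: (nat_Cauchy (sum_count s) (sum_count t)).
have h : (2 * \sum_(s < L) \sum_(t < L) (sum_count s ^ 2 + sum_count t ^ 2) %/ 2 <=
          2 * (L * mass))%N.
  rewrite big_distrr /=; apply: (@leq_trans (\sum_(s < L) \sum_(t < L) (sum_count s ^ 2 + sum_count t ^ 2))%N).
    apply: leq_sum => s _; rewrite big_distrr /=; apply: leq_sum => t _.
    by rewrite mulnC leq_divM.
  under eq_bigr do rewrite big_split /= sum_nat_const card_ord.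
  by rewrite big_split /= -big_distrr /= sum_nat_const card_ord -/mass addnn mul2n.
by move: h; rewrite leq_pmul2l.
Qed.

Lemma mass_gt0 : (0 < mass)%N.
Proof. by have := mass_lower; case: mass => // ; rewrite muln0 leqn0 expn_eq0; lia. Qed.

(** The normalised autocorrelation of [sum_count] at lag [q - L]; the relation [s - t = q - L] is
    written additively because subtraction on [nat] truncates. *)
Definition kernel_coef (q : 'I_(2 * L)) : R :=
  (\sum_(s < L) \sum_(t < L | s + L == q + t :> nat) sum_count s * sum_count t)%N%:R / mass%:R.

(** The [M]-th power of a Fejer kernel, normalised to mean 1. The power makes the tail at distance
    [rho] decay like [(H rho) ^ - (2 M)] up to a factor [M H], so that [M] can be adapted to the
    rate wanted. *)
Definition kernel (x : R) : R := cabs (dirichlet_power x) ^+ 2 / mass%:R.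

Definition frequency (q : 'I_(2 * L)) : int := (q : nat)%:Z - L%:Z.

Lemma kernel_ge0 x : 0 <= kernel x.
Proof. by rewrite divr_ge0 // sqr_ge0. Qed.

Lemma kernelE x : (kernel x)%:C%C =
  \sum_q (kernel_coef q)%:C%C * expi ((frequency q)%:~R * x).
Proof.
have m0 : mass%:R != 0 :> R by rewrite pnatr_eq0 -lt0n mass_gt0.
rewrite /kernel rmorphM /= cabs_sqr.
have -> : (dirichlet_power x)^*%C = dirichlet_power (- x).
  rewrite /dirichlet_power rmorphXn rmorph_sum; congr (_ ^+ _).
  by apply: eq_bigr => h _; rewrite mulNrn; exact: expi_conj.
rewrite !dirichlet_powerE big_distrlr /=.
under [RHS]eq_bigr do rewrite /kernel_coef rmorphM /= mulrAC natr_sum rmorph_sum /= mulr_suml.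
rewrite -mulr_suml; congr (_ * _); rewrite [RHS]exchange_big /=; apply: eq_bigr => s _.
under [RHS]eq_bigr do rewrite natr_sum rmorph_sum /= mulr_suml big_mkcond.
rewrite [RHS]exchange_big /=; apply: eq_bigr => t _.
have lt : (s + L - t < 2 * L)%N by have := ltn_ord s; lia.
rewrite (bigD1 (Ordinal lt)) //= big1 ?addr0 => [|q /eqP qn].
  have -> : (s + L == s + L - t + t)%N by apply/eqP; have := ltn_ord t; lia.
  rewrite natrM rmorphM /= !rmorph_nat mulrACA -expiD; congr (_ * expi _).
  have -> : frequency (Ordinal lt) = (s : nat)%:Z - (t : nat)%:Z.
    by rewrite /frequency /=; have := ltn_ord t; lia.
  by rewrite rmorphB /= mulrBl mulNrn -[X in X - _]mulr_natl -[X in _ - X]mulr_natl.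
case: eqP => // e; case: qn; apply: val_inj => /=; move: e; have := ltn_ord t; lia.
Qed.

Lemma kernel_coef_ge0 q : 0 <= kernel_coef q.
Proof. by rewrite divr_ge0. Qed.

(** This is [2 a b <= a ^ 2 + b ^ 2], where for a given [q] each [s] has at most one partner [t],
    and conversely. *)
Lemma kernel_coef_le1 q : kernel_coef q <= 1.
Proof.
rewrite ler_pdivrMr ?ltr0n ?mass_gt0 // mul1r ler_nat.
have h : (2 * \sum_(s < L) \sum_(t < L | s + L == q + t :> nat) sum_count s * sum_count t <=
   \sum_(s < L) \sum_(t < L | s + L == q + t :> nat) sum_count s ^ 2 +
   \sum_(s < L) \sum_(t < L | s + L == q + t :> nat) sum_count t ^ 2)%N.
  rewrite -big_split big_distrr /=; apply: leq_sum => s _.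
  rewrite -big_split big_distrr /=; apply: leq_sum => t _.
  exact: (nat_Cauchy (sum_count s) (sum_count t)).
have b (F : 'I_L -> nat) (P : 'I_L -> bool) c : (forall i j, P i -> P j -> i = j) ->
    (\sum_(t < L | P t) F t <= c)%N \/ exists2 t, P t & (\sum_(t < L | P t) F t = F t)%N.
  move=> hP; have [t Pt|P0] := pickP P; last by left; rewrite big_pred0.
  right; exists t => //; rewrite (bigD1 t) //= big1 ?addn0 // => i /andP[Pi /eqP].
  by move=> ni; case: ni; exact: hP.
have h1 : (\sum_(s < L) \sum_(t < L | s + L == q + t :> nat) sum_count s ^ 2 <= mass)%N.
  apply: leq_sum => s _.
  have [|//|[t _ ->//]] := b (fun=> sum_count s ^ 2)%N (fun t => s + L == q + t :> nat)%N (sum_count s ^ 2)%N.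
  by move=> i j /eqP e /eqP e'; apply: val_inj => /=; lia.
have h2 : (\sum_(s < L) \sum_(t < L | s + L == q + t :> nat) sum_count t ^ 2 <= mass)%N.
  rewrite (exchange_big_dep predT) //=; apply: leq_sum => t _.
  have [|//|[s _ ->//]] := b (fun=> sum_count t ^ 2)%N (fun s => s + L == q + t :> nat)%N (sum_count t ^ 2)%N.
  by move=> i j /eqP e /eqP e'; apply: val_inj => /=; lia.
lia.
Qed.

Lemma kernel_coef0 q : frequency q = 0 -> kernel_coef q = 1.
Proof.
rewrite /frequency => /eqP; rewrite subr_eq0 => /eqP [] qL.
rewrite /kernel_coef /mass -[RHS](@divff _ mass%:R) ?pnatr_eq0 -?lt0n ?mass_gt0 //.
congr (_%:R / _); apply: eq_bigr => s _; rewrite (bigD1 s) /=; last by rewrite qL addnC.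
rewrite big1 ?addn0 ?mulnn // => t /andP[/eqP e /eqP ne]; case: ne.
by apply: val_inj => /=; lia.
Qed.

(** At distance [rho] from the integers the geometric sum is at most [1 / rho], and [mass_lower]
    bounds [mass] below by [H ^ (2 M) / L]. *)
Lemma kernel_tail (x rho : R) : 0 < rho -> (forall n : int, rho <= `|x - n%:~R|) ->
  kernel x <= L%:R / (H%:R * rho) ^+ (2 * M).
Proof.
move=> rho0 hx; have H0 : 0 < H%:R :> R by rewrite ltr0n.
have hD : cabs (\sum_(h < H) expi (x *+ h)) <= rho^-1.
  have [n hn] := nearest_int x; have := expi_sub1_lower hn; have := hx n.
  have := geometric_sum_bound x H; have := cabs_ge0 (\sum_(h < H) expi (x *+ h)).
  move: (cabs _) (cabs _) (`|_|) => u v w u0 vu rw wv.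
  rewrite -[_^-1]mul1r ler_pdivlMr //; nra.
have hk : kernel x <= rho^-1 ^+ (2 * M) / mass%:R.
  rewrite /kernel /dirichlet_power cabs_exp -exprM mulnC ler_wpM2r ?invr_ge0 //.
  by rewrite lerXn2r // nnegrE ?cabs_ge0 // invr_ge0 ltW.
apply: le_trans hk _.
have hm : mass%:R^-1 <= L%:R / H%:R ^+ (2 * M) :> R.
  rewrite ler_pdivlMr ?exprn_gt0 // mulrC ler_pdivrMr ?ltr0n ?mass_gt0 //.
  by rewrite -natrX -natrM ler_nat mass_lower.
have -> : L%:R / (H%:R * rho) ^+ (2 * M) = rho^-1 ^+ (2 * M) * (L%:R / H%:R ^+ (2 * M)).
  by rewrite exprMn invfM exprVn; ring.
by rewrite ler_wpM2l // exprn_ge0 // invr_ge0 ltW.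
Qed.

(** All frequencies are at most [L < G] in absolute value, so none but 0 is a multiple of [G], and
    every other exponential sums to 0 over the grid. Such exact grid sums take the place of
    integrals over the torus. *)
Lemma kernel_grid_mean (G : nat) x : (2 * L <= G)%N ->
  \sum_(y < G) kernel (x - y%:R / G%:R) = G%:R.
Proof.
move=> LG; have L0 : (0 < L)%N by rewrite muln_gt0 M_gt0.
have G0 : (0 < G)%N by lia.
have GR : G%:R != 0 :> R by rewrite pnatr_eq0 -lt0n.
suff : (\sum_(y < G) kernel (x - y%:R / G%:R))%:C%C = G%:R%:C%C by case.
rewrite rmorph_sum /=; under eq_bigr do rewrite kernelE.
rewrite exchange_big /=.
have ltL : (L < 2 * L)%N by lia.
rewrite (bigD1 (Ordinal ltL)) //= [X in _ + X]big1 => [|q /eqP qL].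
  have f0 : frequency (Ordinal ltL) = 0 by rewrite /frequency subrr.
  under eq_bigr do rewrite f0 mul0r expi0 mulr1 kernel_coef0 //.
  by rewrite addr0 big_const_ord iter_addr_0 rmorph_nat rmorph1.
set z := frequency q.
have z0 : z != 0.
  apply/eqP => z0; apply: qL; apply: val_inj => /=; move: z0; rewrite /z /frequency; lia.
rewrite -mulr_sumr.
have -> : \sum_(y < G) expi (z%:~R * (x - y%:R / G%:R)) =
    expi (z%:~R * x) * \sum_(y < G) expi (- (z%:~R / G%:R)) ^+ y.
  rewrite mulr_sumr; apply: eq_bigr => y _; rewrite -expi_muln -expiD; congr expi.
  by rewrite mulrBr mulNrn -[_ *+ y]mulr_natr; ring.
set w := expi (- _); suff -> : \sum_(y < G) w ^+ y = 0 by rewrite !mulr0.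
have := subrX1 w G; rewrite -expi_muln mulNrn -[_ *+ G]mulr_natr mulfVK // -mulrNz expi_int subrr.
move/esym/eqP; rewrite mulf_eq0 => /orP[|/eqP//]; rewrite subr_eq0 => /eqP /expi_eq1[n e].
have : (- z)%:~R = (n * G%:Z)%:~R :> R.
  by rewrite rmorphM /= -[X in _ * X]/(G%:R) -e mulrNz mulNr mulfVK.
move/eqP; rewrite eqr_int => /eqP en.
have : (`|z| < G%:Z)%R.
  have := ltn_ord q; rewrite /z /frequency; lia.
have : n != 0 by apply: contra z0 => /eqP n0; rewrite -oppr_eq0 en n0 mul0r.
rewrite -normrN en normrM => n0; nia.
Qed.

End Kernel.

(** * Averages along a rotation *)

Section Rotation.
Variables (R : realType) (d r : nat) (A : 'M[R]_(d, r)) (T N : nat).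
Hypothesis T_gt0 : (0 < T)%N.

Local Notation index := {ffun 'I_N * 'I_d -> 'I_T}.

Definition pairing (q : 'rV[int]_r) (xi : 'rV[R]_r) : R :=
  \sum_j (q 0 j)%:~R * xi 0 j.

(** A sum of [N] points of the cube [[0, T)^d]: averaging over [index] iterates the average over the
    cube [N] times. Its multiplier is an [N]-th power and so decays as fast as desired away from
    resonances. *)
Definition shift (m : index) : 'rV[int]_d :=
  \row_i (\sum_a (m (a, i) : nat))%N%:Z.

Definition rotate (n : 'rV[int]_d) : 'rV[R]_r := map_mx intr n *m A.

Definition rotation_avg (u : 'rV[R]_r -> R) (xi : 'rV[R]_r) : R :=
  #|{: index}|%:R^-1 * \sum_(m : index) u (xi + rotate (shift m)).

Definition multiplier (q : 'rV[int]_r) : R[i] :=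
  (#|{: index}|%:R^-1)%:C%C * \sum_(m : index) expi (pairing q (rotate (shift m))).

Lemma pairingD q xi eta : pairing q (xi + eta) = pairing q xi + pairing q eta.
Proof. by rewrite -big_split; apply: eq_bigr => j _; rewrite mxE mulrDr. Qed.

Lemma pairingN q xi : pairing q (- xi) = - pairing q xi.
Proof. by rewrite -sumrN; apply: eq_bigr => j _; rewrite mxE mulrN. Qed.

Lemma pairing0l xi : pairing 0 xi = 0.
Proof. by apply: big1 => j _; rewrite mxE mul0r. Qed.

Lemma pairing_shift q m : pairing q (rotate (shift m)) =
  \sum_(p : 'I_N * 'I_d) pairing q (row p.2 A) *+ (m p : nat).
Proof.
transitivity (\sum_a \sum_i pairing q (row i A) *+ (m (a, i) : nat)); last first.
  by rewrite pair_bigA; apply: eq_bigr => -[a i].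
rewrite [RHS]exchange_big /=; under [RHS]eq_bigr do rewrite sumrMnr -mulr_natl mulr_sumr.
rewrite exchange_big /=; apply: eq_bigr => j _; rewrite mxE mulr_sumr.
by apply: eq_bigr => i _; rewrite !mxE mulrCA -pmulrn.
Qed.

Lemma card_index : #|{: index}| = (T ^ (N * d))%N.
Proof. by rewrite card_ffun card_prod !card_ord. Qed.

Lemma multiplierE q : multiplier q =
  \prod_(p : 'I_N * 'I_d) ((T%:R^-1)%:C%C * \sum_(h < T) expi (pairing q (row p.2 A) *+ h)).
Proof.
rewrite big_split /= prodr_const card_prod !card_ord bigA_distr_bigA /=.
rewrite -rmorphXn /= exprVn -natrX -card_index; congr (_ * _).
by apply: eq_bigr => m _; rewrite pairing_shift expi_sum.
Qed.

Lemma cabs_mean_expi (x : R) : cabs ((T%:R^-1)%:C%C * \sum_(h < T) expi (x *+ h)) <= 1.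
Proof.
have T0 : 0 < T%:R :> R by rewrite ltr0n.
rewrite cabsM cabs_real ger0_norm ?invr_ge0 // mulrC ler_pdivrMr // mul1r.
apply: le_trans (cabs_sum _ _ _) _; under eq_bigr do rewrite cabs_expi.
by rewrite sumr_const card_ord.
Qed.

Lemma cabs_multiplier_le1 q : cabs (multiplier q) <= 1.
Proof.
rewrite multiplierE cabs_prod; apply: prodr_ile1 => p _.
by rewrite cabs_ge0 cabs_mean_expi.
Qed.

(** The [N] factors belonging to coordinate [i] are geometric sums with the small divisor of row
    [i]; those of the other coordinates have modulus at most 1. *)
Lemma cabs_multiplier q i :
  cabs (multiplier q) * (T%:R * cabs (expi (pairing q (row i A)) - 1)) ^+ N <= 2 ^+ N.
Proof.
have T0 : 0 < T%:R :> R by rewrite ltr0n.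
have b a : cabs ((T%:R^-1)%:C%C * \sum_(h < T) expi (pairing q (row (a : 'I_d) A) *+ h)) *
    (T%:R * cabs (expi (pairing q (row a A)) - 1)) <= 2.
  rewrite cabsM cabs_real ger0_norm ?invr_ge0 // mulrACA mulVf ?gt_eqF // mul1r mulrC.
  exact: geometric_sum_bound.
pose f (a : 'I_d) := cabs ((T%:R^-1)%:C%C * \sum_(h < T) expi (pairing q (row a A) *+ h)).
have f01 a : 0 <= f a <= 1 by rewrite cabs_ge0 cabs_mean_expi.
rewrite multiplierE cabs_prod -(pair_bigA _ (fun _ a => f a)) /=.
rewrite prodr_const card_ord -exprMn lerXn2r ?nnegrE //.
  by rewrite !mulr_ge0 ?cabs_ge0 ?prodr_ge0 // => a _; case/andP: (f01 a).
apply: le_trans (b i); rewrite ler_wpM2r ?mulr_ge0 ?cabs_ge0 // (bigD1 i) //= ler_piMr ?cabs_ge0 //.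
by apply: prodr_ile1 => a _; exact: f01.
Qed.

Lemma rotation_avg_le u v xi : (forall x, u x <= v x) ->
  rotation_avg u xi <= rotation_avg v xi.
Proof. by move=> uv; rewrite ler_wpM2l ?invr_ge0 // ler_sum. Qed.

Lemma rotation_avgD u v xi :
  rotation_avg (fun x => u x + v x) xi = rotation_avg u xi + rotation_avg v xi.
Proof. by rewrite /rotation_avg big_split mulrDr. Qed.

Lemma rotation_avgN u xi : rotation_avg (fun x => - u x) xi = - rotation_avg u xi.
Proof. by rewrite /rotation_avg sumrN mulrN. Qed.

Lemma rotation_avg_cst c xi : rotation_avg (fun=> c) xi = c.
Proof.
rewrite /rotation_avg sumr_const -[c *+ _]mulr_natl mulrA mulVf ?mul1r //.
by rewrite pnatr_eq0 -lt0n card_index expn_gt0 T_gt0.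
Qed.

Lemma rotation_avgZ c u xi : rotation_avg (fun x => c * u x) xi = c * rotation_avg u xi.
Proof. by rewrite /rotation_avg -mulr_sumr mulrCA. Qed.

Section Smoothing.
Variables (H M G : nat).
Hypotheses (H_gt0 : (0 < H)%N) (M_gt0 : (0 < M)%N) (LG : (2 * (M * H) <= G)%N).
Local Notation L := (M * H)%N.
Local Notation freq_index := {ffun 'I_r -> 'I_(2 * L)}.
Local Notation grid_index := {ffun 'I_r -> 'I_G}.
Implicit Types (u v f : 'rV[R]_r -> R) (xi eta : 'rV[R]_r).

Definition frequencies (q : freq_index) : 'rV[int]_r := \row_j frequency (q j).

Definition kernels (xi : 'rV[R]_r) : R := \prod_j kernel H M (xi 0 j).

Definition coefs (q : freq_index) : R := \prod_j kernel_coef R (q j).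

Definition grid (y : grid_index) : 'rV[R]_r := \row_j ((y j)%:R / G%:R).

Definition grid_mean f : R := (G%:R ^+ r)^-1 * \sum_y f (grid y).

Definition grid_fourier f (q : 'rV[int]_r) : R[i] :=
  ((G%:R ^+ r)^-1)%:C%C * \sum_y (f (grid y))%:C%C * expi (- pairing q (grid y)).

(** A discrete convolution with the kernel. In [xi] it is a trigonometric polynomial, with
    coefficients [coefs] times the discrete Fourier coefficients of [f]. *)
Definition smoothing f xi : R := (G%:R ^+ r)^-1 * \sum_y f (grid y) * kernels (xi - grid y).

Definition oscillation f : R :=
  \sum_(q : freq_index | frequencies q != 0)
    cabs (grid_fourier f (frequencies q)) * cabs (multiplier (frequencies q)).

Definition tail (rho : R) : R := L%:R / (H%:R * rho) ^+ (2 * M).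

Lemma G_gt0 : (0 < G)%N.
Proof. by apply: leq_trans LG; rewrite !muln_gt0 M_gt0 H_gt0. Qed.

Lemma coefs01 q : 0 <= coefs q <= 1.
Proof.
apply/andP; split; first by apply: prodr_ge0 => j _; exact: kernel_coef_ge0.
by apply: prodr_ile1 => j _; rewrite kernel_coef_ge0 kernel_coef_le1.
Qed.

Lemma kernels_ge0 xi : 0 <= kernels xi.
Proof. by apply: prodr_ge0 => j _; exact: kernel_ge0. Qed.

Lemma kernelsE xi : (kernels xi)%:C%C =
  \sum_(q : freq_index) (coefs q)%:C%C * expi (pairing (frequencies q) xi).
Proof.
rewrite rmorph_prod /=; under eq_bigr do rewrite kernelE //.
rewrite bigA_distr_bigA; apply: eq_bigr => q _.
rewrite big_split /= -rmorph_prod -expi_sum; congr (_ * expi _).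
by apply: eq_bigr => j _; rewrite mxE.
Qed.

Lemma kernels_grid_mean xi : \sum_y kernels (xi - grid y) = G%:R ^+ r.
Proof.
transitivity (\sum_(y : grid_index) \prod_j kernel H M (xi 0 j - (y j)%:R / G%:R)).
  by apply: eq_bigr => y _; apply: eq_bigr => j _; rewrite !mxE.
rewrite -(bigA_distr_bigA (fun (j : 'I_r) (y : 'I_G) => kernel H M (xi 0 j - y%:R / G%:R))) /=.
under eq_bigr do rewrite kernel_grid_mean //.
by rewrite prodr_const card_ord.
Qed.

(** Characters are eigenvectors of the averages along the rotation, with eigenvalue [multiplier]. *)
Lemma rotation_avg_expi f xi : (rotation_avg (smoothing f) xi)%:C%C =
  \sum_(q : freq_index) (coefs q)%:C%C * grid_fourier f (frequencies q) *
     multiplier (frequencies q) * expi (pairing (frequencies q) xi).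
Proof.
rewrite /rotation_avg rmorphM /= rmorph_sum /=.
transitivity ((#|{: index}|%:R^-1)%:C%C * \sum_(m : index) \sum_(q : freq_index)
  (coefs q)%:C%C * grid_fourier f (frequencies q) *
  expi (pairing (frequencies q) xi) * expi (pairing (frequencies q) (rotate (shift m)))).
  congr (_ * _); apply: eq_bigr => m _.
  rewrite /smoothing rmorphM /= rmorph_sum /=.
  under eq_bigr do rewrite rmorphM /= kernelsE mulr_sumr.
  rewrite exchange_big mulr_sumr; apply: eq_bigr => q _ /=.
  rewrite /grid_fourier [_ * (_ * \sum_y _)]mulrCA -!mulrA; congr (_ * _).
  rewrite mulr_suml mulr_sumr; apply: eq_bigr => y _.
  by rewrite !pairingD pairingN !expiD; ring.
rewrite exchange_big mulr_sumr; apply: eq_bigr => q _ /=.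
by rewrite -mulr_sumr /multiplier; ring.
Qed.

Lemma rotation_avg_smoothing f xi :
  `|rotation_avg (smoothing f) xi - grid_mean f| <= oscillation f.
Proof.
have L0 : (0 < L)%N by rewrite muln_gt0 M_gt0.
have ltL : (L < 2 * L)%N by lia.
pose q0 : freq_index := [ffun=> Ordinal ltL].
have f0 : frequencies q0 = 0.
  by apply/rowP => j; rewrite !mxE ffunE /frequency subrr.
have zeroP q : frequencies q = 0 -> q = q0.
  move=> /rowP e; apply/ffunP => j; apply: val_inj; rewrite ffunE /=.
  by have := e j; rewrite !mxE /frequency => /eqP; rewrite subr_eq0 => /eqP [].
rewrite -cabs_real rmorphB /= rotation_avg_expi (bigD1 q0) //=.
have -> : coefs q0 = 1.
  by apply: big1 => j _; apply: kernel_coef0; rewrite ?ffunE /frequency ?subrr.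
rewrite f0 pairing0l expi0 mulr1.
have -> : multiplier 0 = 1.
  rewrite /multiplier; under eq_bigr do rewrite pairing0l expi0.
  rewrite sumr_const rmorphV /=; last by rewrite unitfE pnatr_eq0 -lt0n card_index expn_gt0 T_gt0.
  by rewrite rmorph_nat mulVf // pnatr_eq0 -lt0n card_index expn_gt0 T_gt0.
have -> : grid_fourier f 0 = (grid_mean f)%:C%C.
  rewrite /grid_fourier /grid_mean rmorphM /= rmorph_sum /=; congr (_ * _).
  by apply: eq_bigr => y _; rewrite pairing0l oppr0 expi0 mulr1.
rewrite mul1r mulr1 addrAC subrr add0r; apply: le_trans (cabs_sum _ _ _) _.
rewrite /oscillation (eq_bigl (fun q => frequencies q != 0)) => [|q]; last first.
  by apply/idP/idP; apply: contra => /eqP; [move/zeroP ->|move->; rewrite f0].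
apply: ler_sum => q _; rewrite cabsM cabs_expi mulr1 cabsM.
rewrite [cabs ((coefs q)%:C%C * _)]cabsM cabs_real.
have /andP[c0 c1] := coefs01 q.
by rewrite ger0_norm // ler_wpM2r ?cabs_ge0 // ler_piMl ?cabs_ge0.
Qed.

(** When [y] is far in coordinate [j], the [j]-th kernel is at most [tail rho], while each of the
    other coordinates sums freely to [G]; the choice of [j] costs the factor [r]. *)
Lemma kernels_tail rho xi : 0 < rho -> 
  \sum_(y | [exists j, `[< forall n : int, rho <= `|(xi - grid y) 0 j - n%:~R| >]])
     kernels (xi - grid y) <= r%:R * tail rho * G%:R ^+ r.
Proof.
move=> rho0.
pose far (j : 'I_r) (y : grid_index) :=
  `[< forall n : int, rho <= `|(xi - grid y) 0 j - n%:~R| >].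
apply: (@le_trans _ _ (\sum_j \sum_(y | far j y) kernels (xi - grid y))).
  rewrite (exchange_big_dep predT) //= big_mkcond /=; apply: ler_sum => y _.
  case: ifP => [/existsP[j hj]|_]; last by apply: sumr_ge0 => j _; exact: kernels_ge0.
  by rewrite (bigD1 j) //= lerDl; apply: sumr_ge0 => i _; exact: kernels_ge0.
rewrite -mulrA mulr_natl -[X in _ <= _ *+ X]card_ord -sumr_const; apply: ler_sum => j _.
have G0 : G%:R != 0 :> R by rewrite pnatr_eq0 -lt0n G_gt0.
pose g (i : 'I_r) (y : 'I_G) := if i == j then tail rho else kernel H M (xi 0 i - y%:R / G%:R).
apply: (@le_trans _ _ (\sum_(y : grid_index) \prod_i g i (y i))).
  rewrite big_mkcond /=; apply: ler_sum => y _.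
  have g0 i z : 0 <= g i z.
    rewrite /g; case: ifP => _; last exact: kernel_ge0.
    by rewrite /tail divr_ge0 // exprn_ge0 // mulr_ge0 // ltW.
  case: ifP => [/asboolP hj|_]; last by apply: prodr_ge0.
  apply: ler_prod => i _; rewrite kernel_ge0 /= /g !mxE; case: eqVneq => [->|_ //].
  by apply: kernel_tail => // n; have := hj n; rewrite !mxE.
rewrite -bigA_distr_bigA /= (bigD1 j) //=.
have -> : \sum_(y < G) g j y = G%:R * tail rho.
  by rewrite /g; under eq_bigr do rewrite eqxx; rewrite sumr_const card_ord mulr_natl.
rewrite (eq_bigr (fun=> G%:R)) => [|i ij]; last first.
  by rewrite /g; under eq_bigr do rewrite (negbTE ij); rewrite kernel_grid_mean.
rewrite prodr_const cardC1 card_ord mulrAC -exprS prednK ?[_ * tail _]mulrC //.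
by case: (j) => ? /=; case: (r).
Qed.

(** The kernels have grid mean 1, so the difference is a weighted mean of [u xi - u (grid y)]. Grid
    points near [xi] modulo integers are controlled by the majorant [v], the others by the bound [U]
    and the tail of the kernel. *)
Lemma smoothing_approx u v (U rho : R) xi : 0 < rho ->
  (forall x (n : 'rV[int]_r), u (x + map_mx intr n) = u x) ->
  (forall x, 0 <= v x) -> (forall x y, `|u x - u y| <= U) ->
  (forall x y : 'rV[R]_r, (forall j, `|x 0 j - y 0 j| < rho) -> `|u x - u y| <= v y) ->
  `|u xi - smoothing u xi| <= smoothing v xi + U * (r%:R * tail rho).
Proof.
move=> rho0 per v0 hU hv.
have G0 : 0 < G%:R ^+ r :> R by rewrite exprn_gt0 // ltr0n G_gt0.
have U0 : 0 <= U by apply: le_trans (hU 0 0); rewrite normr_ge0.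
have -> : u xi - smoothing u xi =
    (G%:R ^+ r)^-1 * \sum_y (u xi - u (grid y)) * kernels (xi - grid y).
  under eq_bigr do rewrite mulrBl; rewrite sumrB mulrBr; congr (_ - _).
  by rewrite -mulr_sumr kernels_grid_mean mulrCA mulVf ?mulr1 // gt_eqF.
rewrite normrM gtr0_norm ?invr_gt0 // /smoothing.
have -> : U * (r%:R * tail rho) = (G%:R ^+ r)^-1 * (U * (r%:R * tail rho * G%:R ^+ r)).
  by field; rewrite gt_eqF // -natrX ltr0n expn_gt0 G_gt0.
rewrite -mulrDr ler_wpM2l ?invr_ge0 ?(ltW G0) //.
apply: le_trans (ler_norm_sum _ _ _) _.
rewrite (bigID (fun y => [exists j, `[< forall n : int, rho <= `|(xi - grid y) 0 j - n%:~R| >]])) /=.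
rewrite addrC; apply: lerD; last first.
  apply: le_trans _ (ler_wpM2l U0 (kernels_tail xi rho0)); rewrite mulr_sumr.
  by apply: ler_sum => y _; rewrite normrM (ger0_norm (kernels_ge0 _)) ler_wpM2r ?kernels_ge0.
rewrite big_mkcond; apply: ler_sum => y _.
case: ifP => [hy|_]; last by rewrite mulr_ge0 ?kernels_ge0.
rewrite normrM (ger0_norm (kernels_ge0 _)) ler_wpM2r ?kernels_ge0 //.
have /choice[n hn] : forall j, exists n : int, `|(xi - grid y) 0 j - n%:~R| < rho.
  move=> j; apply: contrapT => hn; move/negP: hy; apply; apply/existsP; exists j.
  by apply/asboolP => n; rewrite leNgt; apply/negP => h; apply: hn; exists n.
rewrite -(per xi (\row_j - n j)); apply: hv => j.
by have := hn j; rewrite !mxE rmorphN /= addrAC.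
Qed.

(** In the applications [u] counts hits in a set and [v] hits near its boundary. Since [v] enters
    only after smoothing, its average is again a grid mean up to an oscillation. *)
Theorem rotation_avg_estimate u v (U rho : R) xi : 0 < rho ->
  (forall x (n : 'rV[int]_r), u (x + map_mx intr n) = u x) ->
  (forall x, 0 <= v x) -> (forall x y, `|u x - u y| <= U) ->
  (forall x y : 'rV[R]_r, (forall j, `|x 0 j - y 0 j| < rho) -> `|u x - u y| <= v y) ->
  `|rotation_avg u xi - grid_mean u| <=
    oscillation u + (grid_mean v + oscillation v + U * (r%:R * tail rho)).
Proof.
move=> rho0 per v0 hU hv.
have -> : rotation_avg u xi - grid_mean u = (rotation_avg (smoothing u) xi - grid_mean u) +
   rotation_avg (fun x => u x - smoothing u x) xi.
  by rewrite rotation_avgD rotation_avgN; ring.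
apply: le_trans (ler_normD _ _) _; apply: lerD; first exact: rotation_avg_smoothing.
apply: (@le_trans _ _ (rotation_avg (fun x => smoothing v x + U * (r%:R * tail rho)) xi)).
  have h x := @smoothing_approx u v U rho x rho0 per v0 hU hv.
  rewrite ler_norml -rotation_avgN; apply/andP; split; apply: rotation_avg_le => x;
    by have := h x; rewrite ler_norml => /andP[].
rewrite rotation_avgD rotation_avg_cst lerD2r -lerBlDl.
by apply: le_trans (ler_norm _) _; exact: rotation_avg_smoothing.
Qed.

End Smoothing.

End Rotation.

(** * A uniform lower bound for averages *)

Section Recurrence.
Variables (R : realType) (d r : nat) (A : 'M[R]_(d, r)).
Hypothesis irrational : forall q : 'rV[int]_r, q != 0 ->
  exists i, expi (pairing q (row i A)) != 1.

(** A bound independent of [N]. With [x] the factor [T * cabs (...)], it is clear for [x <= 2], and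
    otherwise follows from [x / 2 <= (x / 2) ^ N]. *)
Lemma cabs_multiplier_lin T N q i : (0 < T)%N -> (0 < N)%N ->
  cabs (multiplier A T N q) * (T%:R * cabs (expi (pairing q (row i A)) - 1)) <= 2.
Proof.
move=> T0 N0; have := cabs_multiplier A N T0 q i; have := cabs_multiplier_le1 A N T0 q.
have : 0 <= T%:R * cabs (expi (pairing q (row i A)) - 1) by rewrite mulr_ge0 // cabs_ge0.
have := cabs_ge0 (multiplier A T N q).
move: (cabs (multiplier _ _ _ _)) (T%:R * _) => m x m0 x0 m1 h.
have [x2|x2] := leP x 2; first by apply: le_trans x2; rewrite ler_piMl.
have : m * (x / 2) ^+ N <= 1.
  by rewrite expr_div_n mulrA ler_pdivrMr ?exprn_gt0 // mul1r.
have : x / 2 <= (x / 2) ^+ N by apply: ler_eXnr => //; lra.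
move=> h1 h2; have : m * (x / 2) <= 1 by apply: le_trans h2; rewrite ler_wpM2l.
lra.
Qed.

Lemma kernel_upper H M (x : R) : (0 < H)%N -> (0 < M)%N ->
  kernel H M x <= (2 * (M * H))%:R.
Proof.
move=> H0 M0; rewrite -[X in X <= _]ger0_norm ?kernel_ge0 // -cabs_real kernelE //.
apply: le_trans (cabs_sum _ _ _) _.
apply: (@le_trans _ _ (\sum_(q < 2 * (M * H)) 1)); last by rewrite sumr_const card_ord.
apply: ler_sum => q _; rewrite cabsM cabs_expi mulr1 cabs_real.
by rewrite ger0_norm ?kernel_coef_ge0 // kernel_coef_le1.
Qed.

Lemma kernels_upper H M (xi : 'rV[R]_r) : (0 < H)%N -> (0 < M)%N ->
  kernels H M xi <= (2 * (M * H))%:R ^+ r.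
Proof.
move=> H0 M0; rewrite /kernels -[r in X in _ <= X]card_ord -prodr_const.
by apply: ler_prod => j _; rewrite kernel_ge0 kernel_upper.
Qed.

Lemma kernels_far H M (rho : R) (xi : 'rV[R]_r) j : (0 < H)%N -> (0 < M)%N -> 0 < rho ->
  (forall n : int, rho <= `|xi 0 j - n%:~R|) ->
  kernels H M xi <= tail H M rho * (2 * (M * H))%:R ^+ r.
Proof.
move=> H0 M0 rho0 hj; rewrite /kernels (bigD1 j) //=.
have h1 : 1 <= (2 * (M * H))%:R :> R by rewrite (ler_nat R 1) !muln_gt0 H0 M0.
apply: ler_pM.
- exact: kernel_ge0.
- by apply: prodr_ge0 => i _; exact: kernel_ge0.
- exact: kernel_tail.
apply: (@le_trans _ _ (\prod_(i < r | i != j) (2 * (M * H))%:R)).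
  by apply: ler_prod => i _; rewrite kernel_ge0 kernel_upper.
rewrite prodr_const cardC1 card_ord; apply: ler_weXn2l => //.
exact: leq_pred.
Qed.

(** On the coarsest admissible grid, [G = 2 M H], the kernel is the smoothing of a point mass at 0
    of grid mean 1, so [rotation_avg_smoothing] applies. *)
Lemma rotation_avg_kernels T N H M xi : (0 < T)%N -> (0 < H)%N -> (0 < M)%N ->
  1 - \sum_(q : {ffun 'I_r -> 'I_(2 * (M * H))} | frequencies q != 0)
        cabs (multiplier A T N (frequencies q)) <= rotation_avg A T N (kernels H M) xi.
Proof.
move=> T0 H0 M0; pose G := (2 * (M * H))%N.
have G0 : (0 < G)%N by rewrite !muln_gt0 M0 H0.
have GR : G%:R != 0 :> R by rewrite pnatr_eq0 -lt0n.
pose f (x : 'rV[R]_r) : R := if x == 0 then G%:R ^+ r else 0.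
pose y0 : {ffun 'I_r -> 'I_G} := [ffun=> Ordinal G0].
have gy y : (grid R y == 0) = (y == y0).
  apply/eqP/eqP => [/rowP e|->]; last by apply/rowP => j; rewrite !mxE ffunE mul0r.
  apply/ffunP => j; apply: val_inj; rewrite ffunE /=.
  have := e j; rewrite !mxE => /eqP; rewrite mulf_eq0 invr_eq0 (negbTE GR) orbF.
  by rewrite pnatr_eq0 => /eqP.
have sumf (V : zmodType) (F : R -> {ffun 'I_r -> 'I_G} -> V) : (forall y, F 0 y = 0) ->
    \sum_y F (f (grid R y)) y = F (G%:R ^+ r) y0.
  move=> F0; rewrite (bigD1 y0) //= big1 ?addr0 => [|y /negbTE yy0].
    by rewrite /f gy eqxx.
  by rewrite /f gy yy0.
have grid0 : grid R y0 = 0 by apply/eqP; rewrite gy.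
have Gr0 : G%:R ^+ r != 0 :> R by rewrite expf_neq0.
have sm x : smoothing H M G f x = kernels H M x.
  rewrite /smoothing (sumf _ (fun a y => a * kernels H M (x - grid R y))) => [|y]; last exact: mul0r.
  by rewrite grid0 subr0 mulrA mulVf ?mul1r.
have gm : grid_mean G f = 1.
  by rewrite /grid_mean (sumf _ (fun a _ => a)) // mulVf.
have -> : rotation_avg A T N (kernels H M) xi = rotation_avg A T N (smoothing H M G f) xi.
  by congr (_ * _); apply: eq_bigr => m _; rewrite sm.
have := rotation_avg_smoothing A N T0 H0 M0 (leqnn G) f xi; rewrite gm.
have -> : oscillation A T N H M G f = \sum_(q : {ffun 'I_r -> 'I_(2 * (M * H))} | frequencies q != 0)
        cabs (multiplier A T N (frequencies q)).
  apply: eq_bigr => q _; rewrite /grid_fourier.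
  rewrite (sumf _ (fun a y => a%:C%C * expi (- pairing (frequencies q) (grid R y)))) => [|y]; last by rewrite rmorph0 mul0r.
  by rewrite mulrA -rmorphM /= mulVf // rmorph1 mul1r cabs_expi mul1r.
by rewrite ler_norml => /andP[h _]; lra.
Qed.

(** The function [u] dominates [(kernels (x - y) - 1/2) / B], where [B] bounds the kernel and [1/2]
    bounds it off the [rho]-neighbourhood of [y] modulo integers. The average of the kernel is at
    least [3/4] once [T] beats the finitely many small divisors involved, uniformly in [N], [u] and
    [y]. *)
Theorem rotation_avg_lower (rho : R) : 0 < rho ->
  exists c : R, 0 < c /\ exists T0 : nat, forall T N : nat, (T0 <= T)%N -> (0 < T)%N -> (0 < N)%N ->
    forall (u : 'rV[R]_r -> R) (y : 'rV[R]_r), (forall x, 0 <= u x) ->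
    (forall x, (exists n : 'rV[int]_r, forall j, `|(x - y) 0 j - (n 0 j)%:~R| < rho) -> 1 <= u x) ->
    forall xi, c <= rotation_avg A T N u xi.
Proof.
move=> rho0; pose M := r.+1.
(* With [M = r + 1] the bound from [kernels_far] equals [C / H ^ M], hence is at most [1/2] as soon
   as [H >= 2 C]. *)
pose C : R := M%:R * (2 * M)%:R ^+ r / rho ^+ (2 * M).
have C0 : 0 <= C by rewrite divr_ge0 ?mulr_ge0 ?exprn_ge0 // ltW.
pose H := (Num.trunc (2 * C)).+1.
have hH : 2 * C <= H%:R by rewrite ltW // truncnS_gt.
have H0 : 0 < H%:R :> R by rewrite ltr0n.
have hfar : tail H M rho * (2 * (M * H))%:R ^+ r <= 2^-1.
  have -> : tail H M rho * (2 * (M * H))%:R ^+ r = C / H%:R ^+ M.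
    rewrite /tail /C mulnA !natrM mulr_natr.
    rewrite !exprMn /M mul2n -addnn !exprD !exprS; field.
    by rewrite !gt_eqF ?exprn_gt0 //= rho0 H0.
  rewrite ler_pdivrMr ?exprn_gt0 //.
  have : H%:R <= H%:R ^+ M :> R by apply: ler_eXnr => //; rewrite (ler_nat R 1).
  by move: hH; lra.
pose B : R := (2 * (M * H))%:R ^+ r.
have B0 : 0 < B by rewrite exprn_gt0 // ltr0n !muln_gt0.
have /choice[iq hiq] : forall q : {ffun 'I_r -> 'I_(2 * (M * H))}, exists delta : R,
    0 < delta /\ (frequencies q != 0 -> exists i, delta <= cabs (expi (pairing (frequencies q) (row i A)) - 1)).
  move=> q; have [->|q0] := eqVneq (frequencies q) 0; first by exists 1.
  have [i hi] := irrational q0.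
  exists (cabs (expi (pairing (frequencies q) (row i A)) - 1)); split; last by exists i.
  rewrite lt_neqAle cabs_ge0 andbT eq_sym; apply: contra hi => /eqP /Normc.eq0_normc /eqP.
  by rewrite subr_eq0.
pose S := \sum_q (iq q)^-1.
exists (4^-1 / B); split; first by rewrite divr_gt0.
exists (Num.trunc (8 * S)).+1 => T N hT T0 N0 u y u0 hu xi.
have TS : 8 * S <= T%:R.
  by apply: (@le_trans _ _ (Num.trunc (8 * S)).+1%:R); rewrite ?ler_nat // ltW // truncnS_gt.
have TR : 0 < T%:R :> R by rewrite ltr0n.
have osc : \sum_(q : {ffun 'I_r -> 'I_(2 * (M * H))} | frequencies q != 0)
        cabs (multiplier A T N (frequencies q)) <= 4^-1.
  apply: (@le_trans _ _ (\sum_q 2 / T%:R * (iq q)^-1)).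
    rewrite big_mkcond; apply: ler_sum => q _; have [dq hq] := hiq q.
    case: ifP => [/hq[i hi]|_]; last by rewrite mulr_ge0 ?invr_ge0 ?divr_ge0 // ltW.
    have := cabs_multiplier_lin (frequencies q) i T0 N0; have := cabs_ge0 (multiplier A T N (frequencies q)).
    move: (cabs (multiplier _ _ _ _)) (cabs _) hi => m x hi m0 h.
    rewrite ler_pdivlMr // ler_pdivlMr //; apply: le_trans h.
    by rewrite -mulrA ler_wpM2l // mulrC ler_wpM2l // ltW.
  rewrite -mulr_sumr -/S mulrAC ler_pdivrMr //; lra.
have low x : B^-1 * (kernels H M (x - y) - 2^-1) <= u x.
  have [[n hn]|nn] := pselect (exists n : 'rV[int]_r, forall j, `|(x - y) 0 j - (n 0 j)%:~R| < rho).
    apply: le_trans (hu x _); last by exists n.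
    rewrite mulrC ler_pdivrMr // mul1r; apply: (@le_trans _ _ (kernels H M (x - y))); last exact: kernels_upper.
    by rewrite gerBl.
  apply: le_trans (u0 x); rewrite pmulr_rle0 ?invr_gt0 // subr_le0.
  apply: le_trans hfar.
  suff [j hj] : exists j, forall n : int, rho <= `|(x - y) 0 j - n%:~R|.
    exact: kernels_far hj.
  apply: contrapT => hn; apply: nn.
  have /choice[f hf] : forall j, exists n : int, `|(x - y) 0 j - n%:~R| < rho.
    move=> j; apply: contrapT => hj; apply: hn; exists j => n.
    by rewrite leNgt; apply/negP => h; apply: hj; exists n.
  by exists (\row_j f j) => j; rewrite mxE.
apply: le_trans _ (@rotation_avg_le _ _ _ A T N _ _ xi low).
rewrite rotation_avgZ rotation_avgD rotation_avg_cst // mulrC ler_wpM2l ?invr_ge0 ?(ltW B0) //.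
have -> : rotation_avg A T N (fun x => kernels H M (x - y)) xi = rotation_avg A T N (kernels H M) (xi - y).
  by congr (_ * _); apply: eq_bigr => m _; rewrite addrAC.
have := @rotation_avg_kernels T N H M (xi - y) T0 isT isT; lra.
Qed.

End Recurrence.

Section Density.
Variables (R : realType) (d r : nat) (A : 'M[R]_(d, r)).

Lemma rotateD n m : rotate A (n + m) = rotate A n + rotate A m.
Proof. by rewrite /rotate map_mxD mulmxDl. Qed.

Lemma rotation_avg_comm T N T' N' (u : 'rV[R]_r -> R) xi :
  rotation_avg A T N (rotation_avg A T' N' u) xi =
  rotation_avg A T' N' (rotation_avg A T N u) xi.
Proof.
rewrite /rotation_avg -!mulr_sumr mulrCA; congr (_ * (_ * _)); rewrite exchange_big /=.
by apply: eq_bigr => m _; apply: eq_bigr => m' _; rewrite addrAC.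
Qed.

Definition shifts T N : seq 'rV[int]_d :=
  [seq shift m | m <- enum {: {ffun 'I_N * 'I_d -> 'I_T}}].

Lemma translate_avg_shifts T N (u : 'rV[R]_r -> R) theta n :
  translate_avg (shifts T N) (fun n => u (theta + rotate A n)) n =
  rotation_avg A T N u (theta + rotate A n).
Proof.
rewrite /translate_avg /rotation_avg /shifts size_map -cardE; congr (_ * _).
rewrite big_map big_enum /=; apply: eq_bigr => m _.
by rewrite rotateD addrA.
Qed.

(** At scale [T = 1] nothing is averaged, as [sum_le_perimeter] demands of its first scale. *)
Lemma shifts1 N : shifts 1 N = [:: 0].
Proof.
have s0 (m : {ffun 'I_N * 'I_d -> 'I_1}) : shift m = 0.
  by apply/rowP => j; rewrite !mxE big1 // => a _; rewrite ord1.
have : size (shifts 1 N) = 1%N by rewrite size_map -cardE card_index // exp1n.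
have : all (pred1 0) (shifts 1 N) by apply/allP => n /mapP[m _ ->] /=; rewrite s0.
by case: (shifts 1 N) => [//|n [|//]] /=; rewrite andbT => /eqP->.
Qed.

Lemma shift_bound T N (m : {ffun 'I_N * 'I_d -> 'I_T}) j : `|shift m 0 j| <= (N * T)%N%:Z.
Proof.
rewrite mxE ger0_norm // lez_nat -[N in (_ <= N * T)%N]card_ord -sum_nat_const.
by apply: leq_sum => a _; apply: ltnW.
Qed.

(** Averages at two scales commute, whence [c i - eps i <= c j + eps j] for all [i] and [j]. The
    supremum [lam] of the left sides is then within [2 eps i] of every average at scale [i], and the
    lower bound [c0] at a large scale makes it positive. *)
Theorem uniform_discrepancy (u : 'rV[R]_r -> R) (a N : nat) (C kap c0 : R) (T0 : nat)
    (c : nat -> R) : 0 <= C -> 0 <= kap < 1 -> kap * (2 ^ a)%N%:R < 1 -> (0 < a)%N -> (0 < N)%N ->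
  0 < c0 ->
  (forall i xi, `|rotation_avg A (2 ^ (a * i)) N u xi - c i| <= C * kap ^+ i) ->
  (forall T, (T0 <= T)%N -> (0 < T)%N -> forall xi, c0 <= rotation_avg A T N u xi) ->
  exists lam : R, 0 < lam /\ forall theta, exists K : R, 0 <= K /\ forall F : {fset 'rV[int]_d},
    `|\sum_(n <- F) (u (theta + rotate A n) - lam)| <= K * (perimeter F)%:R.
Proof.
move=> C0 /andP[k0 k1] ka a0 N0 c00 hc hlow.
pose eps i := C * kap ^+ i.
have T_gt0 i : (0 < 2 ^ (a * i))%N by rewrite expn_gt0.
have cross i j : c i - eps i <= c j + eps j.
  have h1 : rotation_avg A (2 ^ (a * j)) N (rotation_avg A (2 ^ (a * i)) N u) 0 >= c i - eps i.
    rewrite -{1}(rotation_avg_cst A N (T_gt0 j) (c i - eps i) 0); apply: rotation_avg_le => x.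
    by have := hc i x; rewrite ler_norml => /andP[h _]; rewrite /eps; lra.
  apply: le_trans h1 _; rewrite rotation_avg_comm.
  rewrite -(rotation_avg_cst A N (T_gt0 i) (c j + eps j) 0); apply: rotation_avg_le => x.
  by have := hc j x; rewrite ler_norml => /andP[_ h]; rewrite /eps; lra.
pose lam := sup [set c i - eps i | i in [set: nat]].
have hs : has_sup [set c i - eps i | i in [set: nat]].
  split; first by exists (c 0%N - eps 0%N), 0%N.
  by exists (c 0%N + eps 0%N) => _ [i _ <-]; exact: cross.
have lam1 i : c i - eps i <= lam by apply: ub_le_sup; [exact: hs.2|exists i].
have lam2 i : lam <= c i + eps i.
  by apply: ge_sup; [exact: hs.1|move=> _ [j _ <-]; exact: cross].
have hlam i xi : `|rotation_avg A (2 ^ (a * i)) N u xi - lam| <= 2 * C * kap ^+ i.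
  have := hc i xi; have := lam1 i; have := lam2 i; rewrite /eps !ler_norml.
  by move=> h1 h2 /andP[h3 h4]; apply/andP; split; lra.
exists lam; split.
  have [i [hi hT]] : exists i, 2 * C * kap ^+ i < c0 /\ (T0 <= 2 ^ (a * i))%N.
    have : (fun i : nat => 2 * C * kap ^+ i) @ \oo --> 2 * C * (0 : R).
      by apply: cvgMr; apply: cvg_expr; rewrite ger0_norm.
    rewrite mulr0 => /cvgrPdist_lt /(_ _ c00) [n _ hn].
    exists (maxn n T0); split.
      have /= := hn (maxn n T0) (leq_maxl _ _).
      by rewrite sub0r normrN ger0_norm ?mulr_ge0 ?exprn_ge0.
    apply: leq_trans (leq_maxr n T0) _; apply: leq_trans (ltnW (ltn_expl _ (ltnSn 1))) _.
    by rewrite leq_exp2l // leq_pmull.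
  have := hlam i 0; rewrite ler_norml => /andP[_ h2]; have := hlow _ hT (T_gt0 i) 0; lra.
move=> theta.
apply: (@sum_le_perimeter d R _ (fun i => shifts (2 ^ (a * i)) N) (2 * C) kap N (2 ^ a)).
- by rewrite mulr_ge0.
- by rewrite k0.
- by [].
- by rewrite muln0 shifts1.
- move=> i; rewrite -size_eq0 size_map -cardE card_index ?T_gt0 //.
  by rewrite -lt0n expn_gt0 T_gt0.
- by move=> i _ /mapP[m _ ->] j; rewrite -expnM; exact: shift_bound.
- move=> i n; have := hlam i (theta + rotate A n).
  rewrite -translate_avg_shifts => h; apply: le_trans h; apply/eq_lerW; congr `|_|.
  rewrite /translate_avg sumrB mulrBr; congr (_ - _).
  rewrite big_const_seq count_predT iter_addr_0 -[X in _ * X]mulr_natl mulrA mulVf ?mul1r //.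
  by rewrite pnatr_eq0 size_map -cardE card_index ?T_gt0 // -lt0n expn_gt0 T_gt0.
Qed.

End Density.

(** * Counting hits *)

Lemma card_fset_set_le (T T' : choiceType) (A : set T) (B : set T') (f : T -> T') :
  finite_set B -> (forall x, A x -> B (f x)) ->
  (forall x y, A x -> A y -> f x = f y -> x = y) ->
  (#|` fset_set A| <= #|` fset_set B|)%N.
Proof.
move=> fB AB fi; have [fA|nfA] := pselect (finite_set A); last first.
  by rewrite /fset_set; case: pselect.
have <- : #|` [fset f x | x in fset_set A]%fset| = #|` fset_set A|.
  apply: card_in_imfset => x y /=; rewrite !in_fset_set // => /set_mem + /set_mem.
  exact: fi.
apply: fsubset_leq_card; apply/fsubsetP => _ /imfsetP[x /= xA ->].
by move: xA; rewrite !in_fset_set // => /set_mem xA; apply/mem_set/AB.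
Qed.

Lemma card_fset_setU (T : choiceType) (A B C : set T) :
  finite_set B -> finite_set C -> A `<=` B `|` C ->
  (#|` fset_set A| <= #|` fset_set B| + #|` fset_set C|)%N.
Proof.
move=> fB fC sub; apply: (@leq_trans #|` fset_set (B `|` C)|).
  by apply: (@card_fset_set_le _ _ _ _ id) => //; rewrite finite_setU.
by rewrite fset_setU // -cardfsUI leq_addr.
Qed.

Lemma fset_set_sub (T : choiceType) (A : set T) (F : {fset T}) :
  (forall x, A x -> x \in F) -> finite_set A /\ (#|` fset_set A| <= #|` F|)%N.
Proof.
move=> AF; have fA : finite_set A.
  by apply: (@sub_finite_set _ _ [set` F]) => [x /AF|]; [|exact: finite_fset].
split=> //; apply: fsubset_leq_card; apply/fsubsetP => x.
by rewrite in_fset_set // => /set_mem/AF.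
Qed.

Section Counting.
Variables (R : realType) (r : nat).
Implicit Types (E S : set 'rV[R]_r) (x y : 'rV[R]_r) (p : 'rV[int]_r).

Definition real_of (m n : nat) (p : 'M[int]_(m, n)) : 'M[R]_(m, n) := map_mx intr p.

Definition cbox (lo hi : 'rV[R]_r) : set 'rV[R]_r :=
  [set x : 'rV[R]_r | forall j, lo 0 j <= x 0 j <= hi 0 j].

Lemma lattice_box_count (G : nat) (lo hi : 'rV[R]_r) : (0 < G)%N ->
  (forall j, lo 0 j <= hi 0 j) ->
  exists F : {fset 'rV[int]_r},
    (forall p, cbox lo hi (G%:R^-1 *: real_of p) -> p \in F) /\
    #|` F|%:R <= \prod_j (G%:R * (hi 0 j - lo 0 j) + 1).
Proof.
move=> G0 lohi; have GR : 0 < G%:R :> R by rewrite ltr0n.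
pose w j := (Num.trunc (G%:R * (hi 0 j - lo 0 j))).+1.
pose K := (\max_j w j)%N.
pose m j := Num.ceil (G%:R * lo 0 j).
pose f (h : {ffun 'I_r -> 'I_K}) : 'rV[int]_r := \row_j (m j + (h j : nat)%:Z).
pose FF := family (fun j => [pred i : 'I_K | (i < w j)%N]).
exists [fset f h | h in FF]%fset; split=> [p hp|].
  have hw j : m j <= p 0 j /\ (absz (p 0%R j - m j)%R < w j)%N.
    have := hp j; rewrite !mxE ler_pdivlMl // ler_pdivrMl // => /andP[h1 h2].
    have h3 : m j <= p 0 j by rewrite ceil_le_int.
    split=> //; rewrite -(ltr_nat R); apply: le_lt_trans (truncnS_gt _).
    rewrite natr_absz ger0_norm ?subr_ge0 // rmorphB /= mulrBr.
    by apply: lerB => //; exact: ceil_ge.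
  have lt j : (absz (p 0%R j - m j)%R < K)%N.
    by apply: leq_trans (leq_bigmax j); exact: (hw j).2.
  apply/imfsetP; exists [ffun j => Ordinal (lt j)].
    by apply/familyP => j; rewrite inE ffunE /=; exact: (hw j).2.
  by apply/rowP => j; rewrite !mxE ffunE /=; have := (hw j).1; lia.
apply: (@le_trans _ _ (#|FF|%:R)).
  by rewrite ler_nat (leq_trans (leq_imfset_card _ _ _)) //= cardE.
rewrite card_family foldrE big_map big_enum /= natr_prod; apply: ler_prod => j _.
rewrite ler0n /=.
apply: (@le_trans _ _ (w j)%:R).
  rewrite ler_nat; apply: (@leq_trans #|[pred i : 'I_K | (i < w j)%N]|) => //.
  by rewrite -sum1_card -(big_ord_widen K (fun=> 1%N)) ?sum1_card ?card_ord // leq_bigmax.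
by rewrite /w -natr1 lerD2r truncn_le mulr_ge0 ?subr_ge0 // ltW.
Qed.

Definition lattice_hits E x : set 'rV[int]_r := [set p | E (x + real_of p)].

(** The periodised indicator function of [E]; a point is counted several times where [E] overlaps
    its integer translates. *)
Definition hits E x : nat := #|` fset_set (lattice_hits E x)|.

Lemma hits_box E lo hi x : E `<=` cbox lo hi -> (forall j, lo 0 j <= hi 0 j) ->
  finite_set (lattice_hits E x) /\ (hits E x)%:R <= \prod_j (hi 0 j - lo 0 j + 1) :> R.
Proof.
move=> Eb lohi; have [|F [hF cF]] := @lattice_box_count 1 (lo - x) (hi - x) isT.
  by move=> j; rewrite !mxE lerD2r.
have [|fin le] := @fset_set_sub _ (lattice_hits E x) F.
  move=> p /Eb h; apply: hF => j; have := h j; rewrite !mxE invr1 mul1r.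
  by rewrite lerBlDl lerBrDl.
split=> //; apply: le_trans (le_trans _ cF) _; first by rewrite ler_nat.
apply/eq_lerW/eq_bigr => j _; rewrite !mxE mul1r; ring.
Qed.

Lemma real_ofD (m n : nat) (p q : 'M[int]_(m, n)) : real_of (p + q) = real_of p + real_of q.
Proof. exact: map_mxD. Qed.

Lemma hits_periodic E lo hi x n : E `<=` cbox lo hi -> (forall j, lo 0 j <= hi 0 j) ->
  hits E (x + real_of n) = hits E x.
Proof.
move=> Eb lohi.
have fin y : finite_set (lattice_hits E y) := (hits_box y Eb lohi).1.
apply/eqP; rewrite eqn_leq; apply/andP; split.
  apply: (@card_fset_set_le _ _ _ _ (fun p => n + p)) => // [p|p q _ _ /addrI//].
  by rewrite /lattice_hits /= real_ofD addrA.
apply: (@card_fset_set_le _ _ _ _ (fun p => p - n)) => // [p|p q _ _ /addIr//].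
by rewrite /lattice_hits /= -addrA -real_ofD subrKC.
Qed.

(** Stands in for the [rho]-neighbourhood of the boundary: it accounts for every change of the hit
    count under a move by less than [rho]. *)
Definition mixed (rho : R) E : set 'rV[R]_r :=
  [set x : 'rV[R]_r | exists y : 'rV[R]_r, (forall j, `|x 0 j - y 0 j| < rho) /\ ~ (E x <-> E y)].

Lemma hits_mixed (rho : R) E x y :
  (forall z, finite_set (lattice_hits E z)) ->
  finite_set (lattice_hits (mixed rho E) y) ->
  (forall j, `|x 0 j - y 0 j| < rho) ->
  `|(hits E x)%:R - (hits E y)%:R| <= (hits (mixed rho E) y)%:R :> R.
Proof.
move=> fin finM xy.
have dif p : ~ (E (x + real_of p) <-> E (y + real_of p)) -> mixed rho E (y + real_of p).
  move=> h; exists (x + real_of p); split=> [j|[h1 h2]]; last by apply: h; split.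
  rewrite !mxE opprD addrACA subrr addr0 distrC; exact: xy.
have h1 : (hits E x <= hits E y + hits (mixed rho E) y)%N.
  apply: card_fset_setU => // p; rewrite /lattice_hits /= => hp.
  by have [h|h] := pselect (E (y + real_of p)); [left|right; apply: dif => -[/(_ hp)]].
have h2 : (hits E y <= hits E x + hits (mixed rho E) y)%N.
  apply: card_fset_setU => // p; rewrite /lattice_hits /= => hp.
  by have [h|h] := pselect (E (x + real_of p)); [left|right; apply: dif => -[_ /(_ hp)]].
move: h1 h2; rewrite -!(ler_nat R) !natrD ler_norml => h1 h2.
by apply/andP; split; lra.
Qed.

(** The points [y / G + p] run once through the lattice [Z^r / G], so the sum counts points of that
    lattice in the box. *)
Lemma hits_grid_sum (G : nat) (lo hi : 'rV[R]_r) : (0 < G)%N ->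
  (forall j, lo 0 j <= hi 0 j) ->
  \sum_(y : {ffun 'I_r -> 'I_G}) (hits (cbox lo hi) (grid R y))%:R
    <= \prod_j (G%:R * (hi 0 j - lo 0 j) + 1) :> R.
Proof.
move=> G0 lohi; have [F [hF cF]] := lattice_box_count G0 lohi; apply: le_trans _ cF.
have GR : G%:R != 0 :> R by rewrite pnatr_eq0 -lt0n.
have /choice[res hres] : forall a : 'rV[int]_r, exists h : {ffun 'I_r -> 'I_G},
    a = block_point (block G a) h.
  by move=> a; have [h eh _] := block_offset G0 a; exists h.
have le (y : {ffun 'I_r -> 'I_G}) : (hits (cbox lo hi) (grid R y) <= #|` [fset a in F | res a == y]%fset|)%N.
  pose f (p : 'rV[int]_r) := block_point p y.
  have fF p : cbox lo hi (grid R y + real_of p) -> f p \in F.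
    move=> h; apply: hF; move=> j; have := h j; rewrite !mxE rmorphD rmorphM /=.
    by rewrite mulrDr mulrCA mulVf // mulr1 addrC [_^-1 * _]mulrC.
  have rf p : res (f p) = y.
    have := hres (f p); rewrite /f block_pointK // => e.
    exact/esym/(block_point_inj e).
  apply: leq_trans (_ : #|` fset_set [set` [fset a in F | res a == y]%fset]| <= _)%N; last first.
    by rewrite set_fsetK.
  apply: (@card_fset_set_le _ _ _ _ f) => [|p hp|p q _ _ e]; first exact: finite_fset.
    by rewrite /= !inE rf eqxx fF.
  by rewrite -(block_pointK G0 p y) -/(f p) e block_pointK.
rewrite -natr_sum ler_nat; apply: (@leq_trans (\sum_(y : {ffun 'I_r -> 'I_G}) #|` [fset a in F | res a == y]%fset|)%N).
  by apply: leq_sum => y _; exact: le.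
rewrite card_fset_sum1 (partition_big res predT) //=.
by apply: leq_sum => y _; rewrite card_fset_sum1 big_fset.
Qed.

Lemma hits_grid_sum_cover (G n : nat) (lo hi : 'I_n -> 'rV[R]_r) S : (0 < G)%N ->
  (forall l j, lo l 0 j <= hi l 0 j) -> S `<=` \bigcup_l cbox (lo l) (hi l) ->
  \sum_(y : {ffun 'I_r -> 'I_G}) (hits S (grid R y))%:R
    <= \sum_l \prod_j (G%:R * (hi l 0 j - lo l 0 j) + 1) :> R.
Proof.
move=> G0 lohi cov.
apply: (@le_trans _ _ (\sum_l \sum_(y : {ffun 'I_r -> 'I_G}) (hits (cbox (lo l) (hi l)) (grid R y))%:R)); last first.
  by apply: ler_sum => l _; exact: hits_grid_sum.
rewrite exchange_big; apply: ler_sum => y _; rewrite -natr_sum ler_nat.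
have fin l : finite_set (lattice_hits (cbox (lo l) (hi l)) (grid R y)).
  by have [] := hits_box (grid R y) (@subset_refl _ (cbox (lo l) (hi l))) (lohi l).
have [|_ le] := @fset_set_sub _ (lattice_hits S (grid R y))
    (\bigcup_(l <- enum 'I_n) fset_set (lattice_hits (cbox (lo l) (hi l)) (grid R y)))%fset.
  move=> p /cov[l _ hl]; apply/bigfcupP; exists l; first by rewrite mem_enum.
  by rewrite in_fset_set //; apply/mem_set.
apply: leq_trans le _; rewrite -big_enum /=.
elim: (enum 'I_n) => [|l s IH]; first by rewrite !big_nil cardfs0.
by rewrite !big_cons (leq_trans (leq_trans (leq_addr _ _) (eq_leq (cardfsUI _ _)))) // leq_add2l.
Qed.

End Counting.

(** * Sections with small boundary *)

Lemma linear_exp_bound (R : realType) (a b : nat) (t : R) : 0 <= t < 1 ->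
  exists C : R, 0 <= C /\ forall i : nat, (a * i + b)%N%:R * t ^+ i <= C.
Proof.
move=> /andP[t0 t1]; exists (a%:R / (1 - t) + b%:R); split.
  by rewrite addr_ge0 // divr_ge0 // subr_ge0 ltW.
move=> i; have ti : 0 <= t ^+ i <= 1 by rewrite exprn_ge0 // exprn_ile1 // ltW.
have h : i%:R * t ^+ i <= (1 - t)^-1.
  rewrite -[_^-1]mul1r ler_pdivlMr ?subr_gt0 //.
  have e := subrX1 t i; have : 1 - t ^+ i = (1 - t) * \sum_(j < i) t ^+ j.
    by rewrite -opprB e -mulNr opprB.
  have : i%:R * t ^+ i <= \sum_(j < i) t ^+ j.
    rewrite mulr_natl -[i in _ *+ i]card_ord -sumr_const; apply: ler_sum => j _.
    by apply: ler_wiXn2l => //; [exact: ltW|exact: ltnW].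
  case/andP: ti => ti0 ti1 h1 h2; nra.
rewrite natrD natrM mulrDl -mulrA lerD ?ler_wpM2l //.
by case/andP: ti => ti0 ti1; rewrite ler_piMr.
Qed.

(** With [s = (1 + t) / 2], one factor of the power is absorbed by [(t / s) ^ i] and the others,
    inductively, by [s ^ i]. *)
Lemma poly_exp_bound (R : realType) (a b e : nat) (t : R) : 0 <= t < 1 ->
  exists C : R, 0 <= C /\ forall i : nat, (a * i + b)%N%:R ^+ e * t ^+ i <= C.
Proof.
elim: e t => [|e IH] t /andP[t0 t1].
  by exists 1; split=> // i; rewrite expr0 mul1r exprn_ile1 // ltW.
pose s := (1 + t) / 2; have s01 : 0 <= s < 1 by rewrite /s; apply/andP; split; lra.
have s0 : 0 < s by rewrite /s; lra.
have ts : 0 <= t / s < 1.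
  by rewrite divr_ge0 ?(ltW s0) //= ltr_pdivrMr // mul1r /s; lra.
have [C1 [C10 h1]] := IH s s01; have [C2 [C20 h2]] := linear_exp_bound a b ts.
exists (C1 * C2); split; first exact: mulr_ge0.
move=> i; have -> : (a * i + b)%:R ^+ e.+1 * t ^+ i =
    ((a * i + b)%:R ^+ e * s ^+ i) * ((a * i + b)%:R * (t / s) ^+ i).
  rewrite mulrACA -exprSr -exprMn; congr (_ * _ ^+ _).
  by rewrite mulrC mulfVK // gt_eqF.
apply: ler_pM => //; rewrite mulr_ge0 ?exprn_ge0 ?(ltW s0) //.
by case/andP: ts.
Qed.

Section Diophantine.
Variables (R : realType) (d r : nat) (A : 'M[R]_(d, r)).

(** A multiplicative small divisor condition: [cabs (expi x - 1)] is comparable to the distance of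
    [x] to the integers, and [l.+1 ^ e] is a power of the logarithm of the size of [q]. Taking
    [d]-th powers avoids roots throughout. *)
Definition diophantine := exists c : R, 0 < c /\ exists e : nat,
  forall (l : nat) (q : 'rV[int]_r), q != 0 -> (forall j, `|q 0 j| <= (2 ^ l)%N%:Z) ->
  exists i, c <= cabs (expi (pairing q (row i A)) - 1) ^+ d *
    \prod_j (1 + `|q 0 j|%:~R) * l.+1%:R ^+ e.

Lemma diophantine_irrational : (0 < d)%N -> diophantine ->
  forall q : 'rV[int]_r, q != 0 -> exists i, expi (pairing q (row i A)) != 1.
Proof.
move=> d0 [c [c0 [e hc]]] q q0; pose l := (\max_j absz (q 0%R j))%N.
have [|i hi] := hc l q q0.
  move=> j; rewrite -abszE lez_nat.
  have h : (absz (q 0%R j) <= l)%N by exact: (leq_bigmax (F := fun j => absz (q 0%R j)) j).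
  exact: leq_trans h (ltnW (ltn_expl _ _)).
exists i; apply/eqP => e1; move: hi; rewrite e1 subrr cabs0 expr0n.
by rewrite gtn_eqF // !mul0r leNgt c0.
Qed.

Lemma grid_fourier_le G (f : 'rV[R]_r -> R) (U : R) (q : 'rV[int]_r) : (0 < G)%N -> (forall x, 0 <= f x <= U) ->
  cabs (grid_fourier G f q) <= U.
Proof.
move=> G0 hf; have Gr : 0 < G%:R ^+ r :> R by rewrite exprn_gt0 // ltr0n.
rewrite /grid_fourier cabsM cabs_real ger0_norm ?invr_ge0 ?(ltW Gr) // mulrC ler_pdivrMr //.
apply: le_trans (cabs_sum _ _ _) _.
apply: (@le_trans _ _ (\sum_(y : {ffun 'I_r -> 'I_G}) U)).
  apply: ler_sum => y _; rewrite cabsM cabs_expi mulr1 cabs_real.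
  by have /andP[f0 fU] := hf (grid R y); rewrite ger0_norm.
by rewrite sumr_const card_ffun !card_ord -[U *+ _]mulr_natr natrX.
Qed.

Lemma frequencies_bound M H (q : {ffun 'I_r -> 'I_(2 * (M * H))}) j :
  `|frequencies q 0 j| <= (M * H)%N%:Z.
Proof. by rewrite mxE /frequency; have := ltn_ord (q j); lia. Qed.

Lemma oscillation_crude T N H M G (f : 'rV[R]_r -> R) (U m : R) : (0 < G)%N -> (forall x, 0 <= f x <= U) ->
  (forall q : {ffun 'I_r -> 'I_(2 * (M * H))}, frequencies q != 0 ->
     cabs (multiplier A T N (frequencies q)) <= m) -> 0 <= m ->
  oscillation A T N H M G f <= (2 * (M * H))%:R ^+ r * (U * m).
Proof.
move=> G0 hf hm m0; have U0 : 0 <= U by have /andP[/le_trans] := hf 0; apply.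
apply: (@le_trans _ _ (\sum_(q : {ffun 'I_r -> 'I_(2 * (M * H))}) U * m)).
  rewrite /oscillation big_mkcond; apply: ler_sum => q _.
  case: ifP => [q0|_]; last exact: mulr_ge0.
  by apply: ler_pM; rewrite ?cabs_ge0 ?hm // grid_fourier_le.
by rewrite sumr_const card_ffun !card_ord -[(U * m) *+ _]mulr_natl natrX.
Qed.

Lemma mixed_box rho E (lo hi : 'rV[R]_r) : rho <= 1 -> E `<=` cbox lo hi ->
  mixed rho E `<=` cbox (\row_j (lo 0 j - 1)) (\row_j (hi 0 j + 1)).
Proof.
move=> rho1 Eb x [y [xy h]] j; rewrite !mxE; have := xy j.
have [/Eb/(_ j) + _|nEx] := pselect (E x); first by lra.
have [/Eb/(_ j) + |nEy] := pselect (E y); last by case: h; split.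
by rewrite ltr_norml => /andP[h1 h2] /andP[h3 h4]; apply/andP; split; lra.
Qed.

(** The scales are [T = 2 ^ (2 r i)], [H = 2 ^ ((2 r + 2) i)] and [rho = 2 ^ - ((2 r + 1) i)]. The
    boundary error is about [th ^ i rho], smaller than [1 / T] when [th < 2]. The product
    [H rho = 2 ^ i] gives a small tail of the kernel. As [d >= r + 2], [T ^ d] exceeds [H ^ r] so
    much that [T] times any small divisor in range grows like a power of [2 ^ i]. The factor [th] is
    the loss in covering the boundary. *)
Theorem discrepancy_small_boundary (lo hi : 'rV[R]_r) (E : set 'rV[R]_r) (th C0 C1 : R) :
  diophantine -> (0 < r)%N -> (r + 2 <= d)%N -> 1 <= th -> 0 <= C0 -> 0 <= C1 ->
  E `<=` cbox lo hi -> (forall j, lo 0 j <= hi 0 j) ->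
  (forall i, exists (n : nat) (c : 'I_n -> 'rV[R]_r),
     n%:R <= C0 * (2 ^+ ((2 * r + 1) * r.-1) * th) ^+ i /\
     mixed (2 ^- ((2 * r + 1) * i)) E `<=`
       \bigcup_l cbox (\row_j (c l 0 j - C1 * 2 ^- ((2 * r + 1) * i)))
                      (\row_j (c l 0 j + C1 * 2 ^- ((2 * r + 1) * i)))) ->
  exists N : nat, (0 < N)%N /\ exists C : R, 0 <= C /\ exists c : nat -> R, forall i xi,
    `|rotation_avg A (2 ^ (2 * r * i)) N (fun x => (hits E x)%:R) xi - c i|
      <= C * (th / 2 ^+ (2 * r + 1)) ^+ i.
Proof.
move=> [c0 [c00 [e hdio]]] r0 rd th1 C00 C10 Eb lohi hcov.
pose b := (2 * r + 2)%N; pose M := b.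
(* Multipliers will be [O(2 ^ - (N' i))]: the part [b r] of [N'] pays for the [(2 M H) ^ r]
   frequencies, the part [2 r + 1] yields [rho]. The factor [d] in [N] is there because divisors are
   bounded through their [d]-th powers. *)
pose N' := (b * r + (2 * r + 1))%N; pose N := (d * N')%N.
have d0 : (0 < d)%N by clear - rd; lia.
have N0 : (0 < N)%N by rewrite muln_gt0 d0 /N' addnA addn1.
pose U : R := \prod_j (hi 0 j - lo 0 j + 1).
pose V : R := \prod_j (hi 0 j - lo 0 j + 3).
have half : 0 <= (2^-1 : R) < 1 by apply/andP; split; lra.
have [Cp [Cp0 hp]] := poly_exp_bound b (M + 1) e half.
pose C2 : R := 2 ^+ d * (2 ^+ ((M + 1) * r) / c0) * Cp.
have C20 : 0 <= C2 by rewrite !mulr_ge0 ?exprn_ge0 ?invr_ge0 ?(ltW c00).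
have M_gt0 : (0 < M)%N by rewrite /M /b addnS.
have multb i (q : {ffun 'I_r -> 'I_(2 * (M * 2 ^ (b * i)))}) : frequencies q != 0 ->
    cabs (multiplier A (2 ^ (2 * r * i)) N (frequencies q)) <= C2 ^+ N' * 2^-1 ^+ (N' * i).
  move=> q0; have [|j hj] := hdio (b * i + M)%N _ q0.
    move=> j; apply: le_trans (frequencies_bound q j) _.
    by rewrite lez_nat expnD mulnC leq_mul2l (ltnW (ltn_expl _ _)) // orbT.
  set beta := cabs (expi _ - 1) in hj.
  have T0 : (0 < 2 ^ (2 * r * i))%N by rewrite expn_gt0.
  have := cabs_multiplier A N T0 (frequencies q) j; rewrite -/beta.
  have prodb : \prod_j (1 + `|frequencies q 0 j|%:~R) <= (2 ^+ ((b * i + M + 1) * r) : R).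
    rewrite exprM -[X in _ ^+ X]card_ord -prodr_const; apply: ler_prod => i' _.
    rewrite addr_ge0 ?ler0z //=; have := frequencies_bound q i'.
    rewrite -(ler_int R) => h; apply: le_trans (lerD (lexx 1) h) _.
    rewrite -[_%:~R]/((M * 2 ^ (b * i))%:R) -natrX -(natrD R 1) ler_nat.
    rewrite (expnD 2 (b * i + M)) (expnD 2 (b * i)) expn1.
    have : (0 < 2 ^ (b * i))%N by rewrite expn_gt0.
    have := ltn_expl M (ltnSn 1); move: (2 ^ M)%N (2 ^ (b * i))%N => u v hu v0.
    have h1 : (v * M.+1 <= v * u)%N by rewrite leq_mul2l hu orbT.
    rewrite mulnS mulnC in h1; clear - h1 v0; lia.
  have beta0 : 0 <= beta by exact: cabs_ge0.
  set tb := (2 ^ (2 * r * i))%:R * beta.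
  have tb0 : 0 <= tb by rewrite mulr_ge0.
  (* Here [d >= r + 2] enters, as [2 ^ (2 i) * H ^ r <= T ^ d]. One factor [2 ^ i] of the gain will
     absorb the logarithms in [key2], the other remains. *)
  have key : 2 ^+ (2 * i) <= tb ^+ d * (2 ^+ ((M + 1) * r) / c0) * (b * i + (M + 1))%:R ^+ e.
    have h1 : c0 <= beta ^+ d * 2 ^+ ((b * i + M + 1) * r) * (b * i + (M + 1))%:R ^+ e.
      have -> : (b * i + (M + 1) = (b * i + M).+1)%N by rewrite addnA addn1.
      by apply: le_trans hj _; rewrite ler_wpM2r ?exprn_ge0 // ler_wpM2l ?exprn_ge0.
    have -> : tb ^+ d = 2 ^+ (2 * r * i * d) * beta ^+ d by rewrite /tb exprMn natrX -exprM.
    have h2 : 2 ^+ (2 * i) * 2 ^+ (b * i * r) <= 2 ^+ (2 * r * i * d) :> R.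
      rewrite -exprD ler_eXn2l ?(ltr_nat R 1) // /b.
      have e1 : (r * i * (r + 2) <= r * i * d)%N by rewrite leq_mul2l rd orbT.
      have e2 : (i <= r * i)%N by rewrite leq_pmull.
      clear - e1 e2; lia.
    have -> : 2 ^+ (2 * r * i * d) * beta ^+ d * (2 ^+ ((M + 1) * r) / c0) * (b * i + (M + 1))%:R ^+ e =
      2 ^+ (2 * r * i * d) * ((beta ^+ d * 2 ^+ ((M + 1) * r) * (b * i + (M + 1))%:R ^+ e) / c0) by ring.
    apply: le_trans (_ : 2 ^+ (2 * i) * 2 ^+ (b * i * r) *
      ((beta ^+ d * 2 ^+ ((M + 1) * r) * (b * i + (M + 1))%:R ^+ e) / c0) <= _); last first.
      by apply: ler_wpM2r h2; rewrite divr_ge0 ?(ltW c00) // !mulr_ge0 ?exprn_ge0.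
    have -> : 2 ^+ (2 * i) * 2 ^+ (b * i * r) *
      ((beta ^+ d * 2 ^+ ((M + 1) * r) * (b * i + (M + 1))%:R ^+ e) / c0) = 2 ^+ (2 * i) *
      ((beta ^+ d * 2 ^+ ((b * i + M + 1) * r) * (b * i + (M + 1))%:R ^+ e) / c0).
      have -> : ((b * i + M + 1) * r = b * i * r + (M + 1) * r)%N by rewrite -addnA mulnDl.
      by rewrite exprD; ring.
    by rewrite ler_peMr ?exprn_ge0 // ler_pdivlMr // mul1r.
  have key2 : 2 ^+ i * 2 ^+ d <= tb ^+ d * C2.
    have x0 : 0 < (2 : R) ^+ i by rewrite exprn_gt0.
    have := hp i; rewrite exprVn ler_pdivrMr // => h.
    rewrite /C2.
    have : 2 ^+ (2 * i) * 2 ^+ d <= tb ^+ d * (2 ^+ d * (2 ^+ ((M + 1) * r) / c0)) * (Cp * 2 ^+ i).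
      apply: le_trans (ler_wpM2r (exprn_ge0 d (ler0n R 2)) key) _.
      rewrite mulrAC; apply: ler_pM => //; rewrite ?mulr_ge0 ?exprn_ge0 ?invr_ge0 ?(ltW c00) //.
      by apply/eq_lerW; ring.
    rewrite mul2n -addnn exprD => h'; rewrite -(ler_pM2r x0).
    have -> : 2 ^+ i * 2 ^+ d * 2 ^+ i = 2 ^+ i * 2 ^+ i * 2 ^+ d :> R by ring.
    by apply: le_trans h' _; apply/eq_lerW; ring.
  have tbd : 0 < tb ^+ d.
    rewrite lt_neqAle exprn_ge0 // andbT eq_sym; apply/eqP => z.
    by move: key2; rewrite z mul0r leNgt mulr_gt0 // exprn_gt0.
  rewrite /N exprM (exprM 2) => hm.
  have : cabs (multiplier A (2 ^ (2 * r * i)) (d * N') (frequencies q)) <= (2 ^+ d / tb ^+ d) ^+ N'.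
    by rewrite expr_div_n ler_pdivlMr // exprn_gt0.
  move=> h; apply: le_trans h _.
  rewrite mulnC exprM -exprMn; apply: lerXn2r; rewrite ?nnegrE.
  - by rewrite divr_ge0 // ?exprn_ge0 // ltW.
  - by rewrite mulr_ge0 // exprn_ge0 // invr_ge0.
  rewrite ler_pdivrMr // exprVn mulrAC ler_pdivlMr ?exprn_gt0 // mulrC.
  by rewrite [C2 * _]mulrC.
pose Cu : R := (2 * M)%:R ^+ r * (U * C2 ^+ N').
pose Cv : R := (2 * M)%:R ^+ r * (V * C2 ^+ N').
pose Cm : R := C0 * (2 * C1 + 1) ^+ r.
pose Ct : R := U * (r%:R * M%:R).
have hU x : 0 <= ((hits E x)%:R : R) <= U by rewrite ler0n (hits_box x Eb lohi).2.
have lohi' j : (\row_j (lo 0 j - 1)) 0 j <= (\row_j (hi 0 j + 1)) 0 j :> R.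
  by rewrite !mxE; have := lohi j; lra.
have rho1 i : (2 ^- ((2 * r + 1) * i) : R) <= 1.
  by rewrite invf_le1 ?exprn_gt0 // exprn_ege1 // (ler_nat R 1).
have hV i x : 0 <= ((hits (mixed (2 ^- ((2 * r + 1) * i)) E) x)%:R : R) <= V.
  rewrite ler0n /=; have [_ h] := hits_box x (mixed_box (rho1 i) Eb) lohi'.
  apply: le_trans h _; apply/eq_lerW/eq_bigr => j _; rewrite !mxE; ring.
have U0 : 0 <= U by have /andP[/le_trans] := hU 0; apply.
have V0 : 0 <= V by have /andP[/le_trans] := hV 0%N 0; apply.
have C11 : 0 <= 2 * C1 + 1 by rewrite addr_ge0 // mulr_ge0.
have Cu0 : 0 <= Cu by rewrite mulr_ge0 ?exprn_ge0 // mulr_ge0 // exprn_ge0.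
have Cv0 : 0 <= Cv by rewrite mulr_ge0 ?exprn_ge0 // mulr_ge0 // exprn_ge0.
have Cm0 : 0 <= Cm by rewrite mulr_ge0 // exprn_ge0.
have Ct0 : 0 <= Ct by rewrite !mulr_ge0.
exists N; split=> //; exists (Cu + (Cm + Cv + Ct)); split; first by rewrite !addr_ge0.
pose G i := (2 * (M * 2 ^ (b * i)))%N.
exists (fun i => grid_mean (G i) (fun x => (hits E x)%:R)) => i xi.
set rho : R := 2 ^- ((2 * r + 1) * i).
have rho0 : 0 < rho by rewrite invr_gt0 exprn_gt0.
have H0 : (0 < 2 ^ (b * i))%N by rewrite expn_gt0.
have T0 : (0 < 2 ^ (2 * r * i))%N by rewrite expn_gt0.
have G0 : (0 < G i)%N by rewrite !muln_gt0 H0 M_gt0.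
apply: le_trans (@rotation_avg_estimate R d r A _ N T0 (2 ^ (b * i))%N M (G i) H0 M_gt0 (leqnn _)
  (fun x => (hits E x)%:R) (fun x => (hits (mixed rho E) x)%:R) U rho xi rho0 _ _ _ _) _.
- by move=> x n; rewrite (hits_periodic _ _ Eb lohi).
- by move=> x; rewrite ler0n.
- move=> x y; have /andP[h1 h2] := hU x; have /andP[h3 h4] := hU y.
  by rewrite ler_norml; apply/andP; split; lra.
- move=> x y xy; apply: hits_mixed => //.
    by move=> z; exact: (hits_box z Eb lohi).1.
  exact: (hits_box y (mixed_box (rho1 i) Eb) lohi').1.
have th_i : 1 <= th ^+ i by rewrite exprn_ege1.
have kapE : (th / 2 ^+ (2 * r + 1)) ^+ i = th ^+ i * rho by rewrite expr_div_n -exprM.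
have oscb f W : 0 <= W -> (forall x, 0 <= f x <= W) ->
   oscillation A (2 ^ (2 * r * i)) N (2 ^ (b * i)) M (G i) f <= (2 * M)%:R ^+ r * (W * C2 ^+ N') * rho.
  move=> W0 hf; apply: le_trans (oscillation_crude G0 hf (@multb i) _) _.
    by rewrite mulr_ge0 // exprn_ge0 // invr_ge0.
  rewrite mulnA natrM exprMn -!mulrA ler_wpM2l ?exprn_ge0 //.
  have -> : (2 ^ (b * i))%:R ^+ r * (W * (C2 ^+ N' * 2^-1 ^+ (N' * i))) =
     W * (C2 ^+ N' * ((2 ^ (b * i))%:R ^+ r * 2^-1 ^+ (N' * i))) by ring.
  rewrite !ler_wpM2l ?exprn_ge0 // /rho natrX -exprM exprVn ler_pdivrMr ?exprn_gt0 //.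
  rewrite mulrC ler_pdivlMr ?exprn_gt0 // -exprD ler_eXn2l ?(ltr_nat R 1) //.
  by rewrite /N'; clear; lia.
have rhoth : rho <= th ^+ i * rho by rewrite ler_peMl // ltW.
rewrite kapE !mulrDl; apply: lerD.
  by apply: le_trans (oscb _ U U0 hU) _; rewrite ler_wpM2l.
apply: lerD; last first.
  rewrite /tail /Ct -!mulrA ler_wpM2l // ler_wpM2l //.
  have -> : (2 ^ (b * i))%:R * rho = 2 ^+ i.
    rewrite /rho natrX /b; have -> : ((2 * r + 2) * i = (2 * r + 1) * i + i)%N by clear; lia.
    by rewrite exprD mulrAC divff ?mul1r // expf_neq0.
  rewrite natrM -mulrA ler_wpM2l //; apply: le_trans _ rhoth.
  rewrite /rho ler_pdivrMr ?exprn_gt0 ?exprn_gt0 // mulrC ler_pdivlMr ?exprn_gt0 //.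
  by rewrite natrX -exprM -exprD ler_eXn2l ?(ltr_nat R 1) // /M /b; clear; lia.
apply: lerD.
  have [n [c [hn hc]]] := hcov i.
  have := @hits_grid_sum_cover R r (G i) n _ _ _ G0 _ hc.
  rewrite -/rho => /(_ _)/le_trans h.
  rewrite /grid_mean mulrC ler_pdivrMr ?exprn_gt0 ?ltr0n //.
  apply: h => [l j|]; first by rewrite !mxE lerD2l ge0_cp // mulr_ge0 // ltW.
  have GR : 0 < (G i)%:R :> R by rewrite ltr0n.
  (* The grid is finer than [rho], so a box of side comparable to [rho] holds [O((G rho) ^ r)] grid
     points. *)
  have Grho : 1 <= (G i)%:R * rho.
    rewrite /rho ler_pdivlMr ?exprn_gt0 // mul1r -natrX ler_nat /G /M /b.
    have : (2 ^ ((2 * r + 1) * i) <= 2 ^ ((2 * r + 2) * i))%N by rewrite leq_exp2l //; clear; lia.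
    move=> h; apply: leq_trans h _; rewrite mulnA leq_pmull // muln_gt0 /=; clear; lia.
  apply: (@le_trans _ _ (\sum_(l < n) ((2 * C1 + 1) * ((G i)%:R * rho)) ^+ r)).
    apply: ler_sum => l _; rewrite -[X in _ ^+ X]card_ord -prodr_const; apply: ler_prod => j _.
    rewrite !mxE; have x0 : 0 <= C1 * rho by rewrite mulr_ge0 // ltW.
    have -> : c l 0 j + C1 * rho - (c l 0 j - C1 * rho) = 2 * (C1 * rho) by ring.
    apply/andP; split; first by apply: addr_ge0 => //; apply: mulr_ge0 => //; exact: mulr_ge0.
    have -> : (2 * C1 + 1) * ((G i)%:R * rho) = (G i)%:R * (2 * (C1 * rho)) + (G i)%:R * rho by ring.
    by rewrite lerD2l.
  rewrite sumr_const card_ord -[_ *+ n]mulr_natl exprMn [((G i)%:R * rho) ^+ r]exprMn.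
  have -> : n%:R * ((2 * C1 + 1) ^+ r * ((G i)%:R ^+ r * rho ^+ r)) =
    (n%:R * rho ^+ r) * ((2 * C1 + 1) ^+ r * (G i)%:R ^+ r) by ring.
  have -> : Cm * (th ^+ i * rho) * (G i)%:R ^+ r =
    (C0 * (th ^+ i * rho)) * ((2 * C1 + 1) ^+ r * (G i)%:R ^+ r) by rewrite /Cm; ring.
  rewrite ler_wpM2r ?mulr_ge0 ?exprn_ge0 ?addr_ge0 ?mulr_ge0 //.
  apply: le_trans (ler_wpM2r (exprn_ge0 r (ltW rho0)) hn) _.
  rewrite -mulrA ler_wpM2l // exprMn -exprM mulrC mulrA mulrC ler_wpM2l ?exprn_ge0 ?(le_trans _ th1) //.
  rewrite /rho -exprVn -!exprM !exprVn mulrC ler_pdivrMr ?exprn_gt0 // mulrC ler_pdivlMr ?exprn_gt0 //.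
  rewrite -exprD ler_eXn2l ?(ltr_nat R 1) //.
  by rewrite -[X in (_ <= _ * X)%N](prednK r0) mulnS [((2 * r + 1) * r.-1 * i)%N]mulnAC addnC.
by apply: le_trans (oscb _ V V0 (hV i)) _; rewrite ler_wpM2l.
Qed.

End Diophantine.

(** * Boxes *)

Lemma convex_filter_iota (P : pred nat) (X : nat) :
  (forall a b c, P a -> P c -> (a <= b <= c)%N -> P b) ->
  exists m n, [seq x <- iota 0 X | P x] = iota m n.
Proof.
move=> cP; elim: X => [|X [m [n IH]]]; first by exists 0%N, 0%N.
rewrite -addn1 iotaD add0n filter_cat IH /=.
case: ifP => PX; last by exists m, n; rewrite cats0.
case: n IH => [|n] IH; first by exists X, 1%N.
exists m, n.+2.
have inE' x : (x \in iota m n.+1) = P x && (x < X)%N.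
  by rewrite -IH mem_filter mem_iota add0n.
have /andP[Pl lX] : P (m + n)%N && (m + n < X)%N by rewrite -inE' mem_iota; lia.
have e : (m + n.+1 = X)%N.
  apply/eqP; rewrite eqn_leq; apply/andP; split; first by lia.
  rewrite leqNgt; apply/negP => lt.
  have : P (m + n.+1)%N by apply: (cP (m + n)%N _ X) => //; lia.
  move=> PP; have : (m + n.+1 \in iota m n.+1)%N by rewrite inE' PP.
  by rewrite mem_iota; lia.
by rewrite -[n.+2]addn1 iotaD e.
Qed.

(** A convex set of indices is an interval; up to a unimodular factor the sum is then geometric,
    with a bound that does not depend on the endpoints. *)
Lemma convex_geometric (R : realType) (P : pred nat) (X : nat) (t : R) :
  (forall a b c, P a -> P c -> (a <= b <= c)%N -> P b) ->
  cabs (expi t - 1) * cabs (\sum_(n < X | P n) expi (t *+ n)) <= 2.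
Proof.
move=> cP; have [m [n e]] := convex_filter_iota X cP.
have -> : \sum_(n < X | P n) expi (t *+ n) = expi (t *+ m) * \sum_(h < n) expi (t *+ h).
  rewrite -(big_mkord P (fun n => expi (t *+ n))) -big_filter /index_iota subn0 e.
  rewrite -[m in iota m n]addn0 iotaDl big_map mulr_sumr -(big_mkord xpredT (fun h => expi (t *+ m) * expi (t *+ h))).
  by rewrite /index_iota subn0; apply: eq_bigr => h _; rewrite -expiD mulrnDr.
by rewrite cabsM cabs_expi mul1r; exact: geometric_sum_bound.
Qed.

(** A pigeonhole count in a cube of side [ep], comparing [d]-th powers only. With [K] minimal such
    that [(8 ep) ^ d < K ^ d V], cells of side [ep / K] hold at most one point; for [K = 1] the
    lower bound on the points themselves leaves none. There are [K + 1] cells per side, [K - 1]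
    violates the inequality, and [K + 1 <= 3 (K - 1)] explains [24 = 3 * 8]. *)
Lemma separated_count (R : realType) (X : finType) (S : pred X) (d : nat)
    (x : X -> 'I_d -> R) (ep V : R) : (0 < d)%N -> 0 < ep -> 0 < V ->
  (forall a i, S a -> `|x a i| <= ep / 2) ->
  (forall a, S a -> exists i, V <= (8 * `|x a i|) ^+ d) ->
  (forall a b, S a -> S b -> a != b -> exists i, V <= (8 * `|x a i - x b i|) ^+ d) ->
  #|S|%:R * V <= (24 * ep) ^+ d.
Proof.
move=> d0 e0 V0 hx hS hSS.
have exK : exists K : nat, (8 * ep) ^+ d < K%:R ^+ d * V.
  exists (Num.trunc ((8 * ep) ^+ d / V)).+1; rewrite -ltr_pdivrMr //.
  apply: lt_le_trans (truncnS_gt _) _; apply: ler_eXnr => //; by rewrite (ler_nat R 1).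
have exK' : exists K : nat, `[< (8 * ep) ^+ d < K%:R ^+ d * V >].
  by have [K hK] := exK; exists K; apply/asboolP.
case: (ex_minnP exK') => K /asboolP hK minK.
have dn0 : d != 0%N by rewrite -lt0n.
case: K hK minK => [|[|K]] hK minK.
- by move: hK; rewrite expr0n (negbTE dn0) mul0r ltNge exprn_ge0 // mulr_ge0 // ltW.
- rewrite expr1n mul1r in hK; rewrite (eq_card0 (A := S)) ?mul0r ?exprn_ge0 ?mulr_ge0 ?(ltW e0) //.
  move=> a; apply/negP => Sa; have [i hi] := hS a Sa.
  have : (8 * `|x a i|) ^+ d <= (8 * ep) ^+ d.
    by rewrite lerXn2r ?nnegrE ?mulr_ge0 ?(ltW e0) // ler_wpM2l //; have := hx a i Sa; lra.
  by move=> h; have := lt_le_trans hK (le_trans hi h); rewrite ltxx.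
have hK1 : K.+1%:R ^+ d * V <= (8 * ep) ^+ d.
  rewrite leNgt; apply/negP => h; by have := minK K.+1 (introT (asboolP _) h); rewrite ltnn.
pose kk : R := K.+2%:R / ep.
have kk0 : 0 < kk by rewrite divr_gt0.
pose cell a i := Num.trunc ((x a i + ep / 2) * kk).
have cpos a i : S a -> 0 <= (x a i + ep / 2) * kk.
  move=> Sa; rewrite mulr_ge0 ?(ltW kk0) //.
  by have := hx a i Sa; rewrite ler_norml => /andP[]; lra.
have clt a i : ((if S a then cell a i else 0) < K.+3)%N.
  case: ifP => // Sa; rewrite -(ltr_nat R); apply: le_lt_trans (_ : _ <= K.+2%:R) _; last by rewrite ltr_nat.
  have := cpos a i Sa; rewrite -truncn_le => h; apply: le_trans h _.
  rewrite /kk mulrA ler_pdivrMr // mulrC ler_wpM2l //.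
  by have := hx a i Sa; rewrite ler_norml => /andP[]; lra.
pose f a : {ffun 'I_d -> 'I_K.+3} := [ffun i => Ordinal (clt a i)].
have finj : {in S &, injective f}.
  move=> a b Sa Sb /ffunP e; apply/eqP; apply/negPn/negP => ab.
  have [i hi] := hSS a b Sa Sb ab.
  have := e i; rewrite !ffunE => -[]; rewrite ![S _]Sa ![S b]Sb => ec.
  have h : `|x a i - x b i| < ep / K.+2%:R.
    have : `|(x a i + ep / 2) * kk - (x b i + ep / 2) * kk| < 1.
      have := truncn_itv (cpos a i Sa); have := truncn_itv (cpos b i Sb).
      rewrite -/(cell a i) -/(cell b i) ec -natr1 ltr_norml => /andP[h1 h2] /andP[h3 h4].
      by apply/andP; split; lra.
    rewrite -mulrBl opprD addrACA subrr addr0 normrM (gtr0_norm kk0).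
    by rewrite -ltr_pdivlMr // mul1r /kk invf_div.
  have : (8 * `|x a i - x b i|) ^+ d < V.
    apply: (@le_lt_trans _ _ ((8 * (ep / K.+2%:R)) ^+ d)).
      by rewrite lerXn2r ?nnegrE ?mulr_ge0 ?divr_ge0 ?(ltW e0) // ler_wpM2l // ltW.
    by rewrite mulrA expr_div_n ltr_pdivrMr ?exprn_gt0 // [V * _]mulrC.
  by rewrite ltNge hi.
have card : (#|S| <= K.+3 ^ d)%N.
  rewrite -(card_in_imset finj); apply: leq_trans (max_card _) _.
  by rewrite card_ffun !card_ord.
apply: (@le_trans _ _ ((K.+3 ^ d)%:R * V)); first by rewrite ler_wpM2r ?ler_nat // ltW.
have -> : (24 * ep) ^+ d = 3 ^+ d * (8 * ep) ^+ d.
  by rewrite -exprMn mulrA; congr ((_ * _) ^+ _); ring.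
apply: le_trans (ler_wpM2l _ hK1); last by rewrite exprn_ge0.
rewrite mulrA ler_wpM2r ?(ltW V0) // natrX -exprMn lerXn2r ?nnegrE ?mulr_ge0 //.
by rewrite -natrM ler_nat; lia.
Qed.

(** * Fourier coefficients of boxes *)

Section BoxFourier.
Variables (R : realType) (r : nat).
Variable Q : 'I_r -> R -> Prop.
Variable K : nat.
Hypothesis K0 : (0 < K)%N.
Hypothesis Q_convex : forall j a b c, Q j a -> Q j c -> a <= b <= c -> Q j b.
Hypothesis Q_bounded : forall j t, Q j t -> `|t| <= K%:R - 1.

Definition product_set : set 'rV[R]_r := [set x : 'rV[R]_r | forall j, Q j (x 0 j)].

Lemma product_hits G (y : {ffun 'I_r -> 'I_G}) : (0 < G)%N ->
  (hits product_set (grid R y))%:R =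
    \prod_j \sum_(p < 2 * K) (`[< Q j ((y j)%:R / G%:R + p%:R - K%:R) >])%:R :> R.
Proof.
move=> G0; have GR : 0 < G%:R :> R by rewrite ltr0n.
rewrite bigA_distr_bigA /=.
pose P (h : {ffun 'I_r -> 'I_(2 * K)}) := [forall j, `[< Q j ((y j)%:R / G%:R + (h j)%:R - K%:R) >]].
rewrite (eq_bigr (fun h => (P h)%:R)) => [|h _]; last first.
  have [/forallP hP|] := boolP (P h); first by apply: big1 => j _; rewrite hP.
  by rewrite negb_forall => /existsP[j /negbTE hj]; rewrite (bigD1 j) //= hj mul0r.
rewrite -natr_sum; congr (_%:R).
pose f (h : {ffun 'I_r -> 'I_(2 * K)}) : 'rV[int]_r := \row_j ((h j : nat)%:Z - K%:Z).
have fE (h : {ffun 'I_r -> 'I_(2 * K)}) j : (grid R y + real_of R (f h)) 0 j = (y j)%:R / G%:R + (h j)%:R - K%:R.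
  by rewrite !mxE rmorphB /= addrA.
have finj : injective f.
  move=> h h' /rowP e; apply/ffunP => j; apply: val_inj.
  by have := e j; rewrite !mxE => /addIr [].
rewrite (eq_bigr (fun h => if P h then 1%N else 0%N)) => [|h _]; last by case: (P h).
rewrite -big_mkcond sum1_card.
have lt h : product_set (grid R y + real_of R h) -> forall j, (absz (h 0%R j + K%:Z)%R < 2 * K)%N /\ 0 <= h 0 j + K%:Z.
  move=> hS j; have /Q_bounded := hS j; rewrite !mxE.
  have y0 : 0 <= (y j)%:R / G%:R :> R by rewrite divr_ge0.
  have y1 : (y j)%:R / G%:R < 1 :> R by rewrite ltr_pdivrMr // mul1r ltr_nat.
  rewrite ler_norml => /andP[h1 h2].
  have h3 : - K%:Z < h 0 j by rewrite -(ltr_int R) rmorphN /=; move: h1; rewrite -[(Posz K)%:~R]/(K%:R); lra.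
  have h4 : h 0 j < K%:Z by rewrite -(ltr_int R) -[(Posz K)%:~R]/(K%:R); lra.
  by split; lia.
have eqS : lattice_hits product_set (grid R y) = [set f h | h in [set h | P h]]%classic.
  apply/seteqP; split=> p.
    move=> hp; have hl := lt p hp.
    exists [ffun j => Ordinal (hl j).1].
      apply/forallP => j; apply/asboolP; have := hp j; rewrite !mxE ffunE /=.
      by congr (Q _ _); rewrite natr_absz ger0_norm ?(hl j).2 // rmorphD /=; ring.
    apply/rowP => j; rewrite !mxE ffunE /=; have := (hl j).2; lia.
  by move=> [h /forallP hP <-] j; rewrite fE; apply/asboolP.
rewrite /hits eqS; have -> : [set f h | h in [set h | P h]]%classic = [set` [fset f h | h in enum P]%fset].
  apply/seteqP; split=> p /=; first by move=> [h Ph <-]; apply/imfsetP; exists h; rewrite //= mem_enum.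
  by move=> /imfsetP[h /=]; rewrite mem_enum => Ph ->; exists h.
rewrite set_fsetK; transitivity (size (enum P)); last by rewrite -cardE.
rewrite card_in_imfset //= => [|h h' _ _]; last exact: finj.
by rewrite undup_id ?enum_uniq.
Qed.

Lemma sum_mul_ord (V : nmodType) (m G : nat) (F : nat -> V) :
  \sum_(n < m * G) F n = \sum_(p < m) \sum_(y < G) F (p * G + y)%N.
Proof.
elim: m => [|m IH]; first by rewrite !big_ord0.
rewrite big_ord_recr /= -IH mulSn addnC big_split_ord /=; congr (_ + _).
Qed.

(** The transform factors over the coordinates. In each of them the sums over the grid and over
    integer translates join into one sum over [n < 2 K G], since [q_j] is an integer, and convexity
    of [Q j] makes it a sum over an interval. The condition [2 L <= G] keeps the angle [q_j / G]
    within [1/2] of 0, where [expi_sub1_lower] bounds the divisor. *)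
Lemma product_fourier (L G : nat) (q : 'rV[int]_r) : (0 < G)%N -> (2 * L <= G)%N ->
  (forall j, `|q 0 j| <= L%:Z) ->
  cabs (grid_fourier G (fun x => (hits product_set x)%:R) q) <=
    (2 * K)%:R ^+ r * \prod_j (1 + `|q 0 j|%:~R)^-1.
Proof.
move=> G0 LG hq; have GR : 0 < G%:R :> R by rewrite ltr0n.
pose s j (y : 'I_G) : R := \sum_(p < 2 * K) (`[< Q j (y%:R / G%:R + p%:R - K%:R) >])%:R.
have -> : grid_fourier G (fun x => (hits product_set x)%:R) q =
    \prod_j ((G%:R^-1)%:C%C * \sum_(y < G) (s j y)%:C%C * expi (- ((q 0 j)%:~R / G%:R) *+ y)).
  rewrite big_split /= prodr_const card_ord -rmorphXn /= exprVn bigA_distr_bigA /=; congr (_ * _).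
  apply: eq_bigr => y _; rewrite product_hits // rmorph_prod /= -pairingN expi_sum -big_split /=.
  by apply: eq_bigr => j _; rewrite !mxE -[- _ *+ _]mulr_natr; congr (_ * expi _); ring.
rewrite cabs_prod -[r in _ ^+ r]card_ord -prodr_const -big_split /=.
apply: ler_prod => j _; rewrite cabs_ge0 /= cabsM cabs_real ger0_norm ?invr_ge0 //.
set t := - (_ / _).
have -> : \sum_(y < G) (s j y)%:C%C * expi (t *+ y) =
    \sum_(n < 2 * K * G | `[< Q j (n%:R / G%:R - K%:R) >]) expi (t *+ n).
  rewrite [RHS]big_mkcond (sum_mul_ord (2 * K) G (fun n => if `[< Q j (n%:R / G%:R - K%:R) >]
      then expi (t *+ n) else 0)) exchange_big /=; apply: eq_bigr => y _.
  rewrite rmorph_sum /= mulr_suml; apply: eq_bigr => p _.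
  have -> : (p * G + y)%:R / G%:R - K%:R = y%:R / G%:R + p%:R - K%:R :> R.
    by rewrite natrD natrM; field; rewrite gt_eqF.
  have -> : expi (t *+ (p * G + y)) = expi (t *+ y).
    rewrite mulrnDr addrC -[RHS](expiDint _ (- q 0 j * p%:Z)); congr (expi (_ + _)).
    rewrite /t -[- _ *+ _]mulr_natr natrM rmorphM rmorphN /= -[(Posz p)%:~R]/(p%:R).
    by field; rewrite gt_eqF.
  by case: asboolP => _; rewrite ?rmorph1 ?rmorph0 ?mul1r ?mul0r.
have [q0|q0] := eqVneq (q 0 j) 0.
  rewrite q0 normr0 addr0 invr1 mulr1 mulrC ler_pdivrMr //.
  apply: le_trans (cabs_sum _ _ _) _.
  apply: (@le_trans _ _ (\sum_(n < 2 * K * G) 1)); last by rewrite sumr_const card_ord -natrM.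
  rewrite big_mkcond; apply: ler_sum => n _.
  by case: ifP => _; rewrite ?cabs_expi.
have q1 : 1 <= `|q 0 j|%:~R :> R.
  by rewrite (ler_int R 1) -gtz0_ge1 normr_gt0.
have hn : `|t - (0 : int)%:~R| <= 2^-1.
  rewrite subr0 /t normrN normrM normfV (gtr0_norm GR) ler_pdivrMr //.
  have : (`|q 0 j|%:~R : R) <= L%:R by rewrite -[L%:R]/((Posz L)%:~R) ler_int.
  have : (2 * L)%:R <= G%:R :> R by rewrite ler_nat.
  by rewrite natrM intr_norm; lra.
have h1 := expi_sub1_lower hn.
have cvx a b c : `[< Q j (a%:R / G%:R - K%:R) >] -> `[< Q j (c%:R / G%:R - K%:R) >] ->
    (a <= b <= c)%N -> `[< Q j (b%:R / G%:R - K%:R) >].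
  move=> /asboolP ha /asboolP hc /andP[ab bc]; apply/asboolP; apply: Q_convex ha hc _.
  by rewrite !lerD2r !ler_pM2r ?invr_gt0 // !ler_nat ab bc.
have h2 := convex_geometric (2 * K * G) t cvx.
move: h1 h2; rewrite subr0 /t normrN normrM normfV (gtr0_norm GR) -intr_norm.
set S := cabs (\sum_(n < _ | _) _); set u := cabs (expi _ - 1) => h1 h2.
have S0 : 0 <= S by exact: cabs_ge0.
have K1 : 1 <= K%:R :> R by rewrite (ler_nat R 1).
rewrite ler_pdivlMr; last by rewrite ltr_wpDr // ler0z.
have h3 : 2 * (`|q 0 j|%:~R / G%:R) * S <= 2 by apply: le_trans h2; rewrite ler_wpM2r.
have h4 : G%:R^-1 * S * `|q 0 j|%:~R <= 1 by lra.
have h5 : G%:R^-1 * S <= G%:R^-1 * S * `|q 0 j|%:~R by rewrite ler_peMr // mulr_ge0 ?invr_ge0.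
rewrite natrM mulrDr mulr1; lra.
Qed.

End BoxFourier.

(** * Small divisors weighted by Fourier coefficients of boxes *)

Section WeightedSum.
Variables (R : realType) (d r : nat) (A : 'M[R]_(d, r)).

Lemma frequencies_inj M H : (0 < H)%N -> (0 < M)%N ->
  injective (fun q : {ffun 'I_r -> 'I_(2 * (M * H))} => frequencies q).
Proof.
move=> H0 M0 q q' /rowP e; apply/ffunP => j; apply: val_inj.
by have := e j; rewrite !mxE /frequency => /addIr [].
Qed.

Lemma absz_sub_lt (x y : int) (n : nat) : (absz x < n)%N -> (absz y < n)%N ->
  (absz (x - y)%R < 2 * n)%N.
Proof. by lia. Qed.

Lemma pairingBl (q q' : 'rV[int]_r) (x : 'rV[R]_r) :
  pairing (q - q') x = pairing q x - pairing q' x.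
Proof.
by rewrite -sumrB; apply: eq_bigr => j _; rewrite !mxE rmorphB mulrBl.
Qed.

(** Frequencies with some divisor above [ep = 2 ^ - (3 i)] have tiny multipliers since
    [T ep = 2 ^ i]. The others are sorted by the dyadic sizes of their coordinates. Within a class,
    differences obey a common Diophantine bound [V], so the divisors are separated points of a cube
    of side about [ep] and the class has [O(ep ^ d / V)] elements. Each has weight about [V] up to
    logarithms, so a class contributes [O(ep ^ d)] up to logarithms. There are polynomially many
    classes in [i], and [ep ^ d <= 2 ^ - (6 i)] for [d >= 2]. *)
Theorem weighted_multiplier_sum : diophantine A -> (1 < d)%N ->
  exists C : R, 0 <= C /\ forall i,
    \sum_(q : {ffun 'I_r -> 'I_(2 * (6 * 2 ^ (6 * i)))} | frequencies q != 0)
      (\prod_j (1 + `|frequencies q 0 j|%:~R)^-1) *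
        cabs (multiplier A (2 ^ (4 * i)) (6 * r + 5) (frequencies q))
    <= C * 2 ^- (5 * i).
Proof.
move=> [c [c0 [e hdio]]] d1.
have d0 : (0 < d)%N by apply: ltnW.
pose N := (6 * r + 5)%N.
have half : 0 <= (2^-1 : R) < 1 by apply/andP; split; lra.
have [Cp [Cp0 hp]] := poly_exp_bound 6 6 (r + e) half.
exists (24 ^+ d * (16 ^+ r / c) * Cp + 12 ^+ r * 2 ^+ N); split.
  by rewrite addr_ge0 // ?mulr_ge0 ?exprn_ge0 ?invr_ge0 ?(ltW c0).
move=> i; set L := (6 * 2 ^ (6 * i))%N; set T := (2 ^ (4 * i))%N.
pose X : finType := {ffun 'I_r -> 'I_(2 * L)}.
have L0 : (0 < L)%N by rewrite muln_gt0 expn_gt0.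
have T0 : (0 < T)%N by rewrite expn_gt0.
pose w (q : X) : R := \prod_j (1 + `|frequencies q 0 j|%:~R)^-1.
pose mult (q : X) := cabs (multiplier A T N (frequencies q)).
pose beta (q : X) k := cabs (expi (pairing (frequencies q) (row k A)) - 1).
pose ep : R := 2 ^- (3 * i).
have ep0 : 0 < ep by rewrite invr_gt0 exprn_gt0.
have w01 q : 0 <= w q <= 1.
  apply/andP; split; first by apply: prodr_ge0 => j _; rewrite invr_ge0 addr_ge0 // ler0z.
  apply: prodr_ile1 => j _; rewrite invr_ge0 addr_ge0 ?ler0z //=.
  by rewrite invf_le1 ?lerDl ?ler0z // ltr_wpDr // ler0z.
pose small (q : X) := [forall k, beta q k < ep].
have -> : \sum_(q : X | frequencies q != 0) w q * mult q =
   \sum_(q : X | (frequencies q != 0) && small q) w q * mult q +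
   \sum_(q : X | (frequencies q != 0) && ~~ small q) w q * mult q by rewrite (bigID small).
(* Of the exponent [6 r + 5] of the multiplier, [6 r] pays for the number of frequencies and [5] is
   the rate obtained. *)
have large : \sum_(q : X | (frequencies q != 0) && ~~ small q) w q * mult q <= 12 ^+ r * 2 ^+ N * 2 ^- (5 * i).
  apply: (@le_trans _ _ (\sum_(q : X) (2 / 2 ^+ i) ^+ N)).
    rewrite big_mkcond; apply: ler_sum => q _; case: ifP => [/andP[_]|_]; last first.
      by rewrite exprn_ge0 // divr_ge0 // exprn_ge0.
    rewrite negb_forall => /existsP[k]; rewrite -leNgt => hk.
    have /andP[w0 w1] := w01 q; have := cabs_multiplier A N T0 (frequencies q) k.
    rewrite -/(beta q k) -/(mult q) => h.
    apply: (@le_trans _ _ (mult q)); first by rewrite ler_piMl // cabs_ge0.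
    have h2 : 2 ^+ i <= T%:R * beta q k.
      apply: (@le_trans _ _ (T%:R * ep)); last by rewrite ler_wpM2l.
      rewrite /ep ler_pdivlMr ?exprn_gt0 // /T natrX -exprD ler_eXn2l ?(ltr_nat R 1) //; lia.
    rewrite expr_div_n ler_pdivlMr ?exprn_gt0 //; apply: le_trans h.
    rewrite ler_wpM2l ?cabs_ge0 // lerXn2r ?nnegrE ?exprn_ge0 //.
    by apply: le_trans h2; rewrite exprn_ge0.
  rewrite sumr_const card_ffun !card_ord -[_ *+ (_ ^ _)]mulr_natl.
  rewrite /L mulnA natrX natrM exprMn expr_div_n natrX -!exprM.
  rewrite -!mulrA ler_wpM2l ?exprn_ge0 // mulrCA ler_wpM2l ?exprn_ge0 //.
  rewrite ler_pdivrMr ?exprn_gt0 // mulrC ler_pdivlMr ?exprn_gt0 // -exprD.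
  by rewrite ler_eXn2l ?(ltr_nat R 1) // /N; clear; lia.
suff main : \sum_(q : X | (frequencies q != 0) && small q) w q * mult q <=
    24 ^+ d * (16 ^+ r / c) * Cp * 2 ^- (5 * i) by rewrite mulrDl; exact: lerD.
have levlt (q : X) j : (trunc_log 2 (1 + absz (frequencies q 0%R j)) < 6 * i + 3)%N.
  have := frequencies_bound q j; rewrite -abszE lez_nat => h.
  rewrite -(ltn_exp2l _ _ (ltnSn 1)); apply: (@leq_ltn_trans (1 + absz (frequencies q 0%R j))%N).
    by apply: trunc_logP.
  apply: (@leq_ltn_trans (1 + L)%N); first by rewrite leq_add2l.
  rewrite /L expnD; have : (0 < 2 ^ (6 * i))%N by rewrite expn_gt0.
  clear; move: (2 ^ (6 * i))%N => z; lia.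
pose lev (q : X) : {ffun 'I_r -> 'I_(6 * i + 3)} := [ffun j => Ordinal (levlt q j)].
pose P2 (la : {ffun 'I_r -> 'I_(6 * i + 3)}) : R := \prod_j 2 ^+ (la j).
have P20 la : 0 < P2 la by apply: prodr_gt0 => j _; rewrite exprn_gt0.
pose l := (6 * i + 5)%N.
pose V la : R := c / (8 ^+ r * P2 la * l.+1%:R ^+ e).
have V0 la : 0 < V la by rewrite divr_gt0 // !mulr_gt0 ?exprn_gt0.
pose S la : pred X := [pred q | [&& frequencies q != 0, small q & lev q == la]].
have fb (q : X) j : (absz (frequencies q 0%R j) < 2 ^ (lev q j).+1)%N.
  by rewrite ffunE /=; apply: leq_trans (trunc_log_ltn _ (ltnSn 1)); rewrite add1n.
(* The exponent [(la j).+2], one more than in [fb], leaves room for the difference of two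
   frequencies of the class. *)
have dioV (q : 'rV[int]_r) (la : {ffun 'I_r -> 'I_(6 * i + 3)}) : q != 0 -> (forall j, (absz (q 0%R j) < 2 ^ (la j).+2)%N) ->
    exists k, V la <= cabs (expi (pairing q (row k A)) - 1) ^+ d.
  move=> q0 hq; have [|k hk] := hdio l q q0.
    move=> j; rewrite -abszE lez_nat; apply: leq_trans (ltnW (hq j)) _.
    by rewrite leq_exp2l // /l; have := ltn_ord (la j); lia.
  exists k; rewrite /V ler_pdivrMr; last by rewrite !mulr_gt0 ?exprn_gt0.
  apply: le_trans hk _; rewrite -mulrA ler_wpM2l ?exprn_ge0 ?cabs_ge0 //.
  rewrite ler_wpM2r ?exprn_ge0 // /P2 -[r in 8 ^+ r]card_ord -prodr_const -big_split /=.
  apply: ler_prod => j _; rewrite addr_ge0 ?ler0z //=.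
  rewrite -abszE -[(Posz _)%:~R]/((absz (q 0%R j))%:R) -natrX -natrM -(natrD R 1) ler_nat.
  by have := hq j; rewrite !expnS; move: (2 ^ _)%N => z; lia.
have /choice[nn hnn] : forall z : X * 'I_d, exists n : int,
    `|pairing (frequencies z.1) (row z.2 A) - n%:~R| <= 2^-1 by move=> z; exact: nearest_int.
pose xx (q : X) k := pairing (frequencies q) (row k A) - (nn (q, k))%:~R.
have cnt la : #|S la|%:R * V la <= (24 * ep) ^+ d.
  apply: (@separated_count R X (S la) d xx) => //.
  - move=> q k /and3P[_ /forallP/(_ k) hk _]; have := expi_sub1_lower (hnn (q, k)).
    by rewrite -/(xx q k) -/(beta q k) => h; move: hk; lra.
  - move=> q /and3P[q0 _ /eqP <-]; have [|k hk] := dioV (frequencies q) (lev q) q0.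
      by move=> j; apply: leq_trans (fb q j) _; rewrite leq_exp2l.
    exists k; apply: le_trans hk _; rewrite lerXn2r ?nnegrE ?cabs_ge0 ?mulr_ge0 //.
    exact: expi_sub1_upper.
  - move=> q q' /and3P[_ _ /eqP lq] /and3P[_ _ /eqP lq'] qq'.
    have [||k hk] := dioV (frequencies q - frequencies q') la.
    + rewrite subr_eq0; apply: contra qq' => /eqP h; apply/eqP.
      by apply: (@frequencies_inj 6 (2 ^ (6 * i))) h; rewrite ?expn_gt0.
    + move=> j; rewrite [X in absz X]mxE [X in (_ + X)%R]mxE [(2 ^ _.+2)%N]expnS.
      by apply: absz_sub_lt; [have := fb q j|have := fb q' j]; rewrite ?lq ?lq'.
    exists k; apply: le_trans hk _; rewrite lerXn2r ?nnegrE ?cabs_ge0 ?mulr_ge0 //.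
    rewrite pairingBl /xx.
    have -> : pairing (frequencies q) (row k A) - (nn (q, k))%:~R -
       (pairing (frequencies q') (row k A) - (nn (q', k))%:~R) =
       pairing (frequencies q) (row k A) - pairing (frequencies q') (row k A) -
       (nn (q, k) - nn (q', k))%:~R by rewrite rmorphB /=; ring.
    exact: expi_sub1_upper.

have wle q : w q <= 2 ^+ r / P2 (lev q).
  rewrite -[r in 2 ^+ r]card_ord -prodr_const -prodf_div; apply: ler_prod => j _.
  rewrite invr_ge0 addr_ge0 ?ler0z //= ler_pdivlMr ?exprn_gt0 // mulrC ler_pdivrMr; last first.
    by rewrite ltr_wpDr // ler0z.
  rewrite -abszE -[(Posz _)%:~R]/((absz (frequencies q 0%R j))%:R) -natrX -(natrD R 1) -natrM ler_nat.
  rewrite ffunE /=; apply: leq_trans (leq_pmull _ (ltn0Sn 1)); exact: trunc_logP.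
have m1 q : mult q <= 1 by exact: cabs_multiplier_le1.
have classE la : \sum_(q : X | ((frequencies q != 0) && small q) && (lev q == la)) w q * mult q <=
    (24 * ep) ^+ d * (16 ^+ r * l.+1%:R ^+ e / c).
  apply: (@le_trans _ _ (\sum_(q : X | S la q) 2 ^+ r / P2 la)).
    rewrite (eq_bigl (S la)); last by move=> q; rewrite /S inE -andbA.
    apply: ler_sum => q /and3P[_ _ /eqP lq]; rewrite -lq.
    have /andP[w0 w1] := w01 q; apply: le_trans (wle q); rewrite ler_piMr //.
  rewrite sumr_const -[_ *+ #|_|]mulr_natl.
  apply: le_trans (ler_wpM2r _ (cnt la)); last by rewrite !mulr_ge0 ?exprn_ge0 ?invr_ge0 // ltW.
  have := V0 la; have := P20 la => h1 h2; rewrite -!mulrA ler_wpM2l //.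
  rewrite /V (_ : (16 : R) = 8 * 2); last by ring.
  rewrite le_eqVlt; apply/orP; left; apply/eqP; rewrite exprMn; field.
  by rewrite ?expf_neq0 ?pnatr_eq0 ?lt0r_neq0.
rewrite (partition_big lev xpredT) //=.
apply: (le_trans (ler_sum _ (fun la _ => classE la))).
rewrite sumr_const card_ffun !card_ord -[_ *+ (_ ^ _)]mulr_natl.
have dE : (24 * ep) ^+ d <= 24 ^+ d * 2 ^- (6 * i).
  rewrite exprMn ler_wpM2l ?exprn_ge0 // /ep -exprVn -exprM -exprVn.
  by apply: ler_wiXn2l; rewrite ?invr_ge0 ?invf_le1 ?ler1n //; nia.
have := hp i; have h6 : (6 * i + 3)%N%:R ^+ r * l.+1%:R ^+ e <= (6 * i + 6)%N%:R ^+ (r + e) :> R.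
  rewrite exprD -addnS ler_wpM2r ?exprn_ge0 // lerXn2r ?nnegrE // ler_nat; clear; lia.
move=> h7; rewrite natrX.
have x0 : 0 <= 24 ^+ d * (16 ^+ r / c) :> R by rewrite ?mulr_ge0 ?exprn_ge0 ?invr_ge0 ?(ltW c0).
apply: (@le_trans _ _ (24 ^+ d * (16 ^+ r / c) * (((6 * i + 6)%N%:R ^+ (r + e)) * 2^-1 ^+ i) * 2 ^- (5 * i))); last first.
  by rewrite ler_wpM2r // ler_wpM2l.
have -> : 24 ^+ d * (16 ^+ r / c) * (((6 * i + 6)%N%:R ^+ (r + e)) * 2^-1 ^+ i) * 2 ^- (5 * i) =
   (24 ^+ d * 2 ^- (6 * i)) * ((6 * i + 6)%N%:R ^+ (r + e)) * (16 ^+ r / c) :> R.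
  by rewrite -!exprVn (_ : (6 * i = i + 5 * i)%N) ?exprD; [ring|clear; lia].
have -> : (6 * i + 3)%N%:R ^+ r * ((24 * ep) ^+ d * (16 ^+ r * l.+1%:R ^+ e / c)) =
   (24 * ep) ^+ d * ((6 * i + 3)%N%:R ^+ r * l.+1%:R ^+ e) * (16 ^+ r / c) by ring.
rewrite ler_wpM2r ?divr_ge0 ?exprn_ge0 ?(ltW c0) //.
by apply: ler_pM; rewrite ?mulr_ge0 ?exprn_ge0 ?mulr_ge0 // ltW.
Qed.

End WeightedSum.

Section BoxDiscrepancy.
Variables (R : realType) (d r : nat) (A : 'M[R]_(d, r)).

Lemma hits_cover (I : finType) (lo hi : I -> 'rV[R]_r) S y :
  (forall l j, lo l 0 j <= hi l 0 j) -> S `<=` \bigcup_l cbox (lo l) (hi l) ->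
  (finite_set (lattice_hits S y)) /\ (hits S y <= \sum_l hits (cbox (lo l) (hi l)) y)%N.
Proof.
move=> lohi cov.
have fin l : finite_set (lattice_hits (cbox (lo l) (hi l)) y).
  exact: (hits_box y (@subset_refl _ _) (lohi l)).1.
have [|f le] := @fset_set_sub _ (lattice_hits S y)
    (\bigcup_(l <- enum I) fset_set (lattice_hits (cbox (lo l) (hi l)) y))%fset.
  move=> p Sp; have [l _ hl] := cov _ Sp; apply/bigfcupP; exists l.
    by rewrite mem_enum.
  by rewrite in_fset_set //; apply/mem_set.
split=> //; apply: leq_trans le _; rewrite -big_enum /=.
elim: (enum I) => [|l s IH]; first by rewrite !big_nil cardfs0.
rewrite !big_cons; apply: leq_trans (leq_add (leqnn _) IH).
by rewrite -cardfsUI leq_addr.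
Qed.

Lemma grid_fourier_sum (I : finType) (f : I -> 'rV[R]_r -> R) G q :
  grid_fourier G (fun x => \sum_l f l x) q = \sum_l grid_fourier G (f l) q.
Proof.
rewrite /grid_fourier -mulr_sumr; congr (_ * _); rewrite exchange_big /=.
by apply: eq_bigr => y _; rewrite rmorph_sum mulr_suml.
Qed.

(** Here [T = 2 ^ (4 i)], [H = 2 ^ (6 i)] and [rho = 2 ^ - (5 i)]. The boundary strip is covered by
    two thin boxes per coordinate; their Fourier coefficients factor as well, so the majorant [v] is
    treated like the set itself. [Q j] is an interval open or closed at either end. *)
Theorem discrepancy_box (Q : 'I_r -> R -> Prop) (a b : 'rV[R]_r) :
  diophantine A -> (1 < d)%N -> (forall j, a 0 j <= b 0 j) ->
  (forall j x y z, Q j x -> Q j z -> x <= y <= z -> Q j y) ->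
  (forall j t, a 0 j < t < b 0 j -> Q j t) ->
  (forall j t, Q j t -> a 0 j <= t <= b 0 j) ->
  exists N : nat, (0 < N)%N /\ exists C : R, 0 <= C /\ exists c : nat -> R, forall i xi,
    `|rotation_avg A (2 ^ (4 * i)) N (fun x => (hits (product_set Q) x)%:R) xi - c i|
      <= C * (2 ^- 5) ^+ i.
Proof.
move=> dio d1 ab Qc Qin Qout.
have [C [C0 hC]] := weighted_multiplier_sum dio d1.
pose S := \sum_j (`|a 0 j| + `|b 0 j|).
pose K := (Num.trunc (S + 4)).+1.
have KS : S + 3 <= K%:R - 1 by have := truncnS_gt (S + 4); rewrite -/K; lra.
have bnd j t : a 0 j - 1 <= t <= b 0 j + 1 -> `|t| <= K%:R - 1.
  have : `|a 0 j| + `|b 0 j| <= S.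
    by rewrite /S (bigD1 j) //= lerDl sumr_ge0 // => l _; rewrite addr_ge0.
  have := ler_norm (b 0 j); have := ler_norm (- a 0 j); rewrite normrN.
  have := normr_ge0 (a 0 j); have := normr_ge0 (b 0 j) => h1 h2 h3 h4 h5 /andP[h6 h7].
  by rewrite ler_norml; apply/andP; split; lra.
pose rho i : R := 2 ^- (5 * i).
have rho0 i : 0 < rho i by rewrite invr_gt0 exprn_gt0.
have rho1 i : rho i <= 1 by rewrite invf_le1 ?exprn_gt0 // exprn_ege1 // ler1n.
pose I : finType := ('I_r * bool)%type.
pose e (z : I) := if z.2 then a 0 z.1 else b 0 z.1.
pose lo i (z : I) : 'rV[R]_r := \row_j if j == z.1 then e z - rho i else a 0 j - 1.
pose hi i (z : I) : 'rV[R]_r := \row_j if j == z.1 then e z + rho i else b 0 j + 1.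
have lohi i z j : lo i z 0 j <= hi i z 0 j.
  by have := ab j; have := rho0 i; rewrite !mxE; case: ifP => _; lra.
have lohib i z j t : lo i z 0 j <= t <= hi i z 0 j -> `|t| <= K%:R - 1.
  move=> h; apply: (bnd j); move: h; rewrite !mxE; case: ifP => // /eqP ->.
  by have := ab z.1; have := rho1 i; rewrite /e; case: z.2 => h1 h2 /andP[h3 h4]; apply/andP; split; lra.
pose E := product_set Q.
have Eb : E `<=` cbox a b by move=> x Ex j; apply: Qout.
pose U : R := \prod_j (b 0 j - a 0 j + 1).
have hU x : 0 <= ((hits E x)%:R : R) <= U.
  by rewrite ler0n /=; have [_] := hits_box x Eb ab.
have U0 : 0 <= U by have /andP[/le_trans] := hU 0; apply.
have mix i : mixed (rho i) E `<=` \bigcup_z cbox (lo i z) (hi i z).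
  have side (p q : 'rV[R]_r) l : cbox a b p -> ~ Q l (q 0 l) -> (forall j, `|p 0 j - q 0 j| < rho i) ->
      exists z, cbox (lo i z) (hi i z) p /\ cbox (lo i z) (hi i z) q.
    move=> pE qE pq.
    have [s hs] : exists s : bool, `|p 0 l - e (l, s)| <= rho i /\ `|q 0 l - e (l, s)| <= rho i.
      have := pq l; have := pE l; rewrite ltr_norml => /andP[h1 h2] /andP[h3 h4].
      have [h5|h5] := leP (q 0 l) (a 0 l).
        by exists true; rewrite /e /= !ler_norml; clear - h1 h2 h3 h4 h5; split; apply/andP; split; lra.
      have [h6|h6] := leP (b 0 l) (q 0 l).
        by exists false; rewrite /e /= !ler_norml; clear - h1 h2 h3 h4 h6; split; apply/andP; split; lra.
      by case: qE; apply: Qin; rewrite h5 h6.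
    exists (l, s); case: hs; rewrite !ler_norml => /andP[h1 h2] /andP[h3 h4].
    by split=> j; rewrite !mxE /=; (case: ifP => [/eqP ->|_]; first by clear - h1 h2 h3 h4; apply/andP; split; lra);
       have := pE j; have := pq j; have := rho1 i; rewrite ltr_norml; clear => h5 /andP[h6 h7] /andP[h8 h9];
       apply/andP; split; lra.
  move=> x [y [xy nE]].
  have yx j : `|y 0 j - x 0 j| < rho i by rewrite distrC.
  have [Ex|nEx] := pselect (E x).
    have /existsNP[l hl] : ~ E y by move=> Ey; apply: nE.
    by have [z [h1 _]] := side x y l (Eb _ Ex) hl xy; exists z.
  have Ey : E y by apply: contrapT => nEy; apply: nE.
  have /existsNP[l hl] := nEx.
  by have [z [_ h1]] := side y x l (Eb _ Ey) hl yx; exists z.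
pose B : R := \prod_j (b 0 j - a 0 j + 3).
have B0 : 0 <= B by apply: prodr_ge0 => j _; have := ab j; lra.
pose Cf : R := (2 * K)%:R ^+ r * C.
have Cf0 : 0 <= Cf by rewrite mulr_ge0 ?exprn_ge0.
exists (6 * r + 5)%N; split; first by rewrite addnS.
exists (Cf + (#|{: I}|%:R * (3 * B) + #|{: I}|%:R * Cf + U * (r%:R * 6))); split.
  by rewrite !addr_ge0 // ?mulr_ge0 //.
pose G i := (2 * (6 * 2 ^ (6 * i)))%N.
exists (fun i => grid_mean (G i) (fun x => (hits E x)%:R)) => i xi.
have H0 : (0 < 2 ^ (6 * i))%N by rewrite expn_gt0.
have T0 : (0 < 2 ^ (4 * i))%N by rewrite expn_gt0.
have G0 : (0 < G i)%N by rewrite !muln_gt0 H0.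
have K0 : (0 < K)%N by [].
pose v x : R := \sum_z (hits (cbox (lo i z) (hi i z)) x)%:R.
apply: le_trans (@rotation_avg_estimate R d r A _ (6 * r + 5)%N T0 (2 ^ (6 * i))%N 6 (G i) H0 isT (leqnn _)
  (fun x => (hits E x)%:R) v U (rho i) xi (rho0 i) _ _ _ _) _.
- by move=> x n; rewrite (hits_periodic _ _ Eb ab).
- by move=> x; rewrite /v sumr_ge0.
- move=> x y; have /andP[h1 h2] := hU x; have /andP[h3 h4] := hU y.
  by rewrite ler_norml; apply/andP; split; lra.
- move=> x y xy; have [f le] := hits_cover y (lohi i) (mix i).
  apply: le_trans (hits_mixed (E := E) _ f xy) _; last by rewrite /v -natr_sum ler_nat.
  by move=> z; exact: (hits_box z Eb ab).1.
have rE : rho i = (2 ^- 5) ^+ i by rewrite /rho -exprVn exprM exprVn.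
have osc (P : 'I_r -> R -> Prop) :
   (forall j x y z, P j x -> P j z -> x <= y <= z -> P j y) ->
   (forall j t, P j t -> `|t| <= K%:R - 1) ->
   oscillation A (2 ^ (4 * i)) (6 * r + 5) (2 ^ (6 * i)) 6 (G i) (fun x => (hits (product_set P) x)%:R) <= Cf * rho i.
  move=> Pc Pb; rewrite /Cf -mulrA; apply: le_trans (ler_wpM2l _ (hC i)); last by rewrite exprn_ge0.
  rewrite mulr_sumr; apply: ler_sum => q _; rewrite mulrA ler_wpM2r ?cabs_ge0 //.
  by apply: (product_fourier K0 Pc Pb G0 (leqnn _)) => j; exact: frequencies_bound.
rewrite -rE mulrDl; apply: lerD.
  apply: (osc Q) => // j t /Qout /andP[h1 h2]; apply: (bnd j); apply/andP; split; lra.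
rewrite mulrDl; apply: lerD; last first.
  rewrite -!mulrA ler_wpM2l // ler_wpM2l // /tail.
  have -> : (2 ^ (6 * i))%:R * rho i = 2 ^+ i.
    rewrite /rho natrX; have -> : (6 * i = i + 5 * i)%N by clear; lia.
    by rewrite exprD mulfK // expf_neq0.
  rewrite natrM -mulrA ler_wpM2l // natrX -exprM ler_pdivrMr ?exprn_gt0 // mulrC.
  rewrite ler_pdivlMr ?exprn_gt0 // -exprD ler_eXn2l ?(ltr_nat R 1) //; clear; lia.
rewrite mulrDl; apply: lerD.
  rewrite /grid_mean /v exchange_big /= mulr_sumr -mulrA [#|_|%:R * _]mulr_natl -sumr_const.
  apply: ler_sum => z _; rewrite mulrC ler_pdivrMr ?exprn_gt0 ?ltr0n //.
  apply: le_trans (hits_grid_sum G0 (lohi i z)) _.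
  have GR : 1 <= (G i)%:R :> R by rewrite ler1n.
  have Grho : 1 <= (G i)%:R * rho i.
    rewrite /rho ler_pdivlMr ?exprn_gt0 // mul1r -natrX ler_nat /G.
    have : (2 ^ (5 * i) <= 2 ^ (6 * i))%N by rewrite leq_exp2l //; clear; lia.
    by clear; move: (2 ^ _)%N (2 ^ _)%N => x y; lia.
  have -> : 3 * B * rho i * (G i)%:R ^+ r = 3 * (B * (G i)%:R ^+ r) * rho i by ring.
  rewrite -[r in _ ^+ r]card_ord -prodr_const /B -big_split /=.
  rewrite (bigD1 z.1) //= [X in _ <= _ * X * _](bigD1 z.1) //=.
  rewrite !mxE eqxx.
  have -> : e z + rho i - (e z - rho i) = 2 * rho i by ring.
  set p1 := \prod_(j | _) _; set p2 := \prod_(j | _) _.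
  have p12 : 0 <= p1 <= p2.
    apply/andP; split; first by apply: prodr_ge0 => j _; rewrite addr_ge0 // mulr_ge0 // subr_ge0.
    apply: ler_prod => j /negbTE jz; rewrite !mxE jz; have := ab j => h.
    apply/andP; split; first by rewrite addr_ge0 // mulr_ge0 //; lra.
    have -> : (b 0 j - a 0 j + 3) * (G i)%:R = (G i)%:R * (b 0 j + 1 - (a 0 j - 1)) + (G i)%:R by ring.
    by rewrite lerD2l.
  have [p10 p12'] := andP p12.
  apply: (@le_trans _ _ (3 * ((G i)%:R * rho i) * p2)).
    apply: ler_pM => //; [lra|].
    by rewrite mulrCA; lra.
  have := ab z.1 => h.
  have p20 : 0 <= p2 by apply: le_trans p12'.
  have -> : 3 * ((b 0 z.1 - a 0 z.1 + 3) * (G i)%:R * p2) * rho i =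
    (b 0 z.1 - a 0 z.1 + 3) * (3 * ((G i)%:R * rho i) * p2) by ring.
  rewrite ler_peMl //; last by lra.
  by rewrite !mulr_ge0 // ltW.
apply: (@le_trans _ _ (\sum_(z : I) oscillation A (2 ^ (4 * i)) (6 * r + 5) (2 ^ (6 * i)) 6 (G i)
   (fun x => (hits (cbox (lo i z) (hi i z)) x)%:R))).
  rewrite /oscillation exchange_big /=; apply: ler_sum => q _.
  rewrite -mulr_suml ler_wpM2r ?cabs_ge0 // /v grid_fourier_sum; exact: cabs_sum.
rewrite -mulrA [#|_|%:R * _]mulr_natl -sumr_const; apply: ler_sum => z _.
apply: (osc (fun j t => lo i z 0 j <= t <= hi i z 0 j)) => [j x y t|j t]; last exact: lohib.
by clear => /andP[h1 h2] /andP[h3 h4] /andP[h5 h6]; apply/andP; split; lra.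
Qed.

End BoxDiscrepancy.

(** * Null sets and Diophantine conditions *)

Section Covers.
Variables (R : realType) (m n : nat).
Implicit Types (N : set 'M[R]_(m, n)) (a b : 'M[R]_(m, n)).

Definition box_volume a b : R := \prod_i \prod_j (b i j - a i j).

Definition box_cover N (e : R) :=
  exists a b : nat -> 'M[R]_(m, n),
    [/\ forall l i j, a l i j <= b l i j,
        N `<=` \bigcup_l [set X | forall i j, a l i j <= X i j <= b l i j] &
        (\sum_(0 <= l <oo) (box_volume (a l) (b l))%:E <= e%:E)%E].

Lemma box_volume_ge0 a b : (forall i j, a i j <= b i j) -> 0 <= box_volume a b.
Proof.
by move=> ab; apply: prodr_ge0 => i _; apply: prodr_ge0 => j _; rewrite subr_ge0.
Qed.

Lemma ler_sum_uniq_sub (T : eqType) (s t : seq T) (F : T -> R) :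
  uniq s -> uniq t -> {subset s <= t} -> (forall x, 0 <= F x) ->
  \sum_(x <- s) F x <= \sum_(x <- t) F x.
Proof.
move=> us ut st F0; rewrite (perm_big [seq x <- t | x \in s]) /=; last first.
  apply: uniq_perm => //; first exact: filter_uniq.
  by move=> x; rewrite mem_filter; case: (boolP (x \in s)) => // /st ->.
by rewrite big_filter big_mkcond; apply: ler_sum => x _; case: ifP.
Qed.

(** Codes without a preimage are filled with the box reduced to the zero matrix, of volume 0 because
    matrices here have at least one entry. *)
Lemma box_cover_countable (I : countType) N (e : R) (a b : I -> 'M[R]_(m, n)) :
  (0 < m)%N -> (0 < n)%N ->
  (forall x i j, a x i j <= b x i j) ->
  (forall X, N X -> exists x, forall i j, a x i j <= X i j <= b x i j) ->
  (forall s : seq I, uniq s -> \sum_(x <- s) box_volume (a x) (b x) <= e) ->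
  box_cover N e.
Proof.
move=> m0 n0 ab cov vol.
pose ext (f : I -> 'M[R]_(m, n)) l := if pickle_inv l is Some x then f x else 0.
exists (ext a), (ext b); split=> [l i j|X /cov[x hx]|].
- by rewrite /ext; case: pickle_inv.
- by exists (choice.pickle x) => //= i j; rewrite /ext pickleK_inv.
have vE l : box_volume (ext a l) (ext b l) =
   if pickle_inv l is Some x then box_volume (a x) (b x) else 0.
  rewrite /ext; case: pickle_inv => // ; rewrite /box_volume.
  rewrite (bigD1 (Ordinal m0)) //= (bigD1 (Ordinal n0)) //= subrr.
  by rewrite !mul0r.
apply: lime_le.
  apply: is_cvg_nneseries => l _ _; rewrite lee_fin vE; case: pickle_inv => // x.
  exact: box_volume_ge0.
near=> K; rewrite sumEFin lee_fin; under eq_bigr do rewrite vE.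
apply: le_trans (vol (pmap pickle_inv (iota 0 K)) _); last first.
  by apply: pmap_uniq (iota_uniq _ _); exact: pickle_invK.
rewrite /index_iota subn0; elim: (iota 0 K) => [|l s IH]; first by rewrite !big_nil.
rewrite /= big_cons; case: pickle_inv => [x|] /=; last by rewrite add0r.
by rewrite big_cons lerD2l.
Unshelve. all: by end_near.
Qed.

Lemma box_cover_bigcup (I : countType) (N : I -> set 'M[R]_(m, n)) (ei : I -> R) (e : R) :
  (0 < m)%N -> (0 < n)%N -> (forall x, box_cover (N x) (ei x)) ->
  (forall s : seq I, uniq s -> \sum_(x <- s) ei x <= e) ->
  box_cover (\bigcup_x N x) e.
Proof.
move=> m0 n0 /choice[a /choice[b ab]] he.
apply: (@box_cover_countable (I * nat)%type _ _ (fun x => a x.1 x.2) (fun x => b x.1 x.2)) => //.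
- by move=> x i j; have [h _ _] := ab x.1.
- move=> X [x _ Nx]; have [_ h _] := ab x; have [l _ hl] := h _ Nx.
  by exists (x, l).
move=> s us; pose K := (\max_(x <- s) x.2).+1; pose t := undup (map fst s).
pose v x l := box_volume (a x l) (b x l).
have v0 x l : 0 <= v x l by apply: box_volume_ge0 => i j; have [h _ _] := ab x.
apply: (@le_trans _ _ (\sum_(z <- [seq (x, l) | x <- t, l <- iota 0 K]) v z.1 z.2)).
  apply: ler_sum_uniq_sub => //.
  - by apply: allpairs_uniq => [||]; rewrite ?undup_uniq ?iota_uniq // => -[? ?] [? ?] _ _ [-> ->].
  - move=> [x l] xs; apply/allpairsP; exists (x, l); split=> //; rewrite -?[(x, l).1]/x -?[(x, l).2]/l.
      by rewrite mem_undup; apply/mapP; exists (x, l).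
    rewrite mem_iota add0n ltnS; exact: (@leq_bigmax_seq _ s xpredT (fun z => z.2) (x, l)).
  by move=> z; exact: v0.
rewrite big_allpairs_dep; apply: le_trans (he t (undup_uniq _)).
apply: ler_sum => x _; have [_ _] := ab x; rewrite -lee_fin; apply: le_trans.
rewrite -sumEFin.
have := @nneseries_lim_ge R (fun l => (v x l)%:E) xpredT 0 K.
have v0e l : (0 <= (v x l)%:E)%E by rewrite lee_fin.
move=> /(_ (fun l _ _ => v0e l)).
by rewrite /index_iota subn0.
Qed.

Lemma geometric_seq_le (s : seq nat) : uniq s -> \sum_(x <- s) (2^-1 : R) ^+ x.+1 <= 1.
Proof.
move=> us; pose K := (\max_(x <- s) x).+1.
apply: (@le_trans _ _ (\sum_(x <- iota 0 K) 2^-1 ^+ x.+1)).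
  apply: (ler_sum_uniq_sub us (iota_uniq 0 K)) => [x xs|x]; last by rewrite exprn_ge0 ?invr_ge0.
  by rewrite mem_iota add0n ltnS; exact: (@leq_bigmax_seq _ s xpredT id x).
suff -> : \sum_(x <- iota 0 K) (2^-1 : R) ^+ x.+1 = 1 - 2^-1 ^+ K by rewrite gerBl exprn_ge0 ?invr_ge0.
elim: (K) => [|L IH]; first by rewrite big_nil expr0 subrr.
rewrite -addn1 iotaD big_cat IH big_seq1 add0n addn1 /=.
by rewrite exprS; set y := _ ^+ L; lra.
Qed.

Lemma lebesgue_null_bigcup (I : countType) (N : I -> set 'M[R]_(m, n)) :
  (0 < m)%N -> (0 < n)%N -> (forall x, lebesgue_null (N x)) ->
  lebesgue_null (\bigcup_x N x).
Proof.
move=> m0 n0 hN e e0.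
apply: (@box_cover_bigcup _ _ (fun x => e * 2^-1 ^+ (choice.pickle x).+1)) => //.
  by move=> x; apply: hN; rewrite mulr_gt0 // exprn_gt0 // invr_gt0.
move=> s us; rewrite -mulr_sumr -[leRHS]mulr1 ler_wpM2l ?(ltW e0) //.
rewrite -(big_map choice.pickle xpredT (fun x => 2^-1 ^+ x.+1)); apply: geometric_seq_le.
by rewrite map_inj_uniq //; exact: pcan_inj pickleK.
Qed.

Lemma lebesgue_null_sub (N N' : set 'M[R]_(m, n)) : N `<=` N' -> lebesgue_null N' -> lebesgue_null N.
Proof.
by move=> sub hN e /hN[a [b [h1 h2 h3]]]; exists a, b; split=> //; exact: subset_trans h2.
Qed.

End Covers.

(** * Summable weights on integer vectors *)

Section Weights.
Variable R : realType.

(** About [1 / (|t| log^2 |t|)], made constant on dyadic blocks: the naturals with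
    [2 ^ l <= 1 + t < 2 ^ (l + 1)] have total weight [1 / ((l + 1) (l + 2))], and these totals
    telescope to 1. *)
Definition weight (t : int) : R :=
  let l := trunc_log 2 (1 + absz t) in (2 ^ l * l.+1 * l.+2)%N%:R^-1.

Lemma weight_gt0 t : 0 < weight t.
Proof. by rewrite invr_gt0 ltr0n !muln_gt0 expn_gt0. Qed.

Lemma weight_le1 t : weight t <= 1.
Proof. by rewrite invf_le1 ?ltr0n ?ler1n !muln_gt0 expn_gt0. Qed.

Lemma weightN t : weight (- t) = weight t.
Proof. by rewrite /weight abszN. Qed.

Lemma sum_weight_nat n : \sum_(i < n) weight i%:Z <= 1.
Proof.
suff h l : \sum_(i < 2 ^ l - 1) weight i%:Z <= 1 - l.+1%:R^-1.
  have nl : (n <= 2 ^ n - 1)%N by have := ltn_expl n (ltnSn 1); move: (2 ^ n)%N => z; lia.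
  apply: le_trans (_ : \sum_(i < 2 ^ n - 1) weight i%:Z <= _); last first.
    by apply: le_trans (h n) _; rewrite gerBl invr_ge0.
  rewrite -(subnKC nl) big_split_ord /= lerDl sumr_ge0 // => i _; exact/ltW/weight_gt0.
elim: l => [|l IH]; first by rewrite big_ord0 invr1 subrr.
have -> : (2 ^ l.+1 - 1 = (2 ^ l - 1) + 2 ^ l)%N.
  have : (0 < 2 ^ l)%N by rewrite expn_gt0.
  by rewrite expnS; move: (2 ^ l)%N => z; lia.
rewrite big_split_ord /= [X in _ + X](eq_bigr (fun=> (2 ^ l * l.+1 * l.+2)%N%:R^-1)); last first.
  move=> i _; rewrite /weight absz_nat; suff -> : trunc_log 2 (1 + (2 ^ l - 1 + i)) = l by [].
  apply: trunc_log_eq => //; have := ltn_ord i; have : (0 < 2 ^ l)%N by rewrite expn_gt0.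
  by rewrite expnS; move: (2 ^ l)%N (i : nat) => z y; lia.
rewrite sumr_const card_ord -[_ *+ _]mulr_natl -mulnA natrM invfM mulrA mulfV ?mul1r; last first.
  by rewrite pnatr_eq0 -lt0n expn_gt0.
apply: le_trans (lerD IH (lexx _)) _; apply/eq_lerW; rewrite natrM -[l.+2%:R]natr1.
have : l.+1%:R != 0 :> R by [].
have : l.+1%:R + 1 != 0 :> R by rewrite natr1.
move: (l.+1%:R : R) => y h1 h2; have h3 : 1 + y != 0 by rewrite addrC.
by field; rewrite ?h1 ?h2 ?h3.
Qed.

Lemma sum_weight_range n : \sum_(i < 2 * n) weight (i%:Z - n%:Z) <= 2.
Proof.
rewrite mul2n -addnn big_split_ord /= (_ : 2 = 1 + 1) //; apply: lerD; last first.
  under eq_bigr do rewrite PoszD addrAC subrr add0r; exact: sum_weight_nat.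
rewrite (reindex_inj rev_ord_inj) /=.
apply: le_trans (_ : \sum_(i < n.+1) weight i%:Z <= _); last exact: sum_weight_nat.
rewrite big_ord_recl /= ler_wpDl ?(ltW (weight_gt0 _)) //; apply: ler_sum => i _.
by rewrite /bump leq0n -weightN le_eqVlt; apply/orP; left; apply/eqP; congr weight; have := ltn_ord i; lia.
Qed.

Lemma sum_weight_prod k (s : seq 'rV[int]_k) : uniq s ->
  \sum_(x <- s) \prod_j weight (x 0 j) <= 2 ^+ k.
Proof.
move=> us; pose K := (\max_(x <- s) \max_j absz (x 0%R j)).+1.
pose f (h : {ffun 'I_k -> 'I_(2 * K)}) : 'rV[int]_k := \row_j ((h j)%:Z - K%:Z).
apply: (@le_trans _ _ (\sum_(x <- map f (index_enum _)) \prod_j weight (x 0 j))).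
  apply: ler_sum_uniq_sub => //.
  - rewrite map_inj_uniq ?index_enum_uniq // => h h' /rowP e; apply/ffunP => j.
    by apply: val_inj; have := e j; rewrite !mxE => /addIr[].
  - move=> x xs; have hx j : (absz (x 0%R j) < K)%N.
      rewrite ltnS; apply: leq_trans (@leq_bigmax_seq _ s xpredT (fun x => \max_j absz (x 0%R j))%N x xs isT).
      exact: (@leq_bigmax _ (fun j => absz (x 0%R j))).
    have hj j : (absz (x 0%R j + K%:Z)%R < 2 * K)%N by have := hx j; lia.
    apply/mapP; exists [ffun j => Ordinal (hj j)]; first by rewrite mem_index_enum.
    have e j : x 0%R j = ((absz (x 0%R j + K%:Z)%R)%:Z - K%:Z)%R by have := hx j; lia.
    by apply/rowP => j; rewrite /f mxE ffunE; exact: e.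
  - by move=> x; apply: prodr_ge0 => j _; apply/ltW/weight_gt0.
rewrite big_map /=; under eq_bigr => h _ do under eq_bigr do rewrite mxE.
rewrite -(bigA_distr_bigA (fun (j : 'I_k) (i : 'I_(2 * K)) => weight (i%:Z - K%:Z))).
rewrite -[k in 2 ^+ k]card_ord -prodr_const; apply: ler_prod => j _.
by rewrite sum_weight_range andbT sumr_ge0 // => i _; apply/ltW/weight_gt0.
Qed.

End Weights.

Section SlabCover.
Variables (R : realType) (d r : nat).
Implicit Types (A : 'M[R]_(d, r)).

Definition cube_mx (M : R) : set 'M[R]_(d, r) := [set A : 'M[R]_(d, r) | forall i j, `|A i j| <= M].

(* Within the cube, the slab [|w i + (A y) i| < ep] is cut along the direction [j0] of
   the largest entry of [y]: on each cell of a fine grid in the other coordinates,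
   [A i j0] lies in an interval of length comparable to [ep / |y j0|]. *)
Lemma slab_cover (M ep : R) (w : 'I_d -> R) (y : 'I_r -> R) (j0 : 'I_r) :
  (0 < d)%N -> 0 < M -> 0 < ep -> y j0 != 0 -> (forall j, `|y j| <= `|y j0|) ->
  box_cover (cube_mx M `&` [set A : 'M[R]_(d, r) | forall i, `|w i + \sum_j A i j * y j| < ep])
    (((2 * M) ^+ r.-1 * (4 * (ep / `|y j0|))) ^+ d).
Proof.
move=> d0 M0 ep0 y0 ymax; have r0 : (0 < r)%N by apply: leq_ltn_trans (ltn_ord j0).
have Y0 : 0 < `|y j0| by rewrite normr_gt0.
set del := ep / `|y j0|; have del0 : 0 < del by rewrite divr_gt0.
pose K := (Num.trunc (r%:R * (2 * M) / del)).+1.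
have KR : 0 < K%:R :> R by rewrite ltr0n.
pose t : R := 2 * M / K%:R.
have t0 : 0 < t by rewrite divr_gt0 // mulr_gt0.
have tle : r%:R * t <= del.
  have := ltW (truncnS_gt (r%:R * (2 * M) / del)); rewrite -/K ler_pdivrMr // => h.
  by rewrite /t mulrA ler_pdivrMr // [leRHS]mulrC.
pose cell (p : 'I_K) : R := - M + p%:R * t.
pose ctr (i : 'I_d) (h : {ffun 'I_r -> 'I_K}) : R :=
  - (w i + \sum_(j | j != j0) cell (h j) * y j) / y j0.
pose I : finType := {ffun 'I_d -> {ffun 'I_r -> 'I_K}}.
pose lo (h : I) : 'M[R]_(d, r) := \matrix_(i, j)
  if j == j0 then ctr i (h i) - 2 * del *+ (h i j0 == 0 :> nat) else cell (h i j).
(* All [r] directions carry an index so that volumes factor, but in direction [j0] only index 0 has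
   an interval; the other indices give boxes of width 0, adding nothing to the volume. *)
pose wd j (p : 'I_K) : R := if j == j0 then 4 * del *+ (p == 0 :> nat) else t.
pose hi (h : I) : 'M[R]_(d, r) := \matrix_(i, j) (lo h i j + wd j (h i j)).
have wd0 j p : 0 <= wd j p by rewrite /wd; case: ifP => _; [rewrite mulrn_wge0 // mulr_ge0 // ltW|exact: ltW].
apply: (@box_cover_countable _ _ _ I _ _ lo hi) => //.
- by move=> h i j; rewrite !mxE lerDl.
- move=> A [hA slab].
  have /choice[g hg] : forall z : 'I_d * 'I_r, exists p : 'I_K, cell p <= A z.1 z.2 <= cell p + t.
    move=> z; have := hA z.1 z.2; rewrite ler_norml => /andP[h1 h2].
    pose n := Num.trunc ((A z.1 z.2 + M) / t).
    have x0 : 0 <= (A z.1 z.2 + M) / t by rewrite divr_ge0 ?(ltW t0) //; lra.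
    have hn : n%:R * t <= A z.1 z.2 + M by rewrite -ler_pdivlMr // truncn_le.
    have hn' : A z.1 z.2 + M < n.+1%:R * t by rewrite -ltr_pdivrMr // truncnS_gt.
    have [nK|Kn] := ltnP n K.
      by exists (Ordinal nK); rewrite /cell /=; move: hn'; rewrite -natr1 => hn'; apply/andP; split; lra.
    exists ord_max; rewrite /cell /=.
    have KE : K%:R * t = 2 * M by rewrite /t mulrC divfK // gt_eqF.
    have hK : K%:R * t <= n%:R * t by rewrite ler_wpM2r ?ler_nat // ltW.
    have : K.-1%:R * t = K%:R * t - t by rewrite -[K in RHS]prednK // -natr1; ring.
    by rewrite /= => h3; apply/andP; split; lra.
  exists [ffun i => [ffun j => if j == j0 then ord0 else g (i, j)]] => i j.
  rewrite !mxE /wd !ffunE; case: (boolP (j == j0)) => [/eqP ->|/negbTE jj]; last exact: (hg (i, j)).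
  rewrite ?ffunE ?eqxx /= ?mulr1n.
  suff : `|A i j0 - ctr i [ffun j1 => if j1 == j0 then ord0 else g (i, j1)]| <= 2 * del.
    by rewrite ler_norml => /andP[h1 h2]; apply/andP; split; lra.
  have := slab i; rewrite (bigD1 j0) //= => hs.
  have -> : A i j0 - ctr i [ffun j1 => if j1 == j0 then ord0 else g (i, j1)] =
    ((w i + (A i j0 * y j0 + \sum_(j | j != j0) A i j * y j)) +
     \sum_(j | j != j0) (cell (g (i, j)) - A i j) * y j) / y j0.
    rewrite /ctr (eq_bigr (fun j => cell (g (i, j)) * y j)); last first.
      by move=> l /negbTE hl; rewrite ffunE hl.
    under [X in _ = (_ + X) / _]eq_bigr do rewrite mulrBl.
    by rewrite sumrB; field.
  rewrite normrM normfV ler_pdivrMr //.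
  apply: le_trans (ler_normD _ _) _; have -> : 2 * del * `|y j0| = ep + del * `|y j0|.
    by rewrite /del -mulrA divfK ?gt_eqF //; ring.
  apply: lerD; first exact: ltW.
  apply: le_trans (ler_norm_sum _ _ _) _.
  apply: (@le_trans _ _ (\sum_(j < r) t * `|y j0|)).
    rewrite big_mkcond; apply: ler_sum => l _; case: ifP => _; last by rewrite mulr_ge0 // ltW.
    rewrite normrM; apply: ler_pM => //; have /andP[h1 h2] := hg (i, l).
    by rewrite ler_norml; apply/andP; split; move: h1 h2 => /=; lra.
  by rewrite sumr_const card_ord -[_ *+ r]mulr_natl mulrA ler_wpM2r.
move=> s us; apply: (@le_trans _ _ (\sum_(h : I) box_volume (lo h) (hi h))).
  apply: (ler_sum_uniq_sub us (index_enum_uniq _)) => h; first by rewrite mem_index_enum.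
  by apply: box_volume_ge0 => i j; rewrite !mxE lerDl.
apply/eq_lerW; transitivity (\sum_(h : I) \prod_i \prod_j wd j (h i j)).
  by apply: eq_bigr => h _; apply: eq_bigr => i _; apply: eq_bigr => j _; rewrite !mxE addrC addKr.
rewrite -(bigA_distr_bigA (fun (i : 'I_d) (g : {ffun 'I_r -> 'I_K}) => \prod_j wd j (g j))) /=.
rewrite prodr_const card_ord; congr (_ ^+ _).
rewrite -(bigA_distr_bigA (fun (j : 'I_r) (p : 'I_K) => wd j p)) /= (bigD1 j0) //= mulrC; congr (_ * _).
  rewrite (eq_bigr (fun=> 2 * M)) => [|j /negbTE jj].
    by rewrite prodr_const; congr (_ ^+ _); rewrite cardC1 card_ord.
  rewrite /wd jj sumr_const card_ord /t -[_ *+ K]mulr_natl mulrC divfK // gt_eqF //.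
rewrite /wd eqxx (bigD1 ord0) //= mulr1n big1 ?addr0 // => p p0.
by rewrite (_ : (p == 0 :> nat) = false) ?mulr0n //; apply: negbTE.
Qed.

End SlabCover.

Section Coordinates.
Variables (R : realType) (d k : nat).
Local Notation r := (k - d)%N.
Variables (s : 'I_d + 'I_r -> 'I_k) (A : 'M[R]_(d, r)).
Hypothesis s_bij : bijective s.

Definition free_part (T : Type) (x : 'rV[T]_k) : 'rV[T]_d := \row_i x 0 (s (inl i)).
Definition bound_part (T : Type) (x : 'rV[T]_k) : 'rV[T]_r := \row_j x 0 (s (inr j)).

(* The linear map [R^k -> R^r] whose kernel is the graph of [A]. *)
Definition defect (x : 'rV[R]_k) : 'rV[R]_r := bound_part x - free_part x *m A.

Lemma index_cases (P : 'I_k -> Prop) :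
  (forall i, P (s (inl i))) -> (forall j, P (s (inr j))) -> forall x, P x.
Proof. by move=> hl hr x; have [g _ gs] := s_bij; rewrite -(gs x); case: (g x). Qed.

Lemma row_parts (T : Type) (x y : 'rV[T]_k) :
  free_part x = free_part y -> bound_part x = bound_part y -> x = y.
Proof.
move=> /rowP el /rowP er; apply/rowP; apply: index_cases => i.
  by have := el i; rewrite !mxE.
by have := er i; rewrite !mxE.
Qed.

Lemma free_partD (T : zmodType) (x y : 'rV[T]_k) : free_part (x + y) = free_part x + free_part y.
Proof. by apply/rowP => i; rewrite !mxE. Qed.

Lemma free_partN (T : zmodType) (x : 'rV[T]_k) : free_part (- x) = - free_part x.
Proof. by apply/rowP => i; rewrite !mxE. Qed.

Lemma bound_partD (T : zmodType) (x y : 'rV[T]_k) : bound_part (x + y) = bound_part x + bound_part y.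
Proof. by apply/rowP => i; rewrite !mxE. Qed.

Lemma bound_partN (T : zmodType) (x : 'rV[T]_k) : bound_part (- x) = - bound_part x.
Proof. by apply/rowP => i; rewrite !mxE. Qed.

Lemma defectD x y : defect (x + y) = defect x + defect y.
Proof. by rewrite /defect free_partD bound_partD mulmxDl opprD addrACA. Qed.

Lemma defectN x : defect (- x) = - defect x.
Proof. by rewrite /defect free_partN bound_partN mulNmx opprD. Qed.

Lemma defectB x y : defect (x - y) = defect x - defect y.
Proof. by rewrite defectD defectN. Qed.

Lemma graph_free i i' : (tnth (graph_tuple s A) i) 0 (s (inl i')) = (i == i')%:R.
Proof.
have s_inj := bij_inj s_bij; rewrite tnth_mktuple !mxE eqxx (inj_eq s_inj) summxE.
by rewrite big1 ?addr0 1?eq_sym // => j _; rewrite !mxE (inj_eq s_inj) mulr0.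
Qed.

Lemma graph_bound i j : (tnth (graph_tuple s A) i) 0 (s (inr j)) = A i j.
Proof.
have s_inj := bij_inj s_bij; rewrite tnth_mktuple !mxE eqxx (inj_eq s_inj) summxE.
rewrite (bigD1 j) //= big1 => [|l /negbTE lj]; rewrite !mxE eqxx (inj_eq s_inj).
  by rewrite eqxx mulr1 add0r addr0.
by rewrite (_ : (inr j == inr l :> 'I_d + 'I_r) = false) ?mulr0 // eq_sym; exact: lj.
Qed.

Lemma graph_combination (c : 'I_d -> R) :
  free_part (\sum_i c i *: tnth (graph_tuple s A) i) = \row_i c i /\
  defect (\sum_i c i *: tnth (graph_tuple s A) i) = 0.
Proof.
have f : free_part (\sum_i c i *: tnth (graph_tuple s A) i) = \row_i c i.
  apply/rowP => i; rewrite !mxE summxE (bigD1 i) //= mxE graph_free eqxx mulr1.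
  by rewrite big1 ?addr0 // => l /negbTE li; rewrite mxE graph_free li mulr0.
split=> //; apply/rowP => j; rewrite /defect f !mxE summxE -sumrB big1 // => i _.
by rewrite !mxE graph_bound subrr.
Qed.

Lemma defect0_expand (v : 'rV[R]_k) : defect v = 0 ->
  v = \sum_i v 0 (s (inl i)) *: tnth (graph_tuple s A) i.
Proof.
move=> v0; have [f z] := graph_combination (fun i => v 0 (s (inl i))); apply: row_parts => //.
by move/eqP: z; rewrite subr_eq0 => /eqP ->; rewrite f; move/eqP: v0; rewrite subr_eq0 => /eqP ->.
Qed.

Lemma graph_span (v : 'rV[R]_k) : (v \in <<graph_tuple s A>>%VS) = (defect v == 0).
Proof.
apply/idP/eqP => [/coord_span ->|/defect0_expand ->].
  by under eq_bigr do rewrite -tnth_nth; exact: (graph_combination _).2.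
by apply: memv_suml => i _; apply/memvZ/memv_span/mem_tnth.
Qed.

Lemma pairing_graph (m : 'rV[int]_k) i : pairing m (tnth (graph_tuple s A) i) =
  (m 0 (s (inl i)))%:~R + pairing (bound_part m) (row i A).
Proof.
rewrite /pairing (reindex s) /=; last exact: onW_bij.
rewrite big_sumType /=; congr (_ + _); last first.
  by apply: eq_bigr => j _; rewrite graph_bound !mxE.
rewrite (bigD1 i) //= graph_free eqxx mulr1 big1 ?addr0 // => l li.
by rewrite graph_free eq_sym (negbTE li) mulr0.
Qed.

End Coordinates.

(** * A Diophantine condition on subspaces *)

Section Generic.
Variables (R : realType) (d k : nat).
Local Notation r := (k - d)%N.

Definition height (m : 'rV[int]_k) : nat := (\max_j absz (m 0%R j))%N.

Lemma height_ge (m : 'rV[int]_k) j : (absz (m 0%R j) <= height m)%N.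
Proof. exact: (@leq_bigmax _ (fun j => absz (m 0%R j))). Qed.

(** Stated for a spanning family and all of [Z^k], so that [well_generic_span] carries it between
    charts. The weights have a finite sum over [m], which makes the exceptional set have volume
    [O(c)]; [height ^ d] reflects that the relevant slab is thinner for larger [m]. *)
Definition well_generic (X : d.-tuple 'rV[R]_k) :=
  exists c : R, 0 < c /\ forall m : 'rV[int]_k, m != 0 ->
    exists i, c * (height m)%:R ^+ d * \prod_j weight R (m 0 j) <= `|pairing m (tnth X i)| ^+ d.

Lemma well_generic_span (X Y : d.-tuple 'rV[R]_k) (C : 'M[R]_d) : (0 < d)%N ->
  (forall i, tnth X i = \sum_l C i l *: tnth Y l) -> well_generic X -> well_generic Y.
Proof.
move=> d0 XY [c [c0 hc]]; pose B : R := 1 + \sum_i \sum_l `|C i l|.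
have B0 : 0 < B by rewrite ltr_pwDl // sumr_ge0 // => i _; rewrite sumr_ge0.
exists (c / B ^+ d); split=> [|m m0]; first by rewrite divr_gt0 // exprn_gt0.
have [i hi] := hc m m0.
have hB : \sum_l `|C i l| <= B.
  have -> : B = \sum_l `|C i l| + (1 + \sum_(i' | i' != i) \sum_l `|C i' l|).
    by rewrite /B (bigD1 i) //= addrCA.
  by rewrite lerDl addr_ge0 // sumr_ge0 // => ? _; exact: sumr_ge0.
pose f l : R := `|pairing m (tnth Y l)|.
have [l hl] : exists l, forall l', f l' <= f l.
  have := @arg_maxP _ _ _ (Ordinal d0) xpredT f isT; case=> l _ h; exists l => l'; exact: h.
exists l; set h := _%:R; have -> : c / B ^+ d * h ^+ d * \prod_j weight R (m 0 j) =
  c * h ^+ d * \prod_j weight R (m 0 j) / B ^+ d by ring.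
rewrite ler_pdivrMr ?exprn_gt0 //.
apply: le_trans hi _; rewrite -exprMn lerXn2r ?nnegrE ?mulr_ge0 ?(ltW B0) //.
have -> : pairing m (tnth X i) = \sum_l C i l * pairing m (tnth Y l).
  rewrite /pairing XY; under [RHS]eq_bigr do rewrite mulr_sumr; rewrite exchange_big /=.
  apply: eq_bigr => j _; rewrite summxE mulr_sumr; apply: eq_bigr => l' _; rewrite mxE; ring.
apply: le_trans (ler_norm_sum _ _ _) _.
apply: (@le_trans _ _ (\sum_l' `|C i l'| * f l)).
  by apply: ler_sum => l' _; rewrite normrM ler_wpM2l // hl.
by rewrite -mulr_suml mulrC; apply: ler_wpM2l => //; exact: normr_ge0.
Qed.

Variables (s : 'I_d + 'I_r -> 'I_k).
Hypothesis s_bij : bijective s.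

Lemma box_cover0 (m n : nat) (e : R) : (0 < m)%N -> (0 < n)%N -> 0 <= e ->
  box_cover (set0 : set 'M[R]_(m, n)) e.
Proof.
move=> m0 n0 e0; apply: (@box_cover_countable _ _ _ void _ _ (fun=> 0) (fun=> 0)) => //.
by case=> [|[]]; rewrite ?big_nil.
Qed.

Lemma box_cover_le (m n : nat) (N N' : set 'M[R]_(m, n)) (e e' : R) : N `<=` N' -> e' <= e ->
  box_cover N' e' -> box_cover N e.
Proof.
move=> sub le [a [b [h1 h2 h3]]]; exists a, b; split=> //; first exact: subset_trans h2.
by apply: le_trans h3 _; rewrite lee_fin.
Qed.

Lemma root_exists (x : R) : (0 < d)%N -> 0 < x -> exists y : R, 0 < y /\ y ^+ d = x.
Proof.
move=> d0 x0; exists (powR x (d%:R^-1)); split; first exact: powR_gt0.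
by rewrite -powR_mulrn ?powR_ge0 // -powRrM mulVf ?pnatr_eq0 -?lt0n // powRr1 // ltW.
Qed.

(** For given [m], the exceptional matrices in a cube lie in a slab of width [ep] with
    [ep ^ d = c * height ^ d * P m]. By [slab_cover] its volume is governed by [ep / |y j0|], and
    [|y j0|] is comparable to the height of [m] unless the slab misses the cube. So the volume is at
    most [K0 * c * P m], which is summable over [m]. *)
Theorem well_generic_ae : (0 < d)%N -> (d < k)%N ->
  lebesgue_null [set A : 'M[R]_(d, r) | ~ well_generic (graph_tuple s A)].
Proof.
move=> d0 dk; have r0 : (0 < r)%N by rewrite subn_gt0.
apply: (@lebesgue_null_sub _ _ _ _
  (\bigcup_(n : nat) (cube_mx n.+1%:R `&` [set A | ~ well_generic (graph_tuple s A)]))).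
  move=> A hA; pose S := \sum_i \sum_j `|A i j|.
  exists (Num.trunc S) => //; split=> // i j; apply: le_trans (ltW (truncnS_gt S)).
  rewrite /S (bigD1 i) //= (bigD1 j) //= -addrA lerDl addr_ge0 ?sumr_ge0 // => l _.
  by rewrite sumr_ge0.
apply: lebesgue_null_bigcup => // n e e0.
set M : R := n.+1%:R; have M0 : 0 < M by rewrite ltr0n.
pose D : R := 2 * (r%:R * M + 1); have D0 : 0 < D by rewrite mulr_gt0 // ltr_wpDl // mulr_ge0 // ltW.
pose K0 : R := ((2 * M) ^+ r.-1 * 4) ^+ d * D ^+ d.
have K00 : 0 < K0 by rewrite mulr_gt0 // exprn_gt0 // mulr_gt0 // exprn_gt0 // mulr_gt0.
(* The first bound makes [ep] at most half the height of [m], the second makes the total volume at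
   most [e]. *)
pose c : R := Num.min (2 ^- d) (e / (K0 * 2 ^+ k)).
have c0 : 0 < c by rewrite lt_min invr_gt0 exprn_gt0 // divr_gt0 // mulr_gt0 // exprn_gt0.
have c1 : c <= 2 ^- d by rewrite ge_min lexx.
have ce : K0 * c * 2 ^+ k <= e.
  have : c <= e / (K0 * 2 ^+ k) by rewrite ge_min lexx orbT.
  rewrite ler_pdivlMr; last by apply: mulr_gt0 => //; exact: exprn_gt0.
  by rewrite mulrA [c * _]mulrC.
pose P (m : 'rV[int]_k) : R := \prod_j weight R (m 0 j).
have P0 m : 0 < P m by apply: prodr_gt0 => j _; exact: weight_gt0.
have P1 m : P m <= 1.
  by apply: prodr_ile1 => j _; rewrite (ltW (weight_gt0 _ _)) weight_le1.
pose bad (m : 'rV[int]_k) := cube_mx M `&` [set A : 'M[R]_(d, r) | m != 0 /\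
   forall i, `|pairing m (tnth (graph_tuple s A) i)| ^+ d < c * (height m)%:R ^+ d * P m].
apply: (@box_cover_le d r _ (\bigcup_m bad m) e e _ (lexx e)).
  move=> A [hM hA]; apply: contrapT => nb; apply: hA; exists c; split=> // m m0.
  apply: contrapT => /forallNP hi; apply: nb; exists m => //; split=> //; split=> // i.
  by rewrite ltNge; apply/negP; exact: hi.
apply: (@box_cover_bigcup _ _ _ _ _ (fun m => K0 * c * P m)) => //; last first.
  move=> t ut; rewrite -mulr_sumr; apply: le_trans ce.
  by apply: ler_wpM2l; [apply: mulr_ge0; exact: ltW|exact: sum_weight_prod].
suff H (m : 'rV[int]_k) : box_cover (bad m) (K0 * c * P m) by exact: H.
have e_ge0 : 0 <= K0 * c * P m by apply: mulr_ge0; [apply: mulr_ge0|]; apply: ltW.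
(* A point [A0] of the slab in the cube bounds the free coordinates of [m] by the others, which
   gives [hD]; an empty slab has a cover of any volume. *)
have [[A0 [A0M [m0 A0b]]]|nb] := pselect (exists A, bad m A); last first.
  apply: box_cover_le _ (lexx _) (box_cover0 d0 r0 e_ge0) => A hA.
  by apply: nb; exists A.
have k0 : (0 < k)%N by apply: leq_ltn_trans dk.
have hm0 : (0 < height m)%N.
  rewrite lt0n; apply: contra m0 => /eqP h0; apply/eqP/rowP => j; rewrite !mxE.
  by have := height_ge m j; rewrite h0 leqn0 absz_eq0 => /eqP.
have [ep [ep0 epE]] : exists ep : R, 0 < ep /\ ep ^+ d = c * (height m)%:R ^+ d * P m.
  by apply: root_exists; rewrite // !mulr_gt0 ?exprn_gt0 ?ltr0n.
have slab A i : `|pairing m (tnth (graph_tuple s A) i)| ^+ d < c * (height m)%:R ^+ d * P m ->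
     `|pairing m (tnth (graph_tuple s A) i)| < ep.
  by rewrite -epE ltr_pXn2r ?nnegrE ?(ltW ep0).
have eph : ep <= (height m)%:R / 2.
  rewrite -(@ler_pXn2r _ d) ?nnegrE ?divr_ge0 ?(ltW ep0) // epE expr_div_n.
  rewrite mulrC mulrA [_ / _]mulrC ler_wpM2r ?exprn_ge0 // mulrC; apply: le_trans c1.
  by rewrite ler_piMr // ltW.
have rI : (0 < #|{: 'I_r}|)%N by rewrite card_ord.
have kI : (0 < #|{: 'I_k}|)%N by rewrite card_ord.
have [j0 hj0] := bigop.eq_bigmax (fun j : 'I_r => absz (m 0%R (s (inr j)))) rI.
set y := fun j : 'I_r => ((m 0 (s (inr j)))%:~R : R).
have yE j : `|y j| = (absz (m 0%R (s (inr j))))%:R by rewrite /y -intr_norm -abszE.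
have ymax j : `|y j| <= `|y j0|.
  by rewrite !yE ler_nat -hj0; exact: (@leq_bigmax _ (fun j => absz (m 0%R (s (inr j))))).
have hD : (height m)%:R <= D * `|y j0|.
  have rM0 : 0 <= r%:R * M by rewrite mulr_ge0 // ltW.
  have D1 : 1 <= D by rewrite /D; lra.
  have [x hx] := bigop.eq_bigmax (fun j : 'I_k => absz (m 0%R j)) kI.
  rewrite /height hx; move: x hx; apply: (index_cases s_bij) => i hx; last first.
    rewrite -yE; apply: le_trans (ymax i) _; rewrite ler_peMl //.
  have := slab _ _ (A0b i); rewrite pairing_graph // => h1.
  have h2 : `|pairing (bound_part s m) (row i A0)| <= r%:R * M * `|y j0|.
    apply: le_trans (ler_norm_sum _ _ _) _; rewrite -mulrA -[X in X%:R * _]card_ord mulr_natl -sumr_const.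
    apply: (@ler_sum _ _ _ xpredT) => j _; rewrite !mxE normrM mulrC.
    by apply: ler_pM => //; exact: ymax.
  have h3 : (absz (m 0%R (s (inl i))))%:R = `|(m 0 (s (inl i)))%:~R| :> R by rewrite -intr_norm -abszE.
  have h4 : `|(m 0 (s (inl i)))%:~R : R| <= ep + r%:R * M * `|y j0|.
    rewrite -[X in `|X|](addrK (pairing (bound_part s m) (row i A0))).
    by apply: le_trans (ler_normB _ _) _; apply: lerD => //; exact: ltW.
  move: eph; rewrite /height hx h3 => eph; rewrite /D; have : 0 <= `|y j0| by []. lra.
have y0 : y j0 != 0.
  apply/eqP => z0; move: hD; rewrite z0 normr0 mulr0 lern0 => /eqP h; by rewrite h in hm0.
apply: box_cover_le _ _ (slab_cover (fun i => (m 0 (s (inl i)))%:~R) d0 M0 ep0 y0 ymax).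
  move=> A [hM [_ hA]]; split=> // i /=; have := slab _ _ (hA i); rewrite pairing_graph //.
  suff -> : pairing (bound_part s m) (row i A) = \sum_j A i j * y j by [].
  by apply: eq_bigr => j _; rewrite !mxE mulrC.
have Y0 : 0 < `|y j0| by rewrite normr_gt0.
rewrite mulrA exprMn expr_div_n epE /K0 -!mulrA ler_wpM2l ?exprn_ge0 ?mulr_ge0 ?exprn_ge0 ?mulr_ge0 ?(ltW M0) //.
rewrite [leRHS]mulrCA ler_wpM2l ?(ltW c0) // mulrCA [leRHS]mulrC ler_wpM2l ?(ltW (P0 m)) //.
by rewrite ler_pdivrMr ?exprn_gt0 // -exprMn lerXn2r ?nnegrE // mulr_ge0 // ltW.
Qed.

Lemma weight_ge (t : int) L : (1 + absz t <= 2 ^ L)%N ->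
  ((1 + absz t) * L.+2 ^ 2)%N%:R^-1 <= weight R t.
Proof.
move=> hL; rewrite /weight lef_pV2 ?posrE ?ltr0n ?muln_gt0 ?expn_gt0 // ler_nat -mulnA.
have lL : (trunc_log 2 (1 + absz t) <= L)%N.
  by rewrite -(@leq_exp2l 2) //; apply: leq_trans hL; exact: trunc_logP.
apply: leq_mul; first exact: trunc_logP.
by rewrite expnS expn1; apply: leq_mul; rewrite !ltnS ?(leq_trans lL).
Qed.

(** Complete [q] to [m] by the integers nearest to the entries of [q A], with signs changed. Each of
    these [d] integers is [O(Q)] with [Q] the maximum of the [|q_j|], so their weights cost
    [Q ^ - d] up to logarithms, which [height ^ d] repays. What remains is the product over the
    coordinates of [q]. *)
Theorem well_generic_diophantine (A : 'M[R]_(d, r)) : (0 < d)%N -> (d < k)%N ->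
  well_generic (graph_tuple s A) -> diophantine A.
Proof.
move=> d0 dk [c [c0 hc]]; have r0 : (0 < r)%N by rewrite subn_gt0.
pose S := \sum_i \sum_j `|A i j|; pose D := (Num.trunc (S + 1)).+1.
have SD : S + 1 < D%:R by exact: truncnS_gt.
exists (c / D.+1%:R ^+ d / D.+3%:R ^+ (2 * (d + r))); split.
  by rewrite !divr_gt0 // exprn_gt0.
exists (2 * (d + r))%N => l q q0 hq.
have /choice[nn hnn] : forall i : 'I_d, exists n : int, `|pairing q (row i A) - n%:~R| <= 2^-1.
  by move=> i; exact: nearest_int.
have [g sg gs] := s_bij.
pose m : 'rV[int]_k := \row_x (match g x with inl i => - nn i | inr j => q 0 j end).
have mb : bound_part s m = q by apply/rowP => j; rewrite !mxE sg.
have m0 : m != 0 by apply: contra q0 => /eqP h; rewrite -mb h; apply/eqP/rowP => j; rewrite !mxE.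
have [i hi] := hc m m0; exists i; move: hi; rewrite pairing_graph // mb mxE sg rmorphN /= addrC => hi.
have := expi_sub1_lower (hnn i).
set x := _ - _ in hi *; set be := cabs _ => hbe.
pose Q := (\max_j absz (q 0%R j))%N.
have Qge j : (absz (q 0%R j) <= Q)%N by exact: (@leq_bigmax _ (fun j => absz (q 0%R j))).
have Q0 : (0 < Q)%N.
  rewrite lt0n; apply: contra q0 => /eqP h0; apply/eqP/rowP => j; rewrite !mxE.
  by have := Qge j; rewrite h0 leqn0 absz_eq0 => /eqP.
have Qh : (Q <= height m)%N.
  apply/bigmax_leqP => j _; apply: leq_trans (height_ge m (s (inr j))).
  by rewrite mxE sg.
have Ql : (Q <= 2 ^ l)%N by apply/bigmax_leqP => j _; rewrite -lez_nat abszE hq.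
have nQ i' : (1 + absz (nn i') <= D.+1 * Q)%N.
  have h1 : `|pairing q (row i' A)| <= S * Q%:R.
    apply: le_trans (ler_norm_sum _ _ _) _; rewrite /S (bigD1 i') //= mulrDl ler_wpDr //.
      by rewrite mulr_ge0 // sumr_ge0 // => ? _; rewrite sumr_ge0.
    rewrite mulr_suml; apply: ler_sum => j _; rewrite mxE normrM mulrC ler_wpM2l //.
    by rewrite -intr_norm -abszE ler_nat.
  have h2 : (absz (nn i'))%:R <= S * Q%:R + 1 :> R.
    have -> : (absz (nn i'))%:R = `|(nn i')%:~R| :> R by rewrite -intr_norm -abszE.
    have := hnn i'; rewrite distrC => h3.
    rewrite -[X in `|X|](subrK (pairing q (row i' A))).
    by apply: le_trans (ler_normD _ _) _; lra.
  have Q1 : 1 <= Q%:R :> R by rewrite ler1n.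
  rewrite -(ler_nat R) natrD natrM -[D.+1%:R]natr1; have : (S + 1) * Q%:R <= D%:R * Q%:R by rewrite ler_wpM2r // ltW.
  lra.
pose L := (l + D.+1)%N.
have L1 i' : (1 + absz (nn i') <= 2 ^ L)%N.
  apply: leq_trans (nQ i') _; rewrite /L expnD mulnC; apply: leq_mul => //.
  exact/ltnW/ltn_expl.
have L2 j : (1 + absz (q 0%R j) <= 2 ^ L)%N.
  apply: (@leq_trans (2 * 2 ^ l)%N); last by rewrite /L addnS expnS leq_mul2l leq_exp2l ?leq_addr.
  rewrite mul2n -addnn; apply: leq_add; first by rewrite expn_gt0.
  exact: leq_trans (Qge j) Ql.
have PmE : \prod_j weight R (m 0 j) = \prod_(i' < d) weight R (nn i') * \prod_(j < r) weight R (q 0 j).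
  rewrite (reindex s) /=; last exact: onW_bij.
  rewrite big_sumType /=; congr (_ * _); apply: eq_bigr => j _; rewrite mxE sg ?weightN //.
pose W : R := (L.+2 ^ 2)%N%:R; have W0 : 0 < W by rewrite ltr0n expn_gt0.
have w1 : ((D.+1 * Q)%N%:R * W)^-1 ^+ d <= \prod_(i' < d) weight R (nn i').
  rewrite -[d in X in X <= _]card_ord -prodr_const; apply: ler_prod => i' _.
  rewrite invr_ge0 mulr_ge0 //= ?(ltW W0) //; apply: le_trans (weight_ge (L1 i')).
  by rewrite -natrM lef_pV2 ?posrE ?ltr0n ?muln_gt0 ?Q0 ?expn_gt0 // ler_nat leq_mul2r nQ orbT.
have Pq0 : 0 < \prod_(j < r) (1 + `|q 0 j|%:~R) :> R.
  by apply: prodr_gt0 => j _; rewrite ltr_wpDr // ler0z.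
have w2 : (\prod_(j < r) (1 + `|q 0 j|%:~R) * W ^+ r)^-1 <= \prod_(j < r) weight R (q 0 j).
  rewrite -[r in _ ^+ r]card_ord -prodr_const -big_split /= -prodfV; apply: ler_prod => j _.
  have e : (1 + `|q 0 j|%:~R) * W = ((1 + absz (q 0%R j)) * L.+2 ^ 2)%N%:R.
    by rewrite natrM natrD -abszE.
  by rewrite e invr_ge0 ler0n /=; exact: weight_ge.
have be0 : 0 <= be by exact: cabs_ge0.
have hx : `|x| ^+ d <= be ^+ d by rewrite lerXn2r ?nnegrE //; have := normr_ge0 x; move: hbe; lra.
have main : c * Q%:R ^+ d * (((D.+1 * Q)%N%:R * W)^-1 ^+ d *
    (\prod_(j < r) (1 + `|q 0 j|%:~R) * W ^+ r)^-1) <= be ^+ d.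
  apply: le_trans hx; apply: le_trans hi; rewrite PmE; apply: ler_pM.
  - by rewrite mulr_ge0 ?exprn_ge0 ?(ltW c0).
  - by rewrite mulr_ge0 ?exprn_ge0 ?invr_ge0 ?mulr_ge0 ?exprn_ge0 ?(ltW W0) ?(ltW Pq0).
  - by rewrite ler_wpM2l ?(ltW c0) // lerXn2r ?nnegrE // ler_nat.
  - by apply: ler_pM => //; rewrite ?exprn_ge0 ?invr_ge0 ?mulr_ge0 ?exprn_ge0 ?(ltW W0) ?(ltW Pq0).
have QR0 : Q%:R != 0 :> R by rewrite pnatr_eq0 -lt0n.
have main2 : c / D.+1%:R ^+ d / W ^+ (d + r) <= be ^+ d * \prod_(j < r) (1 + `|q 0 j|%:~R).
  rewrite -ler_pdivrMr //; apply: le_trans main; apply/eq_lerW.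
  rewrite natrM exprVn !exprMn exprD; field.
  by rewrite !expf_neq0 ?(lt0r_neq0 Pq0) ?(lt0r_neq0 W0).
have W2 : W <= (D.+3%:R * l.+1%:R) ^+ 2.
  rewrite /W -natrM -natrX ler_nat leq_exp2r // /L; clear; nia.
have Wn : W ^+ (d + r) <= D.+3%:R ^+ (2 * (d + r)) * l.+1%:R ^+ (2 * (d + r)).
  by rewrite -exprMn exprM lerXn2r ?nnegrE ?(ltW W0) ?exprn_ge0 ?mulr_ge0.
rewrite ler_pdivrMr ?exprn_gt0 // -[leRHS]mulrA [X in _ <= _ * X]mulrC.
move: main2; rewrite ler_pdivrMr ?exprn_gt0 // => h; apply: le_trans h _.
by rewrite ler_wpM2l // mulr_ge0 ?exprn_ge0 // ltW.
Qed.

End Generic.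

(** * Return times to a section *)

Section RowNorm.
Variable R : realType.

Lemma row_norm_le (n : nat) (u : 'rV[R]_n) (c : R) : 0 <= c ->
  (forall j, `|u 0 j| <= c) -> `|u| <= c.
Proof.
move=> c0 h; have -> : `|u| = mx_norm u by []. rewrite mx_normrE.
by apply: bigmax_le => // -[i j] _ /=; rewrite ord1.
Qed.

Lemma row_coord_le (n : nat) (u : 'rV[R]_n) j : `|u 0 j| <= `|u|.
Proof.
have -> : `|u| = mx_norm u by []. rewrite mx_normrE.
exact: (@le_bigmax _ _ _ 0 (fun ij : 'I_1 * 'I_n => `|u ij.1 ij.2|) (0, j)).
Qed.

Lemma mulmx_bound (m n : nat) (Q : 'M[R]_(m, n)) :
  exists C : R, 0 < C /\ forall (u : 'rV[R]_m) c, 0 <= c -> (forall i, `|u 0 i| <= c) ->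
    forall j, `|(u *m Q) 0 j| <= C * c.
Proof.
exists (1 + \sum_i \sum_j `|Q i j|); split.
  by rewrite ltr_pwDl // sumr_ge0 // => i _; exact: sumr_ge0.
move=> u c c0 hu j; rewrite mxE mulrDl mul1r.
apply: (@le_trans _ _ ((\sum_i \sum_j `|Q i j|) * c)); last by rewrite lerDr.
apply: le_trans (ler_norm_sum _ _ _) _; rewrite mulr_suml; apply: ler_sum => i _.
rewrite normrM mulrC; apply: ler_pM => //.
by rewrite (bigD1 j) //= lerDl sumr_ge0.
Qed.

Lemma positive_lower_bound (T : eqType) (s : seq T) (f : T -> R) :
  (forall x, 0 < f x) -> exists e : R, 0 < e /\ forall x, x \in s -> e <= f x.
Proof.
move=> f0; elim: s => [|x s [e [e0 he]]]; first by exists 1.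
exists (Num.min e (f x)); split; first by rewrite lt_min e0 f0.
by move=> y; rewrite inE => /orP[/eqP ->|/he h]; rewrite ge_min ?lexx ?orbT ?h.
Qed.

Lemma integer_translateP (k : nat) (x y : 'rV[R]_k) :
  integer_translate x y <-> exists z : 'rV[int]_k, x = y + real_of R z.
Proof.
split=> [/forallP h|[z ->]]; last first.
  by apply/forallP => i; rewrite addrAC subrr add0r mxE intr_int.
have /choice[z hz] : forall i, exists n : int, (x - y) 0 i = n%:~R.
  by move=> i; exact/intrP.
exists (\row_i z i); apply/rowP => i; rewrite !mxE -hz !mxE; ring.
Qed.

Definition int_window (k N : nat) (h : {ffun 'I_k -> 'I_(2 * N + 1)}) : 'rV[int]_k :=
  \row_j ((h j)%:Z - N%:Z).

Lemma int_windowP (k N : nat) (z : 'rV[int]_k) : (forall j, (absz (z 0%R j) <= N)%N) ->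
  exists h : {ffun 'I_k -> 'I_(2 * N + 1)}, z = int_window h.
Proof.
move=> hz; have hj j : (absz (z 0%R j + N%:Z)%R < 2 * N + 1)%N by have := hz j; lia.
exists [ffun j => Ordinal (hj j)].
have e j : (z 0 j = (absz (z 0%R j + N%:Z)%R)%:Z - N%:Z)%R by have := hz j; lia.
by apply/rowP => j; rewrite [in RHS]mxE ffunE; exact: e.
Qed.

(** Gathers all hits in one countable type with finite fibres over the indices, the form required by
    [equidistributed_bijection]. *)
Lemma fibers_of_sets (d r : nat) (S : 'rV[int]_d -> set 'rV[int]_r) :
  (forall n, finite_set (S n)) ->
  exists (X : countType) (a : X -> 'rV[int]_d) (p : X -> 'rV[int]_r)
     (fib : 'rV[int]_d -> {fset X}),
    [/\ forall x, S (a x) (p x), forall n q, S n q -> exists x, a x = n /\ p x = q,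
        forall x y, a x = a y -> p x = p y -> x = y,
        forall n x, (x \in fib n) = (a x == n) &
        forall n, #|` fib n| = #|` fset_set (S n)|].
Proof.
move=> fS; pose P (z : 'rV[int]_d * 'rV[int]_r) := z.2 \in fset_set (S z.1).
pose X : countType := {z | P z}.
pose l n : seq X := pmap insub [seq (n, q) | q <- fset_set (S n)].
have memP n q : (q \in fset_set (S n)) = P (n, q) by [].
have lu n : uniq (l n).
  by apply: pmap_sub_uniq; rewrite map_inj_uniq ?fset_uniq // => u v [].
exists X, (fun x => (val x).1), (fun x => (val x).2), (fun n => [fset x in l n]%fset); split.
- move=> x; have := valP x; rewrite /P in_fset_set //; by move/set_mem.
- move=> n q Sq; have h : P (n, q) by rewrite /P in_fset_set //; exact/mem_set.
  by exists (Sub (n, q) h); rewrite !SubK.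
- by move=> [[n q] h] [[n' q'] h'] /= e e'; apply: val_inj => /=; rewrite e e'.
- move=> n x; rewrite inE mem_pmap_sub; apply/mapP/eqP => [[q _ ->] //|<-].
  by exists (val x).2; [exact: valP x|case: (val x)].
- move=> n; rewrite card_fseq undup_id ?lu // size_pmap_sub count_map -size_filter.
  by congr size; apply/all_filterP/allP => q hq; exact: hq.
Qed.

End RowNorm.

(** * From hits of a rotation to visits of a subspace *)

Section Transfer.
Variables (R : realType) (d k : nat) (d0 : (0 < d)%N) (dk : (d < k)%N).
Local Notation r := (k - d)%N.
Variables (s : 'I_d + 'I_r -> 'I_k) (A : 'M[R]_(d, r)) (s_bij : bijective s).
Variables (V : {vspace 'rV[R]_k}) (hV : V = <<graph_tuple s A>>%VS).

Lemma parts_surj (T : Type) (n : 'rV[T]_d) (p : 'rV[T]_r) :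
  exists z : 'rV[T]_k, free_part s z = n /\ bound_part s z = p.
Proof.
have [g sg gs] := s_bij.
exists (\row_x (match g x with inl i => n 0 i | inr j => p 0 j end)).
by split; apply/rowP => j; rewrite !mxE sg.
Qed.

Lemma defect_bound : exists C : R, 0 < C /\ forall (x : 'rV[R]_k) c, 0 <= c ->
  (forall j, `|x 0 j| <= c) -> forall j, `|defect s A x 0 j| <= C * c.
Proof.
have [C [C0 hC]] := mulmx_bound A; exists (1 + C); split=> [|x c c0 hx j]; first by rewrite addr_gt0.
rewrite !mxE mulrDl mul1r; apply: le_trans (ler_normB _ _) _; apply: lerD => //.
have := hC (free_part s x) c c0 _ j; rewrite mxE; apply => i; by rewrite mxE.
Qed.

Lemma defect_real_of (z : 'rV[int]_k) :
  defect s A (real_of R z) = real_of R (bound_part s z) - rotate A (free_part s z).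
Proof.
rewrite /defect /rotate; congr (_ - _); last congr (_ *m _).
  by apply/rowP => j; rewrite !mxE.
by apply/rowP => j; rewrite !mxE.
Qed.

Lemma mem_graphV v : (v \in V) = (defect s A v == 0).
Proof. by rewrite hV graph_span. Qed.

Variable phi : 'Hom('rV[R]_d, 'rV[R]_k).
Hypothesis hphi : limg phi = V.

Lemma defect_phi y : defect s A (phi y) = 0.
Proof. by apply/eqP; rewrite -mem_graphV -hphi memv_img ?memvf. Qed.

Lemma phi_inj : injective phi.
Proof.
have dE : \dim (fullv : {vspace 'rV[R]_d}) = d by rewrite dimvf dim_matrix; lia.
apply/lker0P; rewrite -dimv_eq0; have := limg_ker_dim phi fullv.
rewrite hphi hV (eqP (dim_graph A s_bij)) dE capfv => h.
by apply/eqP; lia.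
Qed.

Lemma phi_surj v : defect s A v = 0 -> exists y, v = phi y.
Proof.
move=> v0; have : v \in limg phi by rewrite hphi mem_graphV v0.
by case/memv_imgP => y _ ->; exists y.
Qed.

Lemma phi_coordinates : exists P : 'M[R]_d, P \in unitmx /\
  forall y, free_part s (phi y) = y *m P.
Proof.
pose P : 'M[R]_d := \matrix_(i, j) free_part s (phi (delta_mx 0 i)) 0 j.
have PE y : free_part s (phi y) = y *m P.
  apply/rowP => j; rewrite !mxE {1}[y]row_sum_delta linear_sum summxE; apply: eq_bigr => i _.
  by rewrite linearZ !mxE.
exists P; split=> //; rewrite -row_free_unit -kermx_eq0; apply/rowV0P => u /sub_kermxP uP.
apply: phi_inj; rewrite linear0; apply: (row_parts s_bij).
  by rewrite PE uP; apply/rowP => j; rewrite !mxE.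
have := defect_phi u; rewrite /defect PE uP mul0mx subr0 => ->.
by apply/rowP => j; rewrite !mxE.
Qed.

Variables (B : set 'rV[R]_k) (M : R) (M0 : 0 <= M).
Hypothesis B_bounded : forall b, B b -> forall j, `|b 0 j| <= M.
(** Differences of points of [B] are determined by their projection along [V]; for linear sections
    this is transversality. *)
Hypothesis B_defect : forall b1 b2 b3 b4, B b1 -> B b2 -> B b3 -> B b4 ->
  defect s A (b1 - b2) = defect s A (b3 - b4) -> b1 - b2 = b3 - b4.
Local Notation E := (defect s A @` B).
Variable x : torus R k.
Local Notation x0 := (repr x).
Local Notation Y := (phi @^-1` visit_set V (@torus_proj R k @` B) x).

Lemma visitP y : Y y <-> exists b z, B b /\ phi y = b + real_of R z - x0.
Proof.
rewrite /visit_set /torus_act /=; split=> [[_ [b Bb /torus_projP]]|[b [z [Bb e]]]].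
  move=> /integer_translateP[z e]; exists b, (- z); split=> //.
  rewrite e; have -> : real_of R (- z) = - real_of R z by apply/rowP => j; rewrite !mxE rmorphN.
  by rewrite addrK addrK.
split; first by rewrite mem_graphV defect_phi.
exists b => //; apply/torus_projP; rewrite e subrK; apply/integer_translateP.
exists (- z); have -> : real_of R (- z) = - real_of R z by apply/rowP => j; rewrite !mxE rmorphN.
by rewrite addrK.
Qed.

Lemma section_box : exists lo hi : 'rV[R]_r, E `<=` cbox lo hi /\ forall j, lo 0 j <= hi 0 j.
Proof.
have [C [C0 hC]] := defect_bound; exists (\row_j - (C * M)), (\row_j (C * M)); split.
  move=> _ [b Bb <-] j; have := hC _ _ M0 (B_bounded Bb) j; move: (defect s A b) => w.
  by rewrite !mxE ler_norml.
by move=> j; rewrite !mxE ge0_cp // mulr_ge0 // ltW.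
Qed.

Lemma section_finite y : finite_set (lattice_hits E y).
Proof. by have [lo [hi [h1 h2]]] := section_box; exact: (hits_box y h1 h2).1. Qed.

Lemma hits_ball_ge1 (y0 : 'rV[R]_r) (rho : R) : (forall e : 'rV[R]_r, (forall j, `|e 0 j - y0 0 j| < rho) -> E e) ->
  forall y : 'rV[R]_r, (exists n : 'rV[int]_r, forall j, `|(y - y0) 0 j - (n 0 j)%:~R| < rho) ->
  1 <= (hits E y)%:R :> R.
Proof.
move=> hball y [n hn]; rewrite ler1n cardfs_gt0; apply/fset0Pn; exists (- n).
rewrite in_fset_set; last exact: section_finite.
apply/mem_set; apply: hball => j; have := hn j; rewrite !mxE rmorphN /= => h.
by have -> : y 0 j - (n 0 j)%:~R - y0 0 j = y 0 j + - y0 0 j - (n 0 j)%:~R by ring.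
Qed.

(** The difference of two visits is some [b - b' + z] in [V]. If it is shorter than 1, then [z] lies
    in a finite window, and by [B_defect] each [z] allows a single value; hence a positive minimum.
    Conversely the averages at one fixed scale [T] are positive, so each cube of indices of that
    side holds a hit. *)
Theorem return_times_separated :
  (forall q : 'rV[int]_r, q != 0 -> exists i, expi (pairing q (row i A)) != 1) ->
  (exists (y0 : 'rV[R]_r) (rho : R), 0 < rho /\ forall e : 'rV[R]_r, (forall j, `|e 0 j - y0 0 j| < rho) -> E e) ->
  separated_net Y.
Proof.
move=> irr [y0 [rho [rho0 hball]]].
pose N := (Num.trunc (2 * M + 1)).+1.
have MN : 2 * M + 1 <= N%:R by apply/ltW/truncnS_gt.
have /choice[dl hdl] : forall z : 'rV[int]_k, exists dl : R, 0 < dl /\ forall b b', B b -> B b' ->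
   defect s A (b - b' + real_of R z) = 0 -> b - b' + real_of R z <> 0 -> dl <= `|b - b' + real_of R z|.
  move=> z.
  have [[b [b' [Bb Bb' h0 h1]]]|no] := pselect (exists b b', [/\ B b, B b',
     defect s A (b - b' + real_of R z) = 0 & b - b' + real_of R z <> 0]); last first.
    by exists 1; split=> // b b' Bb Bb' h0 h1; case: no; exists b, b'.
  exists `|b - b' + real_of R z|; split; first by rewrite normr_gt0; exact/eqP.
  move=> c c' Bc Bc' g0 g1; suff -> : c - c' = b - b' by [].
  apply: B_defect => //; move: h0 g0; rewrite !(defectD _ _ _ (real_of R z)).
  by move=> /eqP; rewrite addr_eq0 => /eqP -> /eqP; rewrite addr_eq0 => /eqP.
pose f := @int_window k N.
have [dl0 [dl00 hdl0]] := @positive_lower_bound R _ [seq f h | h : {ffun 'I_k -> 'I_(2 * N + 1)}] dl (fun z => (hdl z).1).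
have [Cp [Cp0 hCp]] : exists C : R, 0 < C /\ forall y, `|phi y| <= C * `|y|.
  have [C [C0 hC]] := mulmx_bound (\matrix_i phi (delta_mx 0 i)).
  exists C; split=> // y; apply: row_norm_le => [|j]; first by rewrite mulr_ge0 // ltW.
  have -> : phi y = y *m (\matrix_i phi (delta_mx 0 i)).
    rewrite {1}[y]row_sum_delta linear_sum mulmx_sum_row; apply: eq_bigr => i _.
    by rewrite linearZ rowK.
  by apply: hC => // i; exact: row_coord_le.
have sep y1 y2 : Y y1 -> Y y2 -> y1 <> y2 -> Num.min 1 dl0 / Cp <= `|y1 - y2|.
  move=> /visitP[b1 [z1 [B1 e1]]] /visitP[b2 [z2 [B2 e2]]] ne.
  rewrite ler_pdivrMr // mulrC; apply: le_trans (hCp _).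
  have eE : phi (y1 - y2) = b1 - b2 + real_of R (z1 - z2).
    rewrite linearB /= e1 e2; apply/rowP => j; rewrite !mxE rmorphB /=; ring.
  have [h|h] := ltP `|phi (y1 - y2)| 1; last by rewrite ge_min h.
  rewrite ge_min; apply/orP; right.
  apply: (@le_trans _ _ (dl (z1 - z2))).
    apply: hdl0; have hz j : (absz ((z1 - z2)%R 0%R j) <= N)%N.
      have := row_coord_le (phi (y1 - y2)) j; rewrite eE => g.
      have g1 := B_bounded B1 j; have g2 := B_bounded B2 j.
      have : `|((z1 - z2) 0 j)%:~R : R| <= N%:R.
        have eQ : (b1 - b2 + real_of R (z1 - z2)) 0 j = b1 0 j - b2 0 j + ((z1 - z2) 0 j)%:~R.
          by rewrite [LHS]mxE; congr (_ + _); [rewrite !mxE|rewrite mxE].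
        move: g h g1 g2; rewrite eE eQ.
        move: (b1 0 j) (b2 0 j) (((z1 - z2) 0 j)%:~R : R) => u v t.
        by rewrite !ler_norml => /andP[? ?] ? /andP[? ?] /andP[? ?]; apply/andP; split; lra.
      by rewrite -intr_norm -abszE ler_nat.
    have [h' ->] := int_windowP hz; exact/map_f/mem_enum.
  rewrite eE; apply: (hdl _).2 => //; first by rewrite -eE defect_phi.
  rewrite -eE -(linear0 phi) => /phi_inj /eqP; rewrite subr_eq0 => /eqP; exact: ne.
have [c0 [c00 [T0 hT]]] := rotation_avg_lower irr rho0.
pose T := T0.+1; have [P [Pu PE]] := phi_coordinates.
have [Cq [Cq0 hCq]] := mulmx_bound (invmx P).
pose X0 : R := `|x0| + M + T%:R + 1.
have X00 : 0 <= X0 by rewrite !addr_ge0.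
pose rr := Num.min 1 dl0 / Cp.
have rr0 : 0 < rr by rewrite divr_gt0 // lt_min ltr01.
exists rr, (Cq * X0 + rr + 1); split=> //.
  by rewrite [Cq * X0 + _]addrC -addrA ltrDl ltr_wpDl // mulr_ge0 // ltW.
move=> c; pose n0 : 'rV[int]_d := \row_j Num.floor ((c *m P) 0 j).
pose xi := defect s A x0 + rotate A n0.
have := hT T 1%N (leqnSn _) isT isT (fun y => (hits E y)%:R) y0 (fun y => ler0n _ _) _ xi.
move=> /(_ (hits_ball_ge1 hball)) avg.
have [m [p hm]] : exists (m : {ffun 'I_1 * 'I_d -> 'I_T}) p, lattice_hits E (xi + rotate A (shift m)) p.
  apply: contrapT => no; suff h0 : rotation_avg A T 1 (fun y => (hits E y)%:R) xi = 0 by move: avg; rewrite h0; lra.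
  rewrite /rotation_avg big1 ?mulr0 // => m _; apply/eqP; rewrite pnatr_eq0 cardfs_eq0.
  apply/eqP/fsetP => p; rewrite in_fset0 in_fset_set; last exact: section_finite.
  by apply/negbTE/negP => /set_mem h; apply: no; exists m, p.
have [b Bb eb] := hm.
have [z [zf zb]] := parts_surj (n0 + shift m) (- p).
have v0 : defect s A (b + real_of R z - x0) = 0.
  rewrite defectB defectD eb defect_real_of zf zb /xi /rotate map_mxD mulmxDl.
  have -> : real_of R (- p) = - real_of R p by apply/rowP => j; rewrite !mxE rmorphN.
  by apply/rowP => j; rewrite !mxE; ring.
have [y ey] := phi_surj v0; exists y; split; first by apply/visitP; exists b, z.
rewrite -ball_normE /ball_ /=; apply: (@le_lt_trans _ _ (Cq * X0)); last first.
  by rewrite -addrA ltrDl addr_gt0.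
apply: row_norm_le => [|j]; first by rewrite mulr_ge0 // ltW.
have -> : c - y = (c *m P - y *m P) *m invmx P by rewrite -mulmxBl mulmxK.
apply: hCq => // i; rewrite -PE -ey.
have zi : (z 0 (s (inl i)))%:~R = (n0 0 i)%:~R + (shift m 0 i)%:~R :> R.
  by have := congr1 (fun w : 'rV[int]_d => w 0 i) zf; rewrite mxE => ->; rewrite mxE rmorphD.
have ent (w u v t : 'rV[R]_d) : (w - (u + v - t)) 0 i = w 0 i - (u 0 i + v 0 i - t 0 i) by rewrite !mxE.
have fe (y' : 'rV[R]_k) : free_part s y' 0 i = y' 0 (s (inl i)) by rewrite mxE.
rewrite !free_partD free_partN ent !fe [real_of R z 0 _]mxE zi.
have := floor_itv ((c *m P) 0 i).
have -> : Num.floor ((c *m P) 0 i) = n0 0 i by rewrite [RHS]mxE.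
rewrite rmorphD /=.
have : 0 <= ((shift m 0 i)%:~R : R) <= T%:R.
  by rewrite mxE big_ord1 [X in _ <= X <= _]/(_%:R) ler0n ler_nat ltnW.
have := B_bounded Bb (s (inl i)); have := row_coord_le x0 (s (inl i)).
move: ((c *m P) 0 i) ((n0 0 i)%:~R : R) ((shift m 0 i)%:~R : R) (b 0 (s (inl i))) (x0 0 (s (inl i))) => t n1 n2 bb xx.
rewrite !ler_norml /X0; clear - d0 dk s_bij hV hphi M0 B_bounded B_defect => /andP[? ?] /andP[? ?] /andP[? ?] /andP[? ?].
apply/andP; split; lra.
Qed.

(** With this, [B] embeds into the torus, so that hits and visits correspond one to one. *)
Hypothesis B_proj : forall b b', B b -> B b' -> integer_translate b b' -> b = b'.

(** The hits are matched with the stretched lattice, at bounded distance in the index coordinates.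
    The index of a visit is its free part up to a bounded error, and the matrix [P] of
    [phi_coordinates] translates free parts back to [R^d]. *)
Theorem return_times_BD (lam : R) : 0 < lam ->
  (forall theta, exists K : R, 0 <= K /\ forall F : {fset 'rV[int]_d},
     `|\sum_(n <- F) ((hits E (theta + rotate A n))%:R - lam)| <= K * (perimeter F)%:R) ->
  BD_to_lattice Y.
Proof.
move=> lam0 /(_ (defect s A x0))[K [K0 hK]].
have [X [a [p [fib [aS surj inj mem card]]]]] :=
  fibers_of_sets (fun n => section_finite (defect s A x0 + rotate A n)).
have hK' (F : {fset 'rV[int]_d}) : `|\sum_(n <- F) (#|` fib n|%:R - lam)| <= K * (perimeter F)%:R.
  by apply: le_trans (hK F); under eq_bigr do rewrite card.
pose i0 := Ordinal d0.
have [h [[h' hh' h'h] [C hC]]] := @equidistributed_bijection R d i0 lam lam0 X a fib K mem K0 hK'.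
have /choice[bz hbz] : forall u : X, exists bz : 'rV[R]_k * 'rV[int]_k,
    [/\ B bz.1, free_part s bz.2 = a u, bound_part s bz.2 = - p u &
        defect s A (bz.1 + real_of R bz.2 - x0) = 0].
  move=> u; have [b Bb eb] := aS u; have [z [zf zb]] := parts_surj (a u) (- p u).
  exists (b, z); split=> //=; rewrite defectB defectD eb defect_real_of zf zb.
  have -> : real_of R (- p u) = - real_of R (p u) by apply/rowP => j; rewrite !mxE rmorphN.
  by apply/rowP => j; rewrite !mxE; ring.
have /choice[pt hpt] : forall u : X, exists y, (bz u).1 + real_of R (bz u).2 - x0 = phi y.
  by move=> u; apply: phi_surj; have [] := hbz u.
have Ypt u : Y (pt u).
  by apply/visitP; exists (bz u).1, (bz u).2; split; [have [] := hbz u|rewrite hpt].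
have /choice[ix hix] : forall y, exists u, Y y -> y = pt u.
  move=> y; have [/visitP[b [z [Bb e]]]|nY] := pselect (Y y); last by exists (h' 0).
  have v0 : defect s A (b + real_of R z - x0) = 0 by rewrite -e defect_phi.
  have Eb : lattice_hits E (defect s A x0 + rotate A (free_part s z)) (- bound_part s z).
    exists b => //; move: v0; rewrite defectB defectD defect_real_of => /eqP.
    have -> : real_of R (- bound_part s z) = - real_of R (bound_part s z).
      by apply/rowP => j; rewrite !mxE rmorphN.
    rewrite subr_eq0 => /eqP <-; apply/rowP => j; rewrite !mxE; ring.
  have [u [au pu]] := surj _ _ Eb; exists u => _.
  have [Bu fu bu du] := hbz u.
  have zE : (bz u).2 = z by apply: (row_parts s_bij); rewrite ?fu ?bu ?au ?pu ?opprK.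
  apply: phi_inj; rewrite -hpt e zE; congr (_ + _ - _).
  have bb : b - b = (bz u).1 - (bz u).1 by rewrite !subrr.
  have : b - (bz u).1 = b - b.
    apply: B_defect => //; rewrite subrr defectB; apply/eqP; rewrite -subr_eq0 -defectB.
    apply/eqP; move: v0 du; rewrite zE !defectB !defectD => h1 h2.
    have -> : defect s A 0 = 0 by rewrite -(subrr 0) defectB subrr.
    apply/eqP; rewrite subr0 subr_eq0; apply/eqP.
    by have := etrans h1 (esym h2) => /addIr/addIr.
  by rewrite subrr => /eqP; rewrite subr_eq0 => /eqP.
have pt_inj u u' : pt u = pt u' -> u = u'.
  move=> e; have : phi (pt u) = phi (pt u') by rewrite e.
  rewrite -!hpt => /addIr e2.
  have [Bu fu bu _] := hbz u; have [Bu' fu' bu' _] := hbz u'.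
  have be : (bz u).1 = (bz u').1.
    apply: B_proj => //; apply/integer_translateP; exists ((bz u').2 - (bz u).2).
    rewrite -[LHS](addrK (real_of R (bz u).2)) e2; apply/rowP => j; rewrite !mxE rmorphB /=; ring.
  have ze : (bz u).2 = (bz u').2.
    move: e2; rewrite be => /addrI /rowP e3; apply/rowP => j; have := e3 j; rewrite !mxE.
    by move/intr_inj.
  by apply: inj; [rewrite -fu ze fu'|apply: oppr_inj; rewrite -bu ze bu'].
have [P [Pu PE]] := phi_coordinates.
pose D : 'M[R]_d := diag_mx (\row_j if j == i0 then lam^-1 else 1).
have DE z : stretch i0 lam z = map_mx intr z *m D.
  apply/rowP => j; rewrite mul_mx_diag !mxE; case: ifP => _ //; by rewrite mulr1.
have Du : D \in unitmx.
  rewrite unitmxE det_diag unitfE; apply/prodf_neq0 => j _; rewrite mxE; case: ifP => _.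
    by rewrite invr_eq0 gt_eqF.
  exact: oner_neq0.
exists (range (fun z : 'rV[int]_d => map_mx intr z *m (D *m invmx P))).
  by exists (D *m invmx P) => //; rewrite unitmx_mul Du unitmx_inv.
exists (fun y => stretch i0 lam (h (ix y)) *m invmx P); split.
  split.
  - by move=> y Yy /=; exists (h (ix y)) => //; rewrite DE mulmxA.
  - move=> y y' /set_mem Yy /set_mem Yy' /(can_inj (mulmxKV Pu)) e.
    rewrite (hix y Yy) (hix y' Yy'); congr pt; apply: (can_inj hh').
    move: e; rewrite !DE => /(can_inj (mulmxK Du)) /rowP e; apply/rowP => j.
    by have := e j; rewrite !mxE => /intr_inj.
  - move=> _ [z _ <-]; exists (pt (h' z)); first exact: Ypt.
    have <- : h' z = ix (pt (h' z)) by apply: pt_inj; exact: hix.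
    by rewrite h'h DE mulmxA.
have [Cq [Cq0 hCq]] := mulmx_bound (invmx P).
exists (Cq * (`|C| + M + `|x0|)) => _ [y Yy <-].
have X00 : 0 <= `|C| + M + `|x0| by rewrite !addr_ge0.
apply: row_norm_le => [|j]; first by rewrite mulr_ge0 // ltW.
have -> : y = (y *m P) *m invmx P by rewrite mulmxK.
rewrite -mulmxBl; set u := ix _.
have uE : ix (y *m P *m invmx P) = ix y by rewrite mulmxK.
apply: hCq => // i; rewrite -PE mxE [X in `|_ + X|]mxE /u uE {u uE}.
have e := hix y Yy; set u := ix y in e *; rewrite e -hpt !free_partD free_partN.
have [Bu fu bu _] := hbz u.
have := hC u i; have := B_bounded Bu (s (inl i)); have := row_coord_le x0 (s (inl i)).
have -> : (free_part s (bz u).1 + free_part s (real_of R (bz u).2) - free_part s x0) 0 i =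
  (bz u).1 0 (s (inl i)) + (a u 0 i)%:~R - x0 0 (s (inl i)) by rewrite -fu !mxE.
move: (stretch _ _ _ 0 i) ((a u 0 i)%:~R : R) ((bz u).1 0 (s (inl i))) (x0 0 (s (inl i))) => t1 t2 t3 t4.
move=> h1 h2 h3; have := ler_norm C => h4; move: h1 h2 h3.
by rewrite !ler_norml => /andP[? ?] /andP[? ?] /andP[? ?]; apply/andP; split; lra.
Qed.

Theorem return_times_conclusion (a : nat) (kap : R) :
  (0 < a)%N -> 0 <= kap < 1 -> kap * (2 ^ a)%N%:R < 1 -> diophantine A ->
  (exists (y0 : 'rV[R]_r) (rho : R), 0 < rho /\ forall e : 'rV[R]_r, (forall j, `|e 0 j - y0 0 j| < rho) -> E e) ->
  (exists N : nat, (0 < N)%N /\ exists C : R, 0 <= C /\ exists c : nat -> R, forall i xi,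
    `|rotation_avg A (2 ^ (a * i)) N (fun y => (hits E y)%:R) xi - c i| <= C * kap ^+ i) ->
  separated_net Y /\ BD_to_lattice Y.
Proof.
move=> a0 kap01 kapa dio ball [N [N0 [C [C0 [c hc]]]]].
have irr := diophantine_irrational d0 dio; split; first exact: return_times_separated.
have [y0 [rho [rho0 hball]]] := ball.
have [c0 [c00 [T0 hT]]] := rotation_avg_lower irr rho0.
have [lam [lam0 hlam]] := @uniform_discrepancy R d r A (fun y => (hits E y)%:R) a N C kap c0 T0 c
  C0 kap01 kapa a0 N0 c00 hc
  (fun T h1 h2 xi => hT T N h1 h2 N0 _ y0 (fun y => ler0n _ _) (hits_ball_ge1 hball) xi).
exact: return_times_BD lam0 hlam.
Qed.

End Transfer.

(** * Choice of charts *)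

Section Charts.
Variables (R : realType) (d k : nat) (d0 : (0 < d)%N) (dk : (d < k)%N).
Local Notation r := (k - d)%N.

Lemma split_indices (J : {set 'I_k}) : #|J| = r ->
  exists s : 'I_d + 'I_r -> 'I_k, [/\ bijective s, forall i, s (inl i) \notin J & forall j, s (inr j) \in J].
Proof.
move=> cJ; have cJ' : #|~: J| = d by have := cardsC J; rewrite cJ card_ord; lia.
pose s (z : 'I_d + 'I_r) : 'I_k := match z with
  | inl i => enum_val (cast_ord (esym cJ') i) | inr j => enum_val (cast_ord (esym cJ) j) end.
have sl i : s (inl i) \notin J by have := enum_valP (cast_ord (esym cJ') i); rewrite inE.
have sr j : s (inr j) \in J by exact: enum_valP.
exists s; split=> //; apply: inj_card_bij; last by rewrite card_sum !card_ord subnKC // ltnW.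
move=> [i|j] [i'|j'] e.
- by congr inl; apply: (@cast_ord_inj _ _ (esym cJ')); apply: enum_val_inj.
- by have := sl i; rewrite e sr.
- by have := sl i'; rewrite -e sr.
- by congr inr; apply: (@cast_ord_inj _ _ (esym cJ)); apply: enum_val_inj.
Qed.

(** A subspace without nonzero vectors supported on [J] is a graph over the coordinates outside [J].
    In this chart a box parallel to the coordinates in [J] projects along [V] to a translate of
    itself. *)
Lemma change_chart (X : d.-tuple 'rV[R]_k) (J : {set 'I_k}) :
  (forall u : 'rV[R]_d, \sum_i u 0 i *: tnth X i = 0 -> u = 0) -> #|J| = r ->
  (forall v, v \in <<X>>%VS -> (forall i, i \notin J -> v 0 i = 0) -> v = 0) ->
  exists (s : 'I_d + 'I_r -> 'I_k) (A : 'M[R]_(d, r)),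
    [/\ bijective s, forall i, s (inl i) \notin J, forall j, s (inr j) \in J,
        <<X>>%VS = <<graph_tuple s A>>%VS &
        well_generic X -> well_generic (graph_tuple s A)].
Proof.
move=> Xfree cJ hJ; have [s [sb sl sr]] := split_indices cJ.
pose P : 'M[R]_d := \matrix_(i, l) (tnth X i) 0 (s (inl l)).
have Pu : P \in unitmx.
  rewrite -row_free_unit -kermx_eq0; apply/rowV0P => u /sub_kermxP uP.
  apply: Xfree; apply: hJ => [|i].
    by apply: memv_suml => i _; apply/memvZ/memv_span/mem_tnth.
  move: i; apply: (index_cases sb) => [i _|j]; last by rewrite sr.
  move/rowP: uP => /(_ i); rewrite !mxE => <-; rewrite summxE; apply: eq_bigr => l _.
  by rewrite !mxE.
pose A := invmx P *m (\matrix_(i, j) (tnth X i) 0 (s (inr j))).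
have dX i : defect s A (tnth X i) = 0.
  rewrite /defect /A mulmxA; have -> : free_part s (tnth X i) = row i P.
    by apply/rowP => l; rewrite !mxE.
  rewrite -row_mul mulmxV // row1 -rowE; apply/rowP => j; rewrite !mxE; exact: subrr.
have fX : free X.
  apply/freeP => c c0 i; have := Xfree (\row_i c i).
  have -> : \sum_i0 (\row_i1 c i1) 0 i0 *: tnth X i0 = \sum_(i0 < d) c i0 *: X`_i0.
    by apply: eq_bigr => l _; rewrite mxE -tnth_nth.
  by move=> /(_ c0) /rowP /(_ i); rewrite !mxE.
exists s, A; split=> //; last first.
  apply: (@well_generic_span _ _ _ _ _ (\matrix_(i, l) (tnth X i) 0 (s (inl l)))) => // i.
  by rewrite {1}(defect0_expand sb (dX i)); apply: eq_bigr => l _; rewrite mxE.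
apply/eqP; rewrite eqEdim (eqP (dim_graph A sb)) (eqP fX) size_tuple leqnn andbT.
apply/span_subvP => v /tnthP[i ->]; by rewrite graph_span // dX.
Qed.

Lemma graph_tuple_free (s : 'I_d + 'I_r -> 'I_k) (A : 'M[R]_(d, r)) (u : 'rV[R]_d) : bijective s ->
  \sum_i u 0 i *: tnth (graph_tuple s A) i = 0 -> u = 0.
Proof.
move=> sb u0; have [f _] := graph_combination A sb (fun i => u 0 i).
apply/rowP => i; move/rowP: f => /(_ i); rewrite u0 !mxE => <-.
by [].
Qed.

(** Take for [J] the complement of [d] columns that carry an invertible minor of the matrix of
    [X]. *)
Lemma chart_exists (X : d.-tuple 'rV[R]_k) :
  (forall u : 'rV[R]_d, \sum_i u 0 i *: tnth X i = 0 -> u = 0) ->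
  exists (s : 'I_d + 'I_r -> 'I_k) (A : 'M[R]_(d, r)),
    bijective s /\ <<X>>%VS = <<graph_tuple s A>>%VS.
Proof.
move=> Xfree; pose Xm : 'M[R]_(d, k) := \matrix_i tnth X i.
have XmE u : u *m Xm = \sum_i u 0 i *: tnth X i.
  by rewrite mulmx_sum_row; apply: eq_bigr => i _; rewrite rowK.
have Xm_free : row_free Xm.
  rewrite -kermx_eq0; apply/rowV0P => u /sub_kermxP; rewrite XmE; exact: Xfree.
have XT : row_full Xm^T by rewrite /row_full mxrank_tr; exact: Xm_free.
pose f := fullrankfun XT; have fu : rowsub f Xm^T \in unitmx by exact: fullrowsub_unit.
pose J := ~: [set f i | i : 'I_d]%SET.
have cJ : #|J| = r.
  by rewrite cardsCs finset.setCK card_imset ?card_ord //; exact: fullrankfun_inj.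
have [|s [A [sb _ _ VE _]]] := change_chart Xfree cJ; last by exists s, A.
move=> v /coord_span ev v0.
have vE : v = (\row_i coord X i v) *m Xm.
  by rewrite {1}ev XmE; apply: eq_bigr => i _; rewrite mxE -tnth_nth.
have c0 : \row_i coord X i v = 0; last by rewrite vE c0 mul0mx.
apply: (can_inj (mulmxK (_ : (rowsub f Xm^T)^T \in unitmx))); first by rewrite unitmx_tr.
rewrite mul0mx; apply/rowP => i; rewrite [RHS]mxE -(v0 (f i)); last first.
  by rewrite inE negbK; apply/imsetP; exists i.
by rewrite {2}vE !mxE; apply: eq_bigr => l _; rewrite !mxE.
Qed.

End Charts.

(** * Reduction of an interval modulo 1 *)

Section UnitReduction.
Variables (R : realType) (I : R -> Prop) (a b : R).
Hypothesis ab : a < b.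
Hypothesis I_convex : forall x y z, I x -> I z -> x <= y <= z -> I y.
Hypothesis I_in : forall t, a < t < b -> I t.
Hypothesis I_out : forall t, I t -> a <= t <= b.

(** The part of [I] not covered by its translate [I + 1]: again an interval, of length at most 1,
    with exactly one point in each class modulo 1 that [I] meets. *)
Definition reduced t := I t /\ ~ I (t - 1).

Lemma reduced_convex x y z : reduced x -> reduced z -> x <= y <= z -> reduced y.
Proof.
move=> [Ix _] [Iz nIz] /andP[xy yz]; split; first by apply: I_convex Ix Iz _; rewrite xy.
move=> Iy; apply: nIz; have [h|h] := leP (z - 1) y.
  by apply: (I_convex Iy Iz _); apply/andP; split; lra.
by apply: (I_convex Ix Iz _); apply/andP; split; lra.
Qed.

Lemma reduced_in t : a < t < Num.min b (a + 1) -> reduced t.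
Proof.
rewrite lt_min => /and3P[h1 h2 h3]; split; first by apply: I_in; rewrite h1.
by move=> /I_out /andP[h4 _]; lra.
Qed.

Lemma reduced_out t : reduced t -> a <= t <= Num.min b (a + 1).
Proof.
move=> [It nI]; have /andP[h1 h2] := I_out It; rewrite le_min h1 h2 /= leNgt.
by apply/negP => h; apply: nI; apply: I_in; apply/andP; split; lra.
Qed.

(** The representative in [[a, a + 1)] serves unless it is [a] and [a] is missing from [I]; then
    [a + 1] does. *)
Lemma reduced_ex t : I t -> exists n : int, reduced (t - n%:~R).
Proof.
move=> It; have /andP[at_ tb] := I_out It.
have := floor_itv (t - a); set n := Num.floor _; rewrite rmorphD /= => /andP[h1 h2].
have [Iu|nIu] := pselect (I (t - n%:~R)).
  by exists n; split=> // /I_out /andP[h3 _]; lra.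
have n0 : n != 0 by apply/eqP => e; apply: nIu; rewrite e subr0.
have n1 : (1 : R) <= n%:~R.
  have : (0 <= n)%R by rewrite /n floor_ge0 subr_ge0.
  by rewrite -[1]/((1%:Z)%:~R) ler_int; lia.
have ua : t - n%:~R = a.
  apply/eqP; rewrite eq_le; apply/andP; split; last by lra.
  by rewrite leNgt; apply/negP => h; apply: nIu; apply: I_in; apply/andP; split; lra.
exists (n - 1); rewrite rmorphB /=; have -> : t - (n%:~R - 1) = a + 1 by lra.
split; last by rewrite addrK -ua.
have [h|h] := ltP (a + 1) t; first by apply: I_in; apply/andP; split; lra.
by have -> : a + 1 = t by lra.
Qed.

Lemma reduced_unique t (n : int) : reduced t -> reduced (t + n%:~R) -> n = 0.
Proof.
move=> [It nI] [It' nI']; have [n0|n0|//] := ltgtP n 0.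
- have h : n%:~R <= - (1 : R) by rewrite -[1]/((1%:Z)%:~R) -rmorphN ler_int; lia.
  by case: nI; apply: (I_convex It' It _); apply/andP; split; lra.
- have h : (1 : R) <= n%:~R by rewrite -[1]/((1%:Z)%:~R) ler_int; lia.
  by case: nI'; apply: (I_convex It It' _); apply/andP; split; lra.
Qed.

End UnitReduction.

Section LinearSections.
Variables (R : realType) (k : nat).

Lemma section_cap (V L : {vspace 'rV[R]_k}) p B : linear_section V p L B -> (V :&: L = 0)%VS.
Proof.
move=> [dL VL _ _]; apply/eqP; rewrite -dimv_eq0; have := dimv_sum_cap V L.
have -> : \dim (V + L)%VS = k by rewrite VL dimvf dim_matrix; lia.
rewrite dL; have : (\dim V <= k)%N by have := dimvS (subvf V); rewrite dimvf dim_matrix; lia.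
by move=> h1 h2; apply/eqP; lia.
Qed.

Lemma bounded_coordinates (B : set 'rV[R]_k) : bounded_set B ->
  exists M : R, 0 <= M /\ forall b, B b -> forall j, `|b 0 j| <= M.
Proof.
move=> [M0 [_ hM]]; exists (`|M0| + 1); split; first by rewrite addr_ge0.
move=> b Bb j; apply: le_trans (row_coord_le b j) _; apply: (hM (`|M0| + 1)) => //.
by apply: le_lt_trans (ler_norm M0) _; rewrite ltrDl.
Qed.

End LinearSections.

Section BoxSections.
Variables (R : realType) (d k : nat) (d1 : (1 < d)%N) (dk : (d < k)%N).
Local Notation r := (k - d)%N.

Theorem box_section_net (s0 : 'I_d + 'I_r -> 'I_k) (A0 : 'M[R]_(d, r)) :
  bijective s0 -> well_generic (graph_tuple s0 A0) ->
  forall (x : torus R k) (p : 'rV[R]_k) (L : {vspace 'rV[R]_k}) (B : set 'rV[R]_k),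
    linear_section <<graph_tuple s0 A0>>%VS p L B -> coordinate_box r B ->
  forall phi : 'Hom('rV[R]_d, 'rV[R]_k), limg phi = <<graph_tuple s0 A0>>%VS ->
    let Y := phi @^-1` visit_set <<graph_tuple s0 A0>>%VS (@torus_proj R k @` B) x in
    separated_net Y /\ BD_to_lattice Y.
Proof.
move=> s0b wg x p L B lin [J [I [q [cJ nd BE]]]] phi hphi Y.
have d0 : (0 < d)%N by apply: ltnW.
have boxE (t : 'I_k -> R) i : (q + \sum_(j in J) t j *: delta_mx 0 j : 'rV[R]_k) 0 i =
    q 0 i + (if i \in J then t i else 0).
  rewrite !mxE summxE; congr (_ + _); rewrite big_mkcond (bigD1 i) //= big1 ?addr0.
    by case: ifP => // _; rewrite !mxE !eqxx mulr1.
  by move=> j /negbTE ji; case: ifP => // _; rewrite !mxE eq_sym ji andbF mulr0.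
have {nd} /choice[ea /choice[eb hI]] : forall i, exists a b, i \in J ->
    [/\ a < b, forall t u w, t \in I i -> w \in I i -> t <= u <= w -> u \in I i,
        forall t, a < t < b -> t \in I i & forall t, t \in I i -> a <= t <= b].
  move=> i; have [iJ|nJ] := boolP (i \in J); last by exists 0, 0.
  have [a [b [ba [bb [ab ->]]]]] := nd i iJ; exists a, b => _; split=> //.
  - move=> t u w; rewrite !in_itv /=; case: ba; case: bb => /= /andP[? ?] /andP[? ?] /andP[? ?]; apply/andP; split; lra.
  - move=> t; rewrite !in_itv /=; case: ba; case: bb => /= /andP[? ?]; apply/andP; split; lra.
  - move=> t; rewrite !in_itv /=; case: ba; case: bb => /= /andP[? ?]; apply/andP; split; lra.
(* Two points of the box differing only in coordinate [j] show that [e_j] is a direction of [L].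
   Transversality of [L] then provides the chart in which the coordinates in [J] are the dependent
   ones. *)
have dirL j : j \in J -> delta_mx 0 j \in L.
  move=> jJ; pose t (c : R) (i : 'I_k) := if i == j then c else (ea i + eb i) / 2.
  have tB c : ea j < c < eb j -> B (q + \sum_(i in J) t c i *: delta_mx 0 i).
    move=> hc; rewrite BE; exists (t c) => // i iJ; have [h1 h2 h3 h4] := hI i iJ.
    rewrite /t; case: ifP => [/eqP ->|_]; first by have [_ _ h _] := hI j jJ; exact: h.
    by apply: h3; apply/andP; split; lra.
  have [h1 _ _ _] := hI j jJ; have [_ _ BL _] := lin.
  pose c1 := (ea j + eb j) / 2; pose c2 := (ea j + 3 * eb j) / 4.
  have [|u1 L1 e1] := BL _ (tB c1 _); first by rewrite /c1; apply/andP; split; lra.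
  have [|u2 L2 e2] := BL _ (tB c2 _); first by rewrite /c2; apply/andP; split; lra.
  have e : u2 - u1 = (c2 - c1) *: delta_mx 0 j.
    have -> : u2 - u1 = (p + u2) - (p + u1) by rewrite opprD addrACA subrr add0r.
    rewrite e1 e2 opprD addrACA subrr add0r -sumrB (bigD1 j) //= big1 ?addr0.
      by rewrite /t eqxx scalerBl.
    by move=> i /andP[_ /negbTE ij]; rewrite /t ij subrr.
  have c12 : c2 - c1 != 0 by apply/eqP; rewrite /c1 /c2; lra.
  have : (c2 - c1) *: delta_mx 0 j \in L by rewrite -e memvB.
  by move=> /(memvZ (c2 - c1)^-1); rewrite scalerA mulVf // scale1r.
have transv v : v \in <<graph_tuple s0 A0>>%VS -> (forall i, i \notin J -> v 0 i = 0) -> v = 0.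
  move=> vV v0; have : v \in (<<graph_tuple s0 A0>> :&: L)%VS.
    rewrite memv_cap vV /= [v]row_sum_delta; apply: memv_suml => j _.
    by have [jJ|/v0 ->] := boolP (j \in J); [apply/memvZ/dirL|rewrite scale0r mem0v].
  by rewrite (section_cap lin) memv0 => /eqP.
have [s [A [sb sl sr VE wgA]]] := change_chart d0 dk (fun u => @graph_tuple_free _ _ _ s0 A0 u s0b) cJ transv.
have dio : diophantine A by apply: (well_generic_diophantine sb) => //; exact: wgA.
have BP b : B b <-> (forall i, b 0 (s (inl i)) = q 0 (s (inl i))) /\
    (forall j, b 0 (s (inr j)) - q 0 (s (inr j)) \in I (s (inr j))).
  rewrite BE; split=> [[t ht <-]|[hl hr]].
    split=> i; rewrite boxE; first by rewrite (negbTE (sl i)) addr0.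
    by rewrite sr addrAC subrr add0r; exact: ht.
  exists (fun i => b 0 i - q 0 i).
    by apply: (index_cases sb) => [i|j _]; [rewrite (negbTE (sl i))|exact: hr].
  apply/rowP; apply: (index_cases sb) => i; rewrite boxE.
    by rewrite (negbTE (sl i)) addr0 hl.
  by rewrite sr subrKC.
pose Q j t := reduced (fun t => t \in I (s (inr j))) t.
pose B' : set 'rV[R]_k := [set b : 'rV[R]_k | (forall i, b 0 (s (inl i)) = q 0 (s (inl i))) /\
    (forall j, Q j (b 0 (s (inr j)) - q 0 (s (inr j))))].
have B'B : B' `<=` B by move=> b [h1 h2]; apply/BP; split=> // j; have [] := h2 j.
have projE : @torus_proj R k @` B = @torus_proj R k @` B'.
  apply/seteqP; split=> [_ [b /BP[hl hr] <-]|_ [b /B'B Bb <-]]; last by exists b.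
  have /choice[n hn] : forall j, exists n : int, Q j (b 0 (s (inr j)) - q 0 (s (inr j)) - n%:~R).
    move=> j; have [h1 h2 h3 h4] := hI _ (sr j).
  by apply: (reduced_ex (a := ea (s (inr j))) (b := eb (s (inr j)))) => //; exact: hr.
  have [z [zf zb]] := parts_surj (T := int) sb (0 : 'rV[int]_d) (\row_j n j).
  exists (b - real_of R z); last first.
    apply/torus_projP/integer_translateP; exists (- z); congr (_ + _).
    by apply/rowP => i; rewrite !mxE rmorphN.
  split=> i.
    move/rowP: zf => /(_ i); rewrite !mxE => ->; by rewrite subr0.
  move/rowP: zb => /(_ i); rewrite !mxE => ->.
  by have := hn i; rewrite addrAC.
have [M [M0 BM]] : exists M : R, 0 <= M /\ forall b, B b -> forall j, `|b 0 j| <= M.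
  by apply: bounded_coordinates; have [] := lin.
pose ga := defect s A q.
have defB' b : B' b -> forall j, defect s A b 0 j = b 0 (s (inr j)) - q 0 (s (inr j)) + ga 0 j.
  move=> [hl _] j; have e : free_part s b = free_part s q by apply/rowP => i; rewrite !mxE hl.
  by rewrite /ga /defect e; set w := _ *m _; rewrite !mxE; ring.
have EE : defect s A @` B' = product_set (fun j t => Q j (t - ga 0 j)).
  apply/seteqP; split=> [_ [b Bb <-] j|y hy].
    by rewrite defB' // addrK; have [_] := Bb; apply.
  have [b [bf bb]] := parts_surj (T := R) sb (free_part s q) (\row_j (y 0 j - ga 0 j + q 0 (s (inr j)))).
  have bj i : b 0 (s (inr i)) = y 0 i - ga 0 i + q 0 (s (inr i)).
    by have := congr1 (fun w : 'rV[R]_r => w 0 i) bb; rewrite mxE [RHS]mxE.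
  have Bb : B' b.
    split=> i; first by move/rowP: bf => /(_ i); rewrite !mxE.
    by rewrite bj addrK; exact: hy.
  by exists b => //; apply/rowP => j; rewrite (defB' _ Bb) bj; ring.
pose a : 'rV[R]_r := \row_j (ga 0 j + ea (s (inr j))).
pose b : 'rV[R]_r := \row_j (ga 0 j + Num.min (eb (s (inr j))) (ea (s (inr j)) + 1)).
have ab j : a 0 j < b 0 j.
  have [h _ _ _] := hI _ (sr j); rewrite !mxE ltrD2l lt_min h /=; lra.
have Qin j t : a 0 j < t < b 0 j -> Q j (t - ga 0 j).
  have [h1 h2 h3 h4] := hI _ (sr j); rewrite !mxE => /andP[h5 h6].
  by apply: (reduced_in h3 h4); apply/andP; split; lra.
rewrite /Y projE; apply: (@return_times_conclusion R d k d0 dk s A sb _ VE phi hphi B' M M0 _ _ x _ 4 (2 ^- 5)) => //.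
- by move=> c /B'B; exact: BM.
- move=> b1 b2 b3 b4 h1 h2 h3 h4 e; apply: (row_parts sb).
    apply/rowP => i; rewrite !mxE; case: h1 h2 h3 h4 => -> _ [-> _] [-> _] [-> _]; by rewrite !subrr.
  move/rowP: e => e; apply/rowP => j; have := e j; rewrite !defectB.
  have ent (u v : 'rV[R]_r) : (u - v) 0 j = u 0 j - v 0 j by rewrite !mxE.
  rewrite (ent (defect s A b1)) (ent (defect s A b3)) (defB' _ h1) (defB' _ h2) (defB' _ h3) (defB' _ h4) !mxE; lra.
- move=> c c' [cl cr] [cl' cr'] /integer_translateP[z ce]; apply: (row_parts sb).
    by apply/rowP => i; rewrite !mxE cl cl'.
  apply/rowP => j; rewrite !mxE; have [h1 h2 h3 h4] := hI _ (sr j).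
  have := cr j; rewrite ce !mxE addrAC => g.
  by rewrite (reduced_unique h1 h2 (cr' j) g) addr0.
- by apply/andP; split; [rewrite invr_ge0 exprn_ge0|rewrite invf_lt1 ?exprn_gt0 // exprn_egt1 // ltr1n].
- by rewrite mulrC ltr_pdivrMr ?exprn_gt0 // mul1r natrX ltr_eXn2l // ltr1n.
- have [rho [rho0 hrho]] := @positive_lower_bound R _ (enum 'I_r) (fun j => (b 0 j - a 0 j) / 2)
    (fun j => divr_gt0 (etrans (subr_gt0 _ _) (ab j)) (ltr0Sn _ _)).
  exists (\row_j ((a 0 j + b 0 j) / 2)), rho; split=> // e he.
  rewrite EE => j; apply: Qin; have := he j; rewrite [(\row__ _) 0 j]mxE ltr_norml => /andP[h1 h2].
  have := hrho j (mem_enum _ _) => h3; apply/andP; split; lra.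
rewrite EE; apply: (discrepancy_box (a := a) (b := b)) => // [j|j t u w|j t].
- exact/ltW.
- move=> Qt Qw /andP[h5 h6]; have [h1 h2 h3 h4] := hI _ (sr j).
  by apply: (reduced_convex h2 Qt Qw); apply/andP; split; lra.
- have [h1 h2 h3 h4] := hI _ (sr j) => /(reduced_out h3 h4) /andP[h5 h6].
  by rewrite [a 0 j]mxE [b 0 j]mxE; apply/andP; split; lra.
Qed.

End BoxSections.

(** * Minkowski dimension of the boundary *)

(** Modulo [D] the lowest digit vanishes, then the next. This supplies an additive function on [Z^k]
    whose only zero in a bounded window is 0. *)
Lemma radix_eq0 (n : nat) (z : 'I_n -> int) (D : nat) : (forall i, (absz (z i) < D)%N) ->
  \sum_i z i * D%:Z ^+ i = 0 -> forall i, z i = 0.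
Proof.
elim: n z => [|n IH] z hz; first by move=> _ [].
rewrite big_ord_recl expr0 mulr1 => e.
have e2 : \sum_(i < n) z (lift ord0 i) * D%:Z ^+ (lift ord0 i) =
    D%:Z * \sum_(i < n) z (lift ord0 i) * D%:Z ^+ i.
  by rewrite mulr_sumr; apply: eq_bigr => i _; rewrite /= /bump leq0n add1n exprS mulrCA.
move: e; rewrite e2; set S := \sum_(i < n) _ => e.
have z0 := hz ord0; have S0 : S = 0.
  have [//|S0] := eqVneq S 0.
  have : (D <= absz (D%:Z * S)%R)%N by rewrite abszM leq_pmulr // absz_gt0.
  have : absz (D%:Z * S)%R = absz (z ord0) by lia.
  by move=> ->; lia.
have h := IH (fun i => z (lift ord0 i)) (fun i => hz _) S0.
move=> i; have [->|i0] := eqVneq i ord0; first by move: e; rewrite S0; lia.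
by have [j -> _] : {j | i = lift ord0 j & unlift ord0 i = Some j}; [apply: unlift_some; rewrite eq_sym|exact: h].
Qed.

Section Lift.
Variables (R : realType) (d k : nat) (dk : (d < k)%N).
Local Notation r := (k - d)%N.
Variables (s : 'I_d + 'I_r -> 'I_k) (A : 'M[R]_(d, r)) (s_bij : bijective s).
Variables (V L : {vspace 'rV[R]_k}) (hV : V = <<graph_tuple s A>>%VS).
Hypotheses (VL : (V + L)%VS = fullv) (capVL : (V :&: L = 0)%VS).

Lemma defectZ (c : R) x : defect s A (c *: x) = c *: defect s A x.
Proof. by apply/rowP => j; rewrite /defect !mxE mulrBr mulr_sumr; congr (_ - _); apply: eq_bigr => i _; rewrite !mxE mulrA. Qed.

Lemma defect0 : defect s A 0 = 0.
Proof. by rewrite -(scale0r 0) defectZ scale0r. Qed.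

(** As [L] is complementary to [V], the projection along [V] maps it isomorphically onto [R^r]; [U]
    is the inverse. *)
Lemma defect_lift : exists U : 'M[R]_(r, k),
  [/\ forall e, e *m U \in L, forall e, defect s A (e *m U) = e &
      forall u, u \in L -> u = defect s A u *m U].
Proof.
have /choice[u hu] : forall j : 'I_r, exists u, u \in L /\ defect s A u = delta_mx 0 j.
  move=> j; have [x [xf xb]] := parts_surj (T := R) s_bij 0 (delta_mx 0 j).
  have /memv_addP[v vV [w wL xE]] : x \in (V + L)%VS by rewrite VL memvf.
  exists w; split=> //; have -> : w = x - v by rewrite xE addrC addKr.
  rewrite defectB {1}/defect xf xb mul0mx subr0; move: vV; rewrite hV graph_span // => /eqP ->.
  by rewrite subr0.
pose U : 'M[R]_(r, k) := \matrix_j u j.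
have UE e : e *m U = \sum_j e 0 j *: u j.
  by rewrite mulmx_sum_row; apply: eq_bigr => j _; rewrite rowK.
have UL e : e *m U \in L by rewrite UE; apply: memv_suml => j _; apply: memvZ; exact: (hu j).1.
have Ud e : defect s A (e *m U) = e.
  rewrite UE (big_morph (defect s A) (@defectD _ _ _ s A) defect0) [RHS]row_sum_delta.
  by apply: eq_bigr => j _; rewrite defectZ (hu j).2.
exists U; split=> // w wL; apply/eqP; rewrite -subr_eq0 -memv0 -capVL memv_cap.
by rewrite hV graph_span // defectB Ud subrr eqxx /= memvB.
Qed.

End Lift.

Section Boundary.
Variables (R : realType) (k : nat) (p : 'rV[R]_k) (L : {vspace 'rV[R]_k}) (B : set 'rV[R]_k).
Hypotheses (BP : B `<=` plane p L) (Bo : open_in (plane p L) B).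

Lemma planeP u : plane p L (p + u) <-> u \in L.
Proof. by split=> [[v vL /addrI <-] //|uL]; exists u. Qed.

Lemma plane_translate x u : plane p L x -> u \in L -> plane p L (x + u).
Proof. by move=> [v vL <-] uL; exists (v + u); rewrite ?addrA //= memvD. Qed.

Lemma open_in_ball b : B b -> exists e : R, 0 < e /\
  forall y, plane p L y -> `|b - y| < e -> B y.
Proof.
move=> Bb; have [W Wo OE] := (open_subspaceP _ _).1 Bo.
have Ob : W b.
  have : (B `&` plane p L) b by split=> //; exact: BP.
  by rewrite -OE => -[].
have := open_nbhs_nbhs (conj Wo Ob); rewrite -nbhs_ballE => -[e e0 he].
exists e; split=> // y Py yb; have : (W `&` plane p L) y.
  by split=> //; apply: he; rewrite -ball_normE.
by rewrite OE => -[].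
Qed.

(** At the supremum of the parameters whose point is in [B], openness of [B] keeps the point out of
    [B], while adherence puts it in the closure. *)
Lemma segment_boundary (q w : 'rV[R]_k) : plane p L q -> w \in L -> B q -> ~ B (q + w) ->
  exists t : R, 0 <= t <= 1 /\ boundary_in (plane p L) B (q + t *: w).
Proof.
move=> Pq wL Bq nBw.
have Pg t : plane p L (q + t *: w) by apply: plane_translate => //; exact: memvZ.
pose S : set R := [set t | 0 <= t <= 1 /\ B (q + t *: w)].
have S0 : S 0 by split; [rewrite lexx ler01|rewrite scale0r addr0].
have hS : has_sup S by split; [exists 0|exists 1 => t [/andP[]]].
pose tau := sup S.
have tau0 : 0 <= tau by apply: sup_upper_bound.
have tau1 : tau <= 1 by apply: sup_le_ub; [exists 0|move=> t [/andP[]]].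
have W0 : 0 < `|w| + 1 by rewrite ltr_wpDl.
have dist t t' : `|q + t *: w - (q + t' *: w)| <= `|t - t'| * (`|w| + 1).
  rewrite opprD addrACA subrr add0r -scalerBl normrZ; apply: ler_wpM2l => //.
  by rewrite lerDl.
have nBt : ~ B (q + tau *: w).
  move=> Bt; have [e [e0 he]] := open_in_ball Bt.
  have tau1' : tau < 1.
    rewrite lt_neqAle tau1 andbT; apply/eqP => t1; apply: nBw; move: Bt; by rewrite t1 scale1r.
  pose dt := Num.min (1 - tau) (e / 2 / (`|w| + 1)).
  have dt0 : 0 < dt by rewrite lt_min subr_gt0 tau1' /= !divr_gt0.
  have dt1 : dt <= 1 - tau by rewrite ge_min lexx.
  have dte : dt * (`|w| + 1) <= e / 2 by rewrite -ler_pdivlMr // ge_min lexx orbT.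
  have : S (tau + dt).
    split; first by apply/andP; split; lra.
    apply: he => //; apply: le_lt_trans (dist _ _) _; rewrite opprD addNKr normrN gtr0_norm //.
    by lra.
  by move/(sup_upper_bound hS); rewrite -/tau; lra.
exists tau; split; first by rewrite tau0.
split; last by move/interior_subset.
move=> N hN; have [W] := (@nbhs_subspace_ex 'rV[R]_k (plane p L) N _ (Pg tau)).1 hN.
rewrite -nbhs_ballE => -[e e0 he] NO.
have [t [t01 Bt] tt] := @sup_adherent _ S (e / (`|w| + 1)) (divr_gt0 e0 W0) hS.
exists (q + t *: w); split=> //; suff : (W `&` plane p L) (q + t *: w) by rewrite -NO => -[].
split=> //; apply: he; rewrite -ball_normE /ball_ /=.
apply: le_lt_trans (dist _ _) _; rewrite -ltr_pdivlMr //.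
have : t <= tau by apply: sup_upper_bound => //; split.
by move: tt; rewrite -/tau => h1 h2; rewrite ger0_norm; lra.
Qed.

End Boundary.

Section Minkowski.
Variables (R : realType) (k : nat).

Lemma minkowski_dim_set0 : minkowski_dim (set0 : set 'rV[R]_k) = -oo%E.
Proof.
apply/eqP; rewrite -leeNy_eq /minkowski_dim /limf_esup.
pose f (t : R) := (lne (covering_number (set0 : set 'rV[R]_k) t) * ((- ln t)^-1)%:E)%E.
apply: (@le_trans _ _ (ereal_sup (f @` [set t : R | 0 < t < 1]))).
  apply: ereal_inf_lbound; exists [set t : R | 0 < t < 1] => //.
  by near=> t; apply/andP; split; near: t; [exact: nbhs_right_gt|exact: nbhs_right_lt].
apply: ge_ereal_sup => _ [t /andP[t0 t1] <-]; rewrite /f.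
have -> : covering_number (set0 : set 'rV[R]_k) t = 0%E.
  apply/eqP; rewrite eq_le; apply/andP; split.
    by apply: ereal_inf_lbound; exists 0%N => //; exists (fun=> 0) => y.
  by apply: le_ereal_inf_tmp => _ [n _ <-]; rewrite lee_fin.
rewrite /lne /= lexx gt0_mulNye // lte_fin invr_gt0 oppr_gt0.
by apply: ln_lt0; rewrite t0 t1.
Unshelve. all: by end_near.
Qed.

Lemma minkowski_cover (S : set 'rV[R]_k) (D ep : R) : minkowski_dim S = D%:E -> 0 < ep ->
  exists e : R, 0 < e /\ forall t : R, 0 < t < e -> exists (n : nat) (c : 'I_n -> 'rV[R]_k),
     n%:R <= 2 * expR ((D + ep) * - ln t) /\ S `<=` \bigcup_i ball (c i) t.
Proof.
move=> hD ep0; pose f (t : R) := (lne (covering_number S t) * ((- ln t)^-1)%:E)%E.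
have : (ereal_inf [set ereal_sup (f @` A) | A in 0^'+] < (D + ep)%:E)%E.
  have : minkowski_dim S = D%:E by []. rewrite /minkowski_dim /limf_esup -/f => ->.
  by rewrite lte_fin ltrDl.
move=> /ereal_inf_lt[_ [N hN <-] hlt].
have [e e0 he] : exists2 e : R, 0 < e & forall t, 0 < t < e -> N t.
  move: hN; rewrite /at_right /within /= -nbhs_ballE => -[e e0 he]; exists e => // t /andP[t0 te].
  by apply: he => //; rewrite /ball /= sub0r normrN gtr0_norm.
exists (Num.min e 1); split; first by rewrite lt_min e0 ltr01.
move=> t; rewrite lt_min => /and3P[t0 te t1].
have lt0 : 0 < - ln t by rewrite oppr_gt0; apply: ln_lt0; rewrite t0.
have ft : (f t < (D + ep)%:E)%E.
  by apply: le_lt_trans hlt; apply: ereal_sup_ubound; exists t => //; apply: he; rewrite t0.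
have : (covering_number S t < (2 * expR ((D + ep) * - ln t))%:E)%E.
  have ex : (lne (covering_number S t) < ((D + ep) * - ln t)%:E)%E.
    by rewrite EFinM -lte_pdivrMr // muleC.
  have cov0 : (0 <= covering_number S t)%E by apply: le_ereal_inf_tmp => _ [n _ <-]; rewrite lee_fin.
  move: ex cov0; case: (covering_number S t) => [c| |] //= ex; rewrite lee_fin => c0.
  rewrite lte_fin; have [c00|cpos] := eqVneq c 0; first by rewrite c00 mulr_gt0 // expR_gt0.
  have c1 : 0 < c by rewrite lt_neqAle eq_sym cpos.
  move: ex; rewrite /lne leNgt c1 /= lte_fin -ltr_expR lnK ?posrE // => h.
  have := expR_gt0 ((D + ep) * - ln t); lra.
by move=> /ereal_inf_lt[_ [n [c hc] <-]]; rewrite lte_fin => /ltW h; exists n, c.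
Qed.

End Minkowski.

Section SmallBoundary.
Variables (R : realType) (d k : nat) (dk : (d < k)%N).
Local Notation r := (k - d)%N.

Lemma small_power (e : R) : 0 < e -> exists n : nat, forall i, (n <= i)%N -> 2 ^- i < e.
Proof.
move=> e0; exists (Num.trunc e^-1).+1 => i ni.
rewrite invf_plt ?posrE ?exprn_gt0 //; apply: lt_trans (truncnS_gt _) _.
by rewrite -natrX ltr_nat; apply: leq_ltn_trans ni (ltn_expl _ _).
Qed.

(** [B] is thinned to [B'], which keeps from each class modulo integer vectors the point extremal
    for an additive function [f]. Between nearby points inside and outside of [B'] one crosses the
    boundary of [B] or of one of its finitely many translates by window vectors, so covers of the
    boundary of [B] also serve for [B']. *)
Theorem small_boundary_net (s : 'I_d + 'I_r -> 'I_k) (A : 'M[R]_(d, r)) :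
  bijective s -> well_generic (graph_tuple s A) -> (k + 1 < 2 * d)%N ->
  forall (x : torus R k) (p : 'rV[R]_k) (L : {vspace 'rV[R]_k}) (B : set 'rV[R]_k),
    linear_section <<graph_tuple s A>>%VS p L B -> open_in (plane p L) B ->
    minkowski_dim (boundary_in (plane p L) B) = (k - d - 1)%:R%:E ->
  forall phi : 'Hom('rV[R]_d, 'rV[R]_k), limg phi = <<graph_tuple s A>>%VS ->
    let Y := phi @^-1` visit_set <<graph_tuple s A>>%VS (@torus_proj R k @` B) x in
    separated_net Y /\ BD_to_lattice Y.
Proof.
move=> sb wg kd x p L B lin Bo dimB phi hphi Y.
have d0 : (0 < d)%N by clear - kd dk; lia.
have r0 : (0 < r)%N by rewrite subn_gt0.
have rd : (r + 2 <= d)%N by clear - kd dk; lia.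
have dio : diophantine A by apply: (well_generic_diophantine sb).
have cap := section_cap lin; have [dL VL BP Bbd] := lin.
have [U [UL Ud Uu]] := defect_lift sb erefl VL cap.
have [M [M0 BM]] := bounded_coordinates Bbd.
(* An empty section would have empty boundary, of dimension [-oo]. *)
have [b0 Bb0] : exists b, B b.
  apply: contrapT => no; have B0 : B = set0 by rewrite -subset0 => b Bb; apply: no; exists b.
  by move: dimB; rewrite /boundary_in B0 closure0 set0D minkowski_dim_set0.
have Bdir b b' : B b -> B b' -> b - b' \in L.
  move=> /BP[u uL <-] /BP[u' uL' <-]; by rewrite opprD addrACA subrr add0r memvB.
pose N := (Num.trunc (2 * M)).+1.
have MN : 2 * M <= N%:R by apply/ltW/truncnS_gt.
(* Integer vectors joining points of [B] have entries at most [N]. Read in base [N + 1], they vanish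
   under [f] only if they are 0, so [f] orders the points of each class. *)
pose f (z : 'rV[int]_k) : int := \sum_i z 0 i * (N.+1)%:Z ^+ i.
have fD (z z' : 'rV[int]_k) : f (z + z') = f z + f z'.
  by rewrite /f -big_split /=; apply: eq_bigr => i _; rewrite mxE mulrDl.
have fN (z : 'rV[int]_k) : f (- z) = - f z.
  by rewrite /f -sumrN; apply: eq_bigr => i _; rewrite mxE mulNr.
have real_ofN (z : 'rV[int]_k) : real_of R (- z) = - real_of R z by apply/rowP => j; rewrite !mxE rmorphN.
have bnd b b' (z : 'rV[int]_k) : B b -> B b' -> b = b' + real_of R z -> forall i, (absz (z 0%R i) <= N)%N.
  move=> Bb Bb' e i; have := BM _ Bb i; have := BM _ Bb' i; rewrite e.
  have -> : (b' + real_of R z) 0 i = b' 0 i + (z 0 i)%:~R by rewrite !mxE.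
  move=> h1 h2; have : `|(z 0 i)%:~R : R| <= N%:R.
    apply: le_trans MN; move: h1 h2; move: (b' 0 i) ((z 0 i)%:~R : R) => u v.
    by rewrite !ler_norml => /andP[? ?] /andP[? ?]; apply/andP; split; lra.
  by rewrite -intr_norm -abszE ler_nat.
pose Kf : int := \sum_(i < k) N%:Z * (N.+1)%:Z ^+ i.
have fK (z : 'rV[int]_k) : (forall i, (absz (z 0%R i) <= N)%N) -> - Kf <= f z <= Kf.
  move=> hz; rewrite -ler_norml; apply: le_trans (ler_norm_sum _ _ _) _; apply: ler_sum => i _.
  rewrite normrM [X in _ * X]ger0_norm ?exprn_ge0 // ler_wpM2r ?exprn_ge0 //.
  by rewrite -abszE lez_nat.
have f0 (z : 'rV[int]_k) : (forall i, (absz (z 0%R i) <= N)%N) -> f z = 0 -> z = 0.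
  move=> hz; have hz' i : (absz (z 0%R i) < N.+1)%N by rewrite ltnS.
  by move=> /(radix_eq0 (z := fun i => z 0 i) hz') h; apply/rowP => i; rewrite mxE h.
have fz0 : f 0 = 0 by rewrite /f big1 // => i _; rewrite mxE mul0r.
have Kf0 : 0 <= Kf by apply: sumr_ge0 => i _; rewrite mulr_ge0 // exprn_ge0.
have rz0 : real_of R (0 : 'rV[int]_k) = 0 by apply/rowP => j; rewrite !mxE.
pose pos (z : 'rV[int]_k) := real_of R z \in L /\ 0 < f z.
pose B' : set 'rV[R]_k := [set b : 'rV[R]_k | B b /\ forall z, pos z -> ~ B (b - real_of R z)].
have projE : @torus_proj R k @` B = @torus_proj R k @` B'.
  apply/seteqP; split=> [_ [b Bb <-]|_ [b [Bb _] <-]]; last by exists b.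
  pose P n := `[< exists z, B (b - real_of R z) /\ f z + Kf = n%:Z >].
  have zb z : B (b - real_of R z) -> forall i, (absz (z 0%R i) <= N)%N.
    by move=> h; apply: (bnd b _ z Bb h); rewrite subrK.
  have exP : exists n, P n.
    exists (absz Kf); apply/asboolP; exists 0; split; first by rewrite rz0 subr0.
    by rewrite fz0 add0r gez0_abs.
  have ubP n : P n -> (n <= absz (2 * Kf)%R)%N.
    move/asboolP => [z [/zb/fK/andP[h1 h2] e]]; lia.
  case: (ex_maxnP exP ubP) => n /asboolP[z [Bz ez]] hmax.
  exists (b - real_of R z); last first.
    by apply/torus_projP/integer_translateP; exists (- z); rewrite real_ofN.
  split=> // z' [_ fz'] Bzz; have Bz2 : B (b - real_of R (z + z')) by rewrite real_ofD opprD addrA.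
  have h := fK _ (zb _ Bz2).
  have : P (absz (f (z + z') + Kf)%R).
    by apply/asboolP; exists (z + z'); split=> //; move: h => /andP[h _]; lia.
  by move/hmax; rewrite fD in h *; move: h => /andP[h1 h2]; lia.
have [Cd [Cd0 hCd]] := defect_bound s A.
pose g (y : 'rV[R]_r) := p + (y - defect s A p) *m U.
have gB b : B b -> g (defect s A b) = b.
  by move=> /BP[u uL <-]; rewrite /g defectD addrAC subrr add0r -Uu.
have dg y : defect s A (g y) = y by rewrite /g defectD Ud subrKC.
have Pg y : plane p L (g y) by apply/planeP; exact: UL.
have gZ y (z : 'rV[int]_k) : real_of R z \in L -> g (y - defect s A (real_of R z)) = g y - real_of R z.
  by move=> zL; rewrite /g addrAC mulmxBl -(Uu _ zL) addrA.
have gD y w : g (y + w) = g y + w *m U by rewrite /g addrAC mulmxDl addrA.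
have E'P y : (defect s A @` B') y <-> B' (g y).
  split=> [[b Bb <-]|h]; first by rewrite gB //; case: Bb.
  by exists (g y) => //; exact: dg.
pose zf (h : {ffun 'I_k -> 'I_(2 * N + 1)}) : 'rV[int]_k := \row_j ((h j)%:Z - N%:Z).
have zfP (z : 'rV[int]_k) : (forall i, (absz (z 0%R i) <= N)%N) -> exists h, z = zf h.
  move=> hz; have hj j : (absz (z 0%R j + N%:Z)%R < 2 * N + 1)%N by have := hz j; lia.
  exists [ffun j => Ordinal (hj j)].
  have e j : (z 0 j = (absz (z 0%R j + N%:Z)%R)%:Z - N%:Z)%R by have := hz j; lia.
  by apply/rowP => j; rewrite [in RHS]mxE ffunE; exact: e.
pose dB := boundary_in (plane p L) B.
have seg (y w z : 'rV[R]_r) (rho : R) : (forall j, `|w 0 j| < rho) -> B (g y) -> ~ B (g (y + w)) ->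
    exists c, dB c /\ (forall j, `|(y + z) 0 j - (defect s A c + z) 0 j| < rho) /\
      (forall j, `|(y + w + z) 0 j - (defect s A c + z) 0 j| < rho).
  move=> hw By nBw; have [t [/andP[t0 t1] ht]] : exists t : R, 0 <= t <= 1 /\ dB (g y + t *: (w *m U)).
    by apply: segment_boundary => //; rewrite -gD.
  exists (g y + t *: (w *m U)); split=> //; rewrite defectD dg defectZ Ud.
  split=> j.
    have -> : (y + z) 0 j - (y + t *: w + z) 0 j = - (t * w 0 j) by rewrite !mxE; ring.
    rewrite normrN normrM ger0_norm //; apply: le_lt_trans (hw j).
    by rewrite ler_piMl.
  have -> : (y + w + z) 0 j - (y + t *: w + z) 0 j = (1 - t) * w 0 j by rewrite !mxE; ring.
  rewrite normrM ger0_norm ?subr_ge0 //; apply: le_lt_trans (hw j).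
  by rewrite ler_piMl // gerBl.
have mixE (rho : R) (y1 : 'rV[R]_r) : mixed rho (defect s A @` B') y1 ->
   exists h c, dB c /\ forall j, `|y1 0 j - (defect s A c + defect s A (real_of R (zf h))) 0 j| < rho.
  have key (y y' : 'rV[R]_r) : (forall j, `|y 0 j - y' 0 j| < rho) -> B' (g y) -> ~ B' (g y') ->
    exists h c, [/\ dB c, forall j, `|y 0 j - (defect s A c + defect s A (real_of R (zf h))) 0 j| < rho &
       forall j, `|y' 0 j - (defect s A c + defect s A (real_of R (zf h))) 0 j| < rho].
    move=> yy' [By ny] nB'.
    have hw j : `|(y' - y) 0 j| < rho by rewrite !mxE distrC.
    have hw' j : `|(y - y') 0 j| < rho by rewrite !mxE.
    have [Bg|nBg] := pselect (B (g y')); last first.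
      have [|h hh] := zfP 0; first by move=> i; rewrite mxE.
      have [||c [dBc [h1 h2]]] := seg y (y' - y) (defect s A (real_of R (zf h))) rho hw => //.
        by rewrite subrKC.
      have z0 : defect s A (real_of R (zf h)) = 0.
        rewrite -hh; have -> : real_of R (0 : 'rV[int]_k) = 0 by apply/rowP => j; rewrite !mxE.
        exact: defect0.
      exists h, c; move: h1 h2; rewrite z0 !addr0 subrKC => h1 h2; split=> //.
    have [z [[zL fz] Bz]] : exists z, pos z /\ B (g y' - real_of R z).
      by apply: contrapT => no; apply: nB'; split=> // z hz Bz; apply: no; exists z.
    have hz : forall i, (absz (z 0%R i) <= N)%N by apply: (bnd _ _ _ Bg Bz); rewrite subrK.
    have [h hh] := zfP z hz; set dz := defect s A (real_of R (zf h)).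
    have [||c [dBc [h1 h2]]] := seg (y' - dz) (y - y') dz rho hw'.
    - by rewrite /dz -hh gZ.
    - rewrite addrAC subrKC /dz -hh gZ //; apply: ny; split=> //.
    exists h, c; split=> //.
      by move: h2; have -> : y' - dz + (y - y') + dz = y by apply/rowP => j; rewrite !mxE; ring.
    by move: h1; rewrite subrK.
  move=> [y2 [y12 nE]].
  have y21 j : `|y2 0 j - y1 0 j| < rho by rewrite distrC.
  have [E1|nE1] := pselect ((defect s A @` B') y1).
    have nE2 : ~ (defect s A @` B') y2 by move=> E2; apply: nE.
    have [||h [c [h1 h2 h3]]] := key y1 y2 y12; [exact/E'P|by move/E'P|].
    by exists h, c.
  have E2 : (defect s A @` B') y2 by apply: contrapT => nE2; apply: nE.
  have [||h [c [h1 h2 h3]]] := key y2 y1 y21; [exact/E'P|by move/E'P|].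
  by exists h, c.
(* With this [ep] the covering loss [rho ^ - ep] is [th ^ i] for [th = sqrt 2]. Since [rho] is
   smaller than [1 / T] by [2 ^ i], the final ratio [kap * tau] is [th / 2 < 1]. *)
pose ep : R := (2 * (2 * r%:R + 1))^-1.
have rR : 0 < 2 * r%:R + 1 :> R by rewrite ltr_wpDl // mulr_ge0.
have ep0 : 0 < ep by rewrite invr_gt0 mulr_gt0.
pose th : R := expR (ln 2 / 2).
have ln2 : 0 < ln (2 : R) by apply: ln_gt0; rewrite ltr1n.
have th1 : 1 <= th by rewrite -expR0 ler_expR; lra.
have th2 : th < 2 by rewrite -[ltRHS](@lnK R) ?posrE // ltr_expR; lra.
have [e [e0 he]] := minkowski_cover dimB ep0.
(* The covering is available for small [rho] only; for the finitely many [i < I0] a single box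
   serves, the last summand of [C1] making it large enough. *)
have [I0 hI0] := small_power e0.
pose Wm := Cd * M + 1.
have CdM : 0 <= Cd * M by rewrite mulr_ge0 // ltW.
pose C1 := Cd + 1 + Wm * 2 ^+ ((2 * r + 1) * I0).
have C10 : 0 <= C1 by rewrite /C1 !addr_ge0 ?mulr_ge0 ?exprn_ge0 ?addr_ge0 ?(ltW Cd0).
pose m := #|{: {ffun 'I_k -> 'I_(2 * N + 1)}}|.
pose C0 : R := 2 * m%:R + 1.
have C00 : 0 <= C0 by rewrite addr_ge0 // mulr_ge0.
have E'b : defect s A @` B' `<=` cbox (\row_j - (Cd * M)) (\row_j (Cd * M)).
  move=> _ [b [Bb _] <-] j; have := hCd _ _ M0 (BM _ Bb) j; move: (defect s A b) => w.
  by rewrite !mxE ler_norml.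
have lohi (j : 'I_r) : (\row__ - (Cd * M)) 0 j <= (\row__ (Cd * M)) 0 j :> R by rewrite !mxE ge0_cp.
have cover i : exists (n : nat) (c : 'I_n -> 'rV[R]_r),
     n%:R <= C0 * (2 ^+ ((2 * r + 1) * r.-1) * th) ^+ i /\
     mixed (2 ^- ((2 * r + 1) * i)) (defect s A @` B') `<=`
       \bigcup_l cbox (\row_j (c l 0 j - C1 * 2 ^- ((2 * r + 1) * i)))
                      (\row_j (c l 0 j + C1 * 2 ^- ((2 * r + 1) * i))).
  set rho : R := 2 ^- ((2 * r + 1) * i).
  have rho0 : 0 < rho by rewrite invr_gt0 exprn_gt0.
  have rho1 : rho <= 1 by rewrite invf_le1 ?exprn_gt0 // exprn_ege1 // ler1n.
  have big1 : 1 <= (2 ^+ ((2 * r + 1) * r.-1) * th) ^+ i.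
    by apply: exprn_ege1; apply: mulr_ege1 => //; apply: exprn_ege1; rewrite ler1n.
  have [iI|Ii] := ltnP i I0.
    exists 1%N, (fun=> 0); split.
      by apply: mulr_ege1 => //; rewrite /C0 lerDr mulr_ge0.
    move=> y hy; exists ord0 => // j; rewrite !mxE sub0r add0r -ler_norml.
    have := mixed_box rho1 E'b hy j; rewrite !mxE => /andP[h1 h2].
    apply: (@le_trans _ _ Wm); first by rewrite ler_norml /Wm; apply/andP; split; lra.
    apply: (@le_trans _ _ (Wm * 2 ^+ ((2 * r + 1) * I0) * rho)).
      rewrite -mulrA ler_peMr ?addr_ge0 // /rho ler_pdivlMr ?exprn_gt0 // mul1r.
      by rewrite ler_eXn2l ?(ltr_nat R 1) // leq_mul2l ltnW ?orbT.
    by rewrite ler_wpM2r ?(ltW rho0) // /C1 lerDr addr_ge0 // ltW.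
  have rhoe : rho < e by apply: hI0; apply: leq_trans Ii _; rewrite leq_pmull // addn1.
  have [n [c [hn hc]]] := he rho (introT andP (conj rho0 rhoe)).
  pose T : finType := ('I_n * {ffun 'I_k -> 'I_(2 * N + 1)})%type.
  pose ctr (z : T) := defect s A (c z.1) + defect s A (real_of R (zf z.2)).
  exists #|T|, (fun l => ctr (enum_val l)); split.
    rewrite card_prod card_ord natrM -/m.
    have eE : expR (((k - d - 1)%:R + ep) * - ln rho) = (2 ^+ ((2 * r + 1) * r.-1) * th) ^+ i.
      have -> : (2 ^+ ((2 * r + 1) * r.-1) * th) ^+ i =
          expR (i%:R * (((2 * r + 1) * r.-1)%:R * ln 2 + ln 2 / 2)).
        by rewrite expRM_natl expRD expRM_natl lnK ?posrE.
      congr expR; rewrite /rho lnV ?posrE ?exprn_gt0 // opprK lnXn // -mulr_natr subn1 !natrM natrD natrM /ep.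
      by field; rewrite gt_eqF.
    move: hn; rewrite eE => hn; set X := _ ^+ i in hn *.
    apply: le_trans (ler_wpM2r _ hn) _ => //; rewrite /C0 mulrDl mul1r.
    have X0 : 0 <= X by apply: le_trans big1; rewrite ler01.
    have -> : (2 * m%:R + 1) * X = (X + X) * m%:R + X by ring.
    by rewrite lerDl.
  move=> y /mixE[h [b [dBb hb]]]; have [l _ hl] := hc b dBb.
  exists (enum_rank ((l, h) : T)) => // j; rewrite [X in X <= _]mxE [X in _ <= _ <= X]mxE enum_rankK.
  rewrite -[ctr (l, h)]/(defect s A (c l) + defect s A (real_of R (zf h))).
  have h1 := hb j; have : forall i, `|(c l - b) 0 i| <= rho.
    move=> i'; apply: le_trans (row_coord_le _ _) _; move: hl; rewrite -ball_normE => /ltW; exact.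
  move=> /(hCd _ _ (ltW rho0)) /(_ j); rewrite defectB.
  have ent (u v : 'rV[R]_r) : (u - v) 0 j = u 0 j - v 0 j by rewrite !mxE.
  have entD (u v : 'rV[R]_r) : (u + v) 0 j = u 0 j + v 0 j by rewrite !mxE.
  rewrite (ent (defect s A (c l))) (entD (defect s A (c l))) => h2; move: h1; rewrite (entD (defect s A b)) => h1.
  have : C1 * rho >= Cd * rho + rho.
    rewrite -[X in _ + X <= _]mul1r -mulrDl ler_wpM2r ?(ltW rho0) // /C1 lerDl mulr_ge0 ?exprn_ge0 //.
    by rewrite addr_ge0.
  move: h1 h2; rewrite !ler_norml ltr_norml; clear - dk => /andP[? ?] /andP[? ?] ?; apply/andP; split; lra.
rewrite /Y projE; apply: (@return_times_conclusion R d k d0 dk s A sb _ erefl phi hphi B' M M0 _ _ x _ (2 * r) (th / 2 ^+ (2 * r + 1))) => //.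
- by move=> b [Bb _]; exact: BM.
- move=> b1 b2 b3 b4 [B1 _] [B2 _] [B3 _] [B4 _] eq.
  by rewrite (Uu _ (Bdir _ _ B1 B2)) (Uu _ (Bdir _ _ B3 B4)) eq.
- move=> b b' [Bb nb] [Bb' nb'] /integer_translateP[z ez].
  have hz := bnd _ _ _ Bb Bb' ez.
  have zL : real_of R z \in L by have := Bdir _ _ Bb Bb'; rewrite ez addrAC subrr add0r.
  have [fz|fz|fz] := ltgtP (f z) 0.
  + exfalso; apply: (nb' (- z)); first by split; [rewrite real_ofN memvN|rewrite fN oppr_gt0].
    by rewrite real_ofN opprK -ez.
  + by exfalso; apply: (nb z) => //; rewrite ez addrK.
  + by rewrite ez (f0 z hz fz); apply/rowP => j; rewrite !mxE addr0.
- by rewrite muln_gt0.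
- apply/andP; split; first by rewrite divr_ge0 ?exprn_ge0 // (le_trans _ th1).
  rewrite ltr_pdivrMr ?exprn_gt0 // mul1r; apply: lt_le_trans th2 _.
  by rewrite addn1 exprS ler_peMr // exprn_ege1 // ler1n.
- have -> : th / 2 ^+ (2 * r + 1) * (2 ^ (2 * r))%:R = th / 2.
    by rewrite natrX addn1 exprS; field; rewrite expf_neq0.
  by rewrite ltr_pdivrMr // mul1r.
(* A ball in the projection of [B']: let [f z] be minimal among vectors joining two points [b] and
   [b + z] of [B]. All points of [B] near [b + z] are kept, for a removed one would yield two points
   joined by a vector with smaller value. *)
- pose P n := `[< exists (z : 'rV[int]_k) b, [/\ B b, B (b + real_of R z) & f z + Kf = n%:Z] >].
  have exP : exists n, P n.
    exists (absz Kf); apply/asboolP; exists 0, b0; rewrite rz0 addr0; split=> //.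
    by rewrite fz0 add0r gez0_abs.
  case: (ex_minnP exP) => n /asboolP[z [b [Bb Bz ez]]] hmin.
  have [e1 [e10 he1]] := open_in_ball BP Bo Bb; have [e2 [e20 he2]] := open_in_ball BP Bo Bz.
  have [CU [CU0 hCU]] := mulmx_bound U.
  pose ee := Num.min e1 e2 / 2.
  have ee0 : 0 < ee by rewrite divr_gt0 // lt_min e10.
  have ee1 : ee < e1.
    have h : Num.min e1 e2 <= e1 by rewrite ge_min lexx.
    by move: ee0 h; rewrite /ee; clear; move: (Num.min _ _) => u; lra.
  have ee2 : ee < e2.
    have h : Num.min e1 e2 <= e2 by rewrite ge_min lexx orbT.
    by move: ee0 h; rewrite /ee; clear; move: (Num.min _ _) => u; lra.
  exists (defect s A (b + real_of R z)), (ee / CU); split; first by rewrite divr_gt0.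
  move=> y hy; set w := (y - defect s A (b + real_of R z)) *m U.
  have wn : `|w| <= ee.
    apply: row_norm_le => [|j]; first exact: ltW.
    have := hCU (y - defect s A (b + real_of R z)) (ee / CU) (ltW (divr_gt0 ee0 CU0)).
    rewrite [CU * (ee / CU)]mulrC divfK ?gt_eqF //; apply => i; have := hy i.
    have ent (u v : 'rV[R]_r) : (u - v) 0 i = u 0 i - v 0 i by rewrite !mxE.
    by rewrite (ent y) => /ltW.
  have wL : w \in L by exact: UL.
  have near1 : B (b + w).
    apply: he1; first by apply: plane_translate => //; exact: BP.
    by rewrite opprD addNKr normrN (le_lt_trans wn).
  have near2 : B (b + real_of R z + w).
    apply: he2; first by apply: plane_translate => //; exact: BP.
    by rewrite opprD addNKr normrN (le_lt_trans wn).
  exists (b + real_of R z + w); last by rewrite defectD Ud subrKC.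
  split=> // z' [zL' fz'] Bzz.
  have Bzz2 : B (b + w + real_of R (z - z')).
    by rewrite real_ofD real_ofN; move: Bzz; congr B; apply/rowP => j; rewrite !mxE; ring.
  have hz2 : forall i, (absz ((z - z')%R 0%R i) <= N)%N by apply: (bnd _ _ _ Bzz2 near1).
  have /andP[h1 h2] := fK _ hz2.
  have fz0' : 0 <= f (z - z') + Kf by rewrite -[0](addNr Kf) lerD2r.
  have /hmin : P (absz (f (z - z') + Kf)%R).
    by apply/asboolP; exists (z - z'), (b + w); split=> //; rewrite gez0_abs.
  by rewrite -lez_nat gez0_abs // -ez lerD2r fD fN lerDl oppr_ge0 leNgt fz'.
exact: (@discrepancy_small_boundary R d r A _ _ _ th C0 C1 dio r0 rd th1 C00 C10 E'b lohi cover).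
Qed.

End SmallBoundary.

(** * Matrices as subspaces *)

Section NearMatrices.
Variables (R : realType).

Definition mclose (m n : nat) (e : R) (X Y : 'M[R]_(m, n)) := forall i j, `|X i j - Y i j| < e.

Lemma open_mclose (m n : nat) (U : set 'M[R]_(m, n)) X : open U -> U X ->
  exists e : R, 0 < e /\ forall Y, mclose e X Y -> U Y.
Proof.
move=> oU UX; have := open_nbhs_nbhs (conj oU UX); rewrite -nbhs_ballE => -[e e0 he].
exists e; split=> // Y hY; apply: he; split=> // i j; rewrite -ball_normE; exact: hY.
Qed.

Lemma mclose_open (m n : nat) (U : set 'M[R]_(m, n)) :
  (forall X, U X -> exists e : R, 0 < e /\ forall Y, mclose e X Y -> U Y) -> open U.
Proof.
move=> h; rewrite openE => X /h[e [e0 he]]; rewrite /interior -nbhs_ballE; exists e => // Y [_ hY].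
by apply: he => i j; have := hY i j; rewrite -ball_normE.
Qed.

Lemma mclose_mull (m n p : nat) (M : 'M[R]_(n, p)) (e : R) : 0 < e ->
  exists eta : R, 0 < eta /\ forall X Y : 'M[R]_(m, n), mclose eta X Y -> mclose e (X *m M) (Y *m M).
Proof.
move=> e0; have [C [C0 hC]] := mulmx_bound M.
have eC : 0 < e / 2 / C by rewrite !divr_gt0.
exists (e / 2 / C); split=> // X Y h i j.
have h2 : `|(row i (X - Y) *m M) 0 j| <= C * (e / 2 / C).
  by apply: hC => [|l]; [exact: ltW|rewrite !mxE; exact/ltW/h].
have e3 : (X *m M) i j - (Y *m M) i j = (row i (X - Y) *m M) 0 j.
  have ent (U V : 'M[R]_(m, p)) : U i j - V i j = (U - V) i j by rewrite !mxE.
  by rewrite ent -mulmxBl -row_mul [RHS]mxE.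
rewrite e3; apply: le_lt_trans h2 _; rewrite mulrC divfK ?gt_eqF //; lra.
Qed.

(* [|u X| >= |u Y| - |u (X - Y)|] keeps [X] injective near an invertible [Y], and
   [X^-1 - Y^-1 = X^-1 (Y - X) Y^-1]. *)
Lemma mclose_solve (n p : nat) (Y : 'M[R]_n) (Z : 'M[R]_(n, p)) (e : R) : Y \in unitmx -> 0 < e ->
  exists eta : R, 0 < eta /\ forall X W, mclose eta Y X -> mclose eta Z W ->
    X \in unitmx /\ mclose e (invmx Y *m Z) (invmx X *m W).
Proof.
move=> Yu e0; have [C [C0 hC]] := mulmx_bound (invmx Y).
pose N : R := n%:R + 1; have N0 : 0 < N by rewrite ltr_wpDl.
have N1 : n%:R <= N by rewrite lerDl.
(* With this closeness the error term in [key] is half the maximum [mu] and is absorbed by the left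
   side. *)
pose et1 : R := (2 * (C * N))^-1.
have CN : 0 < C * N by rewrite mulr_gt0.
have et10 : 0 < et1 by rewrite invr_gt0 mulr_gt0.
have key X (u : 'rV[R]_n) c : mclose et1 Y X -> 0 <= c -> (forall j, `|(u *m X) 0 j| <= c) ->
    forall j, `|u 0 j| <= 2 * C * c.
  move=> hX c0 huX.
  pose mu := \big[Num.max/0]_j `|u 0 j|.
  have mu0 : 0 <= mu by rewrite /mu; elim/big_ind: _ => // x y x0 y0; rewrite le_max x0.
  have muge j : `|u 0 j| <= mu by exact: (@le_bigmax _ _ _ 0 (fun j => `|u 0 j|) j).
  have h1 j : `|u 0 j| <= C * (c + N * (mu * et1)).
    have -> : u = (u *m Y) *m invmx Y by rewrite mulmxK.
    have cc : 0 <= c + N * (mu * et1) by rewrite addr_ge0 // mulr_ge0 ?(ltW N0) // mulr_ge0 // ltW.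
    apply: hC => // i; have -> : u *m Y = u *m X + u *m (Y - X) by rewrite -mulmxDr subrKC.
    rewrite mxE; apply: le_trans (ler_normD _ _) _; apply: lerD => //.
    rewrite mxE; apply: le_trans (ler_norm_sum _ _ _) _.
    apply: (@le_trans _ _ (\sum_(l < n) mu * et1)).
      by apply: ler_sum => l _; rewrite normrM; apply: ler_pM => //; rewrite !mxE; exact/ltW/hX.
    by rewrite sumr_const card_ord -[_ *+ n]mulr_natl; apply: ler_wpM2r => //; rewrite mulr_ge0 // ltW.
  have h2 : mu <= C * (c + N * (mu * et1)).
    have cc' : 0 <= C * (c + N * (mu * et1)).
      by rewrite mulr_ge0 ?(ltW C0) // addr_ge0 // mulr_ge0 ?(ltW N0) // mulr_ge0 // ltW.
    by apply: bigmax_le => // l' _; exact: h1.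
  have h3 : C * (c + N * (mu * et1)) = C * c + mu / 2.
    by rewrite /et1; field; rewrite !gt_eqF.
  have h4 : mu <= 2 * C * c by move: h2; rewrite h3; clear; clearbody mu; lra.
  by move=> l'; exact: le_trans (muge l') h4.
have Xunit X : mclose et1 Y X -> X \in unitmx.
  move=> hX; rewrite -row_free_unit -kermx_eq0; apply/rowV0P => u /sub_kermxP uX.
  apply/rowP => j; rewrite mxE; apply/eqP; rewrite -normr_le0.
  have := key X u 0 hX (lexx _) _ j; rewrite mulr0; apply => i; by rewrite uX mxE normr0.
pose Q := invmx Y *m Z.
pose qm : R := 1 + \sum_i \sum_j `|Q i j|.
have qm0 : 0 < qm by rewrite ltr_pwDl // sumr_ge0 // => i _; exact: sumr_ge0.
have Qle i j : `|Q i j| <= qm.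
  apply: (@le_trans _ _ (\sum_j' `|Q i j'|)); first by rewrite (bigD1 j) //= lerDl sumr_ge0.
  apply: (@le_trans _ _ (\sum_i' \sum_j' `|Q i' j'|)); last by rewrite /qm lerDr.
  by rewrite [leRHS](bigD1 i) //= lerDl sumr_ge0 // => ? _; exact: sumr_ge0.
pose D := 2 * C.
have hD X i l : mclose et1 Y X -> `|invmx X i l| <= D.
  move=> hX; have := key X (row i (invmx X)) 1 hX ler01 _ l; rewrite mulr1 mxE; apply => j.
  by rewrite -row_mul mulVmx ?Xunit // !mxE; case: (i == j); rewrite ?normr1 ?normr0.
have D0 : 0 < D by rewrite mulr_gt0.
pose eta := Num.min et1 (e / (2 * (N * D * (1 + N * qm)))).
have den : 0 < 2 * (N * D * (1 + N * qm)) by rewrite !mulr_gt0 // addr_gt0 // mulr_gt0.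
have eta0 : 0 < eta by rewrite lt_min et10 divr_gt0.
exists eta; split=> // X W hX hW.
have hX1 : mclose et1 Y X by move=> i j; apply: lt_le_trans (hX i j) _; rewrite ge_min lexx.
split; first exact: Xunit.
move=> i j.
have e1 : Q - invmx X *m W = invmx X *m ((X - Y) *m Q + (Z - W)).
  rewrite mulmxDr mulmxA mulmxBr mulVmx ?Xunit // !mulmxBr mulmxBl mul1mx.
  have YQ : Y *m Q = Z by rewrite /Q mulmxA mulmxV // mul1mx.
  by rewrite -[invmx X *m Y *m Q]mulmxA YQ addrA subrK.
have ent (U V : 'M[R]_(n, p)) : U i j - V i j = (U - V) i j by rewrite !mxE.
rewrite ent e1 mxE; apply: le_lt_trans (ler_norm_sum _ _ _) _.
have inner l : `|((X - Y) *m Q + (Z - W)) l j| <= (1 + N * qm) * eta.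
  rewrite mxE mulrDl mul1r addrC; apply: le_trans (ler_normD _ _) _; apply: lerD.
    by rewrite !mxE; exact/ltW/hW.
  rewrite mxE; apply: le_trans (ler_norm_sum _ _ _) _.
  apply: (@le_trans _ _ (\sum_(l' < n) eta * qm)).
    apply: ler_sum => l' _; rewrite normrM; apply: ler_pM => //.
    by rewrite !mxE distrC; exact/ltW/hX.
  rewrite sumr_const card_ord -[_ *+ n]mulr_natl [eta * qm]mulrC mulrA ler_wpM2r ?(ltW eta0) //.
  by rewrite ler_wpM2r // ltW.
apply: (@le_lt_trans _ _ (\sum_(l < n) D * ((1 + N * qm) * eta))).
  by apply: ler_sum => l _; rewrite normrM; apply: ler_pM => //; exact: hD.
rewrite sumr_const card_ord -[_ *+ n]mulr_natl.
have h : eta <= e / (2 * (N * D * (1 + N * qm))) by rewrite ge_min lexx orbT.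
move: h; rewrite ler_pdivlMr // => h.
apply: (@le_lt_trans _ _ (N * (D * ((1 + N * qm) * eta)))).
  by rewrite ler_wpM2r // !mulr_ge0 ?(ltW D0) ?(ltW eta0) // ltW // addr_gt0 // mulr_gt0.
have -> : N * (D * ((1 + N * qm) * eta)) = eta * (2 * (N * D * (1 + N * qm))) / 2 by field.
lra.
Qed.

(* If [D] and [F] have no common left kernel, any kernel vector of [D] can be moved off the
   kernel by adding to [D] a rank one term of the form [F B] with values off the row space of [D]. *)
Lemma unit_perturbation (n p : nat) (D : 'M[R]_n) (F : 'M[R]_(n, p)) (e : R) : 0 < e ->
  (forall u : 'rV[R]_n, u *m D = 0 -> u *m F = 0 -> u = 0) ->
  exists B : 'M[R]_(p, n), mclose e 0 B /\ D + F *m B \in unitmx.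
Proof.
move: (leqnn (\rank (kermx D))); move: {2}(\rank (kermx D)) => m.
elim: m D e => [|m IH] D e hr e0 DF.
  exists 0; split; first by move=> i j; rewrite !mxE subrr normr0.
  by rewrite mulmx0 addr0 -row_free_unit -kermx_eq0 -mxrank_eq0 -leqn0.
have [Du|nDu] := boolP (D \in unitmx).
  exists 0; split; first by move=> i j; rewrite !mxE subrr normr0.
  by rewrite mulmx0 addr0.
have kD : kermx D != 0 by rewrite kermx_eq0 row_free_unit.
have /rowV0Pn[u uD u0] := kD; have uD0 : u *m D = 0 by apply/sub_kermxP.
have [i uFi] : exists i, (u *m F) 0 i != 0.
  by apply/rV0Pn; apply: contra u0 => /eqP h; apply/eqP; exact: DF.
have [c cD] : exists c : 'rV[R]_n, ~~ (c <= D)%MS.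
  have : ~~ row_full D by rewrite row_full_unit.
  rewrite -sub1mx => /row_subPn[l hl]; by exists (row l 1%:M).
pose cn : R := 1 + \sum_j `|c 0 j|.
have cn0 : 0 < cn by rewrite ltr_pwDl // sumr_ge0.
pose t := e / 2 / cn; have t0 : 0 < t by rewrite !divr_gt0.
pose B1 : 'M[R]_(p, n) := \matrix_(l, j) ((l == i)%:R * (t * c 0 j)).
have B1E (v : 'rV[R]_n) : v *m F *m B1 = (t * (v *m F) 0 i) *: c.
  apply/rowP => j; rewrite mxE (bigD1 i) //= big1 ?addr0.
    by rewrite !mxE eqxx mul1r; ring.
  by move=> l /negbTE li; rewrite [B1 l j]mxE li mul0r mulr0.
have kerE (v : 'rV[R]_n) : v *m (D + F *m B1) = 0 -> v *m D = 0 /\ (v *m F) 0 i = 0.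
  rewrite mulmxDr mulmxA B1E => h.
  have [z|nz] := eqVneq ((v *m F) 0 i) 0; first by move: h; rewrite z mulr0 scale0r addr0.
  have : (c <= D)%MS.
    have -> : c = (- (t * (v *m F) 0 i)^-1) *: v *m D.
      move/eqP: h; rewrite addr_eq0 => /eqP h; rewrite -scalemxAl h scalerN scaleNr opprK scalerA.
      by rewrite mulVf ?scale1r // mulf_neq0 // gt_eqF.
    exact: submxMl.
  by rewrite (negbTE cD).
have [|||B2 [hB2 uB2]] := IH (D + F *m B1) (e / 2).
- have lt : (kermx (D + F *m B1)%R < kermx D)%MS.
    rewrite ltmxE; apply/andP; split.
      apply/row_subP => l; apply/sub_kermxP; apply: (kerE _ _).1.
      by apply/sub_kermxP; exact: row_sub.
    apply/negP => h; have : (u <= kermx (D + F *m B1)%R)%MS by apply: submx_trans uD h.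
    by move/sub_kermxP/kerE => [_ h2]; rewrite h2 eqxx in uFi.
  by rewrite -ltnS; apply: leq_trans (rank_ltmx lt) hr.
- by rewrite divr_gt0.
- move=> v /kerE[vD _] vF; exact: DF.
exists (B1 + B2); split; last by rewrite mulmxDr addrA.
move=> l j; have := hB2 l j; rewrite !mxE !sub0r !normrN => h2.
apply: le_lt_trans (ler_normD _ _) _; have -> : e = e / 2 + e / 2 by field.
apply: ler_ltD => //; apply: (@le_trans _ _ (t * cn)); last by rewrite /t divfK ?gt_eqF.
rewrite normrM (normrM t) (ger0_norm (ltW t0)); case: (l == i); rewrite ?normr1 ?normr0 ?mul1r ?mul0r.
  by rewrite ler_wpM2l ?(ltW t0) // /cn (bigD1 j) //= addrCA lerDl addr_ge0 // sumr_ge0.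
by rewrite mulr_ge0 // ltW.
Qed.

End NearMatrices.

(** * Graphs in general frames *)

Section Frames.
Variables (R : realType) (d r k : nat).

(** A splitting of [R^k] into the row spaces of [finv1] and [finv2], with coordinates read off by
    [ftop] and [fbot]. Both the coordinate charts of the Grassmannian and the chart with [W] as
    vertical direction are instances, so [frame_change] can compare them. *)
Record frame := Frame {
  ftop : 'M[R]_(k, d); fbot : 'M[R]_(k, r); finv1 : 'M[R]_(d, k); finv2 : 'M[R]_(r, k);
  frame_id : ftop *m finv1 + fbot *m finv2 = 1%:M;
  frame11 : finv1 *m ftop = 1%:M; frame12 : finv1 *m fbot = 0;
  frame21 : finv2 *m ftop = 0; frame22 : finv2 *m fbot = 1%:M }.

Variable F : frame.
Implicit Type H : 'M[R]_(d, r).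

Definition fgraph_on H (x : 'rV[R]_k) := x *m fbot F = x *m ftop F *m H.
Definition fgraph_mx H : 'M[R]_(d, k) := finv1 F + H *m finv2 F.

Lemma fgraph_top H : fgraph_mx H *m ftop F = 1%:M.
Proof. by rewrite mulmxDl frame11 -mulmxA frame21 mulmx0 addr0. Qed.

Lemma fgraph_bot H : fgraph_mx H *m fbot F = H.
Proof. by rewrite mulmxDl frame12 -mulmxA frame22 mulmx1 add0r. Qed.

Lemma frame_expand m (x : 'M[R]_(m, k)) : x = x *m ftop F *m finv1 F + x *m fbot F *m finv2 F.
Proof. by rewrite -!mulmxA -mulmxDr frame_id mulmx1. Qed.

Lemma fgraph_onE H x : fgraph_on H x <-> exists u, x = u *m fgraph_mx H.
Proof.
split=> [h|[u ->]]; last first.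
  by rewrite /fgraph_on -mulmxA fgraph_bot -[u *m _ *m ftop F]mulmxA fgraph_top mulmx1.
exists (x *m ftop F); rewrite {1}[x]frame_expand h /fgraph_mx mulmxDr.
by rewrite -!mulmxA.
Qed.

End Frames.

Section FrameChange.
Variables (R : realType) (d r k : nat).

(** The rows of [fgraph_mx F H] span the subspace. If their [ftop F'] coordinates form an invertible
    matrix, normalising it to the identity gives the matrix of the same subspace in [F']. *)
Lemma same_graph (F F' : frame R d r k) (H : 'M[R]_(d, r)) : fgraph_mx F H *m ftop F' \in unitmx ->
  let H' := invmx (fgraph_mx F H *m ftop F') *m (fgraph_mx F H *m fbot F') in
  forall x, fgraph_on F H x <-> fgraph_on F' H' x.
Proof.
set X := fgraph_mx F H => Xu H' x; rewrite fgraph_onE; split=> [[u ->]|h].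
  have e : X *m ftop F' *m H' = X *m fbot F' by rewrite /H' mulmxA mulmxV // mul1mx.
  by rewrite /fgraph_on -mulmxA -/X -e !mulmxA.
exists (x *m ftop F' *m invmx (X *m ftop F')); rewrite -/X.
rewrite {1}[x](frame_expand F') [RHS](frame_expand F') h /H'.
by rewrite !mulmxA -![_ *m X *m _]mulmxA; rewrite -![_ *m invmx _ *m (_ *m _)]mulmxA mulVmx ?mulmx1 // !mulmxA.
Qed.

Lemma same_graph_unit (F F' : frame R d r k) H H' : (forall x, fgraph_on F H x <-> fgraph_on F' H' x) ->
  fgraph_mx F H *m ftop F' \in unitmx /\
  H' = invmx (fgraph_mx F H *m ftop F') *m (fgraph_mx F H *m fbot F').
Proof.
move=> h; set X := fgraph_mx F H.
have on u : fgraph_on F' H' (u *m X) by apply/h/fgraph_onE; exists u.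
have Xu : X *m ftop F' \in unitmx.
  rewrite -row_free_unit -kermx_eq0; apply/rowV0P => u /sub_kermxP uX; have := on u.
  have e : u *m X *m ftop F' = 0 by rewrite -mulmxA.
  rewrite /fgraph_on e mul0mx => h2.
  have uX0 : u *m X = 0 by rewrite [u *m X](frame_expand F') e h2 !mul0mx addr0.
  by rewrite -[u]mulmx1 -(fgraph_top F H) mulmxA -/X uX0 mul0mx.
split=> //; have e : X *m fbot F' = X *m ftop F' *m H'.
  apply/row_matrixP => i; have := on (delta_mx 0 i); rewrite /fgraph_on -!rowE -!row_mul //.
by rewrite e mulKmx.
Qed.

Lemma frame_change (F F' : frame R d r k) H H' (e : R) :
  (forall x, fgraph_on F H x <-> fgraph_on F' H' x) -> 0 < e ->
  exists eta : R, 0 < eta /\ forall G, mclose eta H G ->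
    exists G', mclose e H' G' /\ forall x, fgraph_on F G x <-> fgraph_on F' G' x.
Proof.
move=> /same_graph_unit[Xu ->] e0.
have [e1 [e10 h1]] := mclose_solve (fgraph_mx F H *m fbot F') Xu e0.
have [e2 [e20 h2]] := @mclose_mull R d _ _ (finv2 F *m ftop F') e1 e10.
have [e3 [e30 h3]] := @mclose_mull R d _ _ (finv2 F *m fbot F') e1 e10.
exists (Num.min e2 e3); split; first by rewrite lt_min e20.
move=> G hG; have cl (p : nat) (M : 'M[R]_(k, p)) : mclose e1 (H *m (finv2 F *m M)) (G *m (finv2 F *m M)) ->
    mclose e1 (fgraph_mx F H *m M) (fgraph_mx F G *m M).
  move=> h i j; have := h i j; rewrite /fgraph_mx !mulmxDl !mulmxA.
  by rewrite ![((_ + _) : 'M[R]_(_, _)) i j]mxE [X in _ -> `|X| < _](_ : _ =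
    (H *m finv2 F *m M) i j - (G *m finv2 F *m M) i j) //; ring.
have m2 : Num.min e2 e3 <= e2 by rewrite ge_min lexx.
have m3 : Num.min e2 e3 <= e3 by rewrite ge_min lexx orbT.
have [Xu' hX] := h1 (fgraph_mx F G *m ftop F') (fgraph_mx F G *m fbot F')
  (cl _ _ (h2 _ _ (fun i j => lt_le_trans (hG i j) m2)))
  (cl _ _ (h3 _ _ (fun i j => lt_le_trans (hG i j) m3))).
exists (invmx (fgraph_mx F G *m ftop F') *m (fgraph_mx F G *m fbot F')); split=> //.
exact: same_graph.
Qed.

(** The rows of [fgraph_mx F H] and [finv2 F] together span [R^k], so their images under [ftop F']
    span [R^d]. This is the hypothesis of [unit_perturbation], applied to transposes because [H]
    multiplies from the left. *)
Lemma transverse_dense (F F' : frame R d r k) H (e : R) : 0 < e ->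
  exists G, mclose e H G /\ fgraph_mx F G *m ftop F' \in unitmx.
Proof.
move=> e0; pose X := fgraph_mx F H.
have [|B [hB uB]] := @unit_perturbation R d r (X *m ftop F')^T (finv2 F *m ftop F')^T e e0.
  move=> u uX uF; pose y := ftop F' *m u^T.
  have Xy : X *m y = 0 by rewrite /y mulmxA -[X *m _]trmxK -trmx_mul uX trmx0.
  have Fy : finv2 F *m y = 0 by rewrite /y mulmxA -[finv2 F *m _]trmxK -trmx_mul uF trmx0.
  have Gy : finv1 F *m y = 0.
    by move: Xy; rewrite /X /fgraph_mx mulmxDl -mulmxA Fy mulmx0 addr0.
  have y0 : y = 0 by rewrite -[y]mul1mx -(frame_id F) mulmxDl -!mulmxA Fy Gy !mulmx0 addr0.
  by rewrite -[u]trmxK -[u^T]mul1mx -(frame11 F') -mulmxA -/y y0 mulmx0 trmx0.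
exists (H + B^T); split.
  by move=> i j; have := hB j i; rewrite !mxE sub0r opprD addNKr.
have eB : (finv2 F *m ftop F')^T *m B = (B^T *m (finv2 F *m ftop F'))^T by rewrite [RHS]trmx_mul trmxK.
move: uB; rewrite eB -linearD /= unitmx_tr.
suff -> : fgraph_mx F (H + B^T) *m ftop F' = X *m ftop F' + B^T *m (finv2 F *m ftop F') by [].
by rewrite /X /fgraph_mx !mulmxDl mulmxA addrA.
Qed.

End FrameChange.

(** * Counting points of a net near a lattice *)

Section CubeCounts.
Variables (R : realType) (d : nat).

(** The integer parts of [z G] are counted by [lattice_box_count]. Two [z] with the same integer
    part differ by a vector of a window depending on [G] only, whence the factor [C]. *)
Lemma general_lattice_count (G : 'M[R]_d) : G \in unitmx ->
  exists C : R, 0 <= C /\ forall lo hi : 'rV[R]_d, (forall j, lo 0 j <= hi 0 j) ->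
    exists F : {fset 'rV[int]_d}, (forall z, cbox lo hi (real_of R z *m G) -> z \in F) /\
      #|` F|%:R <= C * \prod_j (hi 0 j - lo 0 j + 2).
Proof.
move=> Gu; have [Cq [Cq0 hCq]] := mulmx_bound (invmx G).
pose N := (Num.trunc (Cq * 1)).+1; have CN : Cq * 1 < N%:R by exact: truncnS_gt.
pose W := {ffun 'I_d -> 'I_(2 * N + 1)}.
exists #|{: W}|%:R; split=> // lo hi lohi.
pose lo' : 'rV[R]_d := \row_j (lo 0 j - 1).
have [|F0 [hF0 cF0]] := @lattice_box_count R d 1 lo' hi isT.
  by move=> j; rewrite mxE; have := lohi j; lra.
pose fl (z : 'rV[int]_d) : 'rV[int]_d := \row_j Num.floor ((real_of R z *m G) 0 j).
have /choice[rep hrep] : forall p : 'rV[int]_d, exists q : 'rV[int]_d, forall z, fl z = p -> fl q = p.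
  move=> p; have [[q hq]|no] := pselect (exists q, fl q = p); first by exists q.
  by exists 0 => z hz; case: no; exists z.
pose g (z : 'rV[int]_d * W) : 'rV[int]_d := \row_j (rep z.1 0 j + ((z.2 j)%:Z - N%:Z)).
pose Wp : finType := (F0 * W)%type; pose gp (z : Wp) := g (val z.1, z.2).
exists [fset gp z | z in {: Wp}]%fset; split=> [z hz|].
  have pF : fl z \in F0.
    apply: hF0 => j; have := hz j; rewrite !mxE invr1 mul1r => /andP[h1 h2].
    have := floor_itv ((real_of R z *m G) 0 j); rewrite mxE rmorphD /= => /andP[h3 h4].
    by apply/andP; split; lra.
  have eqf := hrep (fl z) z erefl.
  have dif j : (absz ((z - rep (fl z))%R 0%R j) <= N)%N.
    have h : `|real_of R (z - rep (fl z)) 0 j| <= Cq * 1.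
      have -> : real_of R (z - rep (fl z)) = (real_of R (z - rep (fl z)) *m G) *m invmx G by rewrite mulmxK.
      apply: hCq => // i.
      have -> : real_of R (z - rep (fl z)) = real_of R z - real_of R (rep (fl z)).
        by apply/rowP => l; rewrite !mxE rmorphB.
      rewrite mulmxBl; move/rowP: eqf => /(_ i); rewrite [LHS]mxE [RHS]mxE.
      have := floor_itv ((real_of R z *m G) 0 i); have := floor_itv ((real_of R (rep (fl z)) *m G) 0 i).
      have ent (u v : 'rV[R]_d) : (u - v) 0 i = u 0 i - v 0 i by rewrite !mxE.
      rewrite (ent (real_of R z *m G)); move: ((real_of R z *m G) 0 i) ((real_of R (rep (fl z)) *m G) 0 i) => u v.
      move=> /andP[h1 h2] /andP[h3 h4] e; move: h1 h2; rewrite e => h1 h2; move: h2 h4; rewrite !rmorphD /= => h2 h4.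
      by rewrite ler_norml; apply/andP; split; lra.
    move: h; rewrite mxE -intr_norm -abszE => h.
    by rewrite -(ler_nat R); apply: le_trans h (ltW CN).
  have hj j : (absz ((z - rep (fl z))%R 0%R j + N%:Z)%R < 2 * N + 1)%N by have := dif j; lia.
  apply/imfsetP; exists (FSetSub pF, [ffun j => Ordinal (hj j)]) => //.
  have e j : ((z - rep (fl z))%R 0 j = (absz ((z - rep (fl z))%R 0%R j + N%:Z)%R)%:Z - N%:Z)%R.
    by have := dif j; lia.
  apply/rowP => j; rewrite /gp [RHS]mxE ffunE [X in _ + (X - _)]/= -e !mxE; ring.
apply: (@le_trans _ _ (#|` F0| * #|{: W}|)%N%:R).
  rewrite ler_nat; apply: leq_trans (leq_imfset_card _ _ _) _.
  by rewrite /= -cardE card_prod cardfE.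
rewrite natrM mulrC ler_wpM2l //; apply: le_trans cF0 _; apply/eq_lerW/eq_bigr => j _.
rewrite mxE; ring.
Qed.

(* A bounded perturbation of a lattice has the same number of points in all cubes of side [n],
   up to the [n^(d-1)] points near the boundary. *)
Theorem BD_cube_counts (Y : set 'rV[R]_d) (P : 'M[R]_d) : P \in unitmx -> BD_to_lattice Y ->
  exists C : R, 0 <= C /\ forall (n : nat) (c1 c2 : 'rV[R]_d) (F1 F2 : {fset 'rV[R]_d}), (0 < n)%N ->
    (forall u, u \in F1 -> (exists2 y, Y y & u = y *m P) /\ forall j, c1 0 j <= u 0 j <= c1 0 j + n%:R) ->
    (forall y, Y y -> (forall j, c2 0 j <= (y *m P) 0 j <= c2 0 j + n%:R) -> y *m P \in F2) ->
    (#|` F1|)%:R <= (#|` F2|)%:R + C * n%:R ^+ d.-1.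
Proof.
move=> Pu [Y' [G Gu ->] [f [[fY finj fsurj] [D0 hD0]]]].
pose G' := G *m P; have Gu' : G' \in unitmx by rewrite unitmx_mul Gu.
have [CP [CP0 hCP]] := mulmx_bound P.
pose D := CP * `|D0|; have D00 : 0 <= D by rewrite mulr_ge0 // ltW.
have fD y : Y y -> forall j, `|(f y *m P) 0 j - (y *m P) 0 j| <= D.
  move=> Yy j; have ent (u v : 'rV[R]_d) : u 0 j - v 0 j = (u - v) 0 j by rewrite !mxE.
  rewrite ent -mulmxBl; apply: hCP => // i; apply: le_trans (row_coord_le _ _) _.
  by apply: le_trans (ler_norm D0); apply: hD0; exists y.
have [CG [CG0 hCG]] := mulmx_bound G'.
pose D2 := D + CG; have D20 : 0 < D2 by rewrite ltr_wpDl.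
have [C1 [C10 hC1]] := general_lattice_count Gu'.
pose K : R := 2 * D2 + 3.
have K1 : 1 <= K by rewrite /K; lra.
exists (#|{: 'I_d * bool}|%:R * (C1 * (K * K ^+ d.-1))); split.
  by rewrite !mulr_ge0 ?exprn_ge0 // (le_trans ler01).
move=> n c1 c2 F1 F2 n0 hF1 hF2.
have nR : 1 <= n%:R :> R by rewrite ler1n.
have /choice[zeta hz] : forall u, exists z : 'rV[int]_d, u \in F1 -> exists2 y, Y y & u = y *m P /\ f y = map_mx intr z *m G.
  move=> u; have [uF|nF] := boolP (u \in F1); last by exists 0.
  have [[y Yy uy] _] := hF1 u uF; have [z _ hz] := fY y Yy.
  by exists z => _; exists y.
(* The lattice vector [z0 G'] nearly equals [c2 - c1]. A point of the first cube goes to its lattice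
   partner, moves by [z0] and returns to the net. It lands in the second cube unless its lattice
   point is in one of [2 d] slabs at the faces, which hold [O(n ^ d.-1)] lattice points. *)
pose z0 : 'rV[int]_d := \row_j Num.floor (((c2 - c1) *m invmx G') 0 j).
have hz0 j : `|(real_of R z0 *m G') 0 j - (c2 - c1) 0 j| <= CG.
  have ent (u v : 'rV[R]_d) : u 0 j - v 0 j = (u - v) 0 j by rewrite !mxE.
  have -> : c2 - c1 = ((c2 - c1) *m invmx G') *m G' by rewrite mulmxKV.
  rewrite ent -mulmxBl -[CG]mulr1; apply: hCG => // i.
  have := floor_itv (((c2 - c1) *m invmx G') 0 i).
  have ent' (u v : 'rV[R]_d) : (u - v) 0 i = u 0 i - v 0 i by rewrite !mxE.
  rewrite ent' !mxE rmorphD /=; move: (\sum_(i0 < d) _) => t; move: ((Num.floor t)%:~R : R) => fl /andP[h1 h2].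
  by rewrite ler_norml; apply/andP; split; lra.
pose I : finType := ('I_d * bool)%type.
pose lo (l : I) : 'rV[R]_d := \row_j if j == l.1 then (if l.2 then c2 0 j - D2 else c2 0 j + n%:R - D) else c2 0 j - D2.
pose hi (l : I) : 'rV[R]_d := \row_j if j == l.1 then (if l.2 then c2 0 j + D else c2 0 j + n%:R + D2) else c2 0 j + n%:R + D2.
have DD2 : D <= D2 by rewrite /D2 lerDl ltW.
have lohi l j : lo l 0 j <= hi l 0 j.
  by rewrite !mxE; case: ifP => _; [case: l.2|]; lra.
have /choice[S hS] : forall l, exists F : {fset 'rV[int]_d}, (forall z, cbox (lo l) (hi l) (real_of R z *m G') -> z \in F) /\
      #|` F|%:R <= C1 * \prod_j (hi l 0 j - lo l 0 j + 2).
  by move=> l; exact: hC1.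
have S_le l : #|` S l|%:R <= C1 * (K * K ^+ d.-1) * n%:R ^+ d.-1.
  apply: le_trans (hS l).2 _; rewrite -!mulrA; apply: ler_wpM2l => //.
  rewrite (bigD1 l.1) //=; apply: ler_pM.
  - by have := lohi l l.1; lra.
  - by apply: prodr_ge0 => j _; have := lohi l j; lra.
  - by rewrite !mxE eqxx /K; case: l.2; lra.
  rewrite -exprMn -[d in X in _ <= X](card_ord d) -(cardC1 l.1) -prodr_const; apply: ler_prod => j /negbTE jl.
  rewrite !mxE jl; apply/andP; split; first by lra.
  have : 0 <= (2 * D2 + 2) * (n%:R - 1) by rewrite mulr_ge0 ?subr_ge0 //; lra.
  by rewrite /K; lra.
pose U := (\bigcup_(l <- enum I) S l)%fset.
have U_le : #|` U|%:R <= #|I|%:R * (C1 * (K * K ^+ d.-1)) * n%:R ^+ d.-1.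
  apply: (@le_trans _ _ (\sum_l #|` S l|%:R)).
    rewrite -natr_sum ler_nat /U -big_enum /=; elim: (enum I) => [|l t IH]; first by rewrite !big_nil cardfs0.
    rewrite !big_cons; apply: leq_trans (leq_add (leqnn _) IH).
    by rewrite -cardfsUI leq_addr.
  by rewrite -mulrA [#|I|%:R * _]mulr_natl -sumr_const; apply: ler_sum => l _; exact: S_le.
have /choice[back hback] : forall z : 'rV[int]_d, exists u, exists2 y, Y y & u = y *m P /\ f y = map_mx intr z *m G.
  move=> z; have [|y Yy fy] := fsurj (map_mx intr z *m G); first by exists z.
  by exists (y *m P), y.
have Gz (z : 'rV[int]_d) : map_mx intr z *m G *m P = real_of R z *m G' by rewrite mulmxA.
pose code u := let z := zeta u + z0 in if z \in U then inl z else inr (back z) : 'rV[int]_d + 'rV[R]_d.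
have mapsto u : u \in F1 -> (zeta u + z0 \in U) || (back (zeta u + z0) \in F2).
  move=> uF; have [_ cu] := hF1 u uF; have [y Yy [uy fy]] := hz u uF.
  case: (boolP (_ \in U)) => //= nU.
  have [y2 Yy2 [by2 fy2]] := hback (zeta u + z0).
  have loc j : c2 0 j - D2 <= (real_of R (zeta u + z0) *m G') 0 j <= c2 0 j + n%:R + D2.
    have ent (v w : 'rV[R]_d) : (v + w) 0 j = v 0 j + w 0 j by rewrite !mxE.
    have ent' (v w : 'rV[R]_d) : (v - w) 0 j = v 0 j - w 0 j by rewrite !mxE.
    rewrite real_ofD mulmxDl ent; have := fD y Yy j; rewrite fy Gz -uy.
    have := hz0 j; have := cu j; rewrite (ent' c2).
    move: ((real_of R (zeta u) *m G') 0 j) ((real_of R z0 *m G') 0 j) => s t.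
    by rewrite !ler_norml /D2; clear - CG0 => /andP[? ?] /andP[? ?] /andP[? ?]; apply/andP; split; lra.
  rewrite by2; apply: hF2 => // j; have := fD y2 Yy2 j; rewrite fy2 Gz => hD.
  have inner : c2 0 j + D < (real_of R (zeta u + z0) *m G') 0 j < c2 0 j + n%:R - D.
    rewrite !ltNge -negb_or; apply: contra nU => nU; apply/bigfcupP.
    have [s hs] : exists s, cbox (lo (j, s)) (hi (j, s)) (real_of R (zeta u + z0) *m G').
      case/orP: nU => h; [exists true|exists false] => i; rewrite [X in X <= _]mxE [X in _ <= _ <= X]mxE /=;
        case: ifP => [/eqP ->|_]; try exact: loc; have := loc j; clear - h D00 D20 => /andP[? ?]; apply/andP; split; lra.
    by exists (j, s); [rewrite mem_enum|exact: (hS (j, s)).1].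
  move: hD inner; rewrite ler_norml; clear => /andP[? ?] /andP[? ?]; apply/andP; split; lra.
have zinj u v : u \in F1 -> v \in F1 -> zeta u = zeta v -> u = v.
  move=> uF vF e; have [y Yy [uy fy]] := hz u uF; have [y' Yy' [vy fy']] := hz v vF.
  have e3 : f y = f y' by rewrite fy fy' e.
  by rewrite uy vy (finj _ _ (mem_set Yy) (mem_set Yy') e3).
have backinj z z' : back z = back z' -> z = z'.
  have [y Yy [-> fy]] := hback z; have [y' Yy' [-> fy']] := hback z'.
  move=> /(can_inj (mulmxK Pu)) e; move: fy; rewrite e fy' => /(can_inj (mulmxK Gu)) /rowP e2.
  by apply/rowP => j; have := e2 j; rewrite !mxE => /intr_inj.
pose pu u := zeta u + z0 \in U.
pose A1 := [fset u in F1 | pu u]%fset.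
pose A2 := [fset u in F1 | ~~ pu u]%fset.
have cA : #|` F1| = (#|` A1| + #|` A2|)%N.
  rewrite -cardfsUI; have -> : (A1 `&` A2 = fset0)%fset.
    by apply/fsetP => u; rewrite !inE; case: (pu u); rewrite ?andbF.
  rewrite cardfs0 addn0; congr (#|` _|); apply/fsetP => u; rewrite !inE.
  by case: (pu u); rewrite ?andbT ?andbF ?orbF.
have c1le : (#|` A1| <= #|` U|)%N.
  pose zz u := zeta u + z0; have <- : #|` [fset zz u | u in A1]%fset| = #|` A1|.
    by apply: card_in_imfset => u v /=; rewrite !inE => /andP[uF _] /andP[vF _] /addIr; exact: zinj.
  apply: fsubset_leq_card; apply/fsubsetP => _ /imfsetP[u /= uA ->]; by move: uA; rewrite !inE => /andP[].
have c2le : (#|` A2| <= #|` F2|)%N.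
  pose bb u := back (zeta u + z0); have <- : #|` [fset bb u | u in A2]%fset| = #|` A2|.
    by apply: card_in_imfset => u v /=; rewrite !inE => /andP[uF _] /andP[vF _] /backinj /addIr; exact: zinj.
  apply: fsubset_leq_card; apply/fsubsetP => _ /imfsetP[u /= uA ->]; move: uA; rewrite !inE => /andP[uF nU].
  by have := mapsto u uF; rewrite (negbTE nU : (zeta u + z0 \in U) = false).
rewrite cA natrD addrC; apply: lerD; first by rewrite ler_nat.
by apply: le_trans U_le; rewrite ler_nat.
Qed.

End CubeCounts.

(** * Jumps of the visit counts *)

Lemma avoid_countable (R : realType) (X : countType) (f : X -> R) (al be : R) : al < be ->
  exists t, al < t < be /\ forall x, t != f x.
Proof.
move=> ab; apply: contrapT => no.
have cR : countable (range f) by apply: sub_countable (countableP setT); exact: card_image_le.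
have sub : `]al, be[%classic `<=` range f.
  move=> t; rewrite /= in_itv /= => tab; apply: contrapT => nt; apply: no; exists t; split=> // x.
  by apply/eqP => e; apply: nt; exists x.
have cI : countable (`]al, be[%classic : set R) by apply: sub_countable cR; exact: subset_card_le.
have := countable_lebesgue_measure0 cI.
by rewrite lebesgue_measure_itv /= lte_fin ab => /eqP; rewrite -EFinB eqe subr_eq0 => /eqP e; rewrite e ltxx in ab.
Qed.

Section IrrationalFunctional.
Variables (R : realType) (d r k : nat) (F : frame R d r k) (rk : (r < k)%N).
Hypothesis W_irr : forall m : 'rV[int]_k, m != 0 -> exists x : 'rV[R]_k, x *m ftop F = 0 /\ pairing m x != 0.

Lemma map_ratr_intr (m n : nat) (G : 'M[int]_(m, n)) : map_mx ratr (map_mx intr G : 'M[rat]_(m, n)) = real_of R G.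
Proof. by apply/matrixP => i j; rewrite !mxE ratr_int. Qed.

Lemma clear_denominators (n : nat) (q : 'rV[rat]_n) : q != 0 ->
  exists m : 'rV[int]_n, m != 0 /\ exists c : rat, map_mx intr m = c *: q.
Proof.
move=> q0; pose P := \prod_i denq (q 0 i).
pose m : 'rV[int]_n := \row_j (numq (q 0 j) * \prod_(i | i != j) denq (q 0 i)).
have P0 : P%:~R != 0 :> rat by rewrite intr_eq0; apply/prodf_neq0 => i _; rewrite denq_neq0.
have mE : map_mx intr m = P%:~R *: q.
  apply/rowP => j; have mj : m 0 j = numq (q 0 j) * \prod_(i | i != j) denq (q 0 i) by rewrite mxE.
  by rewrite [LHS]mxE mj [RHS]mxE /P [\prod_i _](bigD1 j) //= !intrM numqE; ring.
exists m; split; last by exists P%:~R.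
apply: contra q0 => /eqP m0; move: mE; rewrite m0 map_mx0 => /esym/eqP.
by rewrite scaler_eq0 (negbTE P0).
Qed.

(* Otherwise the subspace would be spanned by integer vectors, hence be orthogonal to one. *)
Lemma irrational_functional : exists l : 'cV[R]_r, l != 0 /\
  forall g : 'rV[int]_k, real_of R g *m ftop F = 0 -> real_of R g *m fbot F *m l = 0.
Proof.
pose P n := `[< exists q (G : 'M[int]_(q, k)), real_of R G *m ftop F = 0 /\ \rank (real_of R G *m fbot F) = n >].
have exP : exists n, P n.
  exists 0%N; apply/asboolP; exists 0%N, 0; split; first by apply/matrixP => -[].
  by apply/eqP; rewrite -leqn0 rank_leq_row.
have ubP n : P n -> (n <= r)%N by move=> /asboolP[q [G [_ <-]]]; exact: rank_leq_col.
case: (ex_maxnP exP ubP) => n /asboolP[q [G [GT Gn]]] hmax.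
set B := real_of R G *m fbot F in Gn *.
have GE : real_of R G = B *m finv2 F.
  by rewrite [LHS](frame_expand F) GT mul0mx add0r.
have [full|nfull] := boolP (row_full B).
  exfalso; have rG : (\rank (map_mx intr G : 'M[rat]_(q, k)) < k)%N.
    rewrite -(mxrank_map (ratr : rat -> R)) map_ratr_intr GE; apply: leq_ltn_trans rk.
    by apply: leq_trans (mulmx_max_rank _ _) _.
  have : kermx (map_mx intr G : 'M[rat]_(q, k))^T != 0.
    by rewrite kermx_eq0 /row_free mxrank_tr neq_ltn rG.
  case/rowV0Pn => u /sub_kermxP uG u0; have [m [m0 [c mc]]] := clear_denominators u0.
  have [x [xT]] := W_irr m0; case/eqP.
  have xE : x = x *m fbot F *m pinvmx B *m real_of R G.
    rewrite {1}[x](frame_expand F) xT mul0mx add0r GE mulmxA; congr (_ *m _).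
    by rewrite -mulmxA mulVpmx // mulmx1.
  have mG : real_of R m *m (real_of R G)^T = 0.
    have -> : real_of R m = map_mx ratr (map_mx intr m : 'rV[rat]_k) by rewrite map_ratr_intr.
    by rewrite -map_ratr_intr map_trmx -map_mxM mc -scalemxAl uG scaler0 map_mx0.
  have -> : pairing m x = (real_of R m *m x^T) 0 0.
    by rewrite mxE; apply: eq_bigr => j _; rewrite !mxE.
  by rewrite xE trmx_mul mulmxA mG mul0mx mxE.
have : cokermx B != 0 by rewrite cokermx_eq0.
rewrite -(inj_eq trmx_inj) trmx0 => /rowV0Pn[v /submxP[D vE] v0].
exists v^T; split; first by rewrite -(inj_eq trmx_inj) trmxK trmx0.
(* A further integer vector of [W] cannot raise the maximal rank [n], so its image lies in the row
   space of [B], which [v^T] annihilates. *)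
move=> g gT; pose G2 := col_mx G g.
have G2E : real_of R G2 = col_mx (real_of R G) (real_of R g) by rewrite /G2 /real_of map_col_mx.
have le : (\rank (real_of R G2 *m fbot F) <= n)%N.
  apply: hmax; apply/asboolP; exists (q + 1)%N, G2; split=> //.
  by rewrite G2E mul_col_mx GT gT col_mx0.
have sub : (real_of R g *m fbot F <= B)%MS.
  have BS := addsmxSl B (real_of R g *m fbot F).
  apply: submx_trans (addsmxSr B _) _; rewrite -(geq_leqif (mxrank_leqif_sup BS)).
  by rewrite addsmxE Gn; move: le; rewrite G2E mul_col_mx.
move/submxP: sub => [C ->]; rewrite vE trmx_mul trmxK.
by rewrite -[C *m B *m _]mulmxA [B *m _]mulmxA mulmx_coker mul0mx mulmx0.
Qed.

End IrrationalFunctional.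

Section Visits.
Variables (R : realType) (d r k : nat) (F : frame R d r k).
Implicit Types (H : 'M[R]_(d, r)) (a b : 'rV[R]_r).

Definition fdefect H (x : 'rV[R]_k) : 'rV[R]_r := x *m fbot F - x *m ftop F *m H.

Definition param_box a b : set 'rV[R]_r := [set t : 'rV[R]_r | forall i, a 0 i < t 0 i < a 0 i + b 0 i].

Definition in_cube (c : 'rV[R]_d) (N : nat) (u : 'rV[R]_d) := forall j, c 0 j <= u 0 j <= c 0 j + N%:R.

Lemma fdefectD H x y : fdefect H (x + y) = fdefect H x + fdefect H y.
Proof. by rewrite /fdefect !mulmxDl opprD addrACA. Qed.

Lemma fdefectN H x : fdefect H (- x) = - fdefect H x.
Proof. by rewrite /fdefect !mulNmx opprD. Qed.

Lemma fdefectB H x y : fdefect H (x - y) = fdefect H x - fdefect H y.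
Proof. by rewrite fdefectD fdefectN. Qed.

Lemma fdefect_on H x : fgraph_on F H x <-> fdefect H x = 0.
Proof. by split=> [h|/eqP]; rewrite /fgraph_on /fdefect; [rewrite h subrr|rewrite subr_eq0 => /eqP]. Qed.

(** Consider the integer vectors [g] of [W] that bring [y0] between the faces in all directions but
    [i]. As [l i 0 != 0], [hl] bounds the [i]-th coordinate of [g] by the others, so there are
    finitely many. Take the one whose translate of [y0] is highest in direction [i] and slide [y0]
    along [i] until that translate lies on the face [a]; all others are then on it or below. *)
Lemma entry_point a b (l : 'cV[R]_r) (i : 'I_r) (y0 : 'rV[R]_r) :
  (forall j, 0 < b 0 j < 1) -> l i 0 != 0 ->
  (forall g : 'rV[int]_k, real_of R g *m ftop F = 0 -> real_of R g *m fbot F *m l = 0) ->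
  param_box a b y0 ->
  exists (y : 'rV[R]_r) (g : 'rV[int]_k),
    [/\ forall j, j != i -> y 0 j = y0 0 j, real_of R g *m ftop F = 0,
        (forall j, j != i -> a 0 j < (y - real_of R g *m fbot F) 0 j < a 0 j + b 0 j),
        (y - real_of R g *m fbot F) 0 i = a 0 i &
        forall g' : 'rV[int]_k, real_of R g' *m ftop F = 0 ->
          (forall j, j != i -> a 0 j < (y - real_of R g' *m fbot F) 0 j < a 0 j + b 0 j) ->
          (y - real_of R g' *m fbot F) 0 i <= a 0 i].
Proof.
move=> b01 li hl y0b; pose om (g : 'rV[int]_k) := real_of R g *m fbot F.
pose good g := real_of R g *m ftop F = 0 /\ forall j, j != i -> a 0 j < (y0 - om g) 0 j < a 0 j + b 0 j.
have ent (u v : 'rV[R]_r) j : (u - v) 0 j = u 0 j - v 0 j by rewrite !mxE.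
have om1 g j : good g -> j != i -> `|om g 0 j| <= 1.
  move=> [_ h] ji; have := h j ji; have := y0b j; have := b01 j; rewrite ent.
  by move=> /andP[? ?] /andP[? ?] /andP[? ?]; rewrite ler_norml; apply/andP; split; lra.
pose M : R := 1 + \sum_j `|l j 0 / l i 0|.
have M1 : 1 <= M by rewrite lerDl sumr_ge0.
have omM g j : good g -> `|om g 0 j| <= M.
  move=> hg; have [->|ji] := eqVneq j i; last by apply: le_trans (om1 g j hg ji) M1.
  have := hl g hg.1; move/matrixP => /(_ 0 0); rewrite [RHS]mxE mxE (bigD1 i) //= => h0.
  have -> : om g 0 i = - \sum_(j | j != i) om g 0 j * (l j 0 / l i 0).
    apply: (mulIf li); rewrite mulNr mulr_suml; move/eqP: h0; rewrite addr_eq0 => /eqP ->; congr (- _).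
    by apply: eq_bigr => j' _; rewrite mulrA divfK.
  rewrite normrN; apply: le_trans (ler_norm_sum _ _ _) _.
  apply: (@le_trans _ _ (\sum_j `|l j 0 / l i 0|)); last by rewrite /M lerDr.
  rewrite big_mkcond; apply: ler_sum => j' _; case: ifP => // j'i.
  by rewrite normrM ler_piMl // om1.
have [C [C0 hC]] := mulmx_bound (finv2 F).
pose N := (Num.trunc (C * M)).+1; have NC : C * M < N%:R by exact: truncnS_gt.
have gN g : good g -> forall x, (absz (g 0%R x) <= N)%N.
  move=> hg x; have gE : real_of R g = om g *m finv2 F.
    by rewrite [LHS](frame_expand F) hg.1 mul0mx add0r.
  have := hC (om g) M (le_trans ler01 M1) (fun j => omM g j hg) x; rewrite -gE mxE.
  rewrite -intr_norm -abszE => h; rewrite -(ler_nat R); exact: le_trans h (ltW NC).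
pose zf := @int_window k N.
have zfP (z : 'rV[int]_k) : (forall x, (absz (z 0%R x) <= N)%N) -> exists h, z = zf h by exact: int_windowP.
have r00 : real_of R (0 : 'rV[int]_k) = 0 by apply/rowP => j; rewrite !mxE.
have g0 : good 0.
  by rewrite /good /om r00 !mul0mx subr0; split=> // j _; exact: y0b.
have [|h0 hh0] := zfP 0; first by move=> x; rewrite mxE.
have g0' : `[< good (zf h0) >] by rewrite -hh0; exact/asboolP.
case: (@arg_minP _ _ _ h0 (fun h => `[< good (zf h) >]) (fun h => om (zf h) 0 i) g0') => h /asboolP hg hmin.
exists (\row_j if j == i then a 0 i + om (zf h) 0 i else y0 0 j), (zf h); split.
- by move=> j /negbTE ji; rewrite mxE ji.
- exact: hg.1.
- by move=> j ji; rewrite ent mxE (negbTE ji) -ent; exact: hg.2.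
- by rewrite ent mxE eqxx addrK.
- move=> g' g'T hg'; rewrite ent mxE eqxx.
  have gg : good g'.
    by split=> // j ji; have := hg' j ji; rewrite !ent mxE (negbTE ji).
  have [h' hh'] := zfP g' (gN g' gg); have := hmin h'; rewrite -hh' => /(_ (introT (asboolP _) gg)).
  by rewrite -/(om g') => h2; rewrite lerBlDr lerD2l.
Qed.

(** A cube of side [N] sees few visits from [q1] and many from [q2]. [F1] bounds the former from
    above and [F2] the latter from below, for all matrices and base points within [e]. Visits are
    recorded by the [ftop] coordinates of their integer points, which do not move under the
    perturbation. *)
Definition robust_jump a b (n : nat) H :=
  exists (N : nat) (c : 'rV[R]_d) (q1 q2 : 'rV[R]_k) (F1 F2 : {fset 'rV[R]_d}) (e : R),
   [/\ (0 < N)%N, 0 < e,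
    forall H' q z, mclose e H H' -> mclose e q1 q -> in_cube c N ((real_of R z - q) *m ftop F) ->
      param_box a b (fdefect H' (q - real_of R z)) -> real_of R z *m ftop F \in F1,
    forall H' q u, mclose e H H' -> mclose e q2 q -> u \in F2 ->
      exists z, [/\ u = real_of R z *m ftop F, in_cube c N ((real_of R z - q) *m ftop F) &
         param_box a b (fdefect H' (q - real_of R z))] &
    (#|` F2|)%:R >= (#|` F1|)%:R + n%:R * N%:R ^+ d.-1 :> R].

Lemma robust_jump_open a b n H : robust_jump a b n H ->
  exists e : R, 0 < e /\ forall H', mclose e H H' -> robust_jump a b n H'.
Proof.
move=> [N [c [q1 [q2 [F1 [F2 [e [N0 e0 h1 h2 h3]]]]]]]].
exists (e / 2); split; first by rewrite divr_gt0.
move=> H' HH'; exists N, c, q1, q2, F1, F2, (e / 2); split=> //; first by rewrite divr_gt0.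
- move=> H2 q z HH2 hq; apply: (h1 H2).
    move=> i j; have -> : H i j - H2 i j = (H i j - H' i j) + (H' i j - H2 i j) by ring.
    by apply: le_lt_trans (ler_normD _ _) _; have := HH' i j; have := HH2 i j; lra.
  by move=> i j; have := hq i j; lra.
- move=> H2 q u HH2 hq; apply: (h2 H2).
    move=> i j; have -> : H i j - H2 i j = (H i j - H' i j) + (H' i j - H2 i j) by ring.
    by apply: le_lt_trans (ler_normD _ _) _; have := HH' i j; have := HH2 i j; lra.
  by move=> i j; have := hq i j; lra.
Qed.

Lemma fdefect_near H (x : 'rV[R]_k) (e : R) : 0 < e -> exists eta : R, 0 < eta /\
  forall H' y, mclose eta H H' -> mclose eta x y ->
    (forall j, `|fdefect H' y 0 j - fdefect H x 0 j| < e) /\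
    (forall j, `|(y *m ftop F) 0 j - (x *m ftop F) 0 j| < e).
Proof.
move=> e0; have [C1 [C10 hC1]] := mulmx_bound (fbot F); have [C2 [C20 hC2]] := mulmx_bound (ftop F).
pose hm : R := \sum_i \sum_j (`|H i j| + 1).
pose X : R := \sum_j `|(x *m ftop F) 0 j|.
have hm0 : 0 <= hm by apply: sumr_ge0 => i _; apply: sumr_ge0 => j _; rewrite addr_ge0.
have X0 : 0 <= X by exact: sumr_ge0.
pose K : R := C1 + C2 * hm + X + C2 + 1.
have Ch0 : 0 <= C2 * hm by rewrite mulr_ge0 // ltW.
have K0 : 0 < K by rewrite /K; lra.
pose eta := Num.min 1 (e / 2 / K).
have eta0 : 0 < eta by rewrite lt_min ltr01 !divr_gt0.
have eta1 : eta <= 1 by rewrite ge_min lexx.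
have etaK : K * eta <= e / 2.
  have : eta <= e / 2 / K by rewrite ge_min lexx orbT.
  by rewrite ler_pdivlMr // mulrC.
exists eta; split=> // H' y hH hy.
have yx j : `|(y - x) 0 j| <= eta by rewrite !mxE distrC; exact/ltW/hy.
have h1 j : `|((y - x) *m fbot F) 0 j| <= C1 * eta by apply: hC1 => //; exact: ltW.
have h2 j : `|((y - x) *m ftop F) 0 j| <= C2 * eta by apply: hC2 => //; exact: ltW.
have ent (p : nat) (u v : 'rV[R]_p) j : (u - v) 0 j = u 0 j - v 0 j by rewrite !mxE.
have p1 : 0 <= C1 * eta by rewrite mulr_ge0 // ltW.
have p2 : 0 <= C2 * eta by rewrite mulr_ge0 // ltW.
have p3 : 0 <= X * eta by rewrite mulr_ge0 // ltW.
have p4 : 0 <= C2 * eta * hm by rewrite mulr_ge0.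
have KE : K * eta = C1 * eta + C2 * eta * hm + X * eta + C2 * eta + eta by rewrite /K; ring.
rewrite KE in etaK; split=> j; last first.
  by rewrite -ent -mulmxBl; apply: le_lt_trans (h2 j) _; clear - etaK p1 p2 p3 p4 eta0 e0; lra.
have -> : fdefect H' y 0 j - fdefect H x 0 j = ((y - x) *m fbot F) 0 j -
    ((y - x) *m ftop F *m H') 0 j - (x *m ftop F *m (H' - H)) 0 j.
  have entN (u v w : 'rV[R]_r) : u 0 j - v 0 j - w 0 j = (u - v - w) 0 j by rewrite !mxE.
  rewrite entN -ent /fdefect; congr (_ 0 j).
  have alg (A1 B1 D1 E1 G1 : 'rV[R]_r) : A1 - B1 - (D1 - E1) = A1 - D1 - (B1 - G1) - (G1 - E1).
    by apply/rowP => i; rewrite !mxE; ring.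
  rewrite [(y - x) *m fbot F]mulmxBl [(y - x) *m ftop F]mulmxBl [_ *m H' in RHS]mulmxBl mulmxBr.
  by have := alg (y *m fbot F) (y *m ftop F *m H') (x *m fbot F) (x *m ftop F *m H) (x *m ftop F *m H') => ->.
have h3 : `|((y - x) *m ftop F *m H') 0 j| <= C2 * eta * hm.
  rewrite mxE; apply: le_trans (ler_norm_sum _ _ _) _; rewrite /hm mulr_sumr; apply: ler_sum => i _.
  rewrite normrM; apply: ler_pM => //.
  rewrite (bigD1 j) //= -[leLHS]addr0; apply: lerD; last by apply: sumr_ge0 => l _; rewrite addr_ge0.
  have -> : H' i j = H i j + (H' i j - H i j) by ring.
  apply: le_trans (ler_normD _ _) _; rewrite lerD2l distrC; apply: le_trans eta1; exact/ltW/hH.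
have h4 : `|(x *m ftop F *m (H' - H)) 0 j| <= X * eta.
  rewrite mxE; apply: le_trans (ler_norm_sum _ _ _) _; rewrite /X mulr_suml; apply: ler_sum => i _.
  by rewrite normrM ler_wpM2l // !mxE distrC; exact/ltW/hH.
apply: le_lt_trans (ler_normB _ _) _; apply: le_lt_trans (lerD (ler_normB _ _) h4) _.
have := h1 j; clear - h3 etaK p1 p2 p3 p4 eta0 e0.
move: (`|_|) (`|_|) h3 => u v h3 h; lra.
Qed.

End Visits.

Lemma gap_outside (R : realType) (lo hi x : R) : ~ (lo <= x <= hi) ->
  exists e : R, 0 < e /\ forall y, `|y - x| < e -> ~ (lo <= y <= hi).
Proof.
move=> /negP; rewrite negb_and -!ltNge => /orP[h|h].
  exists (lo - x); split=> [|y]; first by rewrite subr_gt0.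
  by rewrite ltr_norml => /andP[? ?] /andP[? ?]; lra.
exists (x - hi); split=> [|y]; first by rewrite subr_gt0.
by rewrite ltr_norml => /andP[? ?] /andP[? ?]; lra.
Qed.

Lemma gap_inside (R : realType) (n : nat) (lo hi x : 'rV[R]_n) : (forall j, lo 0 j < x 0 j < hi 0 j) ->
  exists e : R, 0 < e /\ forall y : 'rV[R]_n, (forall j, `|y 0 j - x 0 j| < e) -> forall j, lo 0 j < y 0 j < hi 0 j.
Proof.
move=> h; pose f j := Num.min (x 0 j - lo 0 j) (hi 0 j - x 0 j).
have f0 j : 0 < f j by have /andP[h1 h2] := h j; rewrite lt_min !subr_gt0 h1.
have [e [e0 he]] := positive_lower_bound (enum 'I_n) f0.
exists e; split=> // y hy j; have := he j (mem_enum _ _); rewrite le_min => /andP[h1 h2].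
by have := hy j; rewrite ltr_norml => /andP[h3 h4]; apply/andP; split; lra.
Qed.

(** * Elementary inequalities for the finite window of integer points *)

Section Estimates.
Variable R : realType.

Lemma cube_bound (c u N S : R) : 0 <= N -> `|c| <= S -> c <= u <= c + N -> `|u| <= S + N + 1.
Proof. by rewrite !ler_norml => ? /andP[? ?] /andP[? ?]; apply/andP; split; lra. Qed.

Lemma cube_bound2 (c u w N S : R) : 0 <= N -> `|w| < 1 -> c <= u - w <= c + N -> `|c| <= S -> `|u| <= S + N + 1.
Proof. by rewrite !ler_norml ltr_norml => ? /andP[? ?] /andP[? ?] /andP[? ?]; apply/andP; split; lra. Qed.

Lemma window_bound (a b y o t S : R) (dl : bool) : `|t| <= 1 -> a <= y - o + t * dl%:R <= a + b ->
  `|a| + `|b| + `|y| <= S -> `|o| <= S + 3.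
Proof.
have := ler_norm a; have := ler_norm (- a); have := ler_norm b; have := ler_norm (- b).
have := ler_norm y; have := ler_norm (- y); rewrite !normrN !ler_norml => ? ? ? ? ? ? /andP[? ?].
by case: dl; rewrite ?mulr1 ?mulr0 => /andP[? ?] ?; apply/andP; split; lra.
Qed.

Lemma window_bound2 (a b y o x w t S : R) (dl : bool) : `|t| <= 1 -> `|x - o| <= 1 ->
  `|w - (y + - t * dl%:R)| < 1 -> a < w - x < a + b -> `|a| + `|b| + `|y| <= S -> `|o| <= S + 3.
Proof.
have := ler_norm a; have := ler_norm (- a); have := ler_norm b; have := ler_norm (- b).
have := ler_norm y; have := ler_norm (- y); rewrite !normrN !ler_norml ltr_norml.
move=> ? ? ? ? ? ? /andP[? ?] /andP[? ?].
by case: dl; rewrite ?mulr1 ?mulr0 => /andP[? ?] /andP[? ?] ?; apply/andP; split; lra.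
Qed.

Lemma face_gap (v ab eta e : R) : 0 < eta -> 3 * eta <= e -> v - eta <= ab -> e <= `|v - ab| -> v + eta < ab.
Proof. by move=> ? ? ?; rewrite ler_normr => /orP[?|?]; lra. Qed.

End Estimates.

(** * Jumps at rational subspaces *)

Section RationalJump.
Variables (R : realType) (d r k : nat) (F : frame R d r k) (d1 : (1 < d)%N).
Variables (a b : 'rV[R]_r) (l : 'cV[R]_r) (i : 'I_r).
Hypothesis b01 : forall j, 0 < b 0 j < 1.
Hypothesis li : l i 0 != 0.
Hypothesis hl : forall g : 'rV[int]_k, real_of R g *m ftop F = 0 -> real_of R g *m fbot F *m l = 0.
Variables (Z : 'M[int]_(d, k)) (H : 'M[R]_(d, r)).
Hypothesis ZT : real_of R Z *m ftop F \in unitmx.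
Hypothesis ZH : forall m : 'rV[int]_d, fdefect F H (real_of R (m *m Z)) = 0.
Hypothesis b_generic : forall z : 'rV[int]_k, b 0 i != - fdefect F H (real_of R z) 0 i.

(** Each coordinate avoids countably many values, so that no integer translate meets the hyperplane
    of a face. *)
Lemma generic_point : exists y0 : 'rV[R]_r, param_box a b y0 /\
  forall (z : 'rV[int]_k) j, y0 0 j - fdefect F H (real_of R z) 0 j != a 0 j /\
     y0 0 j - fdefect F H (real_of R z) 0 j != a 0 j + b 0 j.
Proof.
have /choice[y hy] : forall j, exists t, a 0 j < t < a 0 j + b 0 j /\
   forall z : 'rV[int]_k, t - fdefect F H (real_of R z) 0 j != a 0 j /\ t - fdefect F H (real_of R z) 0 j != a 0 j + b 0 j.
  move=> j; have ab : a 0 j < a 0 j + b 0 j by have := b01 j => /andP[h _]; rewrite ltrDl.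
  have [t [tab ht]] := avoid_countable (X := ('rV[int]_k * bool)%type)
    (fun z => (if z.2 then a 0 j else a 0 j + b 0 j) + fdefect F H (real_of R z.1) 0 j) ab.
  exists t; split=> // z; split; rewrite subr_eq; [exact: (ht (z, true))|exact: (ht (z, false))].
exists (\row_j y j); split=> [j|z j]; rewrite mxE; first exact: (hy j).1.
exact: (hy j).2.
Qed.

Lemma generic_corner : exists c : 'rV[R]_d, forall (N : nat) (z : 'rV[int]_k) j,
  (real_of R z *m ftop F) 0 j != c 0 j /\ (real_of R z *m ftop F) 0 j != c 0 j + N%:R.
Proof.
have /choice[c hc] : forall j, exists t, 0 < t < 1 /\ forall z : nat * 'rV[int]_k,
    t != (real_of R z.2 *m ftop F) 0 j - z.1%:R.
  by move=> j; exact: (avoid_countable (X := (nat * 'rV[int]_k)%type) _ ltr01).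
exists (\row_j c j) => N z j; have -> : (\row_j c j) 0 j = c j by rewrite mxE.
split; rewrite eq_sym; first by have := (hc j).2 (0%N, z); rewrite subr0.
by have := (hc j).2 (N, z); apply: contra => /eqP e; rewrite -e addrK.
Qed.

Lemma lattice_cube_lower (G : 'M[R]_d) : G \in unitmx -> exists E : nat, (0 < E)%N /\
  forall (M : nat) (c : 'rV[R]_d), (0 < M)%N -> exists S : {fset 'rV[int]_d},
    #|` S| = (M ^ d)%N /\ forall m, m \in S -> forall j, c 0 j < (real_of R m *m G) 0 j < c 0 j + (E * M)%N%:R.
Proof.
move=> Gu; have [C [C0 hC]] := mulmx_bound G.
pose E := (Num.trunc (2 * C)).+1; have EC : 2 * C < E%:R by exact: truncnS_gt.
exists E; split=> // M c M0.
pose ctr : 'rV[R]_d := \row_j (c 0 j + (E * M)%:R / 2).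
pose p := ctr *m invmx G.
pose f (h : {ffun 'I_d -> 'I_M}) : 'rV[int]_d := \row_j (Num.floor (p 0 j) + (h j)%:Z).
exists [fset f h | h in {: {ffun 'I_d -> 'I_M}}]%fset; split.
  rewrite card_imfset /=; last first.
    by move=> h h' /rowP e; apply/ffunP => j; apply: val_inj; have := e j; rewrite !mxE => /addrI[].
  by rewrite -cardE card_ffun !card_ord.
move=> _ /imfsetP[h _ ->] j.
have ent (u v : 'rV[R]_d) i' : (u - v) 0 i' = u 0 i' - v 0 i' by rewrite !mxE.
have : `|((real_of R (f h) - p) *m G) 0 j| <= C * M%:R.
  apply: hC => // i'; rewrite ent [real_of R _ 0 i']mxE [f h 0 i']mxE rmorphD /=.
  have := floor_itv (p 0 i'); rewrite rmorphD /= => /andP[h1 h2].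
  have : (h i' : nat)%:R + 1 <= M%:R :> R by rewrite natr1 ler_nat.
  have : 0 <= (h i' : nat)%:R :> R by [].
  rewrite -[(Posz (h i'))%:~R]/((h i' : nat)%:R) => h3 h4.
  by rewrite ler_norml; apply/andP; split; lra.
rewrite mulmxBl ent /p mulmxKV // [ctr 0 j]mxE natrM.
have : 2 * C * M%:R < E%:R * M%:R by rewrite ltr_pM2r // ltr0n.
by rewrite ler_norml => h1 /andP[h2 h3]; apply/andP; split; lra.
Qed.

(** The base point moves from [q (- eta)] to [q eta] across the position [y] of [entry_point]. The
    coset through [g] of the lattice spanned by the rows of [Z] enters through the face [a] in
    direction [i], which gives [M ^ d] new points in the cube. Genericity of [b] keeps integer
    points off the opposite face, that of [y0] off the faces in other directions, so nothing leaves
    for small [eta]. [F1] is defined by closed conditions and [F2] by open ones, which makes the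
    bounds stable. *)
Theorem rational_robust_jump (n : nat) : robust_jump F a b n H.
Proof.
have [y0 [y0b y0g]] := generic_point; have [c hc] := generic_corner.
have [y [g [yj gT gj gi gmin]]] := entry_point b01 li hl y0b.
have [E [E0 hE]] := lattice_cube_lower ZT.
have d0 : (0 < d)%N by apply: ltnW.
(* Chosen so that the number [M ^ d] of entering points is at least [n * N ^ d.-1] with
   [N = E * M]. *)
pose M := (n * E ^ d.-1).+1; pose N := (E * M)%N; have N0 : (0 < N)%N by rewrite muln_gt0 E0.
pose om (z : 'rV[int]_k) := fdefect F H (real_of R z).
have ent (p : nat) (u v : 'rV[R]_p) j : (u - v) 0 j = u 0 j - v 0 j by rewrite !mxE.
have entD (p : nat) (u v : 'rV[R]_p) j : (u + v) 0 j = u 0 j + v 0 j by rewrite !mxE.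
have omg : om g = real_of R g *m fbot F by rewrite /om /fdefect gT mul0mx subr0.
have omW (z : 'rV[int]_k) : real_of R z *m ftop F = 0 -> om z = real_of R z *m fbot F.
  by move=> zT; rewrite /om /fdefect zT mul0mx subr0.
pose q (t : R) : 'rV[R]_k := (y + t *: delta_mx 0 i) *m finv2 F.
have qT t : q t *m ftop F = 0 by rewrite /q -mulmxA frame21 mulmx0.
have qd t : fdefect F H (q t) = y + t *: delta_mx 0 i.
  by rewrite /fdefect qT mul0mx subr0 /q -mulmxA frame22 mulmx1.
have dq t z j : fdefect F H (q t - real_of R z) 0 j = y 0 j - om z 0 j + t * (j == i)%:R.
  by rewrite fdefectB qd ent -/(om z) entD !mxE eqxx /=; ring.
(* All the integer points that can matter lie in a fixed bounded window. *)
pose Bd : R := \sum_j (`|a 0 j| + `|b 0 j| + `|y 0 j|) + 3.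
pose Bu : R := \sum_j `|c 0 j| + N%:R + 1.
have [C1 [C10 hC1]] := mulmx_bound H; have [C2 [C20 hC2]] := mulmx_bound (finv1 F).
have [C3 [C30 hC3]] := mulmx_bound (finv2 F).
have Bd0 : 0 <= Bd by rewrite addr_ge0 // sumr_ge0 // => j _; rewrite !addr_ge0.
have Bu0 : 0 <= Bu by rewrite !addr_ge0 // sumr_ge0.
pose Bz := C2 * Bu + C3 * (Bd + C1 * Bu).
pose K := (Num.trunc Bz).+1; have BK : Bz < K%:R by exact: truncnS_gt.
pose zf := @int_window k K.
have zfP (z : 'rV[int]_k) : (forall x, (absz (z 0%R x) <= K)%N) -> exists h, z = zf h by exact: int_windowP.
have window z : (forall j, `|(real_of R z *m ftop F) 0 j| <= Bu) -> (forall j, `|om z 0 j| <= Bd) ->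
    exists h, z = zf h.
  move=> hu hd; apply: zfP => x.
  have zO j : `|(real_of R z *m fbot F) 0 j| <= Bd + C1 * Bu.
    have -> : real_of R z *m fbot F = om z + real_of R z *m ftop F *m H by rewrite /om /fdefect subrK.
    by rewrite entD; apply: le_trans (ler_normD _ _) _; apply: lerD => //; exact: hC1.
  have : `|real_of R z 0 x| <= Bz.
    rewrite [real_of R z](frame_expand F) entD; apply: le_trans (ler_normD _ _) _; apply: lerD.
      exact: hC2.
    by apply: hC3 => //; rewrite addr_ge0 // mulr_ge0 // ltW.
  by rewrite mxE -intr_norm -abszE => h; rewrite -(ler_nat R); exact: le_trans h (ltW BK).
pose v z : R := y 0 i - om z 0 i.
have yi : y 0 i = a 0 i + om g 0 i by have := gi; rewrite -omg ent => h; lra.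
(* Otherwise [z] would be on the opposite face while [g] is on the face [a], and [z - g] would make
   [b 0 i] one of the excluded values. *)
have v_b z : v z != a 0 i + b 0 i.
  apply: contra (b_generic (z - g)) => /eqP h.
  have -> : real_of R (z - g) = real_of R z - real_of R g by apply/rowP => j; rewrite !mxE rmorphB.
  rewrite fdefectB ent -/(om z) -/(om g); apply/eqP; move: h; rewrite /v yi; lra.
have other z j : j != i -> y 0 j - om z 0 j != a 0 j /\ y 0 j - om z 0 j != a 0 j + b 0 j.
  by move=> ji; rewrite yj //; exact: y0g.
have [e1 [e10 he1]] := @positive_lower_bound R _ (enum {: {ffun 'I_k -> 'I_(2 * K + 1)}})
   (fun h => `|v (zf h) - (a 0 i + b 0 i)|)
   (fun h => etrans (normr_gt0 _) (etrans (congr1 negb (subr_eq0 _ _)) (v_b (zf h)))).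
have /andP[bi0 bi1] := b01 i.
(* Here [e1] bounds below the distance of the relevant points from the opposite face. The first
   bound keeps moved points from crossing that face ([face_gap]), the second keeps the entering
   points below it. *)
pose eta := Num.min (e1 / 3) (b 0 i / 2).
have eta0 : 0 < eta by rewrite lt_min !divr_gt0.
have eta1 : 3 * eta <= e1 by rewrite mulrC -ler_pdivlMr // ge_min lexx.
have etab : 2 * eta <= b 0 i by rewrite mulrC -ler_pdivlMr // ge_min lexx orbT.
pose closedP t z := in_cube c N (real_of R z *m ftop F) /\
   forall j, a 0 j <= fdefect F H (q t - real_of R z) 0 j <= a 0 j + b 0 j.
pose openP t z := (forall j, c 0 j < (real_of R z *m ftop F) 0 j < c 0 j + N%:R) /\
   forall j, a 0 j < fdefect F H (q t - real_of R z) 0 j < a 0 j + b 0 j.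
have zq z p : (real_of R z - p) *m ftop F = - ((p - real_of R z) *m ftop F) by rewrite -mulNmx opprB.
have qzT t z : (q t - real_of R z) *m ftop F = - (real_of R z *m ftop F) by rewrite mulmxBl qT sub0r.
have shiftz (e : R) t p z : mclose e (q t) p -> mclose e (q t - real_of R z) (p - real_of R z).
  by move=> h i1 j; have := h i1 j; rewrite !mxE opprD addrACA opprK [- _ + _]addrC subrr addr0.
have few_near t z : exists e : R, 0 < e /\ forall H' p, mclose e H H' -> mclose e (q t) p ->
    in_cube c N ((real_of R z - p) *m ftop F) -> param_box a b (fdefect F H' (p - real_of R z)) -> closedP t z.
  have [cl|ncl] := pselect (closedP t z); first by exists 1.
  have [x [e [e0 he]]] : exists (x : 'I_d + 'I_r) (e : R), 0 < e /\ match x with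
     | inl j => forall y', `|y' - (real_of R z *m ftop F) 0 j| < e -> ~ (c 0 j <= y' <= c 0 j + N%:R)
     | inr j => forall y', `|y' - fdefect F H (q t - real_of R z) 0 j| < e -> ~ (a 0 j <= y' <= a 0 j + b 0 j) end.
    have [/existsNP[j hj]|/contrapT cu] := pselect (~ in_cube c N (real_of R z *m ftop F)).
      by have [e he] := gap_outside hj; exists (inl j), e.
    have /existsNP[j hj] : ~ forall j, a 0 j <= fdefect F H (q t - real_of R z) 0 j <= a 0 j + b 0 j.
      by move=> h; apply: ncl.
    by have [e he] := gap_outside hj; exists (inr j), e.
  have [eta' [eta'0 hn]] := fdefect_near F H (q t - real_of R z) e0.
  exists eta'; split=> // H' p hH hp cu bx; exfalso.
  have [h1 h2] := hn H' (p - real_of R z) hH (shiftz _ _ _ z hp).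
  case: x he => j; last first.
    by move=> /(_ (fdefect F H' (p - real_of R z) 0 j) (h1 j)); apply; have /andP[? ?] := bx j; apply/andP; split; exact: ltW.
  move=> /(_ (((real_of R z - p) *m ftop F) 0 j)); apply; last exact: cu.
  have := h2 j; rewrite qzT zq; have entN (u : 'rV[R]_d) : (- u) 0 j = - u 0 j by rewrite mxE.
  by rewrite !entN opprK => h3; rewrite -opprD normrN.
have many_near t z : openP t z -> exists e : R, 0 < e /\ forall H' p, mclose e H H' -> mclose e (q t) p ->
    in_cube c N ((real_of R z - p) *m ftop F) /\ param_box a b (fdefect F H' (p - real_of R z)).
  move=> [cu bx].
  have [g1 [g10 hg1]] := @gap_inside R d c (\row_j (c 0 j + N%:R)) (real_of R z *m ftop F)
     (fun j => eq_ind_r (fun w => c 0 j < (real_of R z *m ftop F) 0 j < w) (cu j) (mxE _ _ _ _)).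
  have [g2 [g20 hg2]] := @gap_inside R r a (\row_j (a 0 j + b 0 j)) (fdefect F H (q t - real_of R z))
     (fun j => eq_ind_r (fun w => a 0 j < fdefect F H (q t - real_of R z) 0 j < w) (bx j) (mxE _ _ _ _)).
  have [eta' [eta'0 hn]] := fdefect_near F H (q t - real_of R z) (etrans (lt_min _ _ _) (introT andP (conj g10 g20))).
  exists eta'; split=> // H' p hH hp.
  have [h1 h2] := hn H' (p - real_of R z) hH (shiftz _ _ _ z hp).
  have u1 j : `|((real_of R z - p) *m ftop F) 0 j - (real_of R z *m ftop F) 0 j| < g1.
    have := h2 j; rewrite qzT zq lt_min => /andP[h3 _].
    have entN (u : 'rV[R]_d) : (- u) 0 j = - u 0 j by rewrite mxE.
    by move: h3; rewrite !entN opprK => h3; rewrite -opprD normrN.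
  have u2 j : `|fdefect F H' (p - real_of R z) 0 j - fdefect F H (q t - real_of R z) 0 j| < g2.
    by have := h1 j; rewrite lt_min => /andP[].
  split=> j.
    by have := hg1 _ u1 j; rewrite [(\row__ _) 0 j]mxE => /andP[? ?]; apply/andP; split; exact: ltW.
  by have := hg2 _ u2 j; rewrite [(\row__ _) 0 j]mxE.
have closed_open z h : z = zf h -> closedP (- eta) z -> openP eta z.
  move=> zh [cu bx]; split=> j.
    have /andP[h1 h2] := cu j; have [n1 n2] := hc N z j.
    by rewrite !lt_neqAle h1 h2 n2 eq_sym n1.
  have := bx j; rewrite !dq; case: (eqVneq j i) => [->|ji] /=; last first.
    rewrite !mulr0 !addr0 => /andP[h1 h2]; have [n1 n2] := other z j ji.
    by rewrite !lt_neqAle h1 h2 n2 eq_sym n1.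
  rewrite !mulr1 -/(v z) => /andP[h1 h2].
  have := he1 h (mem_enum _ _); rewrite -zh => h3.
  apply/andP; split; first by clear - d1 b01 li hl ZT ZH b_generic h1 eta0; lra.
  exact: face_gap eta0 eta1 h2 h3.
pose cls h := `[< closedP (- eta) (zf h) >]; pose opn h := `[< openP eta (zf h) >].
pose uT h := real_of R (zf h) *m ftop F.
pose F1 := [fset uT h | h in enum [pred h | cls h]]%fset; pose F2 := [fset uT h | h in enum [pred h | opn h]]%fset.
have [S [cS hS]] := hE M (c - real_of R g *m ftop F) isT.
pose zm m := g + m *m Z.
have zmT m : real_of R (zm m) *m ftop F = real_of R m *m (real_of R Z *m ftop F).
  by rewrite real_ofD mulmxDl gT add0r /real_of map_mxM mulmxA.
have zmo m : om (zm m) = om g by rewrite /om real_ofD fdefectD ZH addr0.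
have zmopen m : m \in S -> openP eta (zm m).
  move=> mS; split=> j; first by have := hS m mS j; rewrite zmT gT subr0.
  rewrite dq zmo; case: (eqVneq j i) => [->|ji] /=.
    by rewrite yi mulr1 addrK ltrDl eta0 ltrD2l /=; apply: lt_le_trans etab; rewrite ltr_pMl // ltr1n.
  by rewrite mulr0 addr0; have := gj j ji; rewrite -omg ent.
have bdW t z : `|t| <= 1 -> closedP t z -> exists h, z = zf h.
  move=> t1 [cu bx]; apply: window => j.
    have : `|c 0 j| <= \sum_j `|c 0 j| by rewrite (bigD1 j) //= lerDl sumr_ge0.
    move=> S1; exact: cube_bound (ler0n _ _) S1 (cu j).
  have S1 : `|a 0 j| + `|b 0 j| + `|y 0 j| <= \sum_j (`|a 0 j| + `|b 0 j| + `|y 0 j|).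
    by rewrite [leRHS](bigD1 j) //= lerDl sumr_ge0 // => l' _; rewrite !addr_ge0.
  by have := bx j; rewrite dq => bj; exact: (window_bound (dl := j == i) t1 bj S1).
have etale1 : `|eta| <= 1.
  by rewrite gtr0_norm //; apply: le_trans (ltW bi1); apply: le_trans etab; rewrite ler_peMl ?ler1n ?(ltW eta0).
have oc t z : openP t z -> closedP t z.
  by move=> [h1 h2]; split=> j; [have /andP[? ?] := h1 j|have /andP[? ?] := h2 j]; apply/andP; split; exact: ltW.
have newF2 m : m \in S -> real_of R (zm m) *m ftop F \in F2.
  move=> mS; have [h hh] := bdW _ _ etale1 (oc _ _ (zmopen m mS)).
  by apply/imfsetP; exists h; [rewrite /= mem_enum inE; apply/asboolP; rewrite -hh; exact: zmopen|rewrite hh].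
(* A point of [F1] with the same [ftop] coordinates differs from [m *m Z] by an integer vector of
   [W], which [entry_point] puts on or below the face [a]; seen from [q (- eta)] it is strictly
   below. *)
have newF1 m : m \in S -> real_of R (zm m) *m ftop F \notin F1.
  move=> mS; apply/negP => /imfsetP[h /=]; rewrite mem_enum inE => /asboolP cl e.
  pose g' := zf h - m *m Z.
  have g'E : real_of R g' = real_of R (zf h) - real_of R (m *m Z) by apply/rowP => j; rewrite !mxE rmorphB.
  have g'T : real_of R g' *m ftop F = 0.
    by rewrite g'E mulmxBl -/(uT h) -e zmT /real_of map_mxM mulmxA subrr.
  have omg' : om g' = om (zf h) by rewrite /om g'E fdefectB ZH subr0.
  have := cl.2 i; rewrite dq eqxx mulr1 => /andP[h1 _].
  have := gmin g' g'T; rewrite -omW // omg' ent => gm.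
  have : y 0 i - om (zf h) 0 i <= a 0 i.
    apply: gm => j ji; rewrite ent; have := cl.2 j; rewrite dq (negbTE ji) mulr0 addr0 => /andP[h3 h4].
    by have [n1 n2] := other (zf h) j ji; rewrite !lt_neqAle h3 h4 n2 eq_sym n1.
  clear - d1 b01 li hl ZT ZH b_generic h1 eta0; lra.
have F12 : (F1 `<=` F2)%fset.
  apply/fsubsetP => u0 /imfsetP[h /=]; rewrite mem_enum inE => /asboolP cl ->; apply/imfsetP; exists h => //.
  by rewrite /= mem_enum inE; apply/asboolP; exact: (closed_open _ h).
pose un m := real_of R (zm m) *m ftop F.
pose New := [fset un m | m in S]%fset.
have cNew : #|` New| = (M ^ d)%N.
  rewrite -cS; apply: card_in_imfset => m m' _ _; rewrite /un !zmT => /(can_inj (mulmxK ZT)) /rowP e.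
  by apply/rowP => j; have := e j; rewrite !mxE => /intr_inj.
have cF : (#|` F1| + M ^ d <= #|` F2|)%N.
  rewrite -cNew -cardfsUI; have -> : (F1 `&` New = fset0)%fset.
    apply/fsetP => u; rewrite !inE; apply/negbTE/negP => /andP[u1 /imfsetP[m /= mS ue]].
    by have := newF1 m mS; rewrite -/(un m) -ue u1.
  rewrite cardfs0 addn0; apply: fsubset_leq_card; rewrite fsubUset F12 /=.
  by apply/fsubsetP => _ /imfsetP[m /= mS ->]; exact: newF2.
have /choice[ef hef] : forall h, exists e : R, 0 < e /\ forall H' p, mclose e H H' -> mclose e (q (- eta)) p ->
    in_cube c N ((real_of R (zf h) - p) *m ftop F) -> param_box a b (fdefect F H' (p - real_of R (zf h))) -> closedP (- eta) (zf h).
  by move=> h; exact: few_near.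
have /choice[em hem] : forall h, exists e : R, 0 < e /\ (opn h -> forall H' p, mclose e H H' -> mclose e (q eta) p ->
    in_cube c N ((real_of R (zf h) - p) *m ftop F) /\ param_box a b (fdefect F H' (p - real_of R (zf h)))).
  move=> h; have [/asboolP o|no] := boolP (opn h); last by exists 1.
  by have [e [e0 he]] := many_near _ _ o; exists e.
have [ef' [ef'0 hef']] := @positive_lower_bound R _ (enum {: {ffun 'I_k -> 'I_(2 * K + 1)}}) ef (fun h => (hef h).1).
have [em' [em'0 hem']] := @positive_lower_bound R _ (enum {: {ffun 'I_k -> 'I_(2 * K + 1)}}) em (fun h => (hem h).1).
have [en [en0 hn]] := fdefect_near F H (q (- eta)) (ltr01 : 0 < (1 : R)).
(* Within [eH] of [H], the defect of an integer point with [ftop] coordinates at most [Bu] changes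
   by at most 1, so the point cannot escape the window. *)
pose eH : R := (d%:R * Bu + 1)^-1; have dB0 : 0 < d%:R * Bu + 1 by rewrite ltr_wpDl // mulr_ge0.
have eH0 : 0 < eH by rewrite invr_gt0.
pose e := Num.min (Num.min ef' em') (Num.min en eH).
have e0 : 0 < e by rewrite !lt_min ef'0 em'0 en0.
have [le1 le2 le3 le4] : [/\ e <= ef', e <= em', e <= en & e <= eH].
  by split; rewrite /e !ge_min lexx ?orbT.
have wk (m1 m2 : nat) (x x' : R) (A1 A2 : 'M[R]_(m1, m2)) : x <= x' -> mclose x A1 A2 -> mclose x' A1 A2.
  by move=> xx h i1 i2; exact: lt_le_trans (h i1 i2) xx.
exists N, c, (q (- eta)), (q eta), F1, F2, e; split=> //.
- move=> H' p z hH hp cu bx.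
  have [n1 n2] := hn H' p (wk _ _ _ _ _ _ le3 hH) (wk _ _ _ _ _ _ le3 hp).
  have hu j : `|(real_of R z *m ftop F) 0 j| <= Bu.
    have S1 : `|c 0 j| <= \sum_j `|c 0 j| by rewrite (bigD1 j) //= lerDl sumr_ge0.
    have := n2 j; rewrite qT [X in _ - X]mxE subr0 => n2j; have := cu j; rewrite mulmxBl ent => cj.
    exact: cube_bound2 (ler0n _ _) n2j cj S1.
  have hd j : `|om z 0 j| <= Bd.
    have dif : `|fdefect F H' (real_of R z) 0 j - om z 0 j| <= 1.
      rewrite /om /fdefect -ent opprB addrC addrA subrK -mulmxBr mxE.
      apply: le_trans (ler_norm_sum _ _ _) _; apply: (@le_trans _ _ (\sum_(j' < d) Bu * eH)).
        apply: ler_sum => j' _; rewrite normrM; apply: ler_pM => //.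
        by rewrite !mxE; apply: ltW; apply: lt_le_trans (hH j' j) le4.
      rewrite sumr_const card_ord -[_ *+ d]mulr_natl mulrA /eH ler_pdivrMr // mul1r lerDl //.
    have S1 : `|a 0 j| + `|b 0 j| + `|y 0 j| <= \sum_j (`|a 0 j| + `|b 0 j| + `|y 0 j|).
      by rewrite [leRHS](bigD1 j) //= lerDl sumr_ge0 // => l' _; rewrite !addr_ge0.
    have := bx j; rewrite fdefectB ent => bj; have := n1 j; rewrite qd (entD _ y).
    have -> : (- eta *: delta_mx 0 i : 'rV[R]_r) 0 j = - eta * (j == i)%:R by rewrite !mxE eqxx.
    by move=> n1j; exact: (window_bound2 etale1 dif n1j bj S1).
  have [h hh] := window z hu hd; apply/imfsetP; exists h; last by rewrite hh.
  rewrite /= mem_enum inE; apply/asboolP.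
  have l1 := le_trans le1 (hef' h (mem_enum _ _)).
  have X1 := (hef h).2 H' p (wk _ _ _ _ _ _ l1 hH) (wk _ _ _ _ _ _ l1 hp).
  by apply: X1; rewrite -hh.
- move=> H' p u hH hp /imfsetP[h /=]; rewrite mem_enum inE => oh ->; exists (zf h).
  have l2 := le_trans le2 (hem' h (mem_enum _ _)).
  by have [] := (hem h).2 oh H' p (wk _ _ _ _ _ _ l2 hH) (wk _ _ _ _ _ _ l2 hp).
apply: (@le_trans _ _ (#|` F1| + M ^ d)%N%:R); last by rewrite ler_nat.
rewrite natrD lerD2l -natrX -natrM ler_nat /N expnMn mulnA.
rewrite -[X in (_ <= _ ^ X)%N](prednK d0) expnS leq_mul2r; apply/orP; right.
exact: leqnSn.
Qed.

End RationalJump.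

(** * Density of orbits *)

Section OrbitDensity.
Variables (R : realType) (d k : nat).
Local Notation r := (k - d)%N.
Variables (s : 'I_d + 'I_r -> 'I_k) (A : 'M[R]_(d, r)) (s_bij : bijective s).

(** If all [pairing q (row i A)] were integers, completing [q] by their negatives would give an
    integer vector orthogonal to [V]. *)
Lemma irrational_rotation :
  (forall m : 'rV[int]_k, m != 0 -> exists v : 'rV[R]_k, defect s A v = 0 /\ pairing m v != 0) ->
  forall q : 'rV[int]_r, q != 0 -> exists i, expi (pairing q (row i A)) != 1.
Proof.
move=> irr q q0; apply: contrapT => no.
have /choice[n hn] : forall i, exists n : int, pairing q (row i A) = n%:~R.
  move=> i; apply: expi_eq1; apply: contrapT => h; apply: no; exists i; exact/eqP.
have [m [mf mb]] := parts_surj s_bij (\row_i - n i) q.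
have m0 : m != 0.
  apply: contra q0 => /eqP m0; apply/eqP; rewrite -mb m0; by apply/rowP => j; rewrite !mxE.
have [v [v0]] := irr m m0; case/eqP; rewrite (defect0_expand s_bij v0).
have pS (c : 'I_d -> R) (u : 'I_d -> 'rV[R]_k) : pairing m (\sum_i c i *: u i) = \sum_i c i * pairing m (u i).
  rewrite /pairing; under eq_bigr do rewrite summxE mulr_sumr.
  rewrite exchange_big; apply: eq_bigr => i _; rewrite mulr_sumr; apply: eq_bigr => j _.
  by rewrite mxE; ring.
rewrite pS big1 // => i _; rewrite pairing_graph // mb hn.
have -> : m 0 (s (inl i)) = - n i by move/rowP: mf => /(_ i); rewrite !mxE.
by rewrite rmorphN addNr mulr0.
Qed.

(** By [rotation_avg_lower] for the [e]-neighbourhood of [Z^r], some rotation brings the defect of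
    [x0 - q] close to an integer vector. The free coordinates are then matched exactly by moving
    along [V]. *)
Lemma orbit_dense (x0 q : 'rV[R]_k) (e : R) : 0 < e ->
  (forall q : 'rV[int]_r, q != 0 -> exists i, expi (pairing q (row i A)) != 1) ->
  exists (v : 'rV[R]_k) (z : 'rV[int]_k), defect s A v = 0 /\ mclose e q (x0 + v - real_of R z).
Proof.
move=> e0 irr; have [c0 [c00 [T0 hT]]] := rotation_avg_lower irr e0.
pose T := T0.+1; pose u (y : 'rV[R]_r) : R := (`[< exists n : 'rV[int]_r, forall j, `|(y - 0) 0 j - (n 0 j)%:~R| < e >])%:R.
pose xi := defect s A (x0 - q).
have u1 (y : 'rV[R]_r) : (exists n : 'rV[int]_r, forall j, `|(y - 0) 0 j - (n 0 j)%:~R| < e) -> 1 <= u y.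
  by move=> hy; rewrite /u (introT (asboolP _) hy).
have avg := hT T 1%N (leqnSn _) isT isT u 0 (fun y => ler0n _ _) u1 xi.
have [m [n hm]] : exists (m : {ffun 'I_1 * 'I_d -> 'I_T}) (n : 'rV[int]_r),
    forall j, `|(xi + rotate A (shift m) - 0) 0 j - (n 0 j)%:~R| < e.
  apply: contrapT => no; suff h0 : rotation_avg A T 1 u xi = 0 by move: avg; rewrite h0; lra.
  rewrite /rotation_avg big1 ?mulr0 // => m _; rewrite /u.
  case: asboolP => // -[n hn]; case: no; by exists m, n.
have [z [zf zb]] := parts_surj s_bij (shift m) n.
have dz : defect s A (real_of R z) = real_of R n - rotate A (shift m).
  by rewrite defect_real_of zf zb.
pose t := x0 - q - real_of R z.
have [v [vf vb]] := parts_surj s_bij (- free_part s t) (- free_part s t *m A).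
have v0 : defect s A v = 0 by rewrite /defect vf vb subrr.
exists v, z; split=> // i j; rewrite (ord1 i) {i}.
have ent (w w' : 'rV[R]_k) : (w - w') 0 j = w 0 j - w' 0 j by rewrite !mxE.
rewrite distrC -ent.
have -> : x0 + v - real_of R z - q = t + v by rewrite /t; apply/rowP => l; rewrite !mxE; ring.
move: j {ent}; apply: (index_cases s_bij) => j.
  have -> : (t + v) 0 (s (inl j)) = free_part s t 0 j + free_part s v 0 j by rewrite !mxE.
  by rewrite vf [X in _ + X]mxE subrr normr0.
have -> : (t + v) 0 (s (inr j)) = bound_part s t 0 j + bound_part s v 0 j by rewrite !mxE.
rewrite vb mulNmx [X in _ + X]mxE.
have ent (w w' : 'rV[R]_r) : w 0 j - w' 0 j = (w - w') 0 j by rewrite !mxE.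
rewrite ent -/(defect s A t) /t defectB -/xi dz.
have := hm j; rewrite subr0.
have -> : (n 0 j)%:~R = real_of R n 0 j by rewrite mxE.
have -> : xi - (real_of R n - rotate A (shift m)) = xi + rotate A (shift m) - real_of R n.
  by move: (xi) (rotate _ _) (real_of R n) => *; apply/rowP => l; rewrite !mxE; ring.
by rewrite ent.
Qed.

End OrbitDensity.

Section ParallelotopeVisits.
Variables (R : realType) (d k : nat) (d0 : (0 < d)%N) (dk : (d < k)%N).
Local Notation r := (k - d)%N.
Variables (s : 'I_d + 'I_r -> 'I_k) (A : 'M[R]_(d, r)) (s_bij : bijective s).
Variables (V : {vspace 'rV[R]_k}) (hV : V = <<graph_tuple s A>>%VS).
Hypothesis irr : forall m : 'rV[int]_k, m != 0 -> exists v : 'rV[R]_k, v \in V /\ pairing m v != 0.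
Variables (phi : 'Hom('rV[R]_d, 'rV[R]_k)) (hphi : limg phi = V).
Variables (F : frame R d r k) (H : 'M[R]_(d, r)) (hF : forall v, v \in V <-> fgraph_on F H v).
Variables (w : r.-tuple 'rV[R]_k) (hw : forall i, row i (finv2 F) = tnth w i).
Variables (a b : 'rV[R]_r) (b0 : forall i, 0 < b 0 i).
Variable x : torus R k.
Local Notation x0 := (repr x).
Local Notation Y := (phi @^-1` visit_set V (@torus_proj R k @` parallelotope w a b) x).

Lemma parallelotopeE : parallelotope w a b = [set t *m finv2 F | t in param_box a b].
Proof.
by apply/seteqP; split=> _ [t ht <-]; exists t => //; rewrite mulmx_sum_row; apply: eq_bigr => i _; rewrite hw.
Qed.

Lemma fdefect_finv2 t : fdefect F H (t *m finv2 F) = t.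
Proof. by rewrite /fdefect -!mulmxA frame22 [finv2 F *m _]mulmxA frame21 mul0mx mulmx0 subr0 mulmx1. Qed.

Lemma defect_finv2_eq0 t : defect s A (t *m finv2 F) = 0 -> t = 0.
Proof.
move=> h; have : t *m finv2 F \in V by rewrite (mem_graphV s_bij hV) h.
by rewrite hF fdefect_on fdefect_finv2.
Qed.

Lemma irr_expi : forall q : 'rV[int]_r, q != 0 -> exists i, expi (pairing q (row i A)) != 1.
Proof.
apply: (irrational_rotation s_bij) => m m0; have [v [vV vm]] := irr m0; exists v; split=> //.
by apply/eqP; rewrite -(mem_graphV s_bij hV).
Qed.

Lemma parallelotope_separated : separated_net Y.
Proof.
pose S : R := \sum_j (`|a 0 j| + `|b 0 j|).
have S0 : 0 <= S by rewrite sumr_ge0 // => j _; rewrite addr_ge0.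
have [C [C0 hC]] := mulmx_bound (finv2 F).
have CS0 : 0 <= C * S by rewrite mulr_ge0 // ltW.
have inj t1 t2 t3 t4 : defect s A (t1 *m finv2 F - t2 *m finv2 F) = defect s A (t3 *m finv2 F - t4 *m finv2 F) ->
    t1 *m finv2 F - t2 *m finv2 F = t3 *m finv2 F - t4 *m finv2 F.
  rewrite -!mulmxBl => /eqP; rewrite -subr_eq0 -defectB -mulmxBl => /eqP/defect_finv2_eq0/eqP.
  by rewrite subr_eq0 => /eqP ->.
apply: (@return_times_separated R d k d0 dk s A s_bij V hV phi hphi _ (C * S) CS0 _ _ x irr_expi).
- rewrite parallelotopeE => _ [t ht <-]; apply: hC => // i.
  apply: (@le_trans _ _ (`|a 0 i| + `|b 0 i|)); last first.
    by rewrite /S (bigD1 i) //= lerDl sumr_ge0 // => j _; rewrite addr_ge0.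
  have := ht i; have := ler_norm (a 0 i); have : - `|a 0 i| <= a 0 i by rewrite lerNl ler_normr lexx orbT.
  have := b0 i.
  move: (a 0 i) (b 0 i) (t 0 i) => u v t'; move=> v0; rewrite (gtr0_norm v0) => h2 h1 /andP[h3 h4].
  by rewrite ler_norml; apply/andP; split; lra.
- by rewrite parallelotopeE => _ _ _ _ [t1 _ <-] [t2 _ <-] [t3 _ <-] [t4 _ <-]; exact: inj.
pose Q : 'M[R]_r := \matrix_i defect s A (row i (finv2 F)).
have QE t : defect s A (t *m finv2 F) = t *m Q.
  rewrite mulmx_sum_row [RHS]mulmx_sum_row.
  have dS (I : finType) (f : I -> 'rV[R]_k) : defect s A (\sum_i f i) = \sum_i defect s A (f i).
    by apply: (big_morph _ (defectD s A)); rewrite -(scale0r (0 : 'rV[R]_k)) defectZ scale0r.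
  by rewrite dS; apply: eq_bigr => i _; rewrite defectZ rowK.
have Qu : Q \in unitmx.
  rewrite -row_free_unit -kermx_eq0; apply/rowV0P => u /sub_kermxP uQ.
  by apply: defect_finv2_eq0; rewrite QE.
have [D [D0 hD]] := mulmx_bound (invmx Q).
have [bm [bm0 hbm]] := @positive_lower_bound R _ (enum 'I_r) (fun j => b 0 j) b0.
pose t0 : 'rV[R]_r := \row_j (a 0 j + b 0 j / 2).
have rho0 : 0 < bm / 4 / D by rewrite !divr_gt0.
exists (t0 *m Q), (bm / 4 / D); split=> // e he.
exists (e *m invmx Q *m finv2 F); last by rewrite QE mulmxKV.
rewrite parallelotopeE; exists (e *m invmx Q) => // j.
have h : `|((e - t0 *m Q) *m invmx Q) 0 j| <= D * (bm / 4 / D).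
  by apply: hD => [|i]; [exact: ltW|rewrite mxE [X in _ + X]mxE; exact/ltW/he].
move: h; rewrite mulmxBl mulmxK // [D * _]mulrC divfK ?gt_eqF //.
have ent (u v : 'rV[R]_r) : (u - v) 0 j = u 0 j - v 0 j by rewrite !mxE.
rewrite (ent _ t0) [t0 0 j]mxE; have := hbm j (mem_enum _ _).
move: ((e *m invmx Q) 0 j) (a 0 j) (b 0 j) => u v v' h1; rewrite ler_norml => /andP[h2 h3].
by apply/andP; split; lra.
Qed.

Lemma visit_frame y y0 q z0 : phi y0 = q - x0 + real_of R z0 ->
  Y y <-> exists z, param_box a b (fdefect F H (q - real_of R z)) /\
    phi (y - y0) = real_of R z - q + fdefect F H (q - real_of R z) *m finv2 F.
Proof.
move=> ey0; have zB (z z' : 'rV[int]_k) : real_of R (z - z') = real_of R z - real_of R z'.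
  by apply/rowP => j; rewrite !mxE rmorphB.
have zD (z z' : 'rV[int]_k) : real_of R (z + z') = real_of R z + real_of R z'.
  by apply/rowP => j; rewrite !mxE rmorphD.
have phi0 u : fdefect F H (phi u) = 0 by apply/fdefect_on/hF; rewrite -hphi memv_img ?memvf.
rewrite (visitP s_bij hV hphi); split=> [[c [z [Bc e]]]|[z [hb e]]].
  exists (z - z0); move: Bc; rewrite parallelotopeE => -[t ht tc].
  have pE : phi (y - y0) = t *m finv2 F + (real_of R (z - z0) - q).
    by rewrite linearB /= e ey0 tc zB; apply/rowP => j; rewrite !mxE; ring.
  have tE : fdefect F H (q - real_of R (z - z0)) = t.
    have := phi0 (y - y0); rewrite pE fdefectD fdefect_finv2 -opprB fdefectN => /eqP.
    by rewrite addr_eq0 opprK => /eqP.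
  by rewrite tE pE addrC.
exists (fdefect F H (q - real_of R z) *m finv2 F), (z + z0); split.
  by rewrite parallelotopeE; exists (fdefect F H (q - real_of R z)).
have -> : phi y = phi (y - y0) + phi y0 by rewrite -linearD /= subrK.
by rewrite e ey0 zD; move: (_ *m finv2 F) => u; apply/rowP => j; rewrite !mxE; ring.
Qed.

Lemma chart_matrix : exists P : 'M[R]_d, P \in unitmx /\ forall y, phi y *m ftop F = y *m P.
Proof.
pose P : 'M[R]_d := (\matrix_i phi (delta_mx 0 i)) *m ftop F.
have PE y : phi y *m ftop F = y *m P.
  rewrite /P mulmxA; congr (_ *m _); rewrite {1}[y]row_sum_delta linear_sum mulmx_sum_row.
  by apply: eq_bigr => i _; rewrite linearZ rowK.
exists P; split=> //; rewrite -row_free_unit -kermx_eq0; apply/rowV0P => u /sub_kermxP uP.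
apply: (phi_inj d0 dk s_bij hV hphi); rewrite linear0.
have : fgraph_on F H (phi u) by apply/hF; rewrite -hphi memv_img ?memvf.
by rewrite /fgraph_on => h; rewrite [phi u](frame_expand F) h PE uP !mul0mx addr0.
Qed.

(** The orbit of [x] passes close to [q1] and to [q2], so two cubes of equal side [N] show the few
    and the many visits of a jump. With [n] above the constant of [BD_cube_counts] the two counts
    differ too much. *)
Lemma jumps_not_BD : (forall n, robust_jump F a b n H) -> ~ BD_to_lattice Y.
Proof.
move=> jump bd; have [P [Pu PE]] := chart_matrix.
have [C [C0 hC]] := BD_cube_counts Pu bd.
pose n := (Num.trunc C).+1; have Cn : C < n%:R by exact: truncnS_gt.
have [N [c [q1 [q2 [F1 [F2 [e [N0 e0 few many cnt]]]]]]]] := jump n.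
have HH : mclose e H H by move=> i j; rewrite subrr normr0.
have near q : exists y0 q' z0, mclose e q q' /\ phi y0 = q' - x0 + real_of R z0.
  have [v [z [v0 hv]]] := orbit_dense s_bij x0 q e0 irr_expi.
  have [y0 ey0] := phi_surj s_bij hV hphi v0.
  by exists y0, (x0 + v - real_of R z), z; split=> //; rewrite -ey0; apply/rowP => j; rewrite !mxE; ring.
have [y1 [q1' [z1 [cl1 e1]]]] := near q1; have [y2 [q2' [z2 [cl2 e2]]]] := near q2.
have top y y0 q z : phi (y - y0) = real_of R z - q + fdefect F H (q - real_of R z) *m finv2 F ->
    y *m P = (real_of R z - q) *m ftop F + y0 *m P.
  move=> h; have : phi (y - y0) *m ftop F = (real_of R z - q) *m ftop F.
    by rewrite h mulmxDl -[_ *m finv2 F *m _]mulmxA frame21 mulmx0 addr0.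
  by rewrite PE mulmxBl => /eqP; rewrite subr_eq => /eqP.
pose g1 (u : 'rV[R]_d) := u - q1' *m ftop F + y1 *m P.
pose g2 (u : 'rV[R]_d) := u - q2' *m ftop F + y2 *m P.
have hB : (#|` [fset g2 u | u in F2]%fset|)%:R <= (#|` [fset g1 u | u in F1]%fset|)%:R + C * N%:R ^+ d.-1.
  apply: (hC N (c + y2 *m P) (c + y1 *m P)) => //.
  - move=> _ /imfsetP[u /= uF2 ->]; have [z [uz cu bx]] := many H q2' u HH cl2 uF2.
    have on : fgraph_on F H (real_of R z - q2' + fdefect F H (q2' - real_of R z) *m finv2 F).
      by apply/fdefect_on; rewrite fdefectD fdefect_finv2 -fdefectD subrKA subrr /fdefect !mul0mx subr0.
    have [y ey] : exists y, real_of R z - q2' + fdefect F H (q2' - real_of R z) *m finv2 F = phi y.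
      by apply: (phi_surj s_bij hV hphi); apply/eqP; rewrite -(mem_graphV s_bij hV); exact/hF.
    have ph : phi (y + y2 - y2) = real_of R z - q2' + fdefect F H (q2' - real_of R z) *m finv2 F by rewrite addrK ey.
    have gE : g2 u = (y + y2) *m P by rewrite (top _ _ _ _ ph) /g2 uz mulmxBl.
    split; first by exists (y + y2) => //; apply/(visit_frame _ e2); exists z.
    move=> j; rewrite gE (top _ _ _ _ ph).
    have ent (u' v : 'rV[R]_d) : (u' + v) 0 j = u' 0 j + v 0 j by rewrite mxE.
    by rewrite !ent; have := cu j; move: (_ 0 j) (c 0 j) => t1 t2 /andP[? ?]; apply/andP; split; lra.
  - move=> y /(visit_frame _ e1)[z [bx ph]] cu; rewrite (top _ _ _ _ ph).
    apply/imfsetP; exists (real_of R z *m ftop F); last by rewrite /g1 mulmxBl.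
    apply: (few H q1' z HH cl1) => // j; have := cu j; rewrite (top _ _ _ _ ph).
    have ent (u' v : 'rV[R]_d) : (u' + v) 0 j = u' 0 j + v 0 j by rewrite mxE.
    by rewrite !ent; move: (_ 0 j) (c 0 j) => t1 t2 /andP[? ?]; apply/andP; split; lra.
have g2i : injective g2 by move=> u u' /addIr/addIr.
have c2 : #|` [fset g2 u | u in F2]%fset| = #|` F2| by apply: card_in_imfset => u u' _ _ /g2i.
have c1 : (#|` [fset g1 u | u in F1]%fset|)%:R <= (#|` F1|)%:R :> R by rewrite ler_nat; exact: leq_imfset_card.
have Nd : 0 < (N%:R : R) ^+ d.-1 by rewrite exprn_gt0 // ltr0n.
have : C * N%:R ^+ d.-1 < n%:R * N%:R ^+ d.-1 by rewrite ltr_pM2r.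
move: hB cnt; rewrite c2; lra.
Qed.

End ParallelotopeVisits.

(** * Topology of the Grassmannian *)

Section GrassmannianFrames.
Variables (R : realType) (d k : nat) (d0 : (0 < d)%N) (dk : (d < k)%N).
Local Notation r := (k - d)%N.
Local Notation sign := ('I_d + 'I_r)%type.

(** Here [finv2] is the given basis of [W], [finv1] a basis of a complement, and [ftop], [fbot] are
    the blocks of the inverse matrix. *)
Lemma basis_frame (W : {vspace 'rV[R]_k}) (w : r.-tuple 'rV[R]_k) : basis_of W w ->
  exists F : frame R d r k, (forall i, row i (finv2 F) = tnth w i) /\ (forall u, u \in W <-> u *m ftop F = 0).
Proof.
move=> bw; have fw := basis_free bw; pose Wm : 'M[R]_(r, k) := \matrix_i tnth w i.
have WmE u : u *m Wm = \sum_i u 0 i *: tnth w i.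
  by rewrite mulmx_sum_row; apply: eq_bigr => i _; rewrite rowK.
have Wfree : row_free Wm.
  rewrite -kermx_eq0; apply/rowV0P => u /sub_kermxP; rewrite WmE => u0.
  have /freeP/(_ (fun i => u 0 i)) h := fw; apply/rowP => i; rewrite mxE; apply: h.
  by rewrite -[RHS]u0; apply: eq_bigr => j _; rewrite -tnth_nth.
have Wr : \rank Wm = r by apply/eqP.
have [Cm hC] : exists Cm : 'M[R]_(d, k), (Cm :=: Wm^C)%MS.
  have e : \rank (Wm^C)%MS = d by rewrite mxrank_compl Wr subKn // ltnW.
  by move: (row_base (Wm^C)%MS) (eq_row_base (Wm^C)%MS); rewrite e => Cm hC; exists Cm.
pose S := col_mx Cm Wm.
have Sr : \rank S = k.
  have h : \rank (Cm + Wm)%MS = \rank (Wm^C + Wm)%MS by rewrite (adds_eqmx hC (eqmx_refl Wm)).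
  by rewrite /S -addsmxE h addsmxC; exact/eqP/addsmx_compl_full.
have Sfull : row_full S by rewrite /row_full Sr.
have Sfree : row_free S by rewrite /row_free Sr subnKC // ltnW.
pose N := pinvmx S.
have e1 : lsubmx N *m Cm + rsubmx N *m Wm = 1%:M by rewrite -mul_row_col hsubmxK mulVpmx.
have e2 : col_mx Cm Wm *m row_mx (lsubmx N) (rsubmx N) = 1%:M by rewrite hsubmxK mulmxVp.
move: e2; rewrite mul_col_row scalar_mx_block => /eq_block_mx[e11 e12 e21 e22].
exists (Frame e1 e11 e12 e21 e22); split=> [i|u] /=; first by rewrite rowK.
split=> [uW|u0].
  rewrite (coord_basis bw uW); have -> : \sum_(i < r) coord w i u *: w`_i = (\row_i coord w i u) *m Wm.
    by rewrite WmE; apply: eq_bigr => i _; rewrite mxE -tnth_nth.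
  by rewrite -mulmxA e21 mulmx0.
have -> : u = (u *m rsubmx N) *m Wm by rewrite -{1}[u]mulmx1 -e1 mulmxDr !mulmxA u0 mul0mx add0r.
by rewrite WmE memv_suml // => i _; apply/memvZ/(basis_mem bw)/mem_tnth.
Qed.

Lemma chart_frame (s : 'I_d + 'I_r -> 'I_k) : bijective s ->
  exists F : frame R d r k, (forall x, x *m ftop F = free_part s x) /\ (forall x, x *m fbot F = bound_part s x).
Proof.
move=> sb; have si := bij_inj sb.
pose E (I : finType) (f : I -> 'I_k) x i : R := (x == f i)%:R.
have sum1 (I : finType) (f : I -> 'I_k) (g : 'I_k -> R) i : \sum_x g x * E I f x i = g (f i).
  rewrite (bigD1 (f i)) //= /E eqxx mulr1 big1 ?addr0 // => x /negbTE xn.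
  by rewrite xn mulr0.
pose T : 'M[R]_(k, d) := \matrix_(x, i) E 'I_d (s \o inl) x i.
pose B : 'M[R]_(k, r) := \matrix_(x, i) E 'I_r (s \o inr) x i.
have e0 : T *m T^T + B *m B^T = 1%:M.
  apply/matrixP => x y; rewrite !mxE.
  transitivity (\sum_(t : 'I_d + 'I_r) (x == s t)%:R * (y == s t)%:R : R).
    by rewrite big_sumType /=; congr (_ + _); apply: eq_bigr => i _; rewrite !mxE.
  rewrite -(reindex s (P := xpredT) (F := fun z => (x == z)%:R * (y == z)%:R)) /=; last exact: onW_bij.
  rewrite (bigD1 x) //= eqxx mul1r big1 ?addr0 ?[y == x]eq_sym // => z /negbTE zx.
  by rewrite [x == z]eq_sym zx mul0r.
have mT (m : nat) (x : 'M[R]_(m, k)) i j : (x *m T) i j = x i (s (inl j)).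
  by rewrite mxE -[RHS](sum1 _ (s \o inl) (x i)); apply: eq_bigr => l _; rewrite [T l j]mxE.
have mB (m : nat) (x : 'M[R]_(m, k)) i j : (x *m B) i j = x i (s (inr j)).
  by rewrite mxE -[RHS](sum1 _ (s \o inr) (x i)); apply: eq_bigr => l _; rewrite [B l j]mxE.
have TE i j : T^T i (s (inl j)) = (i == j)%:R by rewrite !mxE /E /= (inj_eq si) eq_sym.
have e11 : T^T *m T = 1%:M by apply/matrixP => i j; rewrite mT TE [RHS]mxE.
have e12 : T^T *m B = 0 by apply/matrixP => i j; rewrite mB !mxE /E /= (inj_eq si).
have e21 : B^T *m T = 0 by apply/matrixP => i j; rewrite mT !mxE /E /= (inj_eq si).
have e22 : B^T *m B = 1%:M by apply/matrixP => i j; rewrite mB !mxE /E /= (inj_eq si) eq_sym.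
exists (Frame e0 e11 e12 e21 e22); split=> x; apply/rowP => j; rewrite [RHS]mxE; [exact: mT|exact: mB].
Qed.

Lemma chart_frame_graph (s : 'I_d + 'I_r -> 'I_k) A (F : frame R d r k) : bijective s ->
  (forall x, x *m ftop F = free_part s x) -> (forall x, x *m fbot F = bound_part s x) ->
  forall v, v \in <<graph_tuple s A>>%VS <-> fgraph_on F A v.
Proof.
by move=> sb hT hB v; rewrite graph_span // /defect /fgraph_on hT hB subr_eq0; split=> /eqP.
Qed.

Lemma grassmannian_chart (V : grassmannian R d k) : exists (s : 'I_d + 'I_r -> 'I_k) A (hs : bijective s),
  V = grass_chart hs A.
Proof.
have /eqP dV : \dim V == d by case: V.
have [X bX] : exists X : d.-tuple 'rV[R]_k, basis_of V X.
  by have := vbasisP V; move: (vbasis V); rewrite dV => X bX; exists X.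
have [|s [A [sb e]]] := @chart_exists R d k d0 dk X.
  move=> u u0; have /freeP/(_ (fun i => u 0 i)) h := basis_free bX.
  by apply/rowP => i; rewrite mxE; apply: h; rewrite -[RHS]u0; apply: eq_bigr => j _; rewrite -tnth_nth.
exists s, A, sb; apply: val_inj => /=; rewrite -e; exact/esym/span_basis.
Qed.

Variable F : frame R d r k.

Definition frame_set (P : 'M[R]_(d, r) -> Prop) : set (grassmannian R d k) :=
  [set V : grassmannian R d k | exists H, P H /\ forall v, v \in (V : {vspace _}) <-> fgraph_on F H v].

(** Openness is tested in every coordinate chart; [frame_change] turns matrices near [A] there into
    matrices near [H] in the frame [F]. *)
Lemma frame_set_open P : (forall H, P H -> exists e : R, 0 < e /\ forall H', mclose e H H' -> P H') ->
  open (frame_set P).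
Proof.
move=> oP; change (grass_open (frame_set P)) => s hs.
have [Fs [hT hB]] := chart_frame hs; apply: mclose_open => A [H [PH hH]].
have [e [e0 he]] := oP H PH.
have gA A' := @chart_frame_graph s A' Fs hs hT hB.
have same x : fgraph_on Fs A x <-> fgraph_on F H x by rewrite -hH; exact: iff_sym (gA A x).
have [eta [eta0 heta]] := frame_change same e0; exists eta; split=> // A' /heta[H' [HH' hH']].
by exists H'; split=> [|v]; [exact: he|rewrite -hH'; exact: gA].
Qed.

(** Starting in a chart that meets the open set, [transverse_dense] first moves [A] to a subspace
    that is also a graph in [F]. Its matrix there is perturbed into [P], and [frame_change] returns
    to the chart. *)
Lemma frame_set_dense (P : 'M[R]_(d, r) -> Prop) : (forall H (e : R), 0 < e -> exists H', mclose e H H' /\ P H') ->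
  dense (frame_set P).
Proof.
move=> dP O [V0 OV0] oO; have [s [A [hs VA]]] := grassmannian_chart V0.
have [Fs [hT hB]] := chart_frame hs; have gA A' := @chart_frame_graph s A' Fs hs hT hB.
have [|e [e0 he]] := open_mclose (oO s hs) (X := A); first by rewrite /= -VA.
have e20 : 0 < e / 2 by rewrite divr_gt0.
have [A1 [AA1 tr]] := transverse_dense Fs F A e20.
have same := same_graph tr; set H1 := invmx _ *m _ in same.
have [eta [eta0 heta]] := frame_change (fun x => iff_sym (same x)) e20.
have [H2 [HH2 PH2]] := dP H1 eta eta0; have [A2 [AA2 same2]] := heta H2 HH2.
exists (grass_chart hs A2); split.
  apply: he => i j; have -> : A i j - A2 i j = (A i j - A1 i j) + (A1 i j - A2 i j) by ring.
  by apply: le_lt_trans (ler_normD _ _) _; have := AA1 i j; have := AA2 i j; lra.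
by exists H2; split=> // v; rewrite same2; exact: gA.
Qed.

(** A subspace determines its matrix in the frame [F], so the conditions [P n] may be intersected
    before or after passing to subspaces. *)
Lemma frame_set_Gdelta (P : nat -> 'M[R]_(d, r) -> Prop) :
  (forall n H, P n H -> exists e : R, 0 < e /\ forall H', mclose e H H' -> P n H') ->
  Gdelta (frame_set (fun H => forall n, P n H)).
Proof.
move=> oP; exists (fun n => frame_set (P n)) => [n|]; first by apply: frame_set_open; exact: oP.
apply/seteqP; split=> V; first by move=> [H [PH hH]] n _; exists H.
move=> h; have [H [P0 hH]] := h 0%N I; exists H; split=> // n.
have [H' [PH' hH']] := h n I; suff <- : H' = H by [].
have [_ ->] := @same_graph_unit R d r k F F H H' (fun x => iff_trans (iff_sym (hH x)) (hH' x)).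
by rewrite fgraph_top fgraph_bot invmx1 mul1mx.
Qed.

End GrassmannianFrames.

HB.instance Definition _ (R : realType) (m n : nat) := Complete.on 'M[R]_(m, n).

Lemma baire_matrix (R : realType) (m n : nat) (P : nat -> 'M[R]_(m, n) -> Prop) :
  (forall i H, P i H -> exists e : R, 0 < e /\ forall H', mclose e H H' -> P i H') ->
  (forall i H (e : R), 0 < e -> exists H', mclose e H H' /\ P i H') ->
  forall H (e : R), 0 < e -> exists H', mclose e H H' /\ forall i, P i H'.
Proof.
move=> oP dP H e e0.
have D : dense (\bigcap_i [set H | P i H]).
  apply: (@Baire R 'M[R]_(m, n)) => i.
  split; first by apply: mclose_open => H' PH'; exact: oP.
  move=> O [H0 OH0] oO; have [e' [e'0 he']] := open_mclose oO OH0; have [H' [h1 h2]] := dP i H0 e' e'0.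
  by exists H'; split=> //; exact: he'.
have [||H' [/= h1 h2]] := D [set H' | mclose e H H'].
- by exists H => i j; rewrite subrr normr0.
- apply: mclose_open => X hX; have [e' [e'0 he']] := @positive_lower_bound R _ (enum {: 'I_m * 'I_n})
    (fun x => e - `|H x.1 x.2 - X x.1 x.2|) (fun x => etrans (subr_gt0 _ _) (hX x.1 x.2)).
  exists e'; split=> // Z hZ i j; have := he' (i, j) (mem_enum _ _) => /= h.
  have -> : H i j - Z i j = (H i j - X i j) + (X i j - Z i j) by ring.
  by apply: le_lt_trans (ler_normD _ _) _; have := hZ i j; lra.
by exists H'; split=> // i; exact: h2.
Qed.

Section TotalIrrationality.
Variables (R : realType) (k : nat).

Lemma pairing_real_of (m : 'rV[int]_k) (x : 'rV[R]_k) : pairing m x = (x *m (real_of R m)^T) 0 0.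
Proof. by rewrite mxE; apply: eq_bigr => j _; rewrite !mxE mulrC. Qed.

Lemma between_integers (n : int) (t : R) : n%:~R < t < n%:~R + 1 -> t \isn't a Num.int.
Proof.
move=> /andP[h1 h2]; apply/negP => /intrP[z tz]; move: h1 h2; rewrite tz ltr_int.
have -> : (n%:~R + 1 : R) = (n + 1)%:~R by rewrite rmorphD.
by rewrite ltr_int; lia.
Qed.

(** Were [m] orthogonal to [W], the character of the torus given by [m] would be trivial on the
    image of [W], which would miss the nonempty open set where that character is not trivial. *)
Lemma totally_irrational_pairing (W : {vspace 'rV[R]_k}) (m : 'rV[int]_k) :
  totally_irrational W -> m != 0 -> exists u, u \in W /\ pairing m u != 0.
Proof.
move=> irr m0; apply: contrapT => no.
have m_W u : u \in W -> pairing m u = 0.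
  by move=> uW; apply/eqP; apply: contrapT => h; apply: no; exists u; split=> //; exact/negP.
have [j mj] : exists j, m 0 j != 0.
  apply: contrapT => h; case/eqP: m0; apply/rowP => j; rewrite mxE; apply/eqP.
  by apply: contrapT => h2; apply: h; exists j; exact/negP.
pose U : set (torus R k) := [set t | pairing m (repr t) \isn't a Num.int].
have pint (z : 'rV[int]_k) : pairing m (real_of R z) \is a Num.int.
  by apply: rpred_sum => i _; rewrite mxE -intrM intr_int.
have UE y : U (torus_proj y) <-> pairing m y \isn't a Num.int.
  have /torus_projP/integer_translateP[z e] : torus_proj (repr (torus_proj y)) = torus_proj y.
    by rewrite /torus_proj reprK.
  by rewrite /U /= e pairingD (rpredDr _ (pint z)).
have oU : open U.
  change (open (@torus_proj R k @^-1` U)); apply: mclose_open => y /UE yn.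
  have /andP[h1 h2] := floor_itv (pairing m y); rewrite rmorphD /= in h2; set n := Num.floor _ in h1 h2.
  have h3 : n%:~R < pairing m y.
    by rewrite lt_neqAle h1 andbT; apply: contra yn => /eqP <-; exact: intr_int.
  have e0 : 0 < Num.min (pairing m y - n%:~R) (n%:~R + 1 - pairing m y) by rewrite lt_min !subr_gt0 h3.
  have [eta [eta0 heta]] := @mclose_mull R 1 _ _ (real_of R m)^T _ e0.
  exists eta; split=> // y' /heta /(_ 0 0); rewrite -!pairing_real_of => h.
  apply/UE/(between_integers (n := n)); move: h; rewrite lt_min !ltr_norml => /andP[/andP[? ?] /andP[? ?]].
  by apply/andP; split; lra.
have [|t [tU [u uW ut]]] := irr U _ oU; last first.
  by move: tU; rewrite -ut => /UE; rewrite m_W ?rpred0.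
pose y : 'rV[R]_k := (2 * (m 0 j)%:~R)^-1 *: delta_mx 0 j.
exists (torus_proj y); apply/UE/(between_integers (n := 0)).
have -> : pairing m y = 2^-1.
  rewrite /pairing (bigD1 j) //= big1 => [|l /negbTE lj]; last by rewrite !mxE lj !mulr0.
  by rewrite addr0 !mxE !eqxx mulr1; field; rewrite intr_eq0.
by apply/andP; split; lra.
Qed.

End TotalIrrationality.

Section Parallelotopes.
Variables (R : realType) (d k : nat) (d1 : (1 < d)%N) (dk : (d < k)%N).
Local Notation r := (k - d)%N.
Variables (W : {vspace 'rV[R]_k}) (w : r.-tuple 'rV[R]_k).
Hypotheses (W_irr : totally_irrational W).
Variable F : frame R d r k.
Hypotheses (hw : forall i, row i (finv2 F) = tnth w i) (hW : forall u, u \in W <-> u *m ftop F = 0).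

(** Says that the subspace with matrix [H] is rational: the rows of [Z] are integer vectors spanning
    it. *)
Definition meets_integers (H : 'M[R]_(d, r)) (Z : 'M[int]_(d, k)) :=
  real_of R Z *m ftop F \in unitmx /\ forall m : 'rV[int]_d, fdefect F H (real_of R (m *m Z)) = 0.

(** Round [N] times a basis of the subspace to integer vectors; for large [N] their span is close to
    it. *)
Lemma meets_integers_dense H (e : R) : 0 < e -> exists H', mclose e H H' /\ exists Z, meets_integers H' Z.
Proof.
move=> e0; pose X := fgraph_mx F H.
have Xu : X *m ftop F \in unitmx by rewrite fgraph_top unitmx1.
have [e1 [e10 h1]] := mclose_solve (X *m fbot F) Xu e0.
have [e2 [e20 h2]] := @mclose_mull R d _ _ (ftop F) e1 e10.
have [e3 [e30 h3]] := @mclose_mull R d _ _ (fbot F) e1 e10.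
pose et := Num.min e2 e3; have et0 : 0 < et by rewrite lt_min e20.
pose N := (Num.trunc et^-1).+1; have Ne : et^-1 < N%:R by exact: truncnS_gt.
have N0 : 0 < (N%:R : R) by rewrite ltr0n.
pose Z : 'M[int]_(d, k) := \matrix_(i, j) Num.floor (N%:R * X i j).
pose X' := N%:R^-1 *: real_of R Z.
have ZE : real_of R Z = N%:R *: X' by rewrite /X' scalerA divff ?scale1r // gt_eqF.
have cl : mclose et X X'.
  move=> i j; have := floor_itv (N%:R * X i j).
  have -> : Num.floor (N%:R * X i j) = Z i j by rewrite [RHS]mxE.
  have -> : X' i j = N%:R^-1 * (Z i j)%:~R by rewrite [LHS]mxE [real_of R Z i j]mxE.
  rewrite rmorphD /=; move: (X i j) ((Z i j)%:~R : R) => t z /andP[z1 z2].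
  have -> : t - N%:R^-1 * z = (N%:R * t - z) / N%:R by field; rewrite gt_eqF.
  rewrite ger0_norm ?divr_ge0 ?subr_ge0 ?(ltW N0) // ltr_pdivrMr //.
  apply: (@lt_trans _ _ 1); first by lra.
  by rewrite mulrC -ltr_pdivrMr // div1r.
have [m2 m3] : et <= e2 /\ et <= e3 by rewrite /et !ge_min !lexx orbT.
have [X'u hH] := h1 _ _ (h2 _ _ (fun i j => lt_le_trans (cl i j) m2)) (h3 _ _ (fun i j => lt_le_trans (cl i j) m3)).
move: hH; rewrite {1}/X fgraph_top fgraph_bot invmx1 mul1mx; set H' := invmx _ *m _ => hH.
exists H'; split=> //; exists Z; split.
  by rewrite ZE -scalemxAl unitmxZ // unitfE gt_eqF.
move=> m; have -> : real_of R (m *m Z) = N%:R *: (real_of R m *m X').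
  by rewrite /real_of map_mxM -/(real_of R Z) ZE scalemxAr.
have eH : X' *m ftop F *m H' = X' *m fbot F by rewrite /H' mulKVmx.
by rewrite /fdefect -!scalemxAl -scalerBr -!mulmxA (mulmxA X') eH subrr scaler0.
Qed.

(** As [m] is not orthogonal to [W], adding a small multiple of a vector of [W] to one generator of
    the subspace destroys orthogonality to [m]. *)
Lemma orthogonal_avoided (m : 'rV[int]_k) : m != 0 ->
  (forall H, fgraph_mx F H *m (real_of R m)^T != 0 ->
     exists e : R, 0 < e /\ forall H', mclose e H H' -> fgraph_mx F H' *m (real_of R m)^T != 0) /\
  (forall H (e : R), 0 < e -> exists H', mclose e H H' /\ fgraph_mx F H' *m (real_of R m)^T != 0).
Proof.
move=> m0; set M := (real_of R m)^T.
have fE H : fgraph_mx F H *m M = finv1 F *m M + H *m (finv2 F *m M) by rewrite mulmxDl mulmxA.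
split=> [H H0|H e e0].
  have [i hi] : exists i, (fgraph_mx F H *m M) i 0 != 0.
    apply: contrapT => no; case/eqP: H0; apply/matrixP => i j; rewrite (ord1 j) [RHS]mxE; apply/eqP.
    by apply: contrapT => h; apply: no; exists i; exact/negP.
  have c0 : 0 < `|(fgraph_mx F H *m M) i 0| by rewrite normr_gt0.
  have [e [e0 he]] := @mclose_mull R d _ _ (finv2 F *m M) _ c0; exists e; split=> // H' /he h.
  apply: contraTneq (h i 0) => H'0; rewrite -leNgt.
  have -> : (H *m (finv2 F *m M)) i 0 - (H' *m (finv2 F *m M)) i 0 = (fgraph_mx F H *m M - fgraph_mx F H' *m M) i 0.
    by rewrite !fE; move: (H *m _) (H' *m _) (finv1 F *m M) => A B C; rewrite !mxE; ring.
  by rewrite H'0 subr0.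
have [h|h] := eqVneq (fgraph_mx F H *m M) 0; last by exists H; split=> // i j; rewrite subrr normr0.
have [j hj] : exists j, (finv2 F *m M) j 0 != 0.
  have [u [/hW uT um]] := totally_irrational_pairing W_irr m0.
  apply: contrapT => no; case/eqP: um; rewrite pairing_real_of -/M {1}[u](frame_expand F) uT mul0mx add0r.
  have -> : u *m fbot F *m finv2 F *m M = u *m fbot F *m (finv2 F *m M) by rewrite !mulmxA.
  have -> : finv2 F *m M = 0.
    apply/matrixP => i j; rewrite (ord1 j) [RHS]mxE; apply/eqP.
    by apply: contrapT => h2; apply: no; exists i; exact/negP.
  by rewrite mulmx0 mxE.
pose i0 : 'I_d := Ordinal (ltnW d1); exists (H + (e / 2) *: delta_mx i0 j); split.
  move=> i l; rewrite !mxE opprD addrA subrr add0r normrN normrM gtr0_norm ?divr_gt0 //.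
  by case: (_ && _); rewrite ?normr1 ?normr0; lra.
rewrite fE mulmxDl addrA -fE h add0r -scalemxAl; move: hj; set Q := finv2 F *m M; clearbody Q => hj; apply: contra hj => /eqP/matrixP/(_ i0 0).
rewrite !mxE => /eqP; rewrite mulf_eq0 => /orP[/eqP|/eqP]; first by lra.
rewrite (bigD1 j) //= big1 => [|l /negbTE lj]; last by rewrite mxE lj andbF mul0r.
by rewrite mxE !eqxx mul1r addr0 => ->.
Qed.

(** Two countable families of open dense conditions on [H] are interleaved through [unpickle]: jumps
    of every size [n], and non-orthogonality to each nonzero integer vector, which yields the
    density of orbits and so every base point. *)
Lemma parallelotope_residual (a b : 'rV[R]_r) :
  (forall i, 0 < b 0 i < 1) ->
  (forall Z H, meets_integers H Z -> forall (z : 'rV[int]_k) i, b 0 i != - fdefect F H (real_of R z) 0 i) ->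
  residual [set V : grassmannian R d k |
    forall (x : torus R k) (phi : 'Hom('rV[R]_d, 'rV[R]_k)), limg phi = V ->
      let Y := phi @^-1` visit_set V (@torus_proj R k @` parallelotope w a b) x in
      separated_net Y /\ ~ BD_to_lattice Y].
Proof.
move=> b01 gen; have d0 := ltnW d1; have rk : (r < k)%N by rewrite ltn_subrL d0 (ltn_trans d0 dk).
have irr (m : 'rV[int]_k) : m != 0 -> exists x : 'rV[R]_k, x *m ftop F = 0 /\ pairing m x != 0.
  by move=> /(totally_irrational_pairing W_irr)[u [/hW uT um]]; exists u.
have [l [l0 hl]] := irrational_functional rk irr.
have [i li] : exists i, l i 0 != 0.
  apply: contrapT => no; case/eqP: l0; apply/matrixP => i j; rewrite (ord1 j) [RHS]mxE; apply/eqP.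
  by apply: contrapT => h; apply: no; exists i; exact/negP.
pose P (n : nat) (H : 'M[R]_(d, r)) : Prop := match choice.unpickle n : option (nat + 'rV[int]_k) with
  | Some (inl j) => robust_jump F a b j H
  | Some (inr m) => m != 0 -> fgraph_mx F H *m (real_of R m)^T != 0
  | None => True end.
have oP n H : P n H -> exists e : R, 0 < e /\ forall H', mclose e H H' -> P n H'.
  rewrite /P; case: choice.unpickle => [[j|m]|]; [exact: robust_jump_open| |by exists 1].
  have [->|m0] := eqVneq m 0; first by exists 1.
  by move=> /(_ isT) /(orthogonal_avoided m0).1[e [e0 he]]; exists e; split=> // H' /he.
have dP n H (e : R) : 0 < e -> exists H', mclose e H H' /\ P n H'.
  have HH : forall e : R, 0 < e -> mclose e H H by move=> e0 e00 i' j'; rewrite subrr normr0.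
  move=> e0; rewrite /P; case: choice.unpickle => [[j|m]|]; last by exists H; split=> //; exact: HH.
    have [H' [h [Z [ZT ZH]]]] := meets_integers_dense H e0; exists H'; split=> //.
    by apply: (rational_robust_jump d1 a b01 li hl ZT ZH) => z; exact: (gen Z H' (conj ZT ZH)).
  have [->|m0] := eqVneq m 0; first by exists H; split=> //; exact: HH.
  by have [H' [h1 h2]] := (orthogonal_avoided m0).2 H e e0; exists H'.
exists (frame_set F (fun H => forall n, P n H)); split.
- exact: frame_set_Gdelta.
- apply: (frame_set_dense d0 dk) => H e e0; exact: (baire_matrix oP dP).
move=> V [H [PH hH]] x phi hphi Y.
have [s [A [hs VA]]] := grassmannian_chart d0 dk V.
have VE : (V : {vspace 'rV[R]_k}) = <<graph_tuple s A>>%VS by rewrite VA.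
have V_irr (m : 'rV[int]_k) : m != 0 -> exists v : 'rV[R]_k, v \in (V : {vspace 'rV[R]_k}) /\ pairing m v != 0.
  move=> m0; have := PH (choice.pickle (inr m : (nat + 'rV[int]_k)%type)); rewrite /P choice.pickleK => /(_ m0) h.
  have [i' hi'] : exists i', (fgraph_mx F H *m (real_of R m)^T) i' 0 != 0.
    apply: contrapT => no; case/eqP: h; apply/matrixP => i' j; rewrite (ord1 j) [RHS]mxE; apply/eqP.
    by apply: contrapT => h2; apply: no; exists i'; exact/negP.
  exists (row i' (fgraph_mx F H)); split.
    by apply/hH/fgraph_onE; exists (delta_mx 0 i'); rewrite rowE.
  by rewrite pairing_real_of -row_mul mxE.
have jumps n : robust_jump F a b n H.
  by have := PH (choice.pickle (inl n : (nat + 'rV[int]_k)%type)); rewrite /P choice.pickleK.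
have b0 i' : 0 < b 0 i' by have /andP[] := b01 i'.
split; first exact: (parallelotope_separated d0 dk hs VE V_irr hphi hH hw a b0).
exact: (jumps_not_BD d0 dk hs VE V_irr hphi hH hw jumps).
Qed.

(** [Z] determines [H], so each triple [(Z, z, i)] excludes a single value of the [i]-th entry of
    [b]; the exceptional set lies in countably many boxes with a degenerate side. *)
Lemma degenerate_parameters_null :
  lebesgue_null [set ab : 'rV[R]_(r + r) | (forall i, 0 < ab 0 i < 1) /\
     exists Z H, meets_integers H Z /\ exists (z : 'rV[int]_k) i, rsubmx ab 0 i = - fdefect F H (real_of R z) 0 i].
Proof.
pose val (x : 'M[int]_(d, k) * 'rV[int]_k) (i : 'I_r) : R :=
  - fdefect F (invmx (real_of R x.1 *m ftop F) *m (real_of R x.1 *m fbot F)) (real_of R x.2) 0 i.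
pose lo (x : 'M[int]_(d, k) * 'rV[int]_k * 'I_r) : 'rV[R]_(r + r) :=
  \row_j if j == rshift r x.2 then val x.1 x.2 else 0.
pose hi (x : 'M[int]_(d, k) * 'rV[int]_k * 'I_r) : 'rV[R]_(r + r) :=
  \row_j if j == rshift r x.2 then val x.1 x.2 else 1.
move=> e e0; apply: (@box_cover_countable R 1 (r + r) _ _ e lo hi) => //.
- by rewrite addn_gt0 subn_gt0 dk.
- by move=> x i j; rewrite !mxE; case: ifP.
- move=> X [X01 [Z [H [[ZT ZH] [z [i Xi]]]]]]; exists (Z, z, i) => i' j; rewrite (ord1 i') !mxE.
  have HE : H = invmx (real_of R Z *m ftop F) *m (real_of R Z *m fbot F).
    apply: (can_inj (mulKmx ZT)); rewrite mulKVmx //; apply/row_matrixP => l.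
    have := ZH (delta_mx 0 l); rewrite /fdefect /real_of map_mxM map_delta_mx => /eqP.
    by rewrite subr_eq0 -!mulmxA -!rowE -/(real_of R Z) mulmxA => /eqP ->.
  case: eqP => [->|_] /=; last by have /andP[h1 h2] := X01 j; rewrite !ltW.
  by move: Xi; rewrite mxE /val /= -HE => ->; rewrite lexx.
move=> s _; rewrite big1 ?(ltW e0) // => -[x i] _; rewrite /box_volume big_ord1 (bigD1 (rshift r i)) //=.
by rewrite !mxE eqxx subrr mul0r.
Qed.

End Parallelotopes.

Theorem generic_parallelotope (R : realType) (d k : nat) (d1 : (1 < d)%N) (dk : (d < k)%N)
    (W : {vspace 'rV[R]_k}) (w : (k - d).-tuple 'rV[R]_k) :
  totally_irrational W -> basis_of W w ->
  lebesgue_null [set ab : 'rV[R]_((k - d) + (k - d)) |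
    (forall i, 0 < ab 0 i < 1) /\
    ~ residual [set V : grassmannian R d k |
        forall (x : torus R k) (phi : 'Hom('rV[R]_d, 'rV[R]_k)),
          limg phi = V ->
          let P := @torus_proj R k @` parallelotope w (lsubmx ab) (rsubmx ab) in
          let Y := phi @^-1` visit_set V P x in
          separated_net Y /\ ~ BD_to_lattice Y]].
Proof.
move=> W_irr bw; have [F [hw hW]] := basis_frame dk bw.
apply: lebesgue_null_sub (degenerate_parameters_null dk F) => ab [ab01 nres]; split=> //.
apply: contrapT => no; apply: nres; apply: (parallelotope_residual d1 dk W_irr hw hW) => [i|Z H ZH z i].
  by rewrite mxE; exact: ab01.
by apply/eqP => e; apply: no; exists Z, H; split=> //; exists z, i.
Qed.

Theorem theorem1p2 (R : realType) (d k : nat) (d_gt0 : (0 < d)%N)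
    (d_lt_k : (d < k)%N) :
  [/\ (k + 1 < 2 * d)%N ->
        almost_every_subspace (fun V : grassmannian R d k =>
          forall (x : torus R k) (p : 'rV[R]_k) (L : {vspace 'rV[R]_k})
            (B : set 'rV[R]_k),
            linear_section V p L B ->
            open_in (plane p L) B ->
            minkowski_dim (boundary_in (plane p L) B) = (k - d - 1)%:R%:E ->
            forall phi : 'Hom('rV[R]_d, 'rV[R]_k), limg phi = V ->
              let Y := phi @^-1` visit_set V (@torus_proj R k @` B) x in
              separated_net Y /\ BD_to_lattice Y),
      (2 <= d)%N ->
        almost_every_subspace (fun V : grassmannian R d k =>
          forall (x : torus R k) (p : 'rV[R]_k) (L : {vspace 'rV[R]_k})
            (B : set 'rV[R]_k),
            linear_section V p L B ->
            coordinate_box (k - d) B ->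
            forall phi : 'Hom('rV[R]_d, 'rV[R]_k), limg phi = V ->
              let Y := phi @^-1` visit_set V (@torus_proj R k @` B) x in
              separated_net Y /\ BD_to_lattice Y) &
      (1 < d)%N ->
        forall (W : grassmannian R (k - d) k) (w : (k - d).-tuple 'rV[R]_k),
          totally_irrational W ->
          basis_of W w ->
          lebesgue_null [set ab : 'rV[R]_((k - d) + (k - d)) |
            (forall i, 0 < ab 0 i < 1) /\
            ~ residual [set V : grassmannian R d k |
                forall (x : torus R k) (phi : 'Hom('rV[R]_d, 'rV[R]_k)),
                  limg phi = V ->
                  let P := @torus_proj R k @`
                             parallelotope w (lsubmx ab) (rsubmx ab) in
                  let Y := phi @^-1` visit_set V P x in
                  separated_net Y /\ ~ BD_to_lattice Y]]].
Proof.
split=> hd.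
- move=> s hs; apply: lebesgue_null_sub (well_generic_ae hs d_gt0 d_lt_k) => A /= nP wg; apply: nP.
  exact: (small_boundary_net d_lt_k hs wg hd).
- move=> s hs; apply: lebesgue_null_sub (well_generic_ae hs d_gt0 d_lt_k) => A /= nP wg; apply: nP.
  exact: (box_section_net hd d_lt_k hs wg).
- by move=> W w W_irr bw; exact: (generic_parallelotope hd d_lt_k W_irr bw).
Qed.
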